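(* Let $A$ be a real $n\times n$ expansive matrix and let $\Gamma\subset\mathbb{R}^n$ be a full rank lattice. Then, for some $N\in\mathbb{N}$, there exists an $(A,\Gamma)$-MRA $\{V_j\}_{j\in\mathbb{Z}}$ of multiplicity $N$ whose scaling functions $\{\varphi^1,\ldots,\varphi^N\}\subset V_0$ are in the Schwartz class. Moreover, each $\widehat{\varphi^i}$ is a $C^\infty$ real-valued function with compact support.
   Context: A real $n\times n$ matrix $A$ is expansive (an expansive dilation) if all its eigenvalues $\lambda$ satisfy $|\lambda|>1$. Let $T_yf(x)=f(x-y)$, and $\widehat f(\xi)=\int_{\mathbb{R}^n} f(x)e^{-2\pi i\langle x,\xi\rangle}dx$. For an expansive matrix $A$ and a full rank lattice $\Gamma\subset\mathbb{R}^n$, an $(A,\Gamma)$-multiresolution analysis (MRA) of multiplicity $N\in\mathbb{N}$ is a sequence $\{V_j\}_{j\in\mathbb{Z}}$ of closed subspaces of $L^2(\mathbb{R}^n)$ such that: (M1) $V_j\subset V_{j+1}$ for all $j\in\mathbb{Z}$; (M2) $\bigcap_{j\in\mathbb{Z}}V_j=\{0\}$; (M3) $\overline{\bigcup_{j\in\mathbb{Z}}V_j}=L^2(\mathbb{R}^n)$; (M4) $f\in V_0\iff f(A^j\cdot)\in V_j$ for all $j\in\mathbb{Z}$; (M5) there exists $\Phi=\{\varphi^1,\ldots,\varphi^N\}\subset V_0$ (the scaling functions, or scaling vector) such that $E^\Gamma(\Phi)=\{T_\gamma\varphi:\gamma\in\Gamma,\ \varphi\in\Phi\}$ is an orthonormal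 basis of $V_0$. *)

(* Defs.v *)
From HB Require Import structures.
From mathcomp Require Import all_boot all_order all_algebra.
From mathcomp Require Import complex.
From mathcomp Require Import all_classical all_reals all_analysis.

Set Implicit Arguments.
Unset Strict Implicit.
Unset Printing Implicit Defensive.

Import Order.TTheory GRing.Theory Num.Theory.
Import numFieldNormedType.Exports.
Import ComplexField.Normc.

Local Open Scope classical_set_scope.
Local Open Scope complex_scope.
Local Open Scope ring_scope.

(* Column vectors carry the sigma-algebra generated by the coordinates; for
   'cV[R]_n it is the Borel sigma-algebra of R^n. *)
Definition measure_cV_display : measure_display -> measure_display.
Proof. exact. Qed.

Section measurable_cV.
Context {d : measure_display} {T : sigmaRingType d}.
Variable n : nat.

Let coord : 'I_n -> 'cV[T]_n -> T := fun i x => x i ord0.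

Let cV_set0 : g_sigma_preimage coord set0.
Proof. exact: sigma_algebra0. Qed.

Let cV_setC A : g_sigma_preimage coord A -> g_sigma_preimage coord (~` A).
Proof. exact: sigma_algebraC. Qed.

Let cV_bigcup (F : _^nat) : (forall i, g_sigma_preimage coord (F i)) ->
  g_sigma_preimage coord (\bigcup_i (F i)).
Proof. exact: sigma_algebra_bigcup. Qed.

HB.instance Definition _ := @isMeasurable.Build (measure_cV_display d)
  'cV[T]_n (g_sigma_preimage coord) cV_set0 cV_setC cV_bigcup.

End measurable_cV.

Lemma measurable_coord d (T : sigmaRingType d) n (i : 'I_n) :
  measurable_fun [set: 'cV[T]_n] (fun x : 'cV[T]_n => x i ord0).
Proof.
move=> _ Y mY; rewrite setTI; apply: sub_sigma_algebra => /=.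
rewrite -bigcup_seq/=; exists i => /=; first by rewrite mem_index_enum.
by exists Y => //; rewrite setTI.
Qed.

Lemma measurable_fun_cVP d1 d2 (T1 : measurableType d1)
    (T2 : measurableType d2) n (f : T1 -> 'cV[T2]_n) :
  measurable_fun [set: T1] f <->
  forall i, measurable_fun [set: T1] (fun x => f x i ord0).
Proof.
split=> [mf i|mf]; first exact: measurableT_comp (measurable_coord i) mf.
apply: (@measurability _ _ _ _ setT f
  (\big[setU/set0]_(i < n) preimage_set_system setT
    (fun x : 'cV[T2]_n => x i ord0) measurable)) => //.
move=> _ [A + <-]; rewrite -bigcup_seq/= => -[i _ [B mB <-]].
by have := mf i measurableT B mB; rewrite !setTI.
Qed.

Section lebesgue_cV.
Context {R : realType}.

Definition cV_cons n (p : measurableTypeR R * 'cV[R]_n) : 'cV[R]_n.+1 :=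
  \col_i oapp (fun j => p.2 j ord0) p.1 (unlift ord0 i).

Definition cV_uncons n (x : 'cV[R]_n.+1) : measurableTypeR R * 'cV[R]_n :=
  (x ord0 ord0, \col_i x (lift ord0 i) ord0).

Lemma cV_consK n : cancel (@cV_cons n) (@cV_uncons n).
Proof.
move=> [a v]; rewrite /cV_uncons mxE unlift_none; congr pair.
by apply/colP => i; rewrite !mxE liftK.
Qed.

Lemma measurable_cV_cons n : measurable_fun setT (@cV_cons n).
Proof.
apply/measurable_fun_cVP => i; under eq_fun do rewrite mxE.
case: (unliftP ord0 i) => [j|] _ /=; last exact: measurable_fst.
exact: measurableT_comp (measurable_coord j) measurable_snd.
Qed.

Lemma measurable_cV_uncons n : measurable_fun setT (@cV_uncons n).
Proof.
apply/measurable_fun_pairP; split => /=; first exact: measurable_coord.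
apply/measurable_fun_cVP => i /=; rewrite /comp/=.
under eq_fun do rewrite mxE.
exact: measurable_coord.
Qed.

HB.instance Definition _ n :=
  isMeasurableFun.Build _ _ _ _ (@cV_cons n) (@measurable_cV_cons n).

Section lebesgue_cV_succ.
Variables (n : nat) (mu : {sigma_finite_measure set 'cV[R]_n -> \bar R}).

Definition lebesgue_cV_succ : set 'cV[R]_n.+1 -> \bar R :=
  pushforward (lebesgue_measure \x mu)%E (@cV_cons n).

Let lebesgue_cV_succ0 : lebesgue_cV_succ set0 = 0%E.
Proof. exact: measure0. Qed.

Let lebesgue_cV_succ_ge0 A : (0 <= lebesgue_cV_succ A)%E.
Proof. exact: measure_ge0. Qed.

Let lebesgue_cV_succ_sigma_additive : semi_sigma_additive lebesgue_cV_succ.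
Proof. exact: measure_semi_sigma_additive. Qed.

HB.instance Definition _ := isMeasure.Build _ _ _ lebesgue_cV_succ
  lebesgue_cV_succ0 lebesgue_cV_succ_ge0 lebesgue_cV_succ_sigma_additive.

Let sigma_finite_lebesgue_cV_succ : sigma_finite setT lebesgue_cV_succ.
Proof.
have /sigma_finiteP[F [FT ndF Foo]] := sigma_finiteT (@lebesgue_measure R).
have /sigma_finiteP[G [GT ndG Goo]] := sigma_finiteT mu.
exists (fun k => @cV_uncons n @^-1` (F k `*` G k)).
  rewrite -preimage_bigcup -[LHS](preimage_setT (@cV_uncons n)); congr preimage.
  rewrite -setXTT FT GT predeqE => -[x y]; split.
    move=> [/= [j _ Fjx] [k _ Gky]]; exists (maxn j k) => //; split.
    - by move: x Fjx; exact/subsetPset/ndF/leq_maxl.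
    - by move: y Gky; exact/subsetPset/ndG/leq_maxr.
  by move=> [k _ []/= ? ?]; split; exists k.
move=> k; have [? ?] := Foo k; have [? ?] := Goo k.
have mFG : measurable (F k `*` G k) by exact: measurableX.
split.
  by rewrite -[X in measurable X]setTI; exact: measurable_cV_uncons.
rewrite /lebesgue_cV_succ /pushforward -comp_preimage.
rewrite (_ : _ \o _ = id) ?preimage_id; last exact/funext/cV_consK.
by rewrite product_measure1E// lte_mul_pinfty// ge0_fin_numE.
Qed.

HB.instance Definition _ := Measure_isSigmaFinite.Build _ _ _
  lebesgue_cV_succ sigma_finite_lebesgue_cV_succ.

End lebesgue_cV_succ.

Fixpoint lebesgue_cV (n : nat) :
    {sigma_finite_measure set 'cV[R]_n -> \bar R} :=
  match n with
  | 0 => \d_(0 : 'cV[R]_0)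
  | n'.+1 => lebesgue_cV_succ (lebesgue_cV n')
  end.

Lemma lebesgue_cV_box n (a b : 'I_n -> R) : (forall i, a i <= b i) ->
  lebesgue_cV n [set x | forall i, x i ord0 \in `[a i, b i]]
  = (\prod_(i < n) (b i - a i))%:E.
Proof.
elim: n => [|n IHn] in a b * => ab /=.
  by rewrite big_ord0 diracE mem_set// => -[].
rewrite /lebesgue_cV_succ /pushforward.
set box := [set x : 'cV[R]_n | forall i, x i ord0 \in
  `[a (lift ord0 i), b (lift ord0 i)]].
rewrite (_ : _ @^-1` _ =
    [set` `[a ord0, b ord0]] `*` box :> set (measurableTypeR R * _)); last first.
  apply/seteqP; split=> [[t v] /= tv|[t v] [/= t_ v_] i].
    split=> [|i] /=; first by have := tv ord0; rewrite mxE unlift_none.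
    by have := tv (lift ord0 i); rewrite mxE liftK.
  by rewrite mxE; case: (unliftP ord0 i) => [j|] -> /=.
have mbox : measurable box.
  rewrite (_ : box = \big[setI/setT]_(i < n)
      ((fun x : 'cV[R]_n => x i ord0) @^-1`
        `[a (lift ord0 i), b (lift ord0 i)])); last first.
    by rewrite -bigcap_seq; apply/seteqP; split=> x /= xb i;
      [move=> _; exact: xb|exact: (xb i (mem_index_enum i))].
  apply: bigsetI_measurable => i _; rewrite -[X in measurable X]setTI.
  exact: (measurable_coord i measurableT (measurable_itv _)).
rewrite product_measure1E//.
rewrite big_ord_recl EFinM; congr (_ * _)%E; last exact: IHn.
apply: (etrans (lebesgue_measure_itv _)) => /=.
by rewrite lte_fin; case: ltgtP (ab ord0) => // -> _; rewrite subrr.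
Qed.

End lebesgue_cV.

Section complex_functions.
Context {R : realType} {n : nat}.
Implicit Types f g : 'cV[R]_n -> R[i].
Implicit Types S W : set ('cV[R]_n -> R[i]).

Definition cintegral f : R[i] :=
  (\int[lebesgue_cV n]_x complex.Re (f x)) +i*
  (\int[lebesgue_cV n]_x complex.Im (f x)).

Definition cmeasurable f : Prop :=
  measurable_fun setT (fun x => complex.Re (f x)) /\
  measurable_fun setT (fun x => complex.Im (f x)).

(* Elements of L^2(R^n) are handled through representatives. *)
Definition L2norm f : \bar R :=
  ('N[lebesgue_cV n]_2%:E [(fun x => (normc (f x))%:E)])%E.

Definition L2 : set ('cV[R]_n -> R[i]) :=
  [set f | cmeasurable f /\ (L2norm f < +oo)%E].

Definition L2zero : set ('cV[R]_n -> R[i]) :=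
  [set f | cmeasurable f /\ {ae lebesgue_cV n, forall x, f x = 0}].

Definition inner f g : R[i] := cintegral (fun x => f x * conjc (g x)).

Definition L2closure S : set ('cV[R]_n -> R[i]) :=
  [set f | L2 f /\ forall e : R, 0 < e ->
    exists2 g, S g & (L2norm (fun x => f x - g x)%R < e%:E)%E].

(* The last condition makes W stable under almost-everywhere equality, so that
   W is the full preimage of a closed subspace of the quotient space. *)
Record closed_subspace W : Prop := ClosedSubspace {
  closed_subspace_L2 : W `<=` L2 ;
  closed_subspace0 : W (fun=> 0) ;
  closed_subspace_linear : forall (c : R[i]) f g,
    W f -> W g -> W (fun x => c * f x + g x) ;
  closed_subspace_closed : L2closure W `<=` W }.

Definition linear_span S : set ('cV[R]_n -> R[i]) :=
  [set f | exists (m : nat) (c : 'I_m -> R[i]) (g : 'I_m -> 'cV[R]_n -> R[i]),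
    (forall k, S (g k)) /\ f = (fun x => \sum_(k < m) c k * g k x)].

Definition orthonormal_basis (I : eqType) (D : set I)
    (e : I -> 'cV[R]_n -> R[i]) W : Prop :=
  [/\ forall i, D i -> W (e i),
      forall i j, D i -> D j -> inner (e i) (e j) = (i == j)%:R
    & L2closure (linear_span (e @` D)) = W].

Definition translation (y : 'cV[R]_n) f : 'cV[R]_n -> R[i] :=
  fun x => f (x - y).

Definition dot (x y : 'cV[R]_n) : R := \sum_(i < n) x i ord0 * y i ord0.

(* e^{i t} *)
Definition cexpi (t : R) : R[i] := cos t +i* sin t.

Definition fourier f : 'cV[R]_n -> R[i] :=
  fun xi => cintegral (fun x => f x * cexpi (- (2 * pi * dot x xi))).

Definition cpartial (i : 'I_n) f : 'cV[R]_n -> R[i] :=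
  fun x => ('D_(delta_mx i ord0) (fun y => complex.Re (f y)) x) +i*
           ('D_(delta_mx i ord0) (fun y => complex.Im (f y)) x).

(* Iterated partial derivatives are indexed by the sequence of directions; on
   smooth functions only the underlying multi-index matters. *)
Definition cpartials (s : seq 'I_n) f : 'cV[R]_n -> R[i] := foldr cpartial f s.

Definition smooth f : Prop := forall s : seq 'I_n,
  [/\ continuous (fun x => complex.Re (cpartials s f x)),
      continuous (fun x => complex.Im (cpartials s f x))
    & forall (i : 'I_n) (x : 'cV[R]_n),
        derivable (fun y => complex.Re (cpartials s f y)) x (delta_mx i ord0) /\
        derivable (fun y => complex.Im (cpartials s f y)) x (delta_mx i ord0)].

Definition schwartz f : Prop := smooth f /\
  forall (a : 'I_n -> nat) (s : seq 'I_n), exists M : R, forall x : 'cV[R]_n,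
    normc ((\prod_(i < n) x i ord0 ^+ a i)%:C * cpartials s f x) <= M.

Definition real_valued f : Prop := forall x, complex.Im (f x) = 0.

Definition compactly_supported f : Prop :=
  compact (closure [set x | f x != 0]).

Definition full_rank_lattice (Gamma : set 'cV[R]_n) : Prop :=
  exists2 P : 'M[R]_n, P \in unitmx &
    Gamma = [set P *m map_mx intr z | z in [set: 'cV[int]_n]].

Definition expansive (A : 'M[R]_n) : Prop :=
  forall l : R[i], eigenvalue (map_mx (real_complex R) A) l -> 1 < `|l|.

(* The family E^Gamma(Phi) is indexed by the pairs (gamma, i). *)
Definition scaling_functions (Gamma : set 'cV[R]_n)
    (V0 : set ('cV[R]_n -> R[i])) (N : nat)
    (Phi : 'I_N -> 'cV[R]_n -> R[i]) : Prop :=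
  (forall i, V0 (Phi i)) /\
  orthonormal_basis (Gamma `*` [set: 'I_N])
    (fun p => translation p.1 (Phi p.2)) V0.

End complex_functions.

(* The dimension is n.+1, so that A ^ j is the power in the unit ring
   'M[R]_n.+1; A^-1 is the inverse matrix because expansive A are invertible. *)
Record MRA {R : realType} {n : nat} (A : 'M[R]_n.+1)
    (Gamma : set 'cV[R]_n.+1) (N : nat)
    (V : int -> set ('cV[R]_n.+1 -> R[i])) : Prop := MkMRA {
  MRA_closed : forall j, closed_subspace (V j) ;
  MRA_nested : forall j, V j `<=` V (j + 1) ;
  MRA_bigcap : \bigcap_j V j = L2zero ;
  MRA_bigcup : L2closure (\bigcup_j V j) = L2 ;
  MRA_dilation : forall (f : 'cV[R]_n.+1 -> R[i]) (j : int), L2 f ->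
    V 0 f <-> V j (fun x => f (A ^ j *m x)) ;
  MRA_scaling : exists Phi : 'I_N -> 'cV[R]_n.+1 -> R[i],
    scaling_functions Gamma (V 0) Phi }.

(* Main.v *)
Require Import Defs.
From mathcomp Require Import all_boot all_order all_algebra.
From mathcomp Require Import complex.
From mathcomp Require Import all_classical all_reals all_analysis.
From mathcomp Require Import measurable_realfun.
From mathcomp Require Import ring lra.

(** The Fourier transforms of the scaling functions are built by hand. After a
    linear change of variables the lattice is Z^n, the dual dilation M contracts
    a norm q by a factor th < 1, and one needs smooth real u_1, ..., u_N
    supported in the ball {q <= R} such that the modulations u_i e_z (z in Z^n)
    are orthonormal and approximate every function supported in {q <= th R};
    V_0 is then spanned by the integer translates, and its dilates are nested.
    Cover {q <= th R} by cubes of side L with a smooth partition of unity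
    sum_Q a_Q^2 = 1. Cutting exponentials of period K = L + 3 by a_Q gives a
    Parseval system, which fails to be orthonormal only near the faces of the
    cubes, where its defect is the projection 1 - a a^T. Applying this
    projection, cutting by unit windows, and moving the finitely many unit
    pieces by integer vectors to disjoint places of the shell between th R and R
    restores orthonormality without destroying completeness. The pieces are
    O(L^{n-1}) in number while the shell has room for a multiple of L^n, so all
    of them fit once L is large. *)

Set Implicit Arguments.
Unset Strict Implicit.
Unset Printing Implicit Defensive.

Import Order.TTheory GRing.Theory Num.Theory.
Import numFieldNormedType.Exports.
Import ComplexField.Normc.

Local Open Scope classical_set_scope.
Local Open Scope complex_scope.
Local Open Scope ring_scope.

(** * Complex-valued integrals *)

(** At a point x let a be the vector of all a_Q(x), a unit vector. Orthonormality rests on a a^T +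
    (1 - a a^T)^2 = 1: the parts kept in place and the moved parts together form an isometry.
    Completeness rests on (1 - a a^T) a = 0: when the coefficients of cell Q reproduce a_Q F, the
    moved parts cancel and the parts in place add up to F. Moving a piece by an integer vector
    changes no integral against an e_z, since e_z is Z^n-periodic. The obstacle is that smooth
    windows must overlap, and overlap spoils orthogonality; the repair takes place in the shell that
    the strict contraction th < 1 provides. The number of cells is fixed before L is chosen, which
    is why the pieces grow one power slower than the room. Finitely many u_i suffice because K is an
    integer: a frequency in Z^n / K is an integer vector plus one of finitely many residues. K is
    odd, so the residues can be taken symmetric about 0, and sums cos + sin replace exponentials;
    this makes the u_i real. No standard norm need be contracted by M, hence the adapted q, built
    from the decay of the powers of A^-1. *)

Notation Re := complex.Re.
Notation Im := complex.Im.

Section ReIm.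
Context {R : realType}.
Implicit Types x y : R[i].

Lemma ReD x y : Re (x + y) = Re x + Re y. Proof. by case: x; case: y. Qed.
Lemma ImD x y : Im (x + y) = Im x + Im y. Proof. by case: x; case: y. Qed.
Lemma ReN x : Re (- x) = - Re x. Proof. by case: x. Qed.
Lemma ImN x : Im (- x) = - Im x. Proof. by case: x. Qed.
Lemma ReM x y : Re (x * y) = Re x * Re y - Im x * Im y.
Proof. by case: x; case: y. Qed.
Lemma ImM x y : Im (x * y) = Re x * Im y + Im x * Re y.
Proof. by case: x => a b; case: y. Qed.
Lemma ReJ x : Re (conjc x) = Re x. Proof. by case: x. Qed.
Lemma ImJ x : Im (conjc x) = - Im x. Proof. by case: x. Qed.
Lemma Re_real (a : R) : Re (a%:C) = a. Proof. by []. Qed.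
Lemma Im_real (a : R) : Im (a%:C) = 0. Proof. by []. Qed.

Definition ReImE := (ReD, ImD, ReN, ImN, ReM, ImM, ReJ, ImJ, Re_real, Im_real).

Lemma complexP x y : Re x = Re y -> Im x = Im y -> x = y.
Proof. by case: x => a b; case: y => c d /= -> ->. Qed.

Lemma complex_split x : x = (Re x)%:C + (Im x)%:C * 'i%C.
Proof. by apply: complexP; rewrite ?ReImE/= ?mulr0 ?mulr1 ?subr0 ?addr0 ?add0r ?mul0r ?add0r. Qed.

Lemma normc2E x : normc x ^+ 2 = Re x ^+ 2 + Im x ^+ 2.
Proof. by case: x => a b /=; rewrite sqr_sqrtr// addr_ge0// sqr_ge0. Qed.

Lemma normc_ge0 x : 0 <= normc x. Proof. by case: x => a b; exact: sqrtr_ge0. Qed.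

Lemma normc_le x (a : R) : 0 <= a -> (normc x <= a) = (normc x ^+ 2 <= a ^+ 2).
Proof. by move=> a0; rewrite ler_pXn2r// ?nnegrE ?normc_ge0. Qed.

Lemma Re_le_normc x : `|Re x| <= normc x.
Proof.
rewrite -(@ler_pXn2r _ 2)// ?nnegrE ?normr_ge0 ?normc_ge0//.
by rewrite normc2E real_normK ?num_real// lerDl sqr_ge0.
Qed.

Lemma Im_le_normc x : `|Im x| <= normc x.
Proof.
rewrite -(@ler_pXn2r _ 2)// ?nnegrE ?normr_ge0 ?normc_ge0//.
by rewrite normc2E real_normK ?num_real// lerDr sqr_ge0.
Qed.

Lemma normc_le_ReIm x : normc x <= `|Re x| + `|Im x|.
Proof.
rewrite normc_le ?addr_ge0// normc2E sqrrD !real_normK ?num_real//.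
by rewrite -addrA lerD2l lerDr mulrn_wge0// mulr_ge0.
Qed.

Lemma normcJ x : normc (conjc x) = normc x.
Proof. by case: x => a b /=; rewrite sqrrN. Qed.

Lemma normc_real (a : R) : normc a%:C = `|a|.
Proof. by rewrite /normc/= expr0n addr0 sqrtr_sqr. Qed.

Lemma normcD x y : normc (x + y) <= normc x + normc y.
Proof. exact: le_normcD. Qed.

Lemma normcB x y : normc (x - y) = normc (y - x).
Proof. by rewrite -opprB normcN. Qed.

Lemma normc_sum (I : Type) (r : seq I) (P : pred I) (F : I -> R[i]) :
  normc (\sum_(i <- r | P i) F i) <= \sum_(i <- r | P i) normc (F i).
Proof.
elim/big_ind2 : _ => [|x a y b xa yb|//]; first by rewrite normc0.
by rewrite (le_trans (normcD _ _))// lerD.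
Qed.

Lemma mulJc x : x * conjc x = (normc x ^+ 2)%:C.
Proof.
by apply: complexP; rewrite ?ReImE ?normc2E; ring.
Qed.

Lemma normc_cexpi (t : R) : normc (cexpi t) = 1.
Proof. by rewrite /cexpi/normc cos2Dsin2 sqrtr1. Qed.

Lemma cexpiD (s t : R) : cexpi (s + t) = cexpi s * cexpi t.
Proof. by apply: complexP; rewrite ReImE/= ?cosD ?sinD//; ring. Qed.

Lemma cexpi0 : cexpi (0 : R) = 1.
Proof. by rewrite /cexpi cos0 sin0. Qed.

Lemma conj_cexpi (t : R) : conjc (cexpi t) = cexpi (- t).
Proof. by rewrite /cexpi cosN sinN. Qed.

End ReIm.

Section cint.
Context d (T : measurableType d) (R : realType).
Context (mu : {measure set T -> \bar R}).
Implicit Types (f g : T -> R[i]) (u v : T -> R).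

Definition rintg u := mu.-integrable setT (EFin \o u).
Definition cmeas f := measurable_fun setT (fun x => Re (f x)) /\
  measurable_fun setT (fun x => Im (f x)).
Definition cintg f := rintg (fun x => Re (f x)) /\ rintg (fun x => Im (f x)).
(** Convertible to [cintegral] when [mu] is [lebesgue_cV n]; an arbitrary measure is allowed so that
    the same lemmas serve on the real line and on products. *)
Definition cint f : R[i] :=
  (\int[mu]_x Re (f x)) +i* (\int[mu]_x Im (f x)).

Lemma rintg_meas u : rintg u -> measurable_fun setT u.
Proof. by move=> /measurable_int/measurable_EFinP. Qed.

Lemma rintgP u : rintg u <->
  measurable_fun setT u /\ (\int[mu]_x (`|u x|)%:E < +oo)%E.
Proof.
split=> [h|[mu_ h]].
  by split; [exact: rintg_meas|case/integrableP: h].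
by apply/integrableP; split => //; exact/measurable_EFinP.
Qed.

Lemma rintg_le u v : measurable_fun setT u -> rintg v ->
  (forall x, `|u x| <= `|v x|) -> rintg u.
Proof.
move=> mu_ iv uv; apply: (le_integrable _ _ _ iv) => //.
  exact/measurable_EFinP.
by move=> x _ /=; rewrite lee_fin.
Qed.

Lemma eq_rintg u v : u =1 v -> rintg u -> rintg v.
Proof. by move=> /funext ->. Qed.

Lemma rintgD u v : rintg u -> rintg v -> rintg (fun x => u x + v x).
Proof. by move=> iu iv; exact: (integrableD measurableT iu iv). Qed.

Lemma rintgZ k u : rintg u -> rintg (fun x => k * u x).
Proof. by move=> iu; exact: (integrableZl measurableT k iu). Qed.

Lemma rintgN u : rintg u -> rintg (fun x => - u x).
Proof. by move=> /(rintgZ (-1)); apply: eq_rintg => x; rewrite mulN1r. Qed.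

Lemma rintgB u v : rintg u -> rintg v -> rintg (fun x => u x - v x).
Proof. by move=> iu /rintgN; exact: rintgD. Qed.

Lemma rintg_abs u : rintg u -> rintg (fun x => `|u x|).
Proof.
move=> iu; apply: (rintg_le _ iu) => [|x]; last by rewrite normr_id.
by apply: measurableT_comp => //; exact: rintg_meas.
Qed.

Lemma rintg0 : rintg (fun=> 0).
Proof.
by apply/rintgP; split => //; rewrite integral0_eq// => x _; rewrite normr0.
Qed.

Lemma rintE u : rintg u -> (\int[mu]_x (u x)%:E = (\int[mu]_x u x)%:E)%E.
Proof. by move=> iu; rewrite /Rintegral fineK//; exact: integrable_fin_num. Qed.

Lemma rintD u v : rintg u -> rintg v ->
  \int[mu]_x (u x + v x) = \int[mu]_x u x + \int[mu]_x v x.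
Proof. by move=> iu iv; rewrite RintegralD. Qed.

Lemma rintB u v : rintg u -> rintg v ->
  \int[mu]_x (u x - v x) = \int[mu]_x u x - \int[mu]_x v x.
Proof. by move=> iu iv; rewrite RintegralB. Qed.

Lemma rintZ k u : rintg u -> \int[mu]_x (k * u x) = k * \int[mu]_x u x.
Proof. by move=> iu; rewrite RintegralZl. Qed.

Lemma rintN u : rintg u -> \int[mu]_x (- u x) = - \int[mu]_x u x.
Proof. by move=> /(rintZ (-1)); rewrite mulN1r => <-; apply: eq_Rintegral => x _; rewrite mulN1r. Qed.

Lemma rint0 : \int[mu]_x (0 : R) = 0.
Proof. by rewrite /Rintegral integral0_eq. Qed.

Lemma rint_le u v : rintg u -> rintg v -> (forall x, u x <= v x) ->
  \int[mu]_x u x <= \int[mu]_x v x.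
Proof. by move=> iu iv uv; apply: le_Rintegral. Qed.

Lemma rint_dom_cvg (u_ : nat -> T -> R) u v :
  (forall n, measurable_fun setT (u_ n)) -> measurable_fun setT u ->
  {ae mu, forall x, u_ n x @[n --> \oo] --> u x} ->
  rintg v -> (forall n x, `|u_ n x| <= v x) ->
  \int[mu]_x u_ n x @[n --> \oo] --> \int[mu]_x u x.
Proof.
move=> mu_ mu0 cu iv uv.
have [||||| iu _ c] := @dominated_convergence _ _ _ mu _ measurableT
  (fun n => EFin \o u_ n) (EFin \o u) (EFin \o v).
- by move=> n; exact/measurable_EFinP.
- exact/measurable_EFinP.
- by apply: filterS cu => x cx _; apply: cvg_EFin cx; exact: nearW.
- exact: iv.
- by apply: aeW => x n _ /=; rewrite lee_fin.
apply: (@fine_cvg _ _ _ _ (fun n => (\int[mu]_x (u_ n x)%:E)%E)).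
by rewrite -rintE.
Qed.

Lemma cmeas_cst (c : R[i]) : cmeas (fun=> c). Proof. by split. Qed.

Lemma cmeas_real u : measurable_fun setT u -> cmeas (fun x => (u x)%:C).
Proof. by split. Qed.

Lemma cmeasD f g : cmeas f -> cmeas g -> cmeas (fun x => f x + g x).
Proof.
move=> [rf jf] [rg jg]; split.
  by under eq_fun do rewrite ReD; exact: measurable_funD.
by under eq_fun do rewrite ImD; exact: measurable_funD.
Qed.

Lemma cmeasM f g : cmeas f -> cmeas g -> cmeas (fun x => f x * g x).
Proof.
move=> [rf jf] [rg jg]; split.
  by under eq_fun do rewrite ReM; apply: measurable_funB; exact: measurable_funM.
by under eq_fun do rewrite ImM; apply: measurable_funD; exact: measurable_funM.
Qed.

Lemma cmeasZ c f : cmeas f -> cmeas (fun x => c * f x).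
Proof. by apply: cmeasM; exact: cmeas_cst. Qed.

Lemma cmeasN f : cmeas f -> cmeas (fun x => - f x).
Proof. by move=> /(cmeasZ (-1)); under eq_fun do rewrite mulN1r. Qed.

Lemma cmeasB f g : cmeas f -> cmeas g -> cmeas (fun x => f x - g x).
Proof. by move=> mf /cmeasN; exact: cmeasD. Qed.

Lemma cmeasJ f : cmeas f -> cmeas (fun x => conjc (f x)).
Proof.
move=> [rf jf]; split; first by under eq_fun do rewrite ReJ.
by under eq_fun do rewrite ImJ; exact: measurableT_comp.
Qed.

Lemma cmeas_cexpi u : measurable_fun setT u -> cmeas (fun x => cexpi (u x)).
Proof.
move=> mu_; split => /=; apply: measurableT_comp => //.
  by apply: continuous_measurable_fun; exact: continuous_cos.
by apply: continuous_measurable_fun; exact: continuous_sin.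
Qed.

Lemma measurable_normc f : cmeas f -> measurable_fun setT (fun x => normc (f x)).
Proof.
move=> [rf jf].
rewrite (_ : (fun x => _) = Num.sqrt \o (fun x => Re (f x) ^+ 2 + Im (f x) ^+ 2)).
  apply: measurableT_comp; last first.
    by apply: measurable_funD; exact: measurable_funX.
  by apply: continuous_measurable_fun; exact: sqrt_continuous.
by apply/funext => x /=; case: (f x).
Qed.

Lemma cintg_cmeas f : cintg f -> cmeas f.
Proof. by move=> [? ?]; split; exact: rintg_meas. Qed.

Lemma cintg_le f v : cmeas f -> rintg v -> (forall x, normc (f x) <= v x) ->
  cintg f.
Proof.
move=> [rf jf] iv fv; split; apply: (rintg_le _ iv) => // x.
  by rewrite (le_trans (Re_le_normc _))// (le_trans (fv x))// ler_norm.
by rewrite (le_trans (Im_le_normc _))// (le_trans (fv x))// ler_norm.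
Qed.

Lemma cintg_normc f : cintg f -> rintg (fun x => normc (f x)).
Proof.
move=> cf; have [rf jf] := cf.
apply: (rintg_le _ (rintgD (rintg_abs rf) (rintg_abs jf))) => [|x].
  by apply: measurable_normc; exact: cintg_cmeas.
by rewrite (ger0_norm (normc_ge0 _)) ger0_norm ?addr_ge0// normc_le_ReIm.
Qed.

Lemma eq_cintg f g : f =1 g -> cintg f -> cintg g.
Proof. by move=> /funext ->. Qed.

Lemma cintg_real u : rintg u -> cintg (fun x => (u x)%:C).
Proof. by move=> iu; split => //=; exact: rintg0. Qed.

Lemma cintg0 : cintg (fun=> 0). Proof. by split => /=; exact: rintg0. Qed.

Lemma cintgD f g : cintg f -> cintg g -> cintg (fun x => f x + g x).
Proof.
move=> [rf jf] [rg jg]; split.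
  by under eq_fun do rewrite ReD; exact: rintgD.
by under eq_fun do rewrite ImD; exact: rintgD.
Qed.

Lemma cintgZ c f : cintg f -> cintg (fun x => c * f x).
Proof.
move=> cf; have [rf jf] := cf; apply: (cintg_le _ (rintgZ (normc c) (cintg_normc cf))).
  by apply: cmeasZ; exact: cintg_cmeas.
by move=> x; rewrite normcM.
Qed.

Lemma cintgN f : cintg f -> cintg (fun x => - f x).
Proof. by move=> /(cintgZ (-1)); apply: eq_cintg => x; rewrite mulN1r. Qed.

Lemma cintgB f g : cintg f -> cintg g -> cintg (fun x => f x - g x).
Proof. by move=> cf /cintgN; exact: cintgD. Qed.

Lemma cintgJ f : cintg f -> cintg (fun x => conjc (f x)).
Proof.
move=> [rf jf]; split; first by under eq_fun do rewrite ReJ.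
by under eq_fun do rewrite ImJ; exact: rintgN.
Qed.

Lemma cintg_sum (I : Type) (r : seq I) (P : pred I) (F : I -> T -> R[i]) :
  (forall i, cintg (F i)) -> cintg (fun x => \sum_(i <- r | P i) F i x).
Proof.
move=> iF; elim: r => [|i r IH].
  by apply: eq_cintg cintg0 => x; rewrite big_nil.
case: (boolP (P i)) => Pi; last first.
  by apply: eq_cintg IH => x; rewrite big_cons (negbTE Pi).
by apply: eq_cintg (cintgD (iF i) IH) => x; rewrite big_cons Pi.
Qed.

Lemma cintg_bM f g (M : R) : cintg f -> cmeas g -> (forall x, normc (g x) <= M) ->
  cintg (fun x => f x * g x).
Proof.
move=> cf mg gM; apply: (cintg_le _ (rintgZ M (cintg_normc cf))).
  by apply: cmeasM => //; exact: cintg_cmeas.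
by move=> x; rewrite normcM mulrC ler_wpM2r ?normc_ge0.
Qed.

Lemma eq_cint f g : f =1 g -> cint f = cint g.
Proof. by move=> /funext ->. Qed.

Lemma Re_cint f : Re (cint f) = \int[mu]_x Re (f x). Proof. by []. Qed.
Lemma Im_cint f : Im (cint f) = \int[mu]_x Im (f x). Proof. by []. Qed.

Lemma cintD f g : cintg f -> cintg g ->
  cint (fun x => f x + g x) = cint f + cint g.
Proof.
move=> [rf jf] [rg jg]; apply: complexP.
  by rewrite ReD !Re_cint; under eq_Rintegral do rewrite ReD; exact: rintD.
by rewrite ImD !Im_cint; under eq_Rintegral do rewrite ImD; exact: rintD.
Qed.

Lemma cintZ c f : cintg f -> cint (fun x => c * f x) = c * cint f.
Proof.
move=> [rf jf]; apply: complexP.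
  rewrite ReM !(Re_cint, Im_cint); under eq_Rintegral do rewrite ReM.
  by rewrite rintB ?rintZ//; exact: rintgZ.
rewrite ImM !(Re_cint, Im_cint); under eq_Rintegral do rewrite ImM.
by rewrite rintD ?rintZ//; exact: rintgZ.
Qed.

Lemma cintN f : cintg f -> cint (fun x => - f x) = - cint f.
Proof.
by move=> /(cintZ (-1)); rewrite mulN1r => <-; apply: eq_cint => x; rewrite mulN1r.
Qed.

Lemma cintB f g : cintg f -> cintg g ->
  cint (fun x => f x - g x) = cint f - cint g.
Proof. by move=> cf cg; rewrite cintD ?cintN//; exact: cintgN. Qed.

Lemma cintJ f : cintg f -> cint (fun x => conjc (f x)) = conjc (cint f).
Proof.
move=> [rf jf]; apply: complexP.
  by rewrite ReJ !Re_cint; under eq_Rintegral do rewrite ReJ.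
by rewrite ImJ !Im_cint; under eq_Rintegral do rewrite ImJ; exact: rintN.
Qed.

Lemma cint0 : cint (fun=> 0) = 0.
Proof. by rewrite /cint/= !rint0. Qed.

Lemma cint_real u : cint (fun x => (u x)%:C) = (\int[mu]_x u x)%:C.
Proof. by rewrite /cint/= rint0. Qed.

Lemma cint_sum (I : Type) (r : seq I) (P : pred I) (F : I -> T -> R[i]) :
  (forall i, cintg (F i)) ->
  cint (fun x => \sum_(i <- r | P i) F i x) = \sum_(i <- r | P i) cint (F i).
Proof.
move=> iF; elim: r => [|i r IH].
  by rewrite big_nil; under eq_cint do rewrite big_nil; exact: cint0.
rewrite big_cons; case: (boolP (P i)) => Pi.
  by under eq_cint do rewrite big_cons Pi; rewrite cintD ?IH//; exact: cintg_sum.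
by under eq_cint do rewrite big_cons (negbTE Pi).
Qed.

(* the modulus is recovered by rotating the value of the integral to the
   positive half-line *)
Lemma normc_cint f : cintg f -> normc (cint f) <= \int[mu]_x normc (f x).
Proof.
move=> cf; set z := cint f.
have [z0|z0] := eqVneq (normc z) 0.
  by rewrite z0; apply: Rintegral_ge0 => x _; exact: normc_ge0.
have zp : 0 < normc z by rewrite lt_neqAle eq_sym z0 normc_ge0.
rewrite -(ler_pM2l zp) -expr2.
rewrite -rintZ; last exact: cintg_normc.
have -> : normc z ^+ 2 = \int[mu]_x Re (conjc z * f x).
  by rewrite -Re_cint cintZ// -/z mulrC mulJc.
apply: rint_le; first by have [] := cintgZ (conjc z) cf.
  by apply: rintgZ; exact: cintg_normc.
move=> x; rewrite (le_trans (ler_norm _))// (le_trans (Re_le_normc _))//.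
by rewrite normcM normcJ.
Qed.

Lemma normc_cint_le f v : cmeas f -> rintg v -> (forall x, normc (f x) <= v x) ->
  normc (cint f) <= \int[mu]_x v x.
Proof.
move=> mf iv fv; have cf := cintg_le mf iv fv.
by rewrite (le_trans (normc_cint cf))//; apply: rint_le => //; exact: cintg_normc.
Qed.

(** Convergence of complex values is expressed throughout by the real sequence of moduli of the
    differences, tending to 0. *)
Lemma cint_dom_cvg (f_ : nat -> T -> R[i]) f v :
  (forall n, cmeas (f_ n)) -> cmeas f ->
  {ae mu, forall x, normc (f_ n x - f x) @[n --> \oo] --> 0} ->
  rintg v -> (forall n x, normc (f_ n x) <= v x) -> (forall x, normc (f x) <= v x) ->
  normc (cint (f_ n) - cint f) @[n --> \oo] --> 0.
Proof.
move=> mf_ mf cf iv f_v fv.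
have c0 : \int[mu]_x normc (f_ n x - f x) @[n --> \oo] --> (0 : R).
  rewrite -[X in _ --> X]rint0.
  apply: (@rint_dom_cvg (fun n x => normc (f_ n x - f x)) (fun=> 0)
    (fun x => 2 * v x)) => //.
  - by move=> n; apply: measurable_normc; exact: cmeasB.
  - exact: rintgZ.
  - move=> n x; rewrite ger0_norm ?normc_ge0//.
    by rewrite (le_trans (normcD _ _))// normcN mulr_natl mulr2n lerD.
apply: (squeeze_cvgr _ (cvg_cst 0) c0); apply: nearW => n; rewrite normc_ge0 andTb.
have cfn : cintg (f_ n) by exact: cintg_le iv _.
have cff : cintg f by exact: cintg_le iv _.
by rewrite -cintB// normc_cint//; exact: cintgB.
Qed.

End cint.

(** * Translations and linear changes of variables *)

Section cV_measure.
Context {R : realType}.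
Local Notation mu n := (lebesgue_cV (R := R) n).

Lemma measurable_linform n (a : 'I_n -> R) :
  measurable_fun setT (fun x : 'cV[R]_n => \sum_i a i * x i ord0).
Proof.
rewrite (_ : (fun x => _) = fun x : 'cV[R]_n => \sum_(i <- index_enum 'I_n) a i * x i ord0)//.
apply: measurable_sum => i; apply: measurable_funM => //; exact: measurable_coord.
Qed.

Lemma measurable_mulmx n m (M : 'M[R]_(m, n)) :
  measurable_fun setT (fun x : 'cV[R]_n => M *m x).
Proof.
apply/measurable_fun_cVP => i; under eq_fun do rewrite mxE.
exact: measurable_linform.
Qed.

Lemma measurable_cVD d (T : measurableType d) n (f g : T -> 'cV[R]_n) :
  measurable_fun setT f -> measurable_fun setT g ->
  measurable_fun setT (fun x => f x + g x).
Proof.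
move=> /measurable_fun_cVP mf /measurable_fun_cVP mg.
by apply/measurable_fun_cVP => i; under eq_fun do rewrite mxE; exact: measurable_funD.
Qed.

Lemma measurable_shift n (y : 'cV[R]_n) :
  measurable_fun setT (fun x : 'cV[R]_n => x + y).
Proof. by apply: (@measurable_cVD _ _ n id (cst y)). Qed.

Lemma measurable_cVN d (T : measurableType d) n (f : T -> 'cV[R]_n) :
  measurable_fun setT f -> measurable_fun setT (fun x => - f x).
Proof.
move=> /measurable_fun_cVP mf; apply/measurable_fun_cVP => i.
by under eq_fun do rewrite mxE; exact: measurableT_comp.
Qed.

Lemma measurable_dot d (T : measurableType d) n (f g : T -> 'cV[R]_n) :
  measurable_fun setT f -> measurable_fun setT g ->
  measurable_fun setT (fun x => dot (f x) (g x)).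
Proof.
move=> /measurable_fun_cVP mf /measurable_fun_cVP mg; rewrite /dot.
by apply: measurable_sum => i; apply: measurable_funM.
Qed.

(** The Lebesgue measure and its image under the translation agree on half-open intervals, hence
    everywhere. *)
Lemma ge0_integral_shift1 (f : R -> \bar R) (a : R) :
  measurable_fun setT f -> (forall x, 0 <= f x)%E ->
  (\int[@lebesgue_measure R]_x f (x + a)%R = \int[@lebesgue_measure R]_x f x)%E.
Proof.
move=> mf f0.
have ms : measurable_fun setT (fun x : measurableTypeR R => x + a : measurableTypeR R).
  by apply: measurable_funD.
have /= <- := @ge0_integral_pushforward _ _ _ _ R _ ms lebesgue_measure setT f
  measurableT mf (fun x _ => f0 x).
apply: eq_measure_integral => A mA _.
apply/esym/lebesgue_measure_unique => //.
move=> _ [[b c] _ <-]; rewrite /pushforward/=.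
rewrite [X in _ = lebesgue_measure X](_ : _ = `]b - a, c - a]%classic); last first.
  by apply/seteqP; split => x/=; rewrite !in_itv/= lerBrDr ltrBlDr.
rewrite !lebesgue_measure_itv/= !lte_fin ltrD2r.
by case: ifP => // _; rewrite -!EFinB; congr EFin; ring.
Qed.

Lemma ge0_integral_cVS n (f : 'cV[R]_n.+1 -> \bar R) :
  measurable_fun setT f -> (forall x, 0 <= f x)%E ->
  (\int[mu n.+1]_x f x =
   \int[@lebesgue_measure R]_t \int[mu n]_v f (cV_cons (t, v)))%E.
Proof.
move=> mf f0.
have := @ge0_integral_pushforward _ _ _ _ R _ (@measurable_cV_cons R n)
  (@lebesgue_measure R \x mu n)%E setT f measurableT mf (fun x _ => f0 x).
rewrite preimage_setT => ->.
rewrite fubini_tonelli1//; first last.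
  by move=> x; exact: f0.
apply: measurableT_comp => //.
Qed.

Lemma measurable_fun_cVS n (f : 'cV[R]_n.+1 -> \bar R) t :
  measurable_fun setT f -> measurable_fun setT (fun v => f (cV_cons (t, v))).
Proof.
move=> mf; apply: measurableT_comp mf _.
apply/measurable_fun_cVP => i; under eq_fun do rewrite mxE.
case: (unliftP ord0 i) => [j|] _; last exact: measurable_cst.
exact: measurable_coord.
Qed.

Lemma ge0_integral_shift n (f : 'cV[R]_n -> \bar R) (y : 'cV[R]_n) :
  measurable_fun setT f -> (forall x, 0 <= f x)%E ->
  (\int[mu n]_x f (x + y)%R = \int[mu n]_x f x)%E.
Proof.
elim: n => [|n IH] in f y *.
  move=> mf f0; apply: eq_integral => x _; congr f.
  by apply/colP => -[].
move=> mf f0.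
have mfy : measurable_fun setT (fun x : 'cV[R]_n.+1 => f (x + y)).
  exact: measurableT_comp mf (measurable_shift y).
rewrite !ge0_integral_cVS//.
rewrite -(@ge0_integral_shift1 (fun t => \int[mu n]_v f (cV_cons (t, v)))%E (y ord0 ord0)).
- apply: eq_integral => t _.
  have := IH (fun v => f (cV_cons (t + y ord0 ord0, v))) (\col_i y (lift ord0 i) ord0)
    (measurable_fun_cVS _ mf) (fun v => f0 _).
  move=> <-.
  apply: eq_integral => v _; congr f; apply/colP => i; rewrite !mxE.
  by case: (unliftP ord0 i) => [j|] -> /=; rewrite ?mxE.
- have mg : measurable_fun setT (f \o @cV_cons R n).
    by apply: measurableT_comp => //.
  exact: (measurable_fun_fubini_tonelli_F _ mg (fun=> f0 _)).
- by move=> t; exact: integral_ge0.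
Qed.

(** Change of variables with a constant Jacobian [c]. Translations have [c = 1]; for an invertible
    matrix some positive [c] is shown to exist and is carried along as a parameter. *)
Definition rescales n (phi : 'cV[R]_n -> 'cV[R]_n) (c : R) : Prop :=
  measurable_fun setT phi /\
  forall f : 'cV[R]_n -> \bar R, measurable_fun setT f -> (forall x, 0 <= f x)%E ->
  (\int[mu n]_x f (phi x) = c%:E * \int[mu n]_x f x)%E.

Lemma rescales_shift n (y : 'cV[R]_n) : rescales (fun x => x + y) 1.
Proof.
split; first exact: measurable_shift.
by move=> f mf f0; rewrite mul1e ge0_integral_shift.
Qed.

Lemma bounded_lebesgue_lty n (A : set 'cV[R]_n) (K : R) : measurable A ->
  (forall x, A x -> forall i, `|x i ord0| <= K) -> (mu n A < +oo)%E.
Proof.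
move=> mA AK.
have [K0|K0] := leP 0 K; last first.
  (* A negative [K] leaves only the empty set, except in dimension 0, where the condition on
     coordinates is vacuous and the measure is a Dirac mass. *)
  have [m e] : exists m, n = m by exists n.
  case: m e => [|m] e.
    move: A mA AK; rewrite e => A mA AK.
    rewrite (le_lt_trans (y := \d_(0 : 'cV[R]_0) setT))//.
      by apply: le_measure; rewrite ?inE.
    by rewrite diracT ltry.
  rewrite (_ : A = set0) ?measure0//; apply/seteqP; split => // x Ax.
  have i0 : 'I_n by rewrite e; exact: ord0.
  by have := AK x Ax i0; rewrite leNgt (lt_le_trans K0).
have := @lebesgue_cV_box R n (fun=> - K) (fun=> K).
set B := (X in mu n X) => bE.
have mB : measurable B.
  rewrite (_ : B = \bigcap_(i in [set: 'I_n])
    ((fun x : 'cV[R]_n => x i ord0) @^-1` [set` `[- K, K]])); last first.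
    by apply/seteqP; split => x /= h i => [_|]; [exact: h|exact: h i I].
  rewrite bigcap_mkcond; apply: fin_bigcap_measurable => // i _.
  rewrite mem_set//= -[X in measurable X]setTI.
  exact: (measurable_coord i measurableT (measurable_itv _)).
rewrite (le_lt_trans (y := mu n B))//.
  apply: le_measure; rewrite ?inE// => x Ax i.
  by rewrite in_itv/= -ler_norml; exact: AK.
by rewrite bE ?ltry// => i; rewrite ge0_cp.
Qed.

(* Uniqueness of Haar measure: exchanging the order of integration in
   [f (M x) * 1_Q (y - M x)] computes its integral in two ways. *)
Lemma rescales_mulmx n (M : 'M[R]_n) : M \in unitmx ->
  exists2 c : R, 0 < c & rescales (fun x => M *m x) c.
Proof.
move=> uM.
pose Q : set 'cV[R]_n := [set x | forall i, x i ord0 \in `[0 : R, 1]].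
have mQ : measurable Q.
  rewrite (_ : Q = \bigcap_(i in [set: 'I_n])
    ((fun x : 'cV[R]_n => x i ord0) @^-1` [set` `[(0:R), 1]])); last first.
    by apply/seteqP; split => x /= h i => [_|]; [exact: h|exact: h i I].
  rewrite bigcap_mkcond; apply: fin_bigcap_measurable => // i _.
  rewrite mem_set//= -[X in measurable X]setTI.
  exact: (measurable_coord i measurableT (measurable_itv _)).
have Q1 : mu n Q = 1%E.
  rewrite (@lebesgue_cV_box R n (fun=> 0) (fun=> 1)) ?ler01//.
  by rewrite subr0 big1_eq.
pose iQ (x : 'cV[R]_n) : \bar R := (\1_Q x)%:E.
have iQ0 x : (0 <= iQ x)%E by rewrite lee_fin.
have miQ : measurable_fun setT iQ by apply/measurable_EFinP; exact: measurable_indic.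
have intQ : (\int[mu n]_x iQ x = 1)%E by rewrite /iQ integral_indic// setIT.
have mM := measurable_mulmx M.
have mNM : measurable_fun setT (fun x : 'cV[R]_n => - (M *m x)) by exact: measurable_cVN.
pose C := (\int[mu n]_x iQ (- (M *m x))%R)%E.
have miQM : measurable_fun setT (fun x : 'cV[R]_n => iQ (- (M *m x))).
  exact: measurableT_comp miQ mNM.
have key (f : 'cV[R]_n -> \bar R) : measurable_fun setT f -> (forall x, 0 <= f x)%E ->
    (\int[mu n]_x f (M *m x)%R = C * \int[mu n]_x f x)%E.
  move=> mf f0.
  have mfM : measurable_fun setT (fun x : 'cV[R]_n => f (M *m x)).
    exact: measurableT_comp mf mM.
  pose F (p : 'cV[R]_n * 'cV[R]_n) := (f (M *m p.1) * iQ (p.2 - M *m p.1)%R)%E.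
  have F0 p : (0 <= F p)%E by rewrite /F mule_ge0.
  have m1 : measurable_fun setT (fun p : 'cV[R]_n * 'cV[R]_n => M *m p.1).
    exact: measurableT_comp mM measurable_fst.
  have mF : measurable_fun setT F.
    apply: emeasurable_funM; first exact: measurableT_comp mf m1.
    apply: (measurableT_comp miQ); apply: measurable_cVD; first exact: measurable_snd.
    exact: measurable_cVN.
  pose G (p : 'cV[R]_n * 'cV[R]_n) := (iQ (- (M *m p.1))%R * f (p.2 + M *m p.1)%R)%E.
  have G0 p : (0 <= G p)%E by rewrite /G mule_ge0.
  have mG : measurable_fun setT G.
    apply: emeasurable_funM; first exact: measurableT_comp miQM measurable_fst.
    apply: (measurableT_comp mf); apply: measurable_cVD => //; exact: measurable_snd.
  transitivity (\int[mu n]_x \int[mu n]_y F (x, y))%E.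
    apply: eq_integral => x _; rewrite /F/= ge0_integralZl//.
      by rewrite (ge0_integral_shift _ miQ)// intQ mule1.
    exact: measurableT_comp miQ (measurable_shift _).
  rewrite (fubini_tonelli _ mF F0).
  transitivity (\int[mu n]_y \int[mu n]_x G (x, y))%E.
    apply: eq_integral => y _.
    have mFy : measurable_fun setT (fun x => F (x, y)).
      by apply: measurableT_comp mF _; exact: measurable_pair2.
    (* Shifting [x] by [invmx M *m y] adds [y] to [M *m x], so the cube factor becomes independent
       of [y]: this turns [F] into [G]. *)
    rewrite -(ge0_integral_shift (invmx M *m y) mFy)//.
    apply: eq_integral => x _; rewrite /F /G/= mulmxDr mulKVmx// muleC.
    by rewrite opprD addrCA subrr addr0 addrC.
  rewrite -(fubini_tonelli _ mG G0).
  rewrite /C -ge0_integralZr//; last exact: integral_ge0.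
  apply: eq_integral => x _; rewrite /G/= ge0_integralZl//.
    by rewrite (ge0_integral_shift _ mf).
  exact: measurableT_comp mf (measurable_shift _).
have C0 : (0 <= C)%E by exact: integral_ge0.
have Coo : (C < +oo)%E.
  pose A := [set x : 'cV[R]_n | Q (- (M *m x))].
  have mA : measurable A by rewrite -[A]setTI; exact: mNM.
  have -> : C = mu n A.
    by rewrite /C /iQ -[A]setIT -integral_indic.
  apply: (@bounded_lebesgue_lty n A (\sum_i \sum_j `|invmx M i j|)) => // x Ax i.
  have -> : x = invmx M *m (M *m x) by rewrite mulKmx.
  rewrite mxE (le_trans (ler_norm_sum _ _ _))//.
  rewrite [leRHS](bigD1 i)//= ler_wpDr//.
    by apply: sumr_ge0 => k _; apply: sumr_ge0.
  apply: ler_sum => j _; rewrite normrM ler_piMr//.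
  have : (- (M *m x)) j ord0 \in `[0 : R, 1] := Ax j.
  rewrite mxE in_itv/= => /andP[a b].
  by rewrite -normrN ger0_norm.
have Cn0 : C != 0%E.
  apply/eqP => C00.
  have := key (fun=> 1%E) (measurable_cst _) (fun=> lee01).
  rewrite C00 mul0e integral_cst// mul1e => T0.
  have : (mu n Q <= mu n setT)%E by apply: le_measure; rewrite ?inE.
  by rewrite Q1 T0 leNgt lte01.
have Cf : C \is a fin_num by rewrite ge0_fin_numE.
exists (fine C).
  by rewrite fine_gt0// Coo andbT lt_neqAle eq_sym Cn0.
by split => // f mf f0; rewrite fineK//; exact: key.
Qed.

Section rescales_integral.
Context (n : nat) (phi : 'cV[R]_n -> 'cV[R]_n) (c : R).
Context (hphi : rescales phi c).

Lemma rescales_measurable d (T : measurableType d) (u : 'cV[R]_n -> T) :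
  measurable_fun setT u -> measurable_fun setT (fun x => u (phi x)).
Proof. by case: hphi => mphi _ mu_; exact: measurableT_comp mu_ mphi. Qed.

Lemma rescales_rintg (u : 'cV[R]_n -> R) : rintg (mu n) u ->
  rintg (mu n) (fun x => u (phi x)).
Proof.
move=> /rintgP[mu_ ui]; apply/rintgP; split; first exact: rescales_measurable.
have [_ E] := hphi; rewrite (E (fun y => (`|u y|)%:E)) => [||x]; rewrite ?lee_fin//; last first.
  by apply/measurable_EFinP; exact: measurableT_comp.
have := ui; rewrite -ge0_fin_numE; last by apply: integral_ge0 => x _; rewrite lee_fin.
by move=> h; rewrite -(fineK h) -EFinM ltry.
Qed.

Lemma rescales_rint (u : 'cV[R]_n -> R) : rintg (mu n) u ->
  \int[mu n]_x u (phi x) = c * \int[mu n]_x u x.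
Proof.
have ge0 (v : 'cV[R]_n -> R) : rintg (mu n) v -> (forall x, 0 <= v x) ->
    \int[mu n]_x v (phi x) = c * \int[mu n]_x v x.
  move=> iv v0; apply: EFin_inj; rewrite EFinM -!rintE//; last exact: rescales_rintg.
  have [_ E] := hphi; rewrite (E (fun y => (v y)%:E))//.
  by apply/measurable_EFinP; exact: rintg_meas iv.
move=> iu.
have ip : rintg (mu n) (fun x => `|u x| + u x) by apply: rintgD => //; exact: rintg_abs.
have ia : rintg (mu n) (fun x => `|u x|) by exact: rintg_abs.
(* A difference of two nonnegative integrable functions, for each of which the rule is known. *)
have E1 x : u x = (`|u x| + u x) - `|u x| by rewrite addrC addKr.
under eq_Rintegral do rewrite E1.
under [in RHS]eq_Rintegral do rewrite E1.
rewrite !rintB//; [|exact: (rescales_rintg ip)|exact: (rescales_rintg ia)].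
rewrite mulrBr (ge0 (fun x => `|u x| + u x))// ?(ge0 (fun x => `|u x|))//.
by move=> x; have := ler_norm (- u x); rewrite normrN; lra.
Qed.

Lemma rescales_cmeas (f : 'cV[R]_n -> R[i]) : cmeas f -> cmeas (fun x => f (phi x)).
Proof. by move=> [? ?]; split; exact: (rescales_measurable (u := fun x => _ (f x))). Qed.

Lemma rescales_cintg (f : 'cV[R]_n -> R[i]) : cintg (mu n) f ->
  cintg (mu n) (fun x => f (phi x)).
Proof. by move=> [? ?]; split; exact: (rescales_rintg (u := fun x => _ (f x))). Qed.

Lemma rescales_cint (f : 'cV[R]_n -> R[i]) : cintg (mu n) f ->
  cint (mu n) (fun x => f (phi x)) = c%:C * cint (mu n) f.
Proof.
move=> [? ?]; apply: complexP; rewrite !(ReM, ImM) /= mul0r ?subr0 ?addr0.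
  exact: (rescales_rint (u := fun x => Re (f x))).
exact: (rescales_rint (u := fun x => Im (f x))).
Qed.

End rescales_integral.

End cV_measure.

(** * Fubini *)

Section fubini.
Context d1 d2 (T1 : measurableType d1) (T2 : measurableType d2) (R : realType).
Context (m1 : {sigma_finite_measure set T1 -> \bar R})
  (m2 : {sigma_finite_measure set T2 -> \bar R}).

(** The slices are assumed integrable at every point, not almost everywhere, so that the real inner
    integrals agree pointwise with the extended ones. *)
Lemma rint_fubini (u : T1 * T2 -> R) : rintg (m1 \x m2)%E u ->
  (forall x, rintg m2 (fun y => u (x, y))) ->
  (forall y, rintg m1 (fun x => u (x, y))) ->
  \int[m1]_x \int[m2]_y u (x, y) = \int[m2]_y \int[m1]_x u (x, y).
Proof.
move=> iu i2 i1.
rewrite /Rintegral; congr fine.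
transitivity (\int[m1]_x \int[m2]_y (u (x, y))%:E)%E.
  by apply: eq_integral => x _; rewrite [RHS]rintE.
transitivity (\int[m2]_y \int[m1]_x (u (x, y))%:E)%E; last first.
  by apply: eq_integral => x _; rewrite [LHS]rintE.
by rewrite [LHS](integral12_prod_meas1 iu) [RHS](integral21_prod_meas1 iu).
Qed.

Lemma rintg_prod (u : T1 -> R) (v : T2 -> R) : rintg m1 u -> rintg m2 v ->
  rintg (m1 \x m2)%E (fun p => u p.1 * v p.2).
Proof.
move=> iu iv.
have mu_ := rintg_meas iu; have mv := rintg_meas iv.
have muv : measurable_fun setT (fun p : T1 * T2 => u p.1 * v p.2).
  apply: measurable_funM; first exact: measurableT_comp mu_ measurable_fst.
  exact: measurableT_comp mv measurable_snd.
apply/rintgP; split => //.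
rewrite fubini_tonelli1//; last first.
  by apply/measurable_EFinP; exact: measurableT_comp.
have E x : fubini_F m2 (fun p => (`|u p.1 * v p.2|)%:E) x
    = ((\int[m2]_y `|v y|) * `|u x|)%:E.
  rewrite /fubini_F/=.
  under eq_integral do rewrite normrM EFinM.
  rewrite ge0_integralZl//; first by rewrite (rintE (rintg_abs iv)) -EFinM mulrC.
    by apply/measurable_EFinP; exact: measurableT_comp.
rewrite (eq_integral (fun x => ((\int[m2]_y `|v y|) * `|u x|)%:E)) => [|x _]; last exact: E.
rewrite (rintE (u := fun x => _ * `|u x|)) ?ltry//.
by apply: rintgZ; exact: rintg_abs.
Qed.

Lemma cint_fubini (f : T1 * T2 -> R[i]) : cintg (m1 \x m2)%E f ->
  (forall x, cintg m2 (fun y => f (x, y))) ->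
  (forall y, cintg m1 (fun x => f (x, y))) ->
  cint m1 (fun x => cint m2 (fun y => f (x, y))) =
  cint m2 (fun y => cint m1 (fun x => f (x, y))).
Proof.
move=> [rf jf] i2 i1; apply: complexP; rewrite !(Re_cint, Im_cint).
  apply: (rint_fubini rf) => [x|y]; first by have [] := i2 x.
  by have [] := i1 y.
apply: (rint_fubini jf) => [x|y]; first by have [] := i2 x.
by have [] := i1 y.
Qed.

Lemma measurable_rint (u : T1 * T2 -> R) : measurable_fun setT u ->
  measurable_fun setT (fun x => \int[m2]_y u (x, y)).
Proof.
move=> mu_.
have mE : measurable_fun setT (EFin \o u) by exact/measurable_EFinP.
rewrite (_ : (fun x => _) = fun x => fine
  (\int[m2]_y (EFin \o u)^\+ (x, y) - \int[m2]_y (EFin \o u)^\- (x, y))%E).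
  apply: measurableT_comp => //; apply: emeasurable_funB.
    exact: (measurable_fun_fubini_tonelli_F _ (measurable_funepos mE)).
  exact: (measurable_fun_fubini_tonelli_F _ (measurable_funeneg mE)).
apply/funext => x; rewrite /Rintegral integralE.
by congr (fine (_ - _)%E); apply: eq_integral => y _; rewrite ?funeposE ?funenegE.
Qed.

Lemma cmeas_cint (f : T1 * T2 -> R[i]) : cmeas f ->
  cmeas (fun x => cint m2 (fun y => f (x, y))).
Proof.
move=> [rf jf]; split; rewrite /cint/=.
  exact: (@measurable_rint (fun p => Re (f p))).
exact: (@measurable_rint (fun p => Im (f p))).
Qed.

End fubini.

(** * Products of a function of the first coordinate and a function of the others *)

Section tensor.
Context {R : realType}.
Local Notation mu n := (lebesgue_cV (R := R) n).
Local Notation lam := (@lebesgue_measure R).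

Definition ctail n (x : 'cV[R]_n.+1) : 'cV[R]_n := \col_i x (lift ord0 i) ord0.

Lemma measurable_ctail n : measurable_fun setT (@ctail n).
Proof.
by apply/measurable_fun_cVP => i; under eq_fun do rewrite mxE; exact: measurable_coord.
Qed.

Lemma cV_cons0 n (t : R) (v : 'cV[R]_n) : (cV_cons (t, v)) ord0 ord0 = t.
Proof. by rewrite mxE unlift_none. Qed.

Lemma cV_consS n (t : R) (v : 'cV[R]_n) i : (cV_cons (t, v)) (lift ord0 i) ord0 = v i ord0.
Proof. by rewrite mxE liftK. Qed.

Lemma ctail_cons n (t : R) (v : 'cV[R]_n) : ctail (cV_cons (t, v)) = v.
Proof. by apply/colP => i; rewrite mxE cV_consS. Qed.

Lemma measurable_tensor n (u : R -> R) (v : 'cV[R]_n -> R) :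
  measurable_fun setT u -> measurable_fun setT v ->
  measurable_fun setT (fun x : 'cV[R]_n.+1 => u (x ord0 ord0) * v (ctail x)).
Proof.
move=> mu_ mv; apply: measurable_funM.
  exact: measurableT_comp mu_ (measurable_coord _).
exact: measurableT_comp mv (@measurable_ctail n).
Qed.

Lemma ge0_tensor n (u : R -> R) (v : 'cV[R]_n -> R) :
  (forall t, 0 <= u t) -> (forall x, 0 <= v x) -> rintg lam u -> rintg (mu n) v ->
  (\int[mu n.+1]_x (u (x ord0 ord0) * v (ctail x))%:E =
    ((\int[lam]_t u t) * \int[mu n]_x v x)%:E)%E.
Proof.
move=> u0 v0 iu iv.
have mu_ := rintg_meas iu; have mv := rintg_meas iv.
rewrite ge0_integral_cVS//; first last.
- by move=> x; rewrite lee_fin mulr_ge0.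
- by apply/measurable_EFinP; exact: measurable_tensor.
have E t : (\int[mu n]_w (u ((cV_cons (t, w)) ord0 ord0) * v (ctail (cV_cons (t, w))))%:E
    = ((\int[mu n]_x v x) * u t)%:E)%E.
  under eq_integral do rewrite cV_cons0 ctail_cons EFinM.
  rewrite ge0_integralZl//; first by rewrite (rintE iv) muleC -EFinM.
    exact/measurable_EFinP.
    by move=> y _; rewrite lee_fin.
  by rewrite lee_fin.
transitivity (\int[lam]_t ((\int[mu n]_x v x) * u t)%:E)%E.
  by apply: eq_integral => t _; exact: E.
by rewrite (rintE (rintgZ _ iu)) rintZ// mulrC.
Qed.

Lemma rintg_tensor n (u : R -> R) (v : 'cV[R]_n -> R) :
  rintg lam u -> rintg (mu n) v ->
  rintg (mu n.+1) (fun x => u (x ord0 ord0) * v (ctail x)).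
Proof.
move=> iu iv; apply/rintgP; split.
  exact: measurable_tensor (rintg_meas iu) (rintg_meas iv).
under eq_integral do rewrite normrM.
have := ge0_tensor (fun t => normr_ge0 (u t)) (fun t => normr_ge0 (v t))
  (rintg_abs iu) (rintg_abs iv).
by move=> ->; exact: ltry.
Qed.

Lemma rint_tensor n (u : R -> R) (v : 'cV[R]_n -> R) :
  rintg lam u -> rintg (mu n) v ->
  \int[mu n.+1]_x (u (x ord0 ord0) * v (ctail x)) =
  (\int[lam]_t u t) * \int[mu n]_x v x.
Proof.
move=> iu iv.
have ge0 u' v' : (forall t, 0 <= u' t) -> (forall x, 0 <= v' x) ->
   rintg lam u' -> rintg (mu n) v' ->
   \int[mu n.+1]_x (u' (x ord0 ord0) * v' (ctail x)) =
   (\int[lam]_t u' t) * \int[mu n]_x v' x.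
  by move=> u0 v0 iu' iv'; rewrite {1}/Rintegral ge0_tensor.
pose a t := `|u t| + u t; pose b t := `|u t|.
pose c t := `|v t| + v t; pose e t := `|v t|.
have ib : rintg lam b by exact: rintg_abs.
have ie : rintg (mu n) e by exact: rintg_abs.
have ia : rintg lam a by exact: rintgD.
have ic : rintg (mu n) c by exact: rintgD.
have a0 t : 0 <= a t by rewrite /a; have := ler_norm (- u t); rewrite normrN; lra.
have c0 t : 0 <= c t by rewrite /c; have := ler_norm (- v t); rewrite normrN; lra.
have b0 t : 0 <= b t by exact: normr_ge0.
have e0 t : 0 <= e t by exact: normr_ge0.
have uE t : u t = a t - b t by rewrite /a /b; ring.
have vE t : v t = c t - e t by rewrite /c /e; ring.
have -> : \int[lam]_t u t = \int[lam]_t a t - \int[lam]_t b t.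
  by under eq_Rintegral do rewrite uE; exact: rintB.
have -> : \int[mu n]_t v t = \int[mu n]_t c t - \int[mu n]_t e t.
  by under eq_Rintegral do rewrite vE; exact: rintB.
transitivity (\int[mu n.+1]_x ((a (x ord0 ord0) * c (ctail x) + b (x ord0 ord0) * e (ctail x))
   - (a (x ord0 ord0) * e (ctail x) + b (x ord0 ord0) * c (ctail x)))).
  by apply: eq_Rintegral => x _; rewrite uE vE; ring.
have T1 := rintg_tensor ia ic; have T2 := rintg_tensor ib ie.
have T3 := rintg_tensor ia ie; have T4 := rintg_tensor ib ic.
rewrite (rintB (rintgD T1 T2) (rintgD T3 T4)) (rintD T1 T2) (rintD T3 T4).
by rewrite (ge0 a c)// (ge0 b e)// (ge0 a e)// (ge0 b c)//; ring.
Qed.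

Lemma cintg_tensor n (f : R -> R[i]) (g : 'cV[R]_n -> R[i]) :
  cintg lam f -> cintg (mu n) g ->
  cintg (mu n.+1) (fun x => f (x ord0 ord0) * g (ctail x)).
Proof.
move=> [rf jf] [rg jg]; split.
  under eq_fun do rewrite ReM.
  by apply: rintgB; [exact: (rintg_tensor rf rg)|exact: (rintg_tensor jf jg)].
under eq_fun do rewrite ImM.
by apply: rintgD; [exact: (rintg_tensor rf jg)|exact: (rintg_tensor jf rg)].
Qed.

Lemma cint_tensor n (f : R -> R[i]) (g : 'cV[R]_n -> R[i]) :
  cintg lam f -> cintg (mu n) g ->
  cint (mu n.+1) (fun x => f (x ord0 ord0) * g (ctail x)) =
  cint lam f * cint (mu n) g.
Proof.
move=> [rf jf] [rg jg]; apply: complexP.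
  rewrite Re_cint ReM !(Re_cint, Im_cint); under eq_Rintegral do rewrite ReM.
  rewrite rintB ?(rint_tensor rf rg) ?(rint_tensor jf jg)//.
    exact: (rintg_tensor rf rg).
  exact: (rintg_tensor jf jg).
rewrite Im_cint ImM !(Re_cint, Im_cint); under eq_Rintegral do rewrite ImM.
rewrite rintD ?(rint_tensor rf jg) ?(rint_tensor jf rg)//.
  exact: (rintg_tensor rf jg).
exact: (rintg_tensor jf rg).
Qed.

End tensor.

(** * The one-dimensional kernel *)

Section kernel1.
Context {R : realType}.
Local Notation lam := (@lebesgue_measure R).

(** [F] differentiates to [g] on the whole line, while [f] agrees with [g] only on the right half:
    this admits the corner of [e1] at 0. Evenness doubles the integral over the half-line. *)
Lemma even_integral (f g F : R -> R) (l : R) : (forall x, 0 <= f x) ->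
  continuous f -> (forall x, f (- x) = f x) ->
  (forall x : R, is_derive x (1 : R) F (g x)) -> (forall x, 0 <= x -> f x = g x) ->
  F x @[x --> +oo] --> l ->
  (\int[lam]_x (f x)%:E = (2 * (l - F 0))%:E)%E.
Proof.
move=> f0 cf ef dF fg Fl.
rewrite ge0_symfun_integralT//; last by move=> x /=; rewrite ef.
rewrite -set_itvcy (@ge0_continuous_FTC2y _ f F 0 l)//.
- exact: continuous_subspaceT.
- apply: cvg_at_right_filter.
  by apply/differentiable_continuous/derivable1_diffP; apply: ex_derive.
- move=> x; rewrite in_itv/= andbT => x0; rewrite derive1E derive_val fg//.
  exact: ltW.
Qed.

Definition e1 (t : R) : R := expR (- `|t|).

Lemma e1_gt0 t : 0 < e1 t. Proof. exact: expR_gt0. Qed.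
Lemma continuous_e1 : continuous e1.
Proof.
move=> t; apply: continuous_comp; last exact: continuous_expR.
by apply: continuousN; exact: norm_continuous.
Qed.

Lemma cvg0_le (T : Type) (F : set_system T) {FF : Filter F} (f g : T -> R) :
  (forall x, `|f x| <= g x) -> g x @[x --> F] --> 0 -> f x @[x --> F] --> 0.
Proof.
move=> fg g0; apply: norm_cvg0; apply: (squeeze_cvgr _ (cvg_cst 0) g0).
by apply: nearW => x; rewrite normr_ge0 fg.
Qed.

(** Adding 1 to the cosine makes the integrand nonnegative, as [even_integral] demands; [rint_e1cos]
    subtracts the constant part again. *)
Lemma int_e1cos (b : R) :
  (\int[lam]_t (e1 t * (1 + cos (b * t)))%:E = (2 * (1 + (1 + b ^+ 2)^-1))%:E)%E.
Proof.
have b0 : 1 + b ^+ 2 != 0 by rewrite gt_eqF// ltr_wpDr// sqr_ge0.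
pose F t := expR (- t) * (- 1 + (b * sin (b * t) - cos (b * t)) * (1 + b ^+ 2)^-1).
have dF (t : R) : is_derive t (1 : R) F (expR (- t) * (1 + cos (b * t))).
  apply: is_derive_eq.
  rewrite /GRing.scale/=; field; exact: b0.
rewrite (@even_integral _ (fun t => expR (- t) * (1 + cos (b * t))) F 0).
- rewrite /F oppr0 mulr0 expR0 sin0 cos0; congr (_%:E); field; exact: b0.
- by move=> t; rewrite mulr_ge0 ?(ltW (e1_gt0 _))// -lerBlDl sub0r cos_geN1.
- move=> t; apply: continuousM; first exact: continuous_e1.
  apply: continuousD; first exact: cvg_cst.
  apply: continuous_comp; last exact: continuous_cos.
  by apply: continuousM; [exact: cvg_cst|exact: cvg_id].
- by move=> t; rewrite /e1 normrN mulrN cosN.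
- by move=> t t0; rewrite /e1 ger0_norm.
- apply: (@cvg0_le _ _ _ _ (fun t => (1 + (`|b| + 1) * (1 + b ^+ 2)^-1) * expR (- t))).
    move=> t; rewrite /F normrM ger0_norm ?expR_ge0// mulrC ler_wpM2r ?expR_ge0//.
    rewrite (le_trans (ler_normD _ _))// normrN1 lerD2l normrM.
    have i0 : 0 <= (1 + b ^+ 2)^-1 by rewrite invr_ge0 addr_ge0 ?sqr_ge0.
    rewrite (ger0_norm i0) ler_wpM2r// (le_trans (ler_normB _ _))// lerD//.
      by rewrite normrM ler_piMr// ler_norml sin_geN1 sin_le1.
    by rewrite ler_norml cos_geN1 cos_le1.
  rewrite -[X in _ --> X](mulr0 (1 + (`|b| + 1) * (1 + b ^+ 2)^-1)).
  by apply: cvgM; [exact: cvg_cst|exact: cvgr_expR].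
Qed.

Lemma measurable_e1 : measurable_fun setT e1.
Proof. by apply: continuous_measurable_fun; exact: continuous_e1. Qed.

Lemma measurable_mulR (b : R) : measurable_fun setT (fun t : R => b * t).
Proof. by apply: measurable_funM. Qed.

Lemma measurable_cosb (b : R) : measurable_fun setT (fun t : R => cos (b * t)).
Proof.
have mc : measurable_fun setT (@cos R).
  by apply: continuous_measurable_fun; exact: continuous_cos.
exact: measurableT_comp mc (measurable_mulR b).
Qed.

Lemma rintg_e1c b : rintg lam (fun t => e1 t * (1 + cos (b * t))).
Proof.
apply/rintgP; split.
  apply: measurable_funM; first exact: measurable_e1.
  apply: measurable_funD => //; exact: measurable_cosb.
under eq_integral => t _.
  rewrite ger0_norm; last first.
    by rewrite mulr_ge0 ?(ltW (e1_gt0 _))// -lerBlDl sub0r cos_geN1.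
  over.
by rewrite int_e1cos ltry.
Qed.

Lemma rintg_e1 : rintg lam e1.
Proof.
apply: eq_rintg (rintgZ 2^-1 (rintg_e1c 0)) => t.
by rewrite mul0r cos0 mulrCA -natr1 mulVf ?mulr1.
Qed.

Lemma rint_e1 : \int[lam]_t e1 t = 2.
Proof.
have := congr1 fine (int_e1cos 0); rewrite -/(Rintegral _ _ _) /=.
rewrite expr0n addr0 invr1 => h.
have : \int[lam]_t (2 * e1 t) = 2 * 2.
  rewrite -[RHS]h; apply: eq_Rintegral => t _.
  by rewrite mul0r cos0 mulrC.
rewrite rintZ; last exact: rintg_e1.
by move=> /mulfI; apply.
Qed.

Lemma rint_e1cos b : \int[lam]_t (e1 t * cos (b * t)) = 2 * (1 + b ^+ 2)^-1.
Proof.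
have := congr1 fine (int_e1cos b); rewrite -/(Rintegral _ _ _) /= => h.
transitivity (\int[lam]_t (e1 t * (1 + cos (b * t)) - e1 t)).
  by apply: eq_Rintegral => t _; ring.
rewrite rintB; [|exact: rintg_e1c|exact: rintg_e1].
by rewrite h rint_e1; ring.
Qed.

Lemma ge0_integral_opp (f : R -> \bar R) :
  measurable_fun setT f -> (forall x, 0 <= f x)%E ->
  (\int[lam]_x f (- x)%R = \int[lam]_x f x)%E.
Proof.
move=> mf f0.
have ms : measurable_fun setT (fun x : measurableTypeR R => - x : measurableTypeR R).
  exact: measurableT_comp.
have /= <- := @ge0_integral_pushforward _ _ _ _ R _ ms lam setT f
  measurableT mf (fun x _ => f0 x).
apply: eq_measure_integral => A mA _.
apply/esym/lebesgue_measure_unique => //.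
move=> _ [[b c] _ <-]; rewrite /pushforward/=.
rewrite [X in _ = lebesgue_measure X](_ : _ = `[- c, - b[%classic); last first.
  by apply/seteqP; split => x/=; rewrite !in_itv/= lerNl ltrNr andbC.
rewrite !lebesgue_measure_itv/= !lte_fin ltrN2.
by case: ifP => // _; rewrite -!EFinB; congr EFin; ring.
Qed.

Lemma measurable_sinb (b : R) : measurable_fun setT (fun t : R => sin (b * t)).
Proof.
have mc : measurable_fun setT (@sin R).
  by apply: continuous_measurable_fun; exact: continuous_sin.
exact: measurableT_comp mc (measurable_mulR b).
Qed.

Lemma rintg_e1M (h : R -> R) : measurable_fun setT h -> (forall t, `|h t| <= 1) ->
  rintg lam (fun t => e1 t * h t).
Proof.
move=> mh h1; apply: (rintg_le _ rintg_e1) => [|t].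
  by apply: measurable_funM => //; exact: measurable_e1.
by rewrite normrM ler_piMr.
Qed.

(** Reflection exchanges 1 + sin and 1 - sin, so their weighted integrals 2 + I and 2 - I
    coincide. *)
Lemma rint_e1sin b : \int[lam]_t (e1 t * sin (b * t)) = 0.
Proof.
have is_ : rintg lam (fun t => e1 t * sin (b * t)).
  apply: rintg_e1M; first exact: measurable_sinb.
  by move=> t; rewrite ler_norml sin_geN1 sin_le1.
have i1 : \int[lam]_t (e1 t * (1 + sin (b * t))) = 2 + \int[lam]_t (e1 t * sin (b * t)).
  rewrite -rint_e1 -rintD//; last exact: rintg_e1.
  by apply: eq_Rintegral => t _; ring.
have i2 : \int[lam]_t (e1 t * (1 - sin (b * t))) = 2 - \int[lam]_t (e1 t * sin (b * t)).
  rewrite -rint_e1 -rintB//; last exact: rintg_e1.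
  by apply: eq_Rintegral => t _; ring.
have : \int[lam]_t (e1 t * (1 + sin (b * t))) = \int[lam]_t (e1 t * (1 - sin (b * t))).
  have mf : measurable_fun setT (fun t => (e1 t * (1 + sin (b * t)))%:E).
    apply/measurable_EFinP; apply: measurable_funM; first exact: measurable_e1.
    by apply: measurable_funD => //; exact: measurable_sinb.
  have f0 t : (0 <= (e1 t * (1 + sin (b * t)))%:E)%E.
    have h : 0 <= 1 + sin (b * t) by have := sin_geN1 (b * t); lra.
    by rewrite lee_fin mulr_ge0// ltW// e1_gt0.
  rewrite /Rintegral -(ge0_integral_opp mf f0).
  congr fine; apply: eq_integral => t _.
  by rewrite /e1 normrN mulrN sinN.
by rewrite i1 i2; lra.
Qed.

Lemma cintg_e1 b : cintg lam (fun t => (e1 t)%:C * cexpi (b * t)).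
Proof.
apply: (cintg_le _ rintg_e1) => [|t].
  apply: cmeasM; first by apply: cmeas_real; exact: measurable_e1.
  by apply: cmeas_cexpi; exact: measurable_mulR.
by rewrite normcM normc_cexpi mulr1 normc_real ger0_norm ?(ltW (e1_gt0 _)).
Qed.

Lemma cint_e1 b : cint lam (fun t => (e1 t)%:C * cexpi (b * t)) =
  (2 * (1 + b ^+ 2)^-1)%:C.
Proof.
apply: complexP; rewrite ?(Re_cint, Im_cint) ?(Re_real, Im_real).
  rewrite -rint_e1cos; apply: eq_Rintegral => t _.
  by rewrite ReM Re_real Im_real mul0r subr0.
rewrite -(rint_e1sin b); apply: eq_Rintegral => t _.
by rewrite ImM Re_real Im_real mul0r addr0.
Qed.

(** The Poisson kernel, which is the transform of [e1]. Its primitive is an arctangent, so its total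
    mass is computed exactly. *)
Definition P1 (x : R) : R := 2 * (1 + (2 * pi * x) ^+ 2)^-1.

Lemma P1_gt0 x : 0 < P1 x.
Proof. by rewrite mulr_gt0// invr_gt0 ltr_wpDr// sqr_ge0. Qed.

Lemma continuous_P1 : continuous P1.
Proof.
move=> x.
suff : {for x, continuous (fun x => 2 * (1 + (2 * pi * x) ^+ 2)^-1)} by [].
apply: continuousM; first exact: cvg_cst.
apply: continuousV; first by rewrite gt_eqF// ltr_wpDr// sqr_ge0.
apply: continuousD; first exact: cvg_cst.
apply: (@continuous_comp _ _ _ (fun x => 2 * pi * x) (fun x => x ^+ 2)).
  exact: mulrl_continuous.
exact: exprn_continuous.
Qed.

Lemma int_P1 : (\int[lam]_x (P1 x)%:E = 1)%E.
Proof.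
have pi0 : pi != 0 :> R by rewrite gt_eqF// pi_gt0.
have dF (x : R) : is_derive x (1 : R) (fun x => pi^-1 * atan (2 * pi * x)) (P1 x).
  apply: is_derive_eq; rewrite /P1 /GRing.scale/=.
  have h : 1 + (2 * pi * x) ^+ 2 != 0 by rewrite gt_eqF// ltr_wpDr// sqr_ge0.
  by move: h pi0; move: (@pi R) => p h p0; field; rewrite h p0.
rewrite (@even_integral P1 P1 (fun x => pi^-1 * atan (2 * pi * x)) 2^-1).
- by rewrite mulr0 atan0 mulr0 subr0 divff.
- by move=> x; exact/ltW/P1_gt0.
- exact: continuous_P1.
- by move=> x; rewrite /P1 mulrN sqrrN.
- by [].
- have -> : 2^-1 = pi^-1 * (pi / 2) :> R by rewrite mulrA mulVf// mul1r.
  apply: cvgM; first exact: cvg_cst.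
  apply: cvg_comp; last exact: cvgy_atan.
  have pp : 0 < 2 * pi :> R by rewrite mulr_gt0// pi_gt0.
  by apply: (gt0_cvgMry pp); exact: cvg_id.
Qed.

Lemma rintg_P1 : rintg lam P1.
Proof.
apply/rintgP; split.
  by apply: continuous_measurable_fun; exact: continuous_P1.
under eq_integral do rewrite (ger0_norm (ltW (P1_gt0 _))).
by rewrite int_P1 ltry.
Qed.

Lemma rint_P1 : \int[lam]_x P1 x = 1.
Proof. by rewrite /Rintegral int_P1. Qed.

End kernel1.

(** * The kernel in several variables *)

Section dot.
Context {R : realType} {n : nat}.
Implicit Types (x y z : 'cV[R]_n) (f g : 'cV[R]_n -> R[i]).
Local Notation mu := (lebesgue_cV (R := R) n).

Definition n1 x : R := \sum_i `|x i ord0|.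

Lemma dotC x y : dot x y = dot y x.
Proof. by apply: eq_bigr => i _; rewrite mulrC. Qed.
Lemma dotDl x y z : dot (x + y) z = dot x z + dot y z.
Proof. by rewrite -big_split; apply: eq_bigr => i _; rewrite mxE mulrDl. Qed.
Lemma dotDr x y z : dot z (x + y) = dot z x + dot z y.
Proof. by rewrite dotC dotDl !(dotC z). Qed.
Lemma dotZl (a : R) x y : dot (a *: x) y = a * dot x y.
Proof. by rewrite /dot mulr_sumr; apply: eq_bigr => i _; rewrite mxE mulrA. Qed.
Lemma dotZr (a : R) x y : dot x (a *: y) = a * dot x y.
Proof. by rewrite dotC dotZl dotC. Qed.
Lemma dotNl x y : dot (- x) y = - dot x y.
Proof. by rewrite -scaleN1r dotZl mulN1r. Qed.
Lemma dotNr x y : dot x (- y) = - dot x y.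
Proof. by rewrite dotC dotNl dotC. Qed.
Lemma dotBl x y z : dot (x - y) z = dot x z - dot y z.
Proof. by rewrite dotDl dotNl. Qed.
Lemma dotBr x y z : dot z (x - y) = dot z x - dot z y.
Proof. by rewrite dotDr dotNr. Qed.
Lemma dot0l x : dot 0 x = 0.
Proof. by rewrite /dot big1// => i _; rewrite mxE mul0r. Qed.
Lemma dotE x y : dot x y = (x^T *m y) ord0 ord0.
Proof. by rewrite mxE; apply: eq_bigr => i _; rewrite mxE. Qed.

Lemma n1_ge0 x : 0 <= n1 x. Proof. exact: sumr_ge0. Qed.
Lemma n1_coord x i : `|x i ord0| <= n1 x.
Proof. by rewrite /n1 (bigD1 i)//= lerDl sumr_ge0. Qed.
Lemma n1D x y : n1 (x + y) <= n1 x + n1 y.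
Proof. by rewrite -big_split/= ler_sum// => i _; rewrite mxE ler_normD. Qed.
Lemma n1Z (a : R) x : n1 (a *: x) = `|a| * n1 x.
Proof. by rewrite /n1 mulr_sumr; apply: eq_bigr => i _; rewrite mxE normrM. Qed.
Lemma n1N x : n1 (- x) = n1 x.
Proof. by rewrite -scaleN1r n1Z normrN1 mul1r. Qed.
Lemma n1B x y : n1 (x - y) = n1 (y - x).
Proof. by rewrite -opprB n1N. Qed.
Lemma n10 : n1 0 = 0.
Proof. by rewrite /n1 big1// => i _; rewrite mxE normr0. Qed.
Lemma n1_eq0 x : n1 x = 0 -> x = 0.
Proof.
move=> h; apply/colP => i; rewrite mxE; apply/eqP; rewrite -normr_eq0.
by rewrite eq_le normr_ge0 andbT -h n1_coord.
Qed.

Lemma dot_le x y : `|dot x y| <= n1 x * n1 y.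
Proof.
rewrite (le_trans (ler_norm_sum _ _ _))// /n1 mulr_suml ler_sum// => i _.
by rewrite normrM ler_wpM2l// n1_coord.
Qed.

Lemma measurable_n1 : measurable_fun setT n1.
Proof.
by apply: measurable_sum => i; apply: measurableT_comp => //; exact: measurable_coord.
Qed.

End dot.

Lemma dot_mulmxl (R : realType) n m (M : 'M[R]_(m, n)) x y :
  dot (M *m x) y = dot x (M^T *m y).
Proof. by rewrite !dotE trmx_mul mulmxA. Qed.

Lemma cexpi_lip (R : realType) (a b : R) : normc (cexpi a - cexpi b) <= 2 * `|a - b|.
Proof.
have lip (f df : R -> R) : (forall x : R, is_derive x (1 : R) f (df x)) ->
    (forall x, `|df x| <= 1) -> `|f a - f b| <= `|a - b|.
  move=> fdf df1.
  wlog ab : a b / a <= b.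
    move=> h; have [/h//|/ltW/h] := leP a b.
    by rewrite distrC (distrC b).
  move: ab; rewrite le_eqVlt => /predU1P[->|ab]; first by rewrite !subrr.
  have cf : {within `[a, b], continuous f}.
    apply: continuous_subspaceT => x.
    by apply/differentiable_continuous/derivable1_diffP; apply: ex_derive.
  have [c _ e] := MVT ab (fun x _ => fdf x) cf.
  by rewrite distrC e normrM (distrC a) ler_piMl.
rewrite (le_trans (normc_le_ReIm _))// !(ReD, ImD, ReN, ImN)/= mulr_natl mulr2n lerD//.
  apply: (lip _ (fun x => - sin x)) => x.
  by rewrite normrN ler_norml sin_geN1 sin_le1.
by apply: (lip _ cos) => x; rewrite ler_norml cos_geN1 cos_le1.
Qed.

Section kernel.
Context {R : realType}.
Local Notation mu n := (lebesgue_cV (R := R) n).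

(** Tensor powers of [e1] and of its transform [P1]: an integrable damping factor and the
    approximate identity that it produces. *)
Definition en n (x : 'cV[R]_n) : R := \prod_i e1 (x i ord0).
Definition Pn n (x : 'cV[R]_n) : R := \prod_i P1 (x i ord0).

Lemma dot_cons n (x y : 'cV[R]_n.+1) :
  dot x y = x ord0 ord0 * y ord0 ord0 + dot (ctail x) (ctail y).
Proof.
rewrite /dot big_ord_recl; congr (_ + _).
by apply: eq_bigr => i _; rewrite !mxE.
Qed.

Lemma enS n (x : 'cV[R]_n.+1) : en x = e1 (x ord0 ord0) * en (ctail x).
Proof.
by rewrite /en big_ord_recl; congr (_ * _); apply: eq_bigr => i _; rewrite mxE.
Qed.

Lemma PnS n (x : 'cV[R]_n.+1) : Pn x = P1 (x ord0 ord0) * Pn (ctail x).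
Proof.
by rewrite /Pn big_ord_recl; congr (_ * _); apply: eq_bigr => i _; rewrite mxE.
Qed.

Lemma en_gt0 n (x : 'cV[R]_n) : 0 < en x.
Proof. by apply: prodr_gt0 => i _; exact: e1_gt0. Qed.

Lemma Pn_gt0 n (x : 'cV[R]_n) : 0 < Pn x.
Proof. by apply: prodr_gt0 => i _; exact: P1_gt0. Qed.

Lemma PnN n (x : 'cV[R]_n) : Pn (- x) = Pn x.
Proof. by apply: eq_bigr => i _; rewrite mxE /P1 mulrN sqrrN. Qed.

Lemma enE n (x : 'cV[R]_n) : en x = expR (- n1 x).
Proof.
rewrite /en /n1 -sumrN; elim/big_rec2 : _ => [|i a b _ ->]; first by rewrite expR0.
by rewrite expRD.
Qed.

Lemma en_le1 n (x : 'cV[R]_n) : en x <= 1.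
Proof. by rewrite enE -[leRHS]expR0 ler_expR oppr_le0 n1_ge0. Qed.

Lemma rint_cV0 (u : 'cV[R]_0 -> R) : measurable_fun setT u ->
  rintg (mu 0) u /\ \int[mu 0]_x u x = u 0.
Proof.
move=> mu_.
have mE (v : 'cV[R]_0 -> R) : measurable_fun setT v ->
    (\int[\d_(0%R : 'cV[R]_0)]_x (v x)%:E = (v 0)%:E)%E.
  move=> mv; rewrite integral_dirac//; last exact/measurable_EFinP.
  by rewrite diracT mul1e.
split; last by rewrite /Rintegral [X in fine X]mE.
apply/rintgP; split => //.
have := mE (fun x => `|u x|) => ->; first exact: ltry.
exact: measurableT_comp.
Qed.

Lemma rintg_en n : rintg (mu n) (@en n) /\ rintg (mu n) (@Pn n) /\
  \int[mu n]_x Pn x = 1.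
Proof.
elim: n => [|n [ie [iP P1]]].
  have c0 (f : 'cV[R]_0 -> R) : measurable_fun setT f.
    rewrite (_ : f = cst (f 0)) //; apply/funext => x; congr f.
    by apply/colP => -[].
  split; first by case: (rint_cV0 (c0 (@en 0))).
  split; first by case: (rint_cV0 (c0 (@Pn 0))).
  by case: (rint_cV0 (c0 (@Pn 0))) => _ ->; rewrite /Pn big_ord0.
split; first by apply: eq_rintg (rintg_tensor rintg_e1 ie) => x; rewrite enS.
split; first by apply: eq_rintg (rintg_tensor rintg_P1 iP) => x; rewrite PnS.
under eq_Rintegral do rewrite PnS.
by rewrite (rint_tensor rintg_P1 iP) P1 rint_P1 mulr1.
Qed.

Lemma cint_en n (x : 'cV[R]_n) :
  cintg (mu n) (fun xi => (en xi)%:C * cexpi (2 * pi * dot x xi)) /\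
  cint (mu n) (fun xi => (en xi)%:C * cexpi (2 * pi * dot x xi)) = (Pn x)%:C.
Proof.
elim: n x => [|n IH] x.
  have e (xi : 'cV[R]_0) : (en xi)%:C * cexpi (2 * pi * dot x xi) = 1 :> R[i].
    by rewrite /en /dot !big_ord0 mulr0 cexpi0 mulr1.
  have [i1 i1E] := rint_cV0 (@measurable_cst _ _ _ _ setT (1 : R)).
  split; first by apply: eq_cintg (cintg_real i1) => xi; rewrite e.
  rewrite (@eq_cint _ _ _ _ _ (fun=> 1%:C)) => [|xi]; last by rewrite e.
  by rewrite cint_real i1E /Pn big_ord0.
have [ig iE] := IH (ctail x).
have E xi : (en xi)%:C * cexpi (2 * pi * dot x xi) =
    ((e1 (xi ord0 ord0))%:C * cexpi ((2 * pi * x ord0 ord0) * xi ord0 ord0)) *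
    ((en (ctail xi))%:C * cexpi (2 * pi * dot (ctail x) (ctail xi))).
  rewrite enS dot_cons mulrDr cexpiD rmorphM/= !mulrA; congr (_ * _).
  by rewrite -!mulrA; congr (_ * _); rewrite mulrC.
split; first by apply: eq_cintg (cintg_tensor (cintg_e1 _) ig) => xi; rewrite E.
rewrite (eq_cint _ E) (cint_tensor (cintg_e1 _) ig) cint_e1 iE PnS -rmorphM.
by [].
Qed.

End kernel.

(** * Fourier inversion *)

Section fourier_theory.
Context {R : realType} {n : nat}.
Local Notation mu := (lebesgue_cV (R := R) n).
Local Notation T := 'cV[R]_n.
Implicit Types (f g : T -> R[i]) (x y xi : T) (s : R).

(* s = 1 is the inverse Fourier transform, s = -1 the Fourier transform *)
Definition ft s f : T -> R[i] :=
  fun x => cint mu (fun xi => f xi * cexpi (s * (2 * pi * dot x xi))).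

Lemma fourierE f : fourier f = ft (-1) f.
Proof.
by apply/funext => x; apply: eq_cint => y; rewrite mulN1r dotC.
Qed.

Definition ker s (p : T * T) : R[i] := cexpi (s * (2 * pi * dot p.1 p.2)).

Lemma cmeas_ker s : cmeas (ker s).
Proof.
apply: cmeas_cexpi; apply: measurable_funM => //; apply: measurable_funM => //.
exact: (measurable_dot measurable_fst measurable_snd).
Qed.

Lemma cmeas_comp d1 d2 (T1 : measurableType d1) (T2 : measurableType d2)
    (phi : T1 -> T2) (h : T2 -> R[i]) : measurable_fun setT phi -> cmeas h ->
  cmeas (fun t => h (phi t)).
Proof. by move=> mphi [h1 h2]; split; [exact: measurableT_comp h1 mphi|exact: measurableT_comp h2 mphi]. Qed.

Lemma cmeas_kerl s x : cmeas (fun xi => cexpi (s * (2 * pi * dot x xi))).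
Proof. by apply: (cmeas_comp (phi := fun xi => (x, xi)) _ (cmeas_ker s)); exact: measurable_pair1. Qed.

Lemma cintg_ker s f x : cintg mu f ->
  cintg mu (fun xi => f xi * cexpi (s * (2 * pi * dot x xi))).
Proof.
move=> cf; apply: (cintg_bM cf (cmeas_kerl s x)) => xi.
by rewrite (normc_cexpi _ : _ = 1).
Qed.

Lemma cmeas_ft s f : cmeas f -> cmeas (ft s f).
Proof.
move=> mf; apply: (cmeas_cint mu (f := fun p => f p.2 * ker s p)).
by apply: cmeasM (cmeas_ker s); exact: cmeas_comp measurable_snd mf.
Qed.

Lemma normc_ft s f x : cintg mu f -> normc (ft s f x) <= \int[mu]_y normc (f y).
Proof.
move=> cf; apply: normc_cint_le; first exact: (cintg_cmeas (cintg_ker s x cf)).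
  exact: cintg_normc.
by move=> y; rewrite normcM normc_cexpi mulr1.
Qed.

Lemma ft_conj s f x : cintg mu f -> conjc (ft s f x) = ft (- s) (fun y => conjc (f y)) x.
Proof.
move=> cf; rewrite /ft -cintJ; last exact: cintg_ker.
by apply: eq_cint => y; rewrite rmorphM/= mulNr -conj_cexpi.
Qed.

Lemma ftD s f g x : cintg mu f -> cintg mu g ->
  ft s (fun y => f y + g y) x = ft s f x + ft s g x.
Proof.
move=> cf cg; rewrite /ft -cintD; [|exact: cintg_ker|exact: cintg_ker].
by apply: eq_cint => y; rewrite mulrDl.
Qed.

Lemma ftZ s (c : R[i]) f x : cintg mu f ->
  ft s (fun y => c * f y) x = c * ft s f x.
Proof.
move=> cf; rewrite /ft -cintZ; last exact: cintg_ker.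
by apply: eq_cint => y; rewrite -mulrA.
Qed.

Lemma ftB s f g x : cintg mu f -> cintg mu g ->
  ft s (fun y => f y - g y) x = ft s f x - ft s g x.
Proof.
move=> cf cg; rewrite -[- ft s g x]mulN1r -ftZ// -ftD//; last exact: cintgZ.
by rewrite /ft; apply: eq_cint => y; rewrite mulN1r.
Qed.

Lemma ft_sum s (I : Type) (r : seq I) (P : pred I) (F : I -> T -> R[i]) x :
  (forall i, cintg mu (F i)) ->
  ft s (fun y => \sum_(i <- r | P i) F i y) x = \sum_(i <- r | P i) ft s (F i) x.
Proof.
move=> cF; rewrite -cint_sum => [|i]; last exact: cintg_ker.
by apply: eq_cint => y; rewrite mulr_suml.
Qed.

(** The kernel is symmetric in its two variables, so Fubini moves the transform from one factor to
    the other. *)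
Lemma mult_formula s f g : cintg mu f -> cintg mu g ->
  cint mu (fun x => ft s f x * g x) = cint mu (fun y => f y * ft s g y).
Proof.
move=> cf cg.
pose H (p : T * T) := f p.2 * g p.1 * ker s p.
have mf := cintg_cmeas cf; have mg := cintg_cmeas cg.
have mH : cmeas H.
  apply: cmeasM (cmeas_ker s); apply: cmeasM.
    exact: cmeas_comp measurable_snd mf.
  exact: cmeas_comp measurable_fst mg.
have iH : cintg (mu \x mu)%E H.
  apply: (cintg_le mH (rintg_prod (cintg_normc cg) (cintg_normc cf))) => p.
  by rewrite !normcM normc_cexpi mulr1 mulrC.
have H1 x : cintg mu (fun y => H (x, y)).
  apply: eq_cintg (cintgZ (g x) (cintg_ker s x cf)) => y.
  by rewrite /H /ker/=; ring.
have H2 y : cintg mu (fun x => H (x, y)).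
  apply: eq_cintg (cintgZ (f y) (cintg_ker s y cg)) => x.
  by rewrite /H /ker/= dotC; ring.
transitivity (cint mu (fun x => cint mu (fun y => H (x, y)))).
  apply: eq_cint => x; rewrite mulrC -cintZ; last exact: cintg_ker.
  by apply: eq_cint => y; rewrite /H mulrA (mulrC (g x)).
rewrite cint_fubini//; apply: eq_cint => y.
rewrite -cintZ; last exact: cintg_ker.
by apply: eq_cint => x; rewrite /H /ker/= dotC; ring.
Qed.

Lemma scale_rescales (e : R) : 0 < e -> exists2 c : R, 0 < c &
  rescales (fun x : T => e *: x) c.
Proof.
move=> e0.
have ue : (e%:M : 'M[R]_n) \in unitmx.
  by rewrite unitmxE det_scalar unitrX// unitfE gt_eqF.
have [c c0 hc] := rescales_mulmx ue; exists c => //.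
by rewrite (_ : (fun x => _) = (fun x : T => e%:M *m x))//; apply/funext => x; rewrite mul_scalar_mx.
Qed.

Lemma measurable_affine x (e : R) : measurable_fun setT (fun z : T => x + e *: z).
Proof.
rewrite (_ : (fun z => _) = (fun w : T => w + x) \o (fun z : T => e%:M *m z)).
  exact: measurableT_comp (measurable_shift x) (measurable_mulmx _).
by apply/funext => z; rewrite /= mul_scalar_mx addrC.
Qed.

Lemma cintgM_Pn f (M e : R) x : cmeas f -> (forall y, normc (f y) <= M) ->
  cintg mu (fun z => f (x + e *: z) * (Pn z)%:C).
Proof.
move=> mf fM.
have [_ [iP _]] := @rintg_en R n.
have mfe : cmeas (fun z : T => f (x + e *: z)).
  exact: cmeas_comp (measurable_affine x e) mf.
apply: eq_cintg (cintg_bM (cintg_real iP) mfe (M := M) _) => z; first by rewrite mulrC.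
exact: fM.
Qed.

(** With [g] the damped character, [mult_formula] moves the transform onto [g], where [cint_en]
    makes it explicit: a rescaled [Pn] centred at [x]. The substitution y = x + e z then absorbs the
    factor [c]. *)
Lemma smoothed_inversion s f (M e : R) x : s ^+ 2 = 1 -> 0 < e -> cintg mu f ->
  (forall y, normc (f y) <= M) ->
  cint mu (fun xi => ft s f xi * ((en (e *: xi))%:C * cexpi (- s * (2 * pi * dot x xi)))) =
  cint mu (fun z => f (x + e *: z) * (Pn z)%:C).
Proof.
move=> s2 e0 cf fM.
have [c c0 hc] := scale_rescales e0.
have en0 : e != 0 by rewrite gt_eqF.
pose k y (zeta : T) : R[i] := (en zeta)%:C * cexpi (2 * pi * dot ((s / e) *: (y - x)) zeta).
pose g xi : R[i] := (en (e *: xi))%:C * cexpi (- s * (2 * pi * dot x xi)).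
have [ie [iP _]] := @rintg_en R n.
have cg : cintg mu g.
  apply: cintg_ker; apply: cintg_real.
  exact: (rescales_rintg hc ie).
have gE y : ft s g y = (c * Pn ((s / e) *: (y - x)))%:C.
  have [ik kE] := cint_en ((s / e) *: (y - x)).
  rewrite rmorphM/= -kE -(rescales_cint hc ik).
  apply: eq_cint => xi; rewrite /g -mulrA -cexpiD; congr (_ * cexpi _).
  rewrite !dotZl dotZr dotBl; field.
  exact: en0.
rewrite (mult_formula s cf cg).
have PE y : Pn ((s / e) *: (y - x)) = Pn (e^-1 *: (y - x)).
  (* The sign of [s] disappears because [Pn] is even. *)
  have : (s == 1) || (s == -1) by rewrite -sqrf_eq1 s2.
  by move=> /orP[] /eqP ->; rewrite ?mul1r// mulN1r scaleNr PnN.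
rewrite (@eq_cint _ _ _ _ _ (fun y => c%:C * (f y * (Pn (e^-1 *: (y - x)))%:C))) => [|y]; last first.
  by rewrite gE PE rmorphM/= mulrCA.
pose h y : R[i] := f y * (Pn (e^-1 *: (y - x)))%:C.
have mf := cintg_cmeas cf.
have ih : cintg mu h.
  apply: (cintg_bM (M := 1 * 2 ^+ n) cf).
    apply: cmeas_real.
    have mP := rintg_meas iP.
    apply: (measurableT_comp mP).
    rewrite (_ : (fun y => _) = (fun y => - (e^-1 *: x) + e^-1 *: y)).
      exact: measurable_affine.
    by apply/funext => y; rewrite scalerBr addrC.
  move=> y; rewrite normc_real ger0_norm ?(ltW (Pn_gt0 _))// mul1r.
  rewrite /Pn -[X in 2 ^+ X]card_ord -prodr_const ler_prod// => i _.
  rewrite (ltW (P1_gt0 _))/= /P1 ler_piMr// invf_le1 ?ltr_wpDr ?sqr_ge0//.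
  by rewrite lerDl sqr_ge0.
rewrite cintZ//.
have ihx : cintg mu (fun w => h (w + x)) by exact: (rescales_cintg (rescales_shift x) ih).
have := rescales_cint hc ihx.
rewrite (rescales_cint (rescales_shift x) ih) mul1r => <-.
apply: eq_cint => z; rewrite /h addrK scalerA mulVf// scale1r.
by rewrite addrC.
Qed.

Definition ballK (K : R) : set T := [set x | n1 x <= K].

Lemma measurable_ballK K : measurable (ballK K).
Proof.
rewrite (_ : ballK K = setT `&` @n1 R n @^-1` [set` `]-oo, K]]).
  exact: (measurable_n1 measurableT (measurable_itv _)).
by apply/seteqP; split => x /=; rewrite in_itv/=; [split|case].
Qed.

Lemma rintg_ballK K : rintg mu (fun x => \1_(ballK K) x).
Proof.
apply/rintgP; split; first exact: measurable_indic (measurable_ballK _).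
under eq_integral do rewrite ger0_norm//.
rewrite integral_indic//; last exact: measurable_ballK.
rewrite setIT; apply: (@bounded_lebesgue_lty _ _ _ K); first exact: measurable_ballK.
by move=> x Kx i; exact: le_trans (n1_coord _ _) Kx.
Qed.

Definition lip f := exists2 C : R, 0 <= C &
  forall x y, normc (f x - f y) <= C * n1 (x - y).
Definition bnd f := exists M : R, forall x, normc (f x) <= M.
Definition supp (K : R) f := forall x, f x != 0 -> n1 x <= K.

(** Working test class: [blip] stands for bounded Lipschitz and [clip] for compactly supported
    Lipschitz. Both are stable under sums and products, and the transform sends [clip] into
    [blip]. *)
Record blip f : Prop := Blip {
  blip_cmeas : cmeas f; blip_bnd : bnd f; blip_lip : lip f }.

Definition clip f := blip f /\ exists K, supp K f.

Lemma bnd_ge0 f : bnd f -> exists2 M : R, 0 <= M & forall x, normc (f x) <= M.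
Proof. by move=> [M fM]; exists M => //; apply: le_trans (fM 0); exact: normc_ge0. Qed.

Lemma supp_bnd_cintg f (K M : R) : cmeas f -> supp K f ->
  (forall x, normc (f x) <= M) -> cintg mu f.
Proof.
move=> mf fK fM; apply: (cintg_le mf (rintgZ M (rintg_ballK K))) => x.
have M0 : 0 <= M by rewrite (le_trans _ (fM x))// normc_ge0.
rewrite indicE; case: (boolP (x \in ballK K)) => xK; first by rewrite mulr1.
rewrite mulr0; have [->|fx] := eqVneq (f x) 0; first by rewrite normc0.
by move: xK; rewrite notin_setE => -[]; exact: fK.
Qed.

Lemma clip_cintg f : clip f -> cintg mu f.
Proof. by move=> [[mf [M fM] _] [K fK]]; exact: supp_bnd_cintg fK fM. Qed.

Lemma lip_bnd_clip f K : cmeas f -> lip f -> supp K f -> clip f.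
Proof.
move=> mf [C C0 fC] fK; split; last by exists K.
split => //; last by exists C.
exists (normc (f 0) + C * `|K|) => x.
have [->|fx] := eqVneq (f x) 0; first by rewrite normc0 addr_ge0 ?normc_ge0 ?mulr_ge0.
have -> : f x = f 0 + (f x - f 0) by ring.
rewrite (le_trans (normcD _ _))// lerD2l (le_trans (fC _ _))// subr0.
by rewrite ler_wpM2l// (le_trans (fK _ fx))// ler_norm.
Qed.

Lemma blipD f g : blip f -> blip g -> blip (fun x => f x + g x).
Proof.
move=> [mf [M fM] [C C0 fC]] [mg [N gN] [D D0 gD]]; split.
- exact: cmeasD.
- by exists (M + N) => x; rewrite (le_trans (normcD _ _))// lerD.
- exists (C + D) => [|x y]; first exact: addr_ge0.
  by rewrite opprD addrACA mulrDl (le_trans (normcD _ _))// lerD.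
Qed.

Lemma blipM f g : blip f -> blip g -> blip (fun x => f x * g x).
Proof.
move=> [mf bf [C C0 fC]] [mg bg [D D0 gD]].
have [M M0 fM] := bnd_ge0 bf; have [N N0 gN] := bnd_ge0 bg; split.
- exact: cmeasM.
- by exists (M * N) => x; rewrite normcM ler_pM ?normc_ge0.
- exists (M * D + C * N) => [|x y]; first by rewrite addr_ge0 ?mulr_ge0.
  have -> : f x * g x - f y * g y = f x * (g x - g y) + (f x - f y) * g y by ring.
  rewrite (le_trans (normcD _ _))// !normcM mulrDl lerD//.
    by rewrite -mulrA ler_pM ?normc_ge0.
  by rewrite mulrAC ler_pM ?normc_ge0.
Qed.

Lemma blip_cst (c : R[i]) : blip (fun=> c).
Proof.
split; first exact: cmeas_cst.
  by exists (normc c).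
by exists 0 => // x y; rewrite subrr normc0 mul0r.
Qed.

Lemma blipJ f : blip f -> blip (fun x => conjc (f x)).
Proof.
move=> [mf [M fM] [C C0 fC]]; split; first exact: cmeasJ.
  by exists M => x; rewrite normcJ.
by exists C => // x y; rewrite -rmorphB normcJ.
Qed.

Lemma clipD f g : clip f -> clip g -> clip (fun x => f x + g x).
Proof.
move=> [bf [K fK]] [bg [L gL]]; split; first exact: blipD.
exists (Num.max K L) => x; have [fx|/fK fx _] := eqVneq (f x) 0.
  by rewrite fx add0r => /gL gx; rewrite le_max gx orbT.
by rewrite le_max fx.
Qed.

Lemma clipMl f g : clip f -> blip g -> clip (fun x => f x * g x).
Proof.
move=> [bf [K fK]] bg; split; first exact: blipM.
by exists K => x fgx; apply: fK; apply: contra fgx => /eqP ->; rewrite mul0r.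
Qed.

Lemma clipMr f g : blip f -> clip g -> clip (fun x => f x * g x).
Proof. by move=> bf cg; under eq_fun do rewrite mulrC; exact: clipMl. Qed.

Lemma clipZ (c : R[i]) f : clip f -> clip (fun x => c * f x).
Proof. by apply: clipMr; exact: blip_cst. Qed.

Lemma clipB f g : clip f -> clip g -> clip (fun x => f x - g x).
Proof.
move=> cf /(clipZ (-1)) /(clipD cf).
by under eq_fun do rewrite mulN1r.
Qed.

Lemma clipJ f : clip f -> clip (fun x => conjc (f x)).
Proof.
move=> [bf [K fK]]; split; first exact: blipJ.
by exists K => x fx; apply: fK; apply: contra fx => /eqP ->; rewrite rmorph0.
Qed.

Lemma clip0 : clip (fun=> 0).
Proof. by split; [exact: blip_cst|exists 0 => x; rewrite eqxx]. Qed.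

Lemma clip_sum (I : Type) (r : seq I) (P : pred I) (F : I -> T -> R[i]) :
  (forall i, clip (F i)) -> clip (fun x => \sum_(i <- r | P i) F i x).
Proof.
move=> cF; elim: r => [|i r IH]; first by under eq_fun do rewrite big_nil; exact: clip0.
case: (boolP (P i)) => Pi; last by under eq_fun do rewrite big_cons (negbTE Pi).
by under eq_fun do rewrite big_cons Pi; exact: clipD.
Qed.

Lemma blip_ker s y : blip (fun x => cexpi (s * (2 * pi * dot y x))).
Proof.
split; first exact: cmeas_kerl.
  by exists 1 => x; rewrite (normc_cexpi _ : _ = 1).
exists (2 * (`|s * (2 * pi)| * n1 y)) => [|x z]; first by rewrite !mulr_ge0 ?n1_ge0.
have E : s * (2 * pi * dot y x) - s * (2 * pi * dot y z) = s * (2 * pi) * dot y (x - z).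
  by rewrite dotBr; ring.
rewrite (le_trans (cexpi_lip _ _))// E normrM.
by rewrite -[leRHS]mulrA ler_wpM2l// -[leRHS]mulrA ler_wpM2l// dot_le.
Qed.

Lemma harmonic_cvg0 (f : T -> R[i]) x z : lip f ->
  normc (f (x + m.+1%:R^-1 *: z) - f x) @[m --> \oo] --> (0 : R).
Proof.
move=> [C C0 fC].
apply: (@cvg0_le _ _ _ _ _ (fun m => C * n1 z * m.+1%:R^-1)) => [m|].
  rewrite ger0_norm ?normc_ge0// (le_trans (fC _ _))// addrC addKr n1Z.
  by rewrite ger0_norm// le_eqVlt; apply/orP; left; apply/eqP; ring.
rewrite -[X in _ --> X](mulr0 (C * n1 z)).
by apply: cvgM; [exact: cvg_cst|exact: cvg_harmonic].
Qed.

Lemma cvg_en xi : en (m.+1%:R^-1 *: xi) @[m --> \oo] --> (1 : R).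
Proof.
rewrite -[X in _ --> X]expR0; under eq_fun do rewrite enE n1Z ger0_norm//.
apply: continuous_cvg; first exact: continuous_expR.
rewrite -[X in _ --> X]oppr0; apply: cvgN; rewrite -[X in _ --> X](mul0r (n1 xi)).
by apply: cvgM; [exact: cvg_harmonic|exact: cvg_cst].
Qed.

Lemma smoothing_cvg f x : blip f ->
  normc (cint mu (fun z => f (x + m.+1%:R^-1 *: z) * (Pn z)%:C) - f x)
    @[m --> \oo] --> (0 : R).
Proof.
move=> [mf [M fM] lf].
have [_ [iP P1]] := @rintg_en R n.
have fE : f x = cint mu (fun z => f x * (Pn z)%:C).
  by rewrite cintZ ?cint_real ?P1 ?mulr1//; exact: cintg_real.
rewrite fE.
apply: (@cint_dom_cvg _ _ _ mu _ _ (fun z => M * Pn z)).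
- by move=> m; exact: cintg_cmeas (cintgM_Pn _ _ mf fM).
- by apply: cmeasZ; apply: cmeas_real; exact: rintg_meas iP.
- apply: aeW => z.
  have h : normc (f (x + m.+1%:R^-1 *: z) - f x) * `|Pn z| @[m --> \oo] --> (0 : R).
    rewrite -[X in _ --> X](mul0r `|Pn z|).
    by apply: cvgM; [exact: harmonic_cvg0|exact: cvg_cst].
  apply: cvg0_le h => m.
  by rewrite ger0_norm ?normc_ge0// -mulrBl normcM normc_real.
- exact: rintgZ.
- move=> m z; rewrite normcM normc_real ger0_norm ?(ltW (Pn_gt0 _))//.
  by rewrite ler_wpM2r ?(ltW (Pn_gt0 _)).
- move=> z; rewrite normcM normc_real ger0_norm ?(ltW (Pn_gt0 _))//.
  by rewrite ler_wpM2r ?(ltW (Pn_gt0 _)).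
Qed.

Lemma normc_cvg_unique (a : nat -> R[i]) (l k : R[i]) :
  normc (a m - l) @[m --> \oo] --> (0 : R) ->
  normc (a m - k) @[m --> \oo] --> (0 : R) -> l = k.
Proof.
move=> al ak; apply/eqP; rewrite -subr_eq0; apply/eqP/eq0_normc.
have h : (fun=> normc (l - k)) @ \oo --> (0 : R).
  apply: (@cvg0_le _ _ _ _ _ (fun m => normc (a m - k) + normc (a m - l))) => [m|].
    rewrite ger0_norm ?normc_ge0// [X in _ <= _ + X]normcB.
    have -> : l - k = (a m - k) + (l - a m) by ring.
    exact: normcD.
  by rewrite -[X in _ --> X]addr0; exact: cvgD.
by have /cvg_lim := h; rewrite lim_cst//; apply.
Qed.

(** Both sides of [smoothed_inversion] converge as e = 1 / (m + 1) tends to 0: one side by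
    domination with the integrable [ft s f], the other because [Pn] is an approximate identity and
    [f] is Lipschitz. *)
Lemma inversion s f : s ^+ 2 = 1 -> clip f -> cintg mu (ft s f) ->
  ft (- s) (ft s f) = f.
Proof.
move=> s2 cf iF; have [bf _] := cf; have [mf [M fM] _] := bf.
apply/funext => x.
have ck : cintg mu (fun xi => ft s f xi * cexpi (- s * (2 * pi * dot x xi))).
  exact: cintg_ker.
pose a (m : nat) := cint mu (fun xi => ft s f xi *
  ((en (m.+1%:R^-1 *: xi))%:C * cexpi (- s * (2 * pi * dot x xi)))).
apply: (@normc_cvg_unique a); last first.
  rewrite /a; under eq_fun do rewrite (smoothed_inversion _ s2 _ (clip_cintg cf) fM) ?invr_gt0//.
  exact: smoothing_cvg.
apply: (@cint_dom_cvg _ _ _ mu _ _ (fun xi => normc (ft s f xi))).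
- move=> m; apply: cmeasM; first exact: cintg_cmeas iF.
  apply: cmeasM; last exact: cmeas_kerl.
  apply: cmeas_real; have [ie _] := @rintg_en R n.
  have h : 0 < m.+1%:R^-1 :> R by rewrite invr_gt0.
  have [c _ hc] := scale_rescales h.
  exact: (rescales_measurable hc (rintg_meas ie)).
- exact: cintg_cmeas ck.
- apply: aeW => xi.
  have E m : normc (ft s f xi * ((en (m.+1%:R^-1 *: xi))%:C *
      cexpi (- s * (2 * pi * dot x xi))) - ft s f xi * cexpi (- s * (2 * pi * dot x xi)))
     = normc (ft s f xi) * `|en (m.+1%:R^-1 *: xi) - 1|.
    rewrite mulrA -mulrBl normcM normc_cexpi mulr1.
    by rewrite -{2}[ft s f xi]mulr1 -mulrBr normcM -(rmorph1 (real_complex R)) -rmorphB normc_real.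
  have h : normc (ft s f xi) * `|en (m.+1%:R^-1 *: xi) - 1| @[m --> \oo] --> (0 : R).
    rewrite -[X in _ --> X](mulr0 (normc (ft s f xi))); apply: cvgM; first exact: cvg_cst.
    rewrite -[X in _ --> X](normr0 R) -[X in `|X|](subrr 1); apply: cvg_norm.
    by apply: cvgB; [exact: cvg_en|exact: cvg_cst].
  by apply: cvg0_le h => m; rewrite ger0_norm ?normc_ge0// E.
- exact: cintg_normc.
- move=> m xi; rewrite !normcM normc_cexpi mulr1 normc_real ger0_norm ?(ltW (en_gt0 _))//.
  by rewrite ler_piMr ?normc_ge0// en_le1.
- by move=> xi; rewrite normcM normc_cexpi mulr1.
Qed.

End fourier_theory.

(** * Plancherel *)

Section plancherel.
Context {R : realType} {n : nat}.
Local Notation mu := (lebesgue_cV (R := R) n).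
Local Notation T := 'cV[R]_n.
Implicit Types (f g : T -> R[i]) (x y xi : T) (s : R).

(** On the support of [f] the kernel is Lipschitz in the frequency variable, with a constant
    proportional to the bound [K] on the support. *)
Lemma blip_ft s f : clip f -> blip (ft s f).
Proof.
move=> cf; have icf := clip_cintg cf.
have [[mf bf _] [K fK]] := cf.
split.
- exact: cmeas_ft.
- by exists (\int[mu]_y normc (f y)) => x; exact: normc_ft.
have K0 : 0 <= `|K| by [].
pose I := \int[mu]_y normc (f y).
have I0 : 0 <= I by apply: Rintegral_ge0 => y _; exact: normc_ge0.
exists (2 * (`|s * (2 * pi)| * `|K|) * I) => [|x y]; first by rewrite !mulr_ge0.
rewrite /ft -cintB; [|exact: cintg_ker|exact: cintg_ker].
have -> : 2 * (`|s * (2 * pi)| * `|K|) * I * n1 (x - y)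
  = \int[mu]_z ((2 * (`|s * (2 * pi)| * `|K|) * n1 (x - y)) * normc (f z)).
  rewrite rintZ; last exact: cintg_normc.
  by rewrite mulrAC.
apply: normc_cint_le.
- apply: cmeasB; first exact: (cintg_cmeas (cintg_ker s x icf)).
  exact: (cintg_cmeas (cintg_ker s y icf)).
- by apply: rintgZ; exact: cintg_normc.
move=> z; rewrite -mulrBr normcM mulrC.
have [->|fz] := eqVneq (f z) 0; first by rewrite normc0 !mulr0.
rewrite ler_wpM2r ?normc_ge0//.
have E : s * (2 * pi * dot x z) - s * (2 * pi * dot y z) = s * (2 * pi) * dot (x - y) z.
  by rewrite dotBl; ring.
rewrite (le_trans (cexpi_lip _ _))// E normrM.
rewrite -[leRHS]mulrA ler_wpM2l// -[leRHS]mulrA ler_wpM2l//.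
rewrite (le_trans (dot_le _ _))// mulrC ler_wpM2r ?n1_ge0//.
by rewrite (le_trans (fK _ fz))// ler_norm.
Qed.

Lemma measurable_en_scale (e : R) : 0 < e ->
  measurable_fun setT (fun xi : T => en (e *: xi)) /\
  rintg mu (fun xi : T => en (e *: xi)).
Proof.
move=> e0; have [c _ hc] := scale_rescales (n := n) e0.
have [ie _] := @rintg_en R n.
by split; [exact: (rescales_measurable hc (rintg_meas ie))|exact: (rescales_rintg hc ie)].
Qed.

(** The conjugate of [ft s g] is the transform of opposite sign of the conjugate of [g]. Moved
    across by [mult_formula], it leaves the smoothed inversion of [f], tested against the conjugate
    of [g]. The damping by [en] stands in for integrability of [ft s f]. *)
Lemma smoothed_parseval s f g : s ^+ 2 = 1 -> clip f -> clip g ->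
  normc (cint mu (fun xi => ft s f xi * conjc (ft s g xi) * (en (m.+1%:R^-1 *: xi))%:C)
   - cint mu (fun x => f x * conjc (g x))) @[m --> \oo] --> (0 : R).
Proof.
move=> s2 cf cg.
have [bf _] := cf; have [mf bbf _] := bf; have [M fM] := bbf.
have icf := clip_cintg cf; have icg := clip_cintg cg.
have cJg := clipJ cg; have icJg := clip_cintg cJg.
have [_ [iP P1]] := @rintg_en R n.
have E m : cint mu (fun xi => ft s f xi * conjc (ft s g xi) * (en (m.+1%:R^-1 *: xi))%:C)
   = cint mu (fun x => conjc (g x) * cint mu (fun z => f (x + m.+1%:R^-1 *: z) * (Pn z)%:C)).
  have h : 0 < m.+1%:R^-1 :> R by rewrite invr_gt0.
  have [me ie] := measurable_en_scale h.
  have [bft [N fN] _] := blip_ft s cf.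
  have icfe : cintg mu (fun xi => ft s f xi * (en (m.+1%:R^-1 *: xi))%:C).
    apply: eq_cintg (cintg_bM (cintg_real ie) bft fN) => xi; exact: mulrC.
  have := mult_formula (- s) icJg icfe => mE.
  rewrite (@eq_cint _ _ _ mu _ (fun x => ft (- s) (fun y => conjc (g y)) x * (ft s f x * (en (m.+1%:R^-1 *: x))%:C))); last first.
    by move=> xi; rewrite -ft_conj//; ring.
  rewrite mE; apply: eq_cint => x; congr (_ * _).
  rewrite -(smoothed_inversion x s2 h icf fM).
  by apply: eq_cint => xi; rewrite -mulrA.
under eq_fun do rewrite E.
have -> : cint mu (fun x => f x * conjc (g x)) = cint mu (fun x => conjc (g x) * f x).
  by apply: eq_cint => x; exact: mulrC.
have mM m x : normc (cint mu (fun z => f (x + m.+1%:R^-1 *: z) * (Pn z)%:C)) <= M.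
  rewrite -[leRHS]mulr1 -P1 -rintZ//.
  apply: normc_cint_le; first exact: cintg_cmeas (cintgM_Pn _ _ mf fM).
    exact: rintgZ.
  move=> z; rewrite normcM normc_real ger0_norm ?(ltW (Pn_gt0 _))//.
  by rewrite ler_wpM2r ?(ltW (Pn_gt0 _)).
apply: (@cint_dom_cvg _ _ _ mu _ _ (fun x => M * normc (g x))).
- move=> m; apply: cmeasM; first exact: cintg_cmeas icJg.
  apply: (cmeas_cint mu (f := fun p : T * T => f (p.1 + m.+1%:R^-1 *: p.2) * (Pn p.2)%:C)).
  apply: cmeasM; last first.
    by apply: cmeas_real; exact: measurableT_comp (rintg_meas iP) measurable_snd.
  apply: cmeas_comp mf; apply: measurable_cVD; first exact: measurable_fst.
  have := measurable_affine (n := n) 0 (m.+1%:R^-1 : R).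
  under eq_fun do rewrite add0r.
  by move=> ma; exact: measurableT_comp ma measurable_snd.
- by apply: cmeasM => //; exact: cintg_cmeas icJg.
- apply: aeW => x.
  have h : normc (g x) * normc (cint mu (fun z => f (x + m.+1%:R^-1 *: z) * (Pn z)%:C) - f x)
     @[m --> \oo] --> (0 : R).
    rewrite -[X in _ --> X](mulr0 (normc (g x))).
    by apply: cvgM; [exact: cvg_cst|exact: smoothing_cvg].
  apply: cvg0_le h => m.
  by rewrite ger0_norm ?normc_ge0// -mulrBr normcM normcJ.
- by apply: rintgZ; exact: cintg_normc.
- by move=> m x; rewrite normcM normcJ mulrC ler_wpM2r ?normc_ge0.
- by move=> x; rewrite normcM normcJ mulrC ler_wpM2r ?normc_ge0.
Qed.

Lemma mulcJ (z : R[i]) : z * conjc z = (normc z ^+ 2)%:C.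
Proof. exact: mulJc. Qed.

(** The damping factors increase to 1, so monotone convergence yields integrability of the square
    and the equality at once. *)
Lemma plancherel s f : s ^+ 2 = 1 -> clip f ->
  rintg mu (fun xi => normc (ft s f xi) ^+ 2) /\
  \int[mu]_xi normc (ft s f xi) ^+ 2 = \int[mu]_x normc (f x) ^+ 2.
Proof.
move=> s2 cf; have [mft [N fN] _] := blip_ft s cf.
pose u (m : nat) (xi : T) : R := normc (ft s f xi) ^+ 2 * en (m.+1%:R^-1 *: xi).
have h m : 0 < m.+1%:R^-1 :> R by rewrite invr_gt0.
have N0 : 0 <= N by rewrite (le_trans _ (fN 0))// normc_ge0.
have mn2 : measurable_fun setT (fun xi => normc (ft s f xi) ^+ 2).
  by apply: measurable_funX; exact: measurable_normc.
have mu_ m : measurable_fun setT (u m).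
  by apply: measurable_funM => //; have [] := measurable_en_scale (h m).
have iu m : rintg mu (u m).
  have [_ ie] := measurable_en_scale (h m).
  apply: (rintg_le _ (rintgZ (N ^+ 2) ie)) => // xi.
  have e0 := ltW (en_gt0 (m.+1%:R^-1 *: xi)).
  have q0 : 0 <= normc (ft s f xi) ^+ 2 by exact: sqr_ge0.
  have q1 : normc (ft s f xi) ^+ 2 <= N ^+ 2 by rewrite ler_pXn2r ?nnegrE ?normc_ge0.
  rewrite /u ger0_norm ?(mulr_ge0 q0 e0)//.
  rewrite ger0_norm ?(mulr_ge0 (le_trans q0 q1) e0)//.
  exact: ler_wpM2r.
pose I := \int[mu]_x normc (f x) ^+ 2.
have cu : \int[mu]_xi u m xi @[m --> \oo] --> I.
  have := smoothed_parseval s2 cf cf.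
  have -> : cint mu (fun x => f x * conjc (f x)) = I%:C.
    by rewrite -cint_real; apply: eq_cint => x; exact: mulcJ.
  have E m : cint mu (fun xi => ft s f xi * conjc (ft s f xi) * (en (m.+1%:R^-1 *: xi))%:C)
     = (\int[mu]_xi u m xi)%:C.
    by rewrite -cint_real; apply: eq_cint => x; rewrite mulcJ -rmorphM.
  under eq_fun do rewrite E -rmorphB normc_real.
  by move/norm_cvg0P/subr_cvg0.
have key : (\int[mu]_xi (normc (ft s f xi) ^+ 2)%:E = I%:E)%E.
  have c1 := @cvg_monotone_convergence _ _ _ mu _ measurableT (fun m xi => (u m xi)%:E).
  have {}c1 : (\int[mu]_xi (u m xi)%:E)%E @[m --> \oo] -->
      (\int[mu]_xi (normc (ft s f xi) ^+ 2)%:E)%E.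
    have -> : (\int[mu]_xi (normc (ft s f xi) ^+ 2)%:E =
        \int[mu]_xi limn (fun m => (u m xi)%:E))%E.
      apply: eq_integral => xi _; apply/esym/cvg_lim => //.
      apply: cvg_EFin; first exact: nearW.
      rewrite -[X in _ --> X]mulr1; apply: cvgM; first exact: cvg_cst.
      exact: cvg_en.
    apply: c1.
    - by move=> m; exact/measurable_EFinP.
    - by move=> m xi _; rewrite lee_fin mulr_ge0 ?sqr_ge0 ?(ltW (en_gt0 _)).
    - move=> xi _ a b ab; rewrite lee_fin ler_wpM2l ?sqr_ge0//.
      rewrite !enE ler_expR lerN2 !n1Z !ger0_norm//.
      by rewrite ler_wpM2r ?n1_ge0// lef_pV2 ?posrE// ler_nat.
  have c2 : (\int[mu]_xi (u m xi)%:E)%E @[m --> \oo] --> I%:E.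
    under eq_fun do rewrite (rintE (iu _)).
    by apply: cvg_EFin; [exact: nearW|exact: cu].
  exact: (cvg_unique _ c1 c2).
have iR : rintg mu (fun xi => normc (ft s f xi) ^+ 2).
  apply/rintgP; split => //.
  under eq_integral do rewrite ger0_norm ?sqr_ge0//.
  by rewrite key ltry.
split => //; apply: EFin_inj.
by rewrite -rintE.
Qed.

(** Plancherel supplies the integrable majorant |ft f|^2 + |ft g|^2 that removes the damping from
    [smoothed_parseval]. *)
Lemma parseval s f g : s ^+ 2 = 1 -> clip f -> clip g ->
  cint mu (fun xi => ft s f xi * conjc (ft s g xi)) =
  cint mu (fun x => f x * conjc (g x)).
Proof.
move=> s2 cf cg.
have [mf _ _] := blip_ft s cf; have [mg _ _] := blip_ft s cg.
have [i2f _] := plancherel s2 cf; have [i2g _] := plancherel s2 cg.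
have idom := rintgD i2f i2g.
have mfg : cmeas (fun xi => ft s f xi * conjc (ft s g xi)).
  by apply: cmeasM => //; exact: cmeasJ.
have dom xi : normc (ft s f xi * conjc (ft s g xi)) <=
    normc (ft s f xi) ^+ 2 + normc (ft s g xi) ^+ 2.
  rewrite normcM normcJ; have := sqr_ge0 (normc (ft s f xi) - normc (ft s g xi)).
  have := mulr_ge0 (normc_ge0 (ft s f xi)) (normc_ge0 (ft s g xi)).
  by rewrite sqrrB; lra.
apply: (@normc_cvg_unique _ (fun m => cint mu (fun xi => ft s f xi * conjc (ft s g xi) *
   (en (m.+1%:R^-1 *: xi))%:C))); last exact: smoothed_parseval.
apply: (@cint_dom_cvg _ _ _ mu _ _ _ _ _ _ idom) => //.
- move=> m; apply: cmeasM => //; apply: cmeas_real.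
  have h : 0 < m.+1%:R^-1 :> R by rewrite invr_gt0.
  by have [] := measurable_en_scale h.
- apply: aeW => xi.
  have h : normc (ft s f xi * conjc (ft s g xi)) * `|en (m.+1%:R^-1 *: xi) - 1|
      @[m --> \oo] --> (0 : R).
    rewrite -[X in _ --> X](mulr0 (normc (ft s f xi * conjc (ft s g xi)))); apply: cvgM.
      exact: cvg_cst.
    rewrite -[X in _ --> X](normr0 R) -[X in `|X|](subrr 1); apply: cvg_norm.
    by apply: cvgB; [exact: cvg_en|exact: cvg_cst].
  apply: cvg0_le h => m; rewrite ger0_norm ?normc_ge0//.
  rewrite -[X in _ - X]mulr1 -mulrBr normcM -(rmorph1 (real_complex R)) -rmorphB.
  by rewrite normc_real.
- move=> m xi; rewrite normcM normc_real ger0_norm ?(ltW (en_gt0 _))//.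
  by rewrite (le_trans _ (dom xi))// ler_piMr ?normc_ge0// en_le1.
Qed.

End plancherel.

(** * Square-integrable functions *)

Section L2_theory.
Context {R : realType} {n : nat}.
Local Notation mu := (lebesgue_cV (R := R) n).
Local Notation T := 'cV[R]_n.
Implicit Types (f g : T -> R[i]) (S W : set (T -> R[i])).

Lemma sqr_le2 (a b c : R) : 0 <= c -> c <= a + b -> c ^+ 2 <= 2 * a ^+ 2 + 2 * b ^+ 2.
Proof.
move=> c0 cab; have ab0 : 0 <= a + b by exact: le_trans cab.
have : c ^+ 2 <= (a + b) ^+ 2 by rewrite ler_pXn2r.
by have := sqr_ge0 (a - b); rewrite sqrrB sqrrD; lra.
Qed.

(** The squared norm as a real number. Approximation is carried out with [nq], and [L2closureP]
    translates it to the extended-valued [L2norm]. *)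
Definition nq f : R := \int[mu]_x normc (f x) ^+ 2.
Definition sqi f := rintg mu (fun x => normc (f x) ^+ 2).

Lemma nq_ge0 f : 0 <= nq f.
Proof. by apply: Rintegral_ge0 => x _; exact: sqr_ge0. Qed.

Lemma L2norm_sq f :
  (L2norm f `^ 2 = \int[mu]_x (normc (f x) ^+ 2)%:E)%E.
Proof.
rewrite /L2norm poweR_Lnorm ?pnatr_eq0//; apply: eq_integral => x _.
by rewrite gee0_abs ?lee_fin ?normc_ge0// poweR_EFin powR_mulrn ?normc_ge0.
Qed.

Lemma L2norm_ge0 f : (0 <= L2norm f)%E.
Proof. exact: Lnorm_ge0. Qed.

Lemma L2P f : L2 f <-> cmeas f /\ sqi f.
Proof.
split=> [[mf f2]|[mf f2]]; split => //.
  apply/rintgP; split; first by apply: measurable_funX; exact: measurable_normc.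
  under eq_integral do rewrite ger0_norm ?sqr_ge0//.
  rewrite -L2norm_sq; move: f2; have := L2norm_ge0 f.
  by case: (L2norm f) => [r| |]//= _ _; rewrite ltry.
move/rintgP: f2 => [_]; under eq_integral do rewrite ger0_norm ?sqr_ge0//.
rewrite -L2norm_sq; have := L2norm_ge0 f.
case: (L2norm f) => [r| |]//= _; first by move=> _; exact: ltry.
by rewrite pnatr_eq0 ltxx.
Qed.

Lemma L2_cmeas f : L2 f -> cmeas f. Proof. by case. Qed.
Lemma L2_sqi f : L2 f -> sqi f. Proof. by move/L2P => []. Qed.

Lemma L2norm_lt f (e : R) : L2 f -> 0 < e -> (L2norm f < e%:E)%E <-> nq f < e ^+ 2.
Proof.
move=> /L2P[mf f2] e0.
have := L2norm_sq f; rewrite (rintE f2) -/(nq f); have := L2norm_ge0 f.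
case: (L2norm f) => [r| |]//=; last by rewrite pnatr_eq0.
rewrite lee_fin => r0; rewrite powR_mulrn// => -[<-].
by rewrite lte_fin ltr_pXn2r// nnegrE ltW.
Qed.

Lemma L2lin (c : R[i]) f g : L2 f -> L2 g -> L2 (fun x => c * f x + g x).
Proof.
move=> /L2P[mf f2] /L2P[mg g2]; apply/L2P.
have mfg : cmeas (fun x => c * f x + g x) by apply: cmeasD => //; exact: cmeasZ.
split => //.
apply: (rintg_le _ (rintgD (rintgZ (2 * normc c ^+ 2) f2) (rintgZ 2 g2))).
  by apply: measurable_funX; exact: measurable_normc.
move=> x; rewrite ger0_norm ?sqr_ge0// ger0_norm; last first.
  by apply: addr_ge0; do !apply: mulr_ge0; rewrite ?sqr_ge0 ?normc_ge0.
have := sqr_le2 (normc_ge0 _) (normcD (c * f x) (g x)).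
by rewrite normcM exprMn mulrA.
Qed.

Lemma L20 : L2 (fun _ : T => 0 : R[i]).
Proof.
apply/L2P; split; first exact: cmeas_cst.
by apply: eq_rintg (rintg0 _) => x; rewrite normc0 expr0n.
Qed.

Lemma L2Z (c : R[i]) f : L2 f -> L2 (fun x => c * f x).
Proof. by move=> /(L2lin c) /(_ L20); under eq_fun do rewrite addr0. Qed.
Lemma L2D f g : L2 f -> L2 g -> L2 (fun x => f x + g x).
Proof. by move=> /(L2lin 1) h /h; under eq_fun do rewrite mul1r. Qed.
Lemma L2B f g : L2 f -> L2 g -> L2 (fun x => f x - g x).
Proof. by move=> lf lg; have := L2lin (-1) lg lf; under eq_fun do rewrite mulN1r addrC. Qed.

Lemma nqZ (c : R[i]) f : sqi f -> nq (fun x => c * f x) = normc c ^+ 2 * nq f.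
Proof.
move=> f2; rewrite /nq -rintZ//; apply: eq_Rintegral => x _.
by rewrite normcM exprMn.
Qed.

(** Stands in for the triangle inequality; the factors 2 are absorbed in density arguments. *)
Lemma nqD f g : L2 f -> L2 g -> nq (fun x => f x + g x) <= 2 * nq f + 2 * nq g.
Proof.
move=> lf lg; have := L2D lf lg => /L2_sqi fg2.
have f2 := L2_sqi lf; have g2 := L2_sqi lg.
rewrite /nq -!rintZ// -rintD//; [|exact: rintgZ|exact: rintgZ].
apply: rint_le => //; first by apply: rintgD; exact: rintgZ.
by move=> x; exact: sqr_le2 (normc_ge0 _) (normcD _ _).
Qed.

Lemma nqB_tri f g h : L2 f -> L2 g -> L2 h ->
  nq (fun x => f x - h x) <= 2 * nq (fun x => f x - g x) + 2 * nq (fun x => g x - h x).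
Proof.
move=> lf lg lh; rewrite -[X in X <= _](_ : nq (fun x => (f x - g x) + (g x - h x)) = _).
  by apply: nqD; exact: L2B.
by apply: eq_Rintegral => x _; rewrite subrKA.
Qed.

Lemma eq_nq f g : f =1 g -> nq f = nq g.
Proof. by move=> /funext ->. Qed.

Lemma nq0 : nq (fun=> 0) = 0.
Proof. by rewrite -[RHS](rint0 mu); apply: eq_Rintegral => x _; rewrite normc0 expr0n. Qed.

Lemma L2closureP S f : S `<=` L2 ->
  L2closure S f <-> L2 f /\ forall e : R, 0 < e -> exists2 g, S g & nq (fun x => f x - g x) < e.
Proof.
move=> SL; split=> [[lf h]|[lf h]]; split => // e e0.
  have s0 : 0 < Num.sqrt e by rewrite sqrtr_gt0.
  have [g Sg b] := h _ s0; exists g => //.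
  by have := (L2norm_lt (L2B lf (SL _ Sg)) s0).1 b; rewrite sqr_sqrtr ?(ltW e0).
have [|g Sg fg] := h (e ^+ 2); first by rewrite exprn_gt0.
by exists g => //; apply/L2norm_lt => //; apply: L2B => //; exact: SL.
Qed.

Definition linear_set W := W (fun=> 0) /\
  forall (c : R[i]) f g, W f -> W g -> W (fun x => c * f x + g x).

Lemma linear_setZ W (c : R[i]) f : linear_set W -> W f -> W (fun x => c * f x).
Proof. by move=> [W0 WL] Wf; have := WL c _ _ Wf W0; under eq_fun do rewrite addr0. Qed.
Lemma linear_setD W f g : linear_set W -> W f -> W g -> W (fun x => f x + g x).
Proof. by move=> [W0 WL] Wf Wg; have := WL 1 _ _ Wf Wg; under eq_fun do rewrite mul1r. Qed.
Lemma linear_setB W f g : linear_set W -> W f -> W g -> W (fun x => f x - g x).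
Proof. by move=> [W0 WL] Wf Wg; have := WL (-1) _ _ Wg Wf; under eq_fun do rewrite mulN1r addrC. Qed.
Lemma linear_set_sum W (I : Type) (r : seq I) (P : pred I) (F : I -> T -> R[i]) :
  linear_set W -> (forall i, W (F i)) -> W (fun x => \sum_(i <- r | P i) F i x).
Proof.
move=> WL WF; elim: r => [|i r IH]; first by under eq_fun do rewrite big_nil; exact: WL.1.
case: (boolP (P i)) => Pi; last by under eq_fun do rewrite big_cons (negbTE Pi).
by under eq_fun do rewrite big_cons Pi; exact: linear_setD.
Qed.

Lemma subset_L2closure S : S `<=` L2 -> S `<=` L2closure S.
Proof.
move=> SL f Sf; apply/(L2closureP _ SL); split; first exact: SL.
move=> e e0; exists f => //; rewrite (eq_nq (g := fun=> 0)) ?nq0// => x.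
by rewrite subrr.
Qed.

Lemma L2closure_L2 S : L2closure S `<=` L2. Proof. by move=> f []. Qed.

Lemma L2closure_closed S : S `<=` L2 -> L2closure (L2closure S) `<=` L2closure S.
Proof.
move=> SL f /(L2closureP _ (@L2closure_L2 S))[lf h]; apply/(L2closureP _ SL).
split => // e e0.
have e4 : 0 < e / 4 by rewrite divr_gt0.
have [g cg fg] := h _ e4.
have := cg => /(L2closureP _ SL)[lg hg].
have [k Sk gk] := hg _ e4; exists k => //.
rewrite (le_lt_trans (nqB_tri lf lg (SL _ Sk)))//.
by move: fg gk; lra.
Qed.

Lemma L2closure_linear S : S `<=` L2 -> linear_set S -> linear_set (L2closure S).
Proof.
move=> SL [S0 SD]; split; first exact: subset_L2closure.
move=> c f g /(L2closureP _ SL)[lf hf] /(L2closureP _ SL)[lg hg].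
apply/(L2closureP _ SL); split; first exact: L2lin.
move=> e e0.
(* By [nqD] and [nqZ] the error is at most 2 |c|^2 p + 2 q, with both p and q below e / (4 a). *)
pose a := normc c ^+ 2 + 1.
have a1 : 1 <= a by rewrite lerDr sqr_ge0.
have a0 : 0 < a by exact: lt_le_trans a1.
have ea : 0 < e / (4 * a) by rewrite divr_gt0// mulr_gt0.
have [f' Sf' ff'] := hf _ ea; have [g' Sg' gg'] := hg _ ea.
exists (fun x => c * f' x + g' x); first exact: SD.
have lff := L2B lf (SL _ Sf'); have lgg := L2B lg (SL _ Sg').
rewrite (eq_nq (g := fun x => c * (f x - f' x) + (g x - g' x))); last by move=> x; ring.
rewrite (le_lt_trans (nqD (L2Z c lff) lgg))// nqZ; last exact: L2_sqi.
have E : e = 4 * a * (e / (4 * a)) by rewrite mulrC divfK// mulf_neq0// gt_eqF.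
set d := e / (4 * a) in E ea ff' gg'.
have := nq_ge0 (fun x => f x - f' x); have := nq_ge0 (fun x => g x - g' x).
set p := nq _ in ff' *; set q := nq _ in gg' *; move=> q0 p0.
rewrite E; have c0 : 0 <= normc c ^+ 2 by exact: sqr_ge0.
rewrite /a; move: c0; set k := normc c ^+ 2 => k0; nra.
Qed.

Lemma closed_subspace_closure S : S `<=` L2 -> linear_set S ->
  closed_subspace (L2closure S).
Proof.
move=> SL lS; have [c0 cL] := L2closure_linear SL lS.
split => //; first exact: L2closure_L2.
exact: L2closure_closed.
Qed.

Lemma closed_subspace_linset W : closed_subspace W -> linear_set W.
Proof. by case=> WL W0 Wl _; split. Qed.

Lemma closed_subspace_approx W f : closed_subspace W -> L2 f ->
  (forall e : R, 0 < e -> exists2 g, W g & nq (fun x => f x - g x) < e) -> W f.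
Proof. by move=> [WL _ _ Wc] lf h; apply: Wc; apply/L2closureP. Qed.

Lemma closed_subspace_lim W f (f_ : nat -> T -> R[i]) : closed_subspace W -> L2 f ->
  (forall m, W (f_ m)) -> nq (fun x => f x - f_ m x) @[m --> \oo] --> (0 : R) -> W f.
Proof.
move=> cW lf Wf c0; apply: (closed_subspace_approx cW lf) => e e0.
have [m _ /(_ m (leqnn m))/= h] := (cvgr0Pnorm_lt _).1 c0 e e0.
by exists (f_ m) => //; rewrite (le_lt_trans _ h)// ler_norm.
Qed.

Lemma linear_set_span S : linear_set (linear_span S).
Proof.
split.
  exists 0%N, (fun=> 0), (fun _ _ => 0); split; first by case.
  by apply/funext => x; rewrite big_ord0.
move=> c f g [m [a [u [Su ->]]]] [k [b [v [Sv ->]]]].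
exists (m + k)%N,
  (fun i : 'I_(m + k) => match fintype.split i with inl j => c * a j | inr j => b j end),
  (fun i : 'I_(m + k) => match fintype.split i with inl j => u j | inr j => v j end).
split; first by move=> i; case: (fintype.split i).
have El i : fintype.split (lshift k i) = inl i := unsplitK (inl i).
have Er i : fintype.split (rshift m i) = inr i := unsplitK (inr i).
apply/funext => x; rewrite big_split_ord/= mulr_sumr; congr (_ + _).
  by apply: eq_bigr => i _; rewrite El mulrA.
by apply: eq_bigr => i _; rewrite Er.
Qed.

Lemma span_incl S : S `<=` linear_span S.
Proof.
move=> f Sf; exists 1%N, (fun=> 1), (fun=> f); split => //.
by apply/funext => x; rewrite big_ord1 mul1r.
Qed.

Lemma span_min S W : linear_set W -> S `<=` W -> linear_span S `<=` W.
Proof.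
move=> lW SW f [m [c [g [Sg ->]]]].
apply: linear_set_sum => // i; apply: linear_setZ => //; exact/SW.
Qed.

Lemma L2closure_min S W : closed_subspace W -> S `<=` W -> L2closure S `<=` W.
Proof.
move=> cW SW f [lf h]; case: (cW) => _ _ _; apply; split => // e /h[g Sg fg].
by exists g => //; exact: SW.
Qed.

(** A weighted arithmetic-geometric mean inequality in the role of Cauchy-Schwarz: the weight [t] is
    free and balances the two terms where it is applied. *)
Lemma inner_le f g (t : R) : L2 f -> L2 g -> 0 < t ->
  cintg mu (fun x => f x * conjc (g x)) /\
  normc (inner f g) <= t * nq f + t^-1 * nq g.
Proof.
move=> lf lg t0; have f2 := L2_sqi lf; have g2 := L2_sqi lg.
have mfg : cmeas (fun x => f x * conjc (g x)).
  by apply: cmeasM; [exact: L2_cmeas|apply: cmeasJ; exact: L2_cmeas].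
have i2 := rintgD (rintgZ t f2) (rintgZ t^-1 g2).
have dom x : normc (f x * conjc (g x)) <= t * normc (f x) ^+ 2 + t^-1 * normc (g x) ^+ 2.
  rewrite normcM normcJ.
  set p := normc (f x); set q := normc (g x).
  have p0 : 0 <= p by exact: normc_ge0. have q0 : 0 <= q by exact: normc_ge0.
  have -> : t^-1 * q ^+ 2 = t * (t^-1 * q) ^+ 2 by field; rewrite gt_eqF.
  have -> : p * q = t * (p * (t^-1 * q)) by field; rewrite gt_eqF.
  rewrite -mulrDr ler_pM2l//.
  have := sqr_ge0 (p - t^-1 * q).
  have : 0 <= p * (t^-1 * q) by rewrite !mulr_ge0// invr_ge0 ltW.
  by rewrite sqrrB; lra.
split; first exact: cintg_le i2 dom.
have -> : t * nq f + t^-1 * nq g = \int[mu]_x (t * normc (f x) ^+ 2 + t^-1 * normc (g x) ^+ 2).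
  by rewrite rintD ?rintZ//; exact: rintgZ.
exact: normc_cint_le.
Qed.

Lemma L2_cintgM f g : L2 f -> L2 g -> cintg mu (fun x => f x * conjc (g x)).
Proof. by move=> lf lg; have [] := inner_le lf lg ltr01. Qed.

Lemma inner_self f : inner f f = (nq f)%:C.
Proof. by rewrite -cint_real; apply: eq_cint => x; exact: mulcJ. Qed.

Lemma innerC f g : L2 f -> L2 g -> inner g f = conjc (inner f g).
Proof.
move=> lf lg; rewrite -[RHS]cintJ; last exact: L2_cintgM.
by apply: eq_cint => x; rewrite rmorphM/= conjcK mulrC.
Qed.

Lemma inner_linl (c : R[i]) f g h : L2 f -> L2 g -> L2 h ->
  inner (fun x => c * f x + g x) h = c * inner f h + inner g h.
Proof.
move=> lf lg lh; rewrite -[c * _]cintZ; last exact: L2_cintgM.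
rewrite -cintD; [|by apply: cintgZ; exact: L2_cintgM|exact: L2_cintgM].
by apply: eq_cint => x; rewrite mulrDl mulrA.
Qed.

Lemma inner_closure0 S g : S `<=` L2 -> L2 g -> (forall f, S f -> inner f g = 0) ->
  forall f, L2closure (linear_span S) f -> inner f g = 0.
Proof.
move=> SL lg Sg.
pose W : set (T -> R[i]) := [set f | L2 f /\ inner f g = 0].
have lW : linear_set W.
  split.
    split; first exact: L20.
    by rewrite -[RHS](cint0 mu); apply: eq_cint => x; rewrite mul0r.
  move=> c u v [lu u0] [lv v0]; split; first exact: L2lin.
  by rewrite inner_linl// u0 v0 mulr0 addr0.
have WL : W `<=` L2 by move=> f [].
have spW : linear_span S `<=` W.
  by apply: span_min => // f Sf; split; [exact: SL|exact: Sg].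
have spL : linear_span S `<=` L2 by move=> f /spW[].
move=> f /(L2closureP _ spL)[lf h].
apply: eq0_normc; apply/eqP; rewrite eq_le normc_ge0 andbT.
apply/ler_addgt0Pr => e e0; rewrite add0r.
have q0 := nq_ge0 g.
(* This weight brings the term in [g] below e / 2; approximating [f] within (e / 2) / t then does
   the same for the other term. *)
pose t := (nq g + 1) / (e / 2).
have t0 : 0 < t by rewrite !divr_gt0// ltr_wpDl.
have et : 0 < e / 2 / t by rewrite divr_gt0// divr_gt0.
have [k Sk fk] := h _ et.
have [lk k0] := spW _ Sk.
have -> : inner f g = inner (fun x => f x - k x) g.
  rewrite (_ : (fun x => f x - k x) = fun x => -1 * k x + f x); last first.
    by apply/funext => x; rewrite mulN1r addrC.
  by rewrite inner_linl// k0 mulr0 add0r.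
have [_ ub] := inner_le (L2B lf lk) lg t0.
rewrite (le_trans ub)//.
have -> : e = e / 2 + e / 2 by field.
apply: lerD; first by rewrite mulrC -ler_pdivlMr// ltW.
rewrite /t invf_div mulrAC ler_pdivrMr ?ltr_wpDl//.
by rewrite ler_wpM2l ?divr_ge0 ?(ltW e0)// lerDl.
Qed.

End L2_theory.

(** * Density of band-limited functions *)

Section clamp.
Context {R : realType}.

Definition clamp (t : R) : R := Num.min 1 (Num.max 0 t).

Lemma clamp_ge0 t : 0 <= clamp t.
Proof. by rewrite /clamp le_min ler01 le_max lexx. Qed.
Lemma clamp_le1 t : clamp t <= 1.
Proof. by rewrite /clamp ge_min lexx. Qed.
Lemma clamp0 t : t <= 0 -> clamp t = 0.
Proof. by move=> t0; rewrite /clamp max_l// min_r. Qed.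
Lemma clamp1 t : 1 <= t -> clamp t = 1.
Proof. by move=> t1; rewrite /clamp max_r ?min_l// (le_trans ler01). Qed.
Lemma clamp_lip a b : `|clamp a - clamp b| <= `|a - b|.
Proof.
wlog ab : a b / a <= b.
  move=> h; have [/h//|/ltW/h] := leP a b.
  by rewrite distrC (distrC b).
rewrite distrC (distrC a) [leRHS]ger0_norm ?subr_ge0//.
have [a0|a0] := leP a 0; have [b1|b1] := leP 1 b.
- by rewrite (clamp0 a0) (clamp1 b1) subr0 normr1; lra.
- have [b0|b0] := leP b 0; first by rewrite !clamp0// subrr normr0; lra.
  rewrite (clamp0 a0) subr0 ger0_norm ?clamp_ge0// /clamp max_r ?(ltW b0)//.
  by rewrite min_r ?(ltW b1)//; lra.
- have [a1|a1] := leP 1 a; first by rewrite !clamp1// subrr normr0; lra.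
  rewrite (clamp1 b1) ger0_norm ?subr_ge0 ?clamp_le1// /clamp max_r ?(ltW a0)//.
  by rewrite min_r ?(ltW a1)//; lra.
- rewrite /clamp !max_r ?(ltW a0) ?min_r ?(ltW b1)//; try lra.
  by rewrite ger0_norm ?subr_ge0.
Qed.

Lemma measurable_clamp : measurable_fun setT clamp.
Proof. by apply: measurable_minr => //; exact: measurable_maxr. Qed.

End clamp.

Section density.
Context {R : realType} {n : nat}.
Local Notation mu := (lebesgue_cV (R := R) n.+1).
Local Notation T := 'cV[R]_n.+1.
Implicit Types (f g : T -> R[i]).

Lemma blip_clamp (u : T -> R) (C : R) : 0 <= C -> measurable_fun setT u ->
  (forall x y, `|u x - u y| <= C * n1 (x - y)) -> blip (fun x => (clamp (u x))%:C).
Proof.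
move=> C0 mu_ uC; split.
- by apply: cmeas_real; exact: measurableT_comp measurable_clamp mu_.
- by exists 1 => x; rewrite normc_real ger0_norm ?clamp_ge0 ?clamp_le1.
- by exists C => // x y; rewrite -rmorphB normc_real (le_trans (clamp_lip _ _)).
Qed.

Lemma n1_lip (x y : T) : `|n1 x - n1 y| <= n1 (x - y).
Proof.
have := n1D (x - y) y; have := n1D (y - x) x; rewrite !subrK n1B.
by move=> h1 h2; rewrite ler_norml; apply/andP; split; lra.
Qed.

Definition vanish0 f := exists2 r : R, 0 < r & forall x, n1 x < r -> f x = 0.

(** The spectrum is compact and avoids a neighbourhood of 0. Compactness will put such functions in
    some [resolution j]; avoiding 0 will make them orthogonal to the intersection of all of them. *)
Definition band : set (T -> R[i]) :=
  [set f | exists G, [/\ clip G, vanish0 G & f = ft 1 G]].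

Lemma clip_L2 f : clip f -> L2 f.
Proof.
move=> [[mf [M fM] _] [K fK]]; apply/L2P; split => //.
have [M0 M0'] : 0 <= M /\ 0 <= M ^+ 2.
  by have := le_trans (normc_ge0 _) (fM 0) => M0; split => //; exact: sqr_ge0.
apply: (rintg_le _ (rintgZ (M ^+ 2) (rintg_ballK K))).
  by apply: measurable_funX; exact: measurable_normc.
move=> x; rewrite ger0_norm ?sqr_ge0// indicE.
have [->|/fK xK] := eqVneq (f x) 0; first by rewrite normc0 expr0n normr_ge0.
rewrite mem_set// mulr1 ger0_norm//.
by rewrite ler_pXn2r ?nnegrE ?normc_ge0.
Qed.

Lemma ft_L2 s f : s ^+ 2 = 1 -> clip f -> L2 (ft s f).
Proof.
move=> s2 cf; apply/L2P; split; first by have [] := blip_ft s cf.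
by have [] := plancherel s2 cf.
Qed.

Lemma nq_ft s f : s ^+ 2 = 1 -> clip f -> nq (ft s f) = nq f.
Proof. by move=> s2 cf; have [_] := plancherel s2 cf. Qed.

Lemma sqr1 : (1 : R) ^+ 2 = 1. Proof. by rewrite expr1n. Qed.
Lemma sqrN1 : (- 1 : R) ^+ 2 = 1. Proof. by rewrite sqrrN expr1n. Qed.

Lemma band_L2 : band `<=` L2.
Proof. by move=> f [G [cG _ ->]]; apply: ft_L2 => //; exact: sqr1. Qed.

Lemma band_linear : linear_set band.
Proof.
split.
  exists (fun=> 0); split; [exact: clip0|by exists 1|].
  by apply/funext => x; rewrite /ft -[LHS](cint0 mu); apply: eq_cint => y; rewrite mul0r.
move=> c f g [F [cF [r r0 Fr] ->]] [G [cG [q q0 Gq] ->]].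
exists (fun x => c * F x + G x); split.
- by apply: clipD => //; exact: clipZ.
- exists (Num.min r q); first by rewrite lt_min r0.
  by move=> x; rewrite lt_min => /andP[/Fr -> /Gq ->]; rewrite mulr0 addr0.
- apply/funext => x; rewrite ftD ?ftZ//; [exact: clip_cintg|apply: cintgZ|]; exact: clip_cintg.
Qed.

Local Notation V := (L2closure band).

Let cV : closed_subspace V.
Proof. by apply: closed_subspace_closure; [exact: band_L2|exact: band_linear]. Qed.
Let lV : linear_set V. Proof. exact: closed_subspace_linset. Qed.

(** A Lipschitz cutoff to an annulus, with M = m + 1: it vanishes for n1 x below 1 / M or above 2 M,
    and equals 1 for n1 x between 2 / M and M. *)
Definition kap (m : nat) (x : T) : R :=
  clamp (m.+1%:R * n1 x - 1) * clamp (2 - m.+1%:R^-1 * n1 x).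

Lemma kap_ge0 m x : 0 <= kap m x.
Proof. by rewrite mulr_ge0 ?clamp_ge0. Qed.
Lemma kap_le1 m x : kap m x <= 1.
Proof. by rewrite mulr_ile1 ?clamp_ge0 ?clamp_le1. Qed.

Lemma kap_clip m : clip (fun x => (kap m x)%:C).
Proof.
have m0 : 0 < m.+1%:R^-1 :> R by rewrite invr_gt0.
have b1 : blip (fun x : T => (clamp (m.+1%:R * n1 x - 1))%:C).
  apply: (@blip_clamp _ m.+1%:R) => //.
    by apply: measurable_funB => //; apply: measurable_funM => //; exact: measurable_n1.
  move=> x y; rewrite opprB addrA subrK -mulrBr normrM ger0_norm//.
  by rewrite ler_wpM2l// n1_lip.
have b2 : blip (fun x : T => (clamp (2 - m.+1%:R^-1 * n1 x))%:C).
  apply: (@blip_clamp _ m.+1%:R^-1) => //.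
    by apply: measurable_funB => //; apply: measurable_funM => //; exact: measurable_n1.
  move=> x y.
  have -> : 2 - m.+1%:R^-1 * n1 x - (2 - m.+1%:R^-1 * n1 y) = m.+1%:R^-1 * (n1 y - n1 x) by ring.
  by rewrite normrM ger0_norm// ler_wpM2l// n1B n1_lip.
split.
  by have := blipM b1 b2; under eq_fun do rewrite -rmorphM.
exists (2 * m.+1%:R) => x; apply: contraNT; rewrite -ltNge => h.
rewrite /kap (clamp0 (t := 2 - _)) ?mulr0//.
by rewrite subr_le0 mulrC ler_pdivlMr// ltW.
Qed.

Lemma kap_vanish m : vanish0 (fun x => (kap m x)%:C).
Proof.
exists m.+1%:R^-1; first by rewrite invr_gt0.
move=> x h; rewrite /kap clamp0 ?mul0r// subr_le0 mulrC -ler_pdivlMr// div1r.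
exact: ltW.
Qed.

Lemma kap_cvg x : x != 0 -> kap m x @[m --> \oo] --> (1 : R).
Proof.
move=> x0; have nx : 0 < n1 x.
  by rewrite lt_neqAle n1_ge0 andbT eq_sym; apply: contra x0 => /eqP/n1_eq0 ->.
apply: cvg_near_cst.
pose N := Num.Def.archi_bound (n1 x + 2 * (n1 x)^-1).
have hN : n1 x + 2 * (n1 x)^-1 < N%:R.
  by apply: archi_boundP; rewrite addr_ge0 ?mulr_ge0 ?invr_ge0 ?n1_ge0.
exists N => // m /= Nm.
have Nm' : N%:R <= m.+1%:R :> R by rewrite ler_nat (leq_trans Nm).
have i0 : 0 < 2 * (n1 x)^-1 by rewrite mulr_gt0 ?invr_gt0.
rewrite /kap !clamp1 ?mulr1//.
  rewrite lerBrDl -lerBrDr (_ : 2 - 1 = 1); last by ring.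
  rewrite mulrC ler_pdivrMr// mul1r; lra.
rewrite lerBrDl (_ : 1 + 1 = 2)// -ler_pdivrMr//; lra.
Qed.

Lemma null_pt : mu [set 0] = 0%E.
Proof.
have := @lebesgue_cV_box R n.+1 (fun=> 0) (fun=> 0) (fun=> lexx 0).
rewrite big_ord_recl subrr mul0r => h.
transitivity (0%:E : \bar R) => //; rewrite -h; congr (mu _).
apply/seteqP; split=> [x -> i|x {}h]; first by rewrite mxE in_itv/= lexx.
apply/colP => i; rewrite mxE; apply/eqP; rewrite eq_le.
by have := h i; rewrite in_itv/= andbC.
Qed.

Lemma measurable_pt0 : measurable [set (0 : T)].
Proof.
rewrite (_ : [set 0] = ballK 0); first exact: measurable_ballK.
apply/seteqP; split=> [x ->|x /= h]; first by rewrite /ballK/= n10.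
by apply: n1_eq0; apply/eqP; rewrite eq_le h n1_ge0.
Qed.

(** The transform [F] of [f] is cut off by [kap m] and transformed back. Since [F] is not known to
    be integrable, the squared distance to [f] is expanded instead of inverting: Plancherel gives
    the two norms, [mult_formula] the cross term, and the total is the integral of (1 - kap)^2
    |F|^2. *)
Lemma clip_band f : clip f -> V f.
Proof.
move=> cf; have lf := clip_L2 cf; have icf := clip_cintg cf.
pose F := ft (-1) f.
have bF : blip F by exact: blip_ft.
have [iF FE] := plancherel sqrN1 cf.
pose G m x := (kap m x)%:C * F x.
have cG m : clip (G m) by apply: clipMl => //; exact: kap_clip.
apply: (closed_subspace_lim (f_ := fun m => ft 1 (G m)) cV lf).
  move=> m; apply: subset_L2closure; first exact: band_L2.
  exists (G m); split => //.
  by have [r r0 h] := kap_vanish m; exists r => // x /h; rewrite /G => ->; rewrite mul0r.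
have E m : nq (fun x => f x - ft 1 (G m) x) =
    \int[mu]_x ((1 - kap m x) ^+ 2 * normc (F x) ^+ 2).
  set H := ft 1 (G m).
  have lH : L2 H by apply: ft_L2 => //; exact: sqr1.
  have HE : nq H = \int[mu]_x (kap m x ^+ 2 * normc (F x) ^+ 2).
    rewrite nq_ft ?sqr1//; apply: eq_Rintegral => x _.
    by rewrite /G normcM normc_real exprMn real_normK// num_real.
  have iK (k : T -> R) : measurable_fun setT k -> (forall x, `|k x| <= 1) ->
      rintg mu (fun x => k x * normc (F x) ^+ 2).
    move=> mk k1; apply: (rintg_le _ iF).
      by apply: measurable_funM => //; exact: rintg_meas iF.
    by move=> x; rewrite normrM ler_piMl.
  have mkap : measurable_fun setT (kap m).
    have [[[mk _] _ _] _] := kap_clip m; exact: mk.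
  have k1 x : `|kap m x| <= 1 by rewrite ger0_norm ?kap_ge0 ?kap_le1.
  have ik := iK _ mkap k1.
  have ik2 : rintg mu (fun x => kap m x ^+ 2 * normc (F x) ^+ 2).
    apply: iK; first exact: measurable_funX.
    by move=> x; rewrite normrX exprn_ile1.
  have HI : cint mu (fun x => H x * conjc (f x)) = (\int[mu]_x (kap m x * normc (F x) ^+ 2))%:C.
    rewrite (mult_formula 1 (clip_cintg (cG m)) (cintgJ icf)) -cint_real.
    apply: eq_cint => x; have := ft_conj (-1) x icf; rewrite opprK => <-.
    by rewrite /G -mulrA mulcJ -rmorphM.
  have lHf := L2_cintgM lH lf.
  transitivity (\int[mu]_x ((normc (f x) ^+ 2 + normc (H x) ^+ 2) -
      2 * Re (H x * conjc (f x)))).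
    apply: eq_Rintegral => x _; rewrite !normc2E !ReImE; ring.
  have f2 := L2_sqi lf; have H2 := L2_sqi lH.
  have [iR _] := lHf.
  rewrite rintB; [|exact: rintgD|exact: rintgZ].
  rewrite rintD// rintZ// -Re_cint HI Re_real -/(nq f) -/(nq H) HE.
  rewrite -[nq f]FE -rintD// -rintZ// -rintB//; [|exact: rintgD|exact: rintgZ].
  by apply: eq_Rintegral => x _; rewrite -/F; ring.
under eq_fun do rewrite E.
rewrite -(rint0 mu).
have mF2 := rintg_meas iF.
have mkap m : measurable_fun setT (kap m).
  have [[[mk _] _ _] _] := kap_clip m; exact: mk.
apply: (@rint_dom_cvg _ _ _ mu _ (fun=> 0) (fun x => normc (F x) ^+ 2)) => //.
- move=> m; apply: measurable_funM => //; apply: measurable_funX.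
  exact: measurable_funB.
(* Every [kap m] vanishes at the origin, so convergence can fail only there, on a null set. *)
- exists [set 0]; split; [exact: measurable_pt0|exact: null_pt|].
  move=> x /= h; apply: contrapT => /eqP x0; apply: h.
  have c1 : 1 - kap m x @[m --> \oo] --> (1 - 1 : R).
    by apply: cvgB; [exact: cvg_cst|exact: kap_cvg].
  have c2 : (fun _ : nat => normc (F x) ^+ 2) @ \oo --> normc (F x) ^+ 2 by exact: cvg_cst.
  have c0 : (1 - kap m x) * (1 - kap m x) * normc (F x) ^+ 2 @[m --> \oo] -->
      ((1 - 1) * (1 - 1) * normc (F x) ^+ 2 : R).
    by apply: cvgM => //; exact: cvgM.
  rewrite subrr mulr0 mul0r in c0.
  apply: (cvg0_le _ c0) => m.
  by rewrite -expr2 ger0_norm// mulr_ge0 ?sqr_ge0.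
- move=> m x; rewrite normrM [X in _ * X]ger0_norm ?sqr_ge0// ler_piMl ?sqr_ge0//.
  rewrite normrX exprn_ile1//.
  by rewrite ger0_norm ?subr_ge0 ?kap_le1// lerBlDl lerDr kap_ge0.
Qed.

End density.

(** * From compactly supported Lipschitz functions to all of L2 *)

Section band_dense.
Context {R : realType} {n : nat}.
Local Notation mu := (lebesgue_cV (R := R) n.+1).
Local Notation T := 'cV[R]_n.+1.
Implicit Types (f g : T -> R[i]).
Local Notation V := (L2closure (@band R n)).

(** Dominated convergence in L2: the squared differences are bounded by 4 v^2. *)
Lemma closed_subspace_dom W (f_ : nat -> T -> R[i]) f (v : T -> R) :
  closed_subspace W -> (forall m, W (f_ m)) -> cmeas f ->
  rintg mu (fun x => v x ^+ 2) ->
  (forall m x, normc (f_ m x) <= v x) -> (forall x, normc (f x) <= v x) ->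
  (forall x, normc (f x - f_ m x) @[m --> \oo] --> (0 : R)) -> W f.
Proof.
move=> cW Wf mf iv f_v fv cf.
have v0 x : 0 <= v x by exact: le_trans (normc_ge0 _) (fv x).
have lf_ m : L2 (f_ m) by exact: closed_subspace_L2 cW _ (Wf m).
have lf : L2 f.
  apply/L2P; split => //; apply: (rintg_le _ iv).
    by apply: measurable_funX; exact: measurable_normc.
  move=> x; rewrite !ger0_norm ?sqr_ge0//.
  by rewrite ler_pXn2r ?nnegrE ?normc_ge0.
apply: (closed_subspace_lim cW lf Wf).
rewrite -(rint0 mu).
apply: (@rint_dom_cvg _ _ _ mu _ (fun=> 0) (fun x => 4 * v x ^+ 2)) => //.
- move=> m; apply: measurable_funX; apply: measurable_normc; apply: cmeasB => //.
  exact: L2_cmeas.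
- apply: aeW => x.
  have c0 : normc (f x - f_ m x) * normc (f x - f_ m x) @[m --> \oo] --> (0 * 0 : R).
    by apply: cvgM.
  rewrite mulr0 in c0.
  apply: (cvg0_le _ c0) => m.
  by rewrite -expr2 ger0_norm// sqr_ge0.
- exact: rintgZ.
- move=> m x; rewrite ger0_norm ?sqr_ge0//.
  have -> : 4 * v x ^+ 2 = (2 * v x) ^+ 2 by ring.
  rewrite ler_pXn2r ?nnegrE ?normc_ge0 ?mulr_ge0//.
  rewrite (le_trans (normcD _ _))// normcN mulr_natl mulr2n lerD//.
Qed.

Let cV : closed_subspace V.
Proof. by apply: closed_subspace_closure; [exact: band_L2|exact: band_linear]. Qed.
Let lV : linear_set V. Proof. exact: closed_subspace_linset. Qed.

Definition cind (A : set T) (x : T) : R[i] := (\1_A x)%:C.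

Lemma cind_in A x : A x -> cind A x = 1. Proof. by move=> Ax; rewrite /cind indicE mem_set. Qed.
Lemma cind_out A x : ~ A x -> cind A x = 0. Proof. by move=> Ax; rewrite /cind indicE memNset. Qed.
Lemma normc_cind A x : normc (cind A x) = \1_A x.
Proof. by rewrite normc_real ger0_norm. Qed.

Definition box (a b : 'I_n.+1 -> R) : set T := [set x | forall i, a i <= x i ord0 <= b i].

(** For a nonempty box, the [n1]-distance to it, written coordinatewise and without an infimum. *)
Definition dbox (a b : 'I_n.+1 -> R) (x : T) : R :=
  \sum_i (Num.max 0 (a i - x i ord0) + Num.max 0 (x i ord0 - b i)).

Lemma max0_lip (s t : R) : `|Num.max 0 s - Num.max 0 t| <= `|s - t|.
Proof.
wlog st : s t / s <= t.
  move=> h; have [/h//|/ltW/h] := leP s t.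
  by rewrite distrC (distrC t).
have [s0|s0] := leP s 0; have [t0|t0] := leP t 0.
- by rewrite subrr normr0.
- by rewrite distrC (distrC s) !ger0_norm ?subr_ge0 ?(ltW t0)//; lra.
- by move: (lt_le_trans s0 st); rewrite ltNge t0.
- by [].
Qed.

Lemma dbox_ge0 a b x : 0 <= dbox a b x.
Proof. by apply: sumr_ge0 => i _; rewrite addr_ge0// le_max lexx. Qed.

Lemma dbox_lip a b (x y : T) : `|dbox a b x - dbox a b y| <= 2 * n1 (x - y).
Proof.
rewrite /dbox -sumrB (le_trans (ler_norm_sum _ _ _))// /n1 mulr_sumr ler_sum// => i _.
rewrite opprD addrACA (le_trans (ler_normD _ _))// mulr_natl mulr2n lerD//.
  rewrite (le_trans (max0_lip _ _))//.
  have -> : a i - x i ord0 - (a i - y i ord0) = - (x - y) i ord0 by rewrite !mxE; ring.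
  by rewrite normrN.
rewrite (le_trans (max0_lip _ _))//.
by have -> : x i ord0 - b i - (y i ord0 - b i) = (x - y) i ord0 by rewrite !mxE; ring.
Qed.

Lemma measurable_dbox a b : measurable_fun setT (dbox a b).
Proof.
apply: measurable_sum => i; apply: measurable_funD; apply: measurable_maxr => //;
  apply: measurable_funB => //; exact: measurable_coord.
Qed.

Lemma dbox0 a b x : dbox a b x = 0 <-> box a b x.
Proof.
split=> [d0 i|h].
  have := d0; rewrite /dbox => /eqP; rewrite psumr_eq0; last first.
    by move=> j _; rewrite addr_ge0// le_max lexx.
  move=> /allP /(_ i (mem_index_enum i)) /=.
  rewrite paddr_eq0 ?le_max ?lexx// => /andP[/eqP h1 /eqP h2].
  have : a i - x i ord0 <= 0 by rewrite -h1 le_max lexx orbT.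
  have : x i ord0 - b i <= 0 by rewrite -h2 le_max lexx orbT.
  by move=> h3 h4; apply/andP; split; lra.
rewrite /dbox big1// => i _; have /andP[h1 h2] := h i.
by rewrite !max_l ?addr0//; lra.
Qed.

Lemma dbox_bounded a b x : dbox a b x <= 1 ->
  n1 x <= \sum_i (`|a i| + `|b i| + 1).
Proof.
move=> d1; apply: ler_sum => i _.
have : Num.max 0 (a i - x i ord0) + Num.max 0 (x i ord0 - b i) <= 1.
  rewrite (le_trans _ d1)// /dbox (bigD1 i)//= lerDl.
  by apply: sumr_ge0 => j _; rewrite addr_ge0// le_max lexx.
have h1 : 0 <= Num.max 0 (a i - x i ord0) by rewrite le_max lexx.
have h2 : 0 <= Num.max 0 (x i ord0 - b i) by rewrite le_max lexx.
have h3 : a i - x i ord0 <= Num.max 0 (a i - x i ord0) by rewrite le_max lexx orbT.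
have h4 : x i ord0 - b i <= Num.max 0 (x i ord0 - b i) by rewrite le_max lexx orbT.
have a1 := ler_norm (a i); have a2 := ler_norm (- a i); rewrite normrN in a2.
have b1 := ler_norm (b i); have b2 := ler_norm (- b i); rewrite normrN in b2.
by move=> h; rewrite ler_norml; apply/andP; split; lra.
Qed.

Lemma measurable_box a b : measurable (box a b).
Proof.
rewrite (_ : box a b = setT `&` dbox a b @^-1` [set 0]); last first.
  by apply/seteqP; split=> [x /dbox0 //|x [_ /dbox0]].
exact: measurable_dbox.
Qed.

Lemma cmeas_cind A : measurable A -> cmeas (cind A).
Proof. by move=> mA; apply: cmeas_real; exact: measurable_indic. Qed.

Lemma rintg_indic_sq K : rintg mu (fun x => (\1_(@ballK R n.+1 K) x : R) ^+ 2).
Proof.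
apply: eq_rintg (rintg_ballK K) => x.
by rewrite indicE; case: (_ \in _); rewrite ?expr1n ?expr0n.
Qed.

(** The indicator is the pointwise limit of the Lipschitz functions max(0, 1 - (m + 1) dbox), all
    supported in the unit neighbourhood of the box. *)
Lemma box_band a b : V (cind (box a b)).
Proof.
set K := \sum_i (`|a i| + `|b i| + 1).
pose h m (x : T) : R[i] := (clamp (1 - m.+1%:R * dbox a b x))%:C.
have hK m x : h m x != 0 -> n1 x <= K.
  move=> hx; apply: dbox_bounded; rewrite leNgt; apply: contra hx => d1.
  rewrite /h clamp0// subr_le0 (le_trans (ltW d1))// ler_peMl ?dbox_ge0//.
  by rewrite ler1n.
have bh m : blip (h m).
  apply: (@blip_clamp _ _ _ (m.+1%:R * 2)); first by [].
    apply: measurable_funB => //; apply: measurable_funM => //.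
    exact: measurable_dbox.
  move=> x y.
  rewrite (_ : 1 - m.+1%:R * dbox a b x - (1 - m.+1%:R * dbox a b y) =
    m.+1%:R * (dbox a b y - dbox a b x)); last by ring.
  by rewrite normrM ger0_norm// -mulrA ler_wpM2l// n1B dbox_lip.
have boxK x : box a b x -> n1 x <= K.
  by move=> /dbox0 d0; apply: dbox_bounded; rewrite d0.
apply: (closed_subspace_dom (f_ := h) (v := \1_(@ballK R n.+1 K)) cV).
- by move=> m; apply: clip_band; split => //; exists K => x; exact: hK.
- by apply: cmeas_cind; exact: measurable_box.
- exact: rintg_indic_sq.
- move=> m x; have [->|/hK xK] := eqVneq (h m x) 0; first by rewrite normc0.
  by rewrite indicE mem_set// normc_real ger0_norm ?clamp_ge0 ?clamp_le1.
- move=> x; rewrite normc_cind !indicE.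
  by case: (boolP (x \in box a b)) => // /set_mem/boxK xK; rewrite mem_set.
- move=> x; have [bx|bx] := pselect (box a b x).
    have E m : normc (cind (box a b) x - h m x) = 0.
      by rewrite cind_in// /h (dbox0 _ _ _).2// mulr0 subr0 clamp1// subrr normc0.
    by under eq_fun do rewrite E; exact: cvg_cst.
  have d0 : 0 < dbox a b x.
    rewrite lt_neqAle dbox_ge0 andbT eq_sym; apply/eqP => d0; apply: bx.
    exact/dbox0.
  apply: cvg_near_cst.
  pose N := Num.Def.archi_bound (dbox a b x)^-1.
  have hN : (dbox a b x)^-1 < N%:R by apply: archi_boundP; rewrite invr_ge0 ltW.
  exists N => // m Nm.
  have Nm' : N%:R <= m.+1%:R :> R by rewrite ler_nat (leq_trans Nm).
  suff : normc (cind (box a b) x - h m x) = 0 by [].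
  rewrite cind_out// /h clamp0 ?subrr ?normc0// subr_le0 -ler_pdivrMr// div1r.
  by rewrite (le_trans (ltW hN)).
Qed.

(** Products of closed half-lines: a family stable under intersection that generates the
    sigma-algebra, as the Dynkin argument in [meas_band] asks. *)
Definition upset (a : 'I_n.+1 -> R) : set T := [set x | forall i, a i <= x i ord0].
Definition upsets : set (set T) := [set A | exists a, A = upset a].

Lemma measurable_upsets : @measurable _ T = <<s upsets >>.
Proof.
apply/seteqP; split; last first.
  apply: smallest_sub; first exact: sigma_algebra_measurable.
  move=> _ [a ->].
  rewrite (_ : upset a = \bigcap_(i in [set: 'I_n.+1])
      ((fun x : T => x i ord0) @^-1` `[a i, +oo[)).
    rewrite bigcap_mkcond; apply: fin_bigcap_measurable => // i _.
    rewrite mem_set//= -[X in measurable X]setTI.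
    exact: (measurable_coord i measurableT (measurable_itv _)).
  apply/seteqP; split => x /= h i => [_|]; first by rewrite /= in_itv/= h.
  by have := h i I; rewrite /= in_itv/= andbT.
apply: smallest_sub; first exact: smallest_sigma_algebra.
rewrite -bigcup_seq => A /= [i _].
have mc : @measurable_fun _ _ (g_sigma_algebraType upsets) (measurableTypeR R) setT
    (fun x : T => x i ord0).
  have := @measurability _ _ (g_sigma_algebraType upsets) (measurableTypeR R) setT (fun x : T => x i ord0) _ (RGenCInfty.measurableE R).
  apply=> B [_ [t ->] <-].
  rewrite setTI.
  (* A half-space is the increasing union of the upsets whose other lower bounds are - k. *)
  rewrite (_ : _ @^-1` _ = \bigcup_k upset (fun j => if j == i then t else - k%:R)).
    by apply: bigcup_measurable => k _; apply: sub_sigma_algebra; eexists.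
  apply/seteqP; split => [x /=|x [k _ /= /(_ i)]]; last by rewrite eqxx in_itv/= andbT.
  rewrite in_itv/= andbT => tx.
  exists (Num.Def.archi_bound (n1 x)) => //= j; case: eqP => [->//|_].
  have := archi_boundP (n1_ge0 x) => h; rewrite lerNl (le_trans _ (ltW h))//.
  by rewrite (le_trans _ (n1_coord x j))// -normrN ler_norm.
move=> [B mB <-].
exact: (mc measurableT B mB).
Qed.

Definition cubeK (K : R) : set T := box (fun=> - K) (fun=> K).

Lemma cubeK_n1 K x : cubeK K x -> n1 x <= \sum_(i < n.+1) (`|- K| + `|K| + 1).
Proof. by move=> /dbox0 d0; apply: dbox_bounded; rewrite d0. Qed.

(** Dynkin induction from boxes. Intersecting with a fixed cube keeps all indicators in L2, those of
    complements included, and dominates the partial sums of disjoint unions. *)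
Lemma meas_band K (S : set T) : measurable S -> V (cind (S `&` cubeK K)).
Proof.
rewrite {1}measurable_upsets.
apply: (@dynkin_induction _ _ upsets (fun A => V (cind (A `&` cubeK K)))) => //.
- exact: measurable_upsets.
- move=> _ _ [a ->] [b ->]; exists (fun i => Num.max (a i) (b i)).
  apply/seteqP; split => [x [ax bx] i|x abx]; first by rewrite ge_max ax bx.
  by split => i; have := abx i; rewrite ge_max => /andP[].
- by rewrite setTI; exact: box_band.
- move=> _ [a ->].
  rewrite (_ : _ `&` _ = box (fun i => Num.max (a i) (- K)) (fun=> K)); first exact: box_band.
  apply/seteqP; split => [x [ax Kx] i|x abx].
    by have /andP[h1 h2] := Kx i; rewrite ge_max ax h1 h2.
  by split => i; have := abx i; rewrite ge_max => /andP[/andP[h1 h2] h3]; rewrite ?h2.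
- move=> S' mS VS.
  rewrite (_ : cind _ = fun x => cind (cubeK K) x - cind (S' `&` cubeK K) x).
    by apply: linear_setB => //; exact: box_band.
  apply/funext => x; have [Kx|Kx] := pselect (cubeK K x); last first.
    have h A : ~ (A `&` cubeK K) x by case.
    by rewrite !(cind_out (h _)) (cind_out Kx) subrr.
  rewrite (cind_in Kx).
  have [Sx|Sx] := pselect (S' x).
    by rewrite (cind_in (A := S' `&` _))// subrr cind_out//; case.
  by rewrite (cind_out (A := S' `&` _)) ?subr0 ?cind_in// => -[].
- move=> F mF tF VF.
  pose K1 := \sum_(i < n.+1) (`|- K| + `|K| + 1).
  pose f_ m x := \sum_(k < m) cind (F k `&` cubeK K) x.
  have f1 m x : f_ m x = cind ((\bigcup_(k in `I_m) F k) `&` cubeK K) x.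
    elim: m => [|m IH].
      by rewrite /f_ big_ord0 cind_out// => -[[k]].
    have -> : f_ m.+1 x = f_ m x + cind (F m `&` cubeK K) x by rewrite /f_ big_ord_recr.
    rewrite IH; have [Kx|Kx] := pselect (cubeK K x); last first.
      have h A : ~ (A `&` cubeK K) x by case.
      by rewrite !(cind_out (h _)) addr0.
    have [Fx|Fx] := pselect (F m x).
      rewrite [X in X + _]cind_out; last first.
        move=> [[k /= km Fk] _]; have := tF k m I I.
        have h : F k `&` F m !=set0 by exists x.
        by move=> /(_ h) kmE; move: km; rewrite kmE ltnn.
      by rewrite add0r !cind_in//; split => //; exists m => //=.
    rewrite [X in _ + X]cind_out; last by case.
    rewrite addr0; have [Ux|Ux] := pselect ((\bigcup_(k in `I_m) F k) x).
      by rewrite !cind_in//; split => //; case: Ux => k /= km Fk; exists k => //=; exact: ltnW.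
    rewrite [LHS]cind_out; last by case=> [].
    rewrite [RHS]cind_out// => -[[k /=]]; rewrite ltnS leq_eqVlt => /predU1P[->//|km] Fk _.
    by apply: Ux; exists k.
  have ub (A : set T) x : normc (cind (A `&` cubeK K) x) <= (\1_(@ballK R n.+1 K1) x : R).
    rewrite normc_cind !indicE; case: (boolP (x \in A `&` _)) => // /set_mem[_ Kx].
    by rewrite mem_set//; exact: cubeK_n1.
  apply: (closed_subspace_dom (f_ := f_) (v := \1_(@ballK R n.+1 K1)) cV).
  + by move=> m; apply: linear_set_sum.
  + apply: cmeas_cind; apply: measurableI; last exact: measurable_box.
    exact: bigcup_measurable.
  + exact: rintg_indic_sq.
  + by move=> m x; rewrite f1.
  + by move=> x; exact: ub.
  + move=> x; apply: cvg_near_cst.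
    have [[[k _ Fk] Kx]|Ux] := pselect (((\bigcup_k F k) `&` cubeK K) x).
      exists k.+1 => // m km.
      suff : normc (cind ((\bigcup_k F k) `&` cubeK K) x - f_ m x) = 0 by [].
      rewrite f1 !cind_in ?subrr ?normc0//; last first.
        by split => //; exists k.
      by split => //; exists k.
    exists 0%N => // m _.
    suff : normc (cind ((\bigcup_k F k) `&` cubeK K) x - f_ m x) = 0 by [].
    rewrite f1 (cind_out Ux) cind_out ?subrr ?normc0//.
    by move=> [[k /= _ Fk] Kx]; apply: Ux; split => //; exists k.
Qed.

Import HBSimple HBNNSimple.

(** Simple functions increasing to [u], each cut to a cube that grows with the index; [u] itself is
    the majorant. *)
Lemma nnL2_band (u : T -> R) : measurable_fun setT u -> (forall x, 0 <= u x) ->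
  rintg mu (fun x => u x ^+ 2) -> V (fun x => (u x)%:C).
Proof.
move=> mu_ u0 iu.
have mE : measurable_fun setT (EFin \o u) by exact/measurable_EFinP.
pose s := nnsfun_approx measurableT mE.
have cs x : s m x @[m --> \oo] --> u x.
  have := @cvg_nnsfun_approx _ _ _ _ measurableT _ mE (fun x _ => u0 x) x I.
  exact: fine_cvg.
have su m x : s m x <= u x.
  have nd := @nd_nnsfun_approx _ _ _ _ measurableT _ mE.
  have ndx : nondecreasing_seq (fun m => s m x).
    by move=> a b ab; have := nd _ _ ab => /lefP; exact.
  by have := nondecreasing_cvgn_le ndx (cvgP _ (cs x)) m; rewrite (cvg_lim _ (cs x)).
pose f_ m x := (s m x)%:C * cind (cubeK m%:R) x.
apply: (closed_subspace_dom (f_ := f_) (v := u) cV) => //.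
- move=> m.
  pose t := finmap.enum_fset (fset_set (range (s m))).
  rewrite (_ : f_ m = fun x => \sum_(i < size t)
      (t`_i)%:C * cind ((s m @^-1` [set t`_i]) `&` cubeK m%:R) x).
    apply: linear_set_sum => // i; apply: linear_setZ => //.
    by apply: meas_band; exact: measurable_sfunP.
  apply/funext => x; rewrite /f_ fimfunEord rmorph_sum/= mulr_suml.
  apply: eq_bigr => i _; rewrite rmorphM/= -mulrA; congr (_ * _).
  rewrite /cind -rmorphM/=; congr (_%:C).
  by rewrite indicI.
- move=> m x; rewrite normcM normc_cind normc_real ger0_norm; last exact: fun_ge0.
  by rewrite (le_trans _ (su m x))// ler_piMr// ?fun_ge0// indicE lern1; case: (_ \in _).
- by move=> x; rewrite normc_real ger0_norm.
- move=> x.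
  have c0 : s m x - u x @[m --> \oo] --> (0 : R) by exact/subr_cvg0.
  have c1 : `|s m x - u x| @[m --> \oo] --> (0 : R) by apply/norm_cvg0P.
  apply: (squeeze_cvgr _ (cvg_cst 0) c1).
  exists (Num.Def.archi_bound (n1 x)) => // m h.
  have Kx : cubeK m%:R x.
    move=> i; rewrite -ler_norml (le_trans (n1_coord _ _))//.
    by rewrite (le_trans (ltW (archi_boundP (n1_ge0 x))))// ler_nat.
  have -> : f_ m x = (s m x)%:C by rewrite /f_ cind_in// mulr1.
  by rewrite -rmorphB normc_real distrC normr_ge0 lexx.
Qed.

Theorem band_dense : L2 `<=` V.
Proof.
move=> f lf; have [mr mi] := L2_cmeas lf; have f2 := L2_sqi lf.
have part (u : T -> R) : measurable_fun setT u -> (forall x, `|u x| <= normc (f x)) ->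
    V (fun x => (u x)%:C).
  move=> mu_ uf.
  have half (w : T -> R) : measurable_fun setT w -> (forall x, 0 <= w x) ->
      (forall x, w x <= 2 * normc (f x)) -> V (fun x => (w x)%:C).
    move=> mw w0 wf; apply: nnL2_band => //.
    apply: (rintg_le _ (rintgZ 4 f2)); first exact: measurable_funX.
    move=> x; have -> : 4 * normc (f x) ^+ 2 = (2 * normc (f x)) ^+ 2 by ring.
    have h : 0 <= 2 * normc (f x) by rewrite mulr_ge0 ?normc_ge0.
    by rewrite !ger0_norm ?sqr_ge0// ler_pXn2r ?nnegrE.
  rewrite [X in V X](_ : _ = fun x => (`|u x| + u x)%:C - (`|u x|)%:C); last first.
    by apply/funext => x; rewrite -rmorphB addrAC subrr add0r.
  have mau : measurable_fun setT (fun x => `|u x|) by exact: measurableT_comp.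
  apply: linear_setB => //; apply: half => //.
  - exact: measurable_funD.
  - by move=> x; have := ler_norm (- u x); rewrite normrN; lra.
  - by move=> x; have := ler_norm (u x); have := uf x; lra.
  - by move=> x; have := uf x; have := normc_ge0 (f x); lra.
rewrite (_ : f = fun x => 'i%C * (Im (f x))%:C + (Re (f x))%:C).
  apply: lV.2; apply: part => // x; [exact: Im_le_normc|exact: Re_le_normc].
by apply/funext => x; rewrite {1}[f x]complex_split addrC mulrC.
Qed.

End band_dense.

(** * Smooth windows *)

Section derive_bound.
Context {R : realType} {V : normedModType R}.

Lemma is_derive_lim (f : V -> R) x v (d : R) :
  h^-1 * (f (h *: v + x) - f x) @[h --> (0 : R)^'] --> d -> is_derive x v f d.
Proof.
move=> c; split; first by apply/cvg_ex; exists d; exact: c.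
exact: cvg_lim c.
Qed.

Lemma lim_is_derive (f : V -> R) x v (d : R) : is_derive x v f d ->
  h^-1 * (f (h *: v + x) - f x) @[h --> (0 : R)^'] --> d.
Proof. by case=> df <-; exact: df. Qed.

(** Serves where only the increment can be estimated: at the flat point of [EE] and for
    differentiation under the integral sign. *)
Lemma is_derive_bound (f : V -> R) x v (d C : R) :
  (forall h : R, `|f (h *: v + x) - f x - h * d| <= C * h ^+ 2) ->
  is_derive x v f d.
Proof.
move=> fC; apply: is_derive_lim; apply/subr_cvg0.
have c0 : C * `|h| @[h --> (0 : R)^'] --> (0 : R).
  rewrite -[X in _ --> X](mulr0 C) -[X in _ * X](normr0 R).
  apply: cvgM; first exact: cvg_cst.
  by apply: cvg_norm; exact: cvg_within_filter.
apply: norm_cvg0; apply: (squeeze_cvgr _ (cvg_cst 0) c0).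
near=> h; rewrite normr_ge0/=.
have h0 : h != 0 by near: h; exact: nbhs_dnbhs_neq.
have -> : h^-1 * (f (h *: v + x) - f x) - d = h^-1 * (f (h *: v + x) - f x - h * d).
  by rewrite [RHS]mulrBr mulKf.
rewrite normrM normfV mulrC ler_pdivrMr ?normr_gt0// (le_trans (fC h))//.
by rewrite -mulrA -normrM ger0_norm -?expr2 ?sqr_ge0.
Unshelve. all: by end_near. Qed.

End derive_bound.

Section derive_line.
Context {R : realType} {V : normedModType R}.

Lemma is_derive_line (f : V -> R) x v (d : R) :
  is_derive (0 : R) (1 : R) (fun h : R => f (h *: v + x)) d -> is_derive x v f d.
Proof.
move=> H; have := @lim_is_derive R R _ _ _ _ H; rewrite scale0r add0r => c.
apply: is_derive_lim; apply: cvg_trans c.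
by apply: near_eq_cvg; apply: nearW => h; rewrite addr0 /GRing.scale/= mulr1.
Qed.

End derive_line.

(** * Smooth functions of one variable *)

Section smooth1.
Context {R : realType}.
Implicit Types f g : R -> R.

(** Each derivative is given by a witness instead of an iterated derivation operator, so closure
    properties are plain inductions on the order. *)
Fixpoint Ck (k : nat) f : Prop :=
  match k with
  | 0 => continuous f
  | k'.+1 => exists2 g, (forall x : R, is_derive x (1 : R) f (g x)) & Ck k' g
  end.

Definition smooth1 f := forall k, Ck k f.

Lemma is_derive_continuous f g : (forall x : R, is_derive x (1 : R) f (g x)) -> continuous f.
Proof. by move=> fg x; apply/differentiable_continuous/derivable1_diffP; apply: ex_derive. Qed.

Lemma CkS k f : Ck k.+1 f -> Ck k f.
Proof.
elim: k f => [|k IH] f [g fg Cg]; first exact: is_derive_continuous fg.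
by exists g => //; exact: IH.
Qed.

Lemma Ck_cont k f : Ck k f -> continuous f.
Proof. by elim: k f => [//|k IH] f /CkS; exact: IH. Qed.

Lemma Ck_cst k (c : R) : Ck k (fun=> c).
Proof.
elim: k c => [|k IH] c; first by move=> x; exact: cvg_cst.
by exists (fun=> 0) => // x; exact: is_derive_cst.
Qed.

Lemma Ck_id k : Ck k (fun x => x).
Proof.
case: k => [|k]; first by move=> x; exact: cvg_id.
by exists (fun=> 1); [move=> x; exact: is_derive_id|exact: Ck_cst].
Qed.

Lemma CkD k f g : Ck k f -> Ck k g -> Ck k (fun x => f x + g x).
Proof.
elim: k f g => [|k IH] f g; first by move=> cf cg x; apply: continuousD; [exact: cf|exact: cg].
move=> [f' ff' Cf'] [g' gg' Cg']; exists (fun x => f' x + g' x); last exact: IH.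
by move=> x; exact: is_deriveD.
Qed.

Lemma CkM k f g : Ck k f -> Ck k g -> Ck k (fun x => f x * g x).
Proof.
elim: k f g => [|k IH] f g; first by move=> cf cg x; apply: continuousM; [exact: cf|exact: cg].
move=> Cf Cg; have := Cf; have := Cg; move=> [g' gg' Cg'] [f' ff' Cf'].
exists (fun x => f x * g' x + g x * f' x).
  by move=> x; apply: is_derive_eq; rewrite /GRing.scale.
by apply: CkD; apply: IH => //; exact: CkS.
Qed.

Lemma smooth1_cst (c : R) : smooth1 (fun=> c). Proof. by move=> k; exact: Ck_cst. Qed.
Lemma smooth1_id : smooth1 (fun x => x). Proof. by move=> k; exact: Ck_id. Qed.
Lemma smooth1D f g : smooth1 f -> smooth1 g -> smooth1 (fun x => f x + g x).
Proof. by move=> sf sg k; exact: CkD. Qed.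
Lemma smooth1M f g : smooth1 f -> smooth1 g -> smooth1 (fun x => f x * g x).
Proof. by move=> sf sg k; exact: CkM. Qed.

Lemma smooth1_derive f : smooth1 f ->
  exists2 g, (forall x : R, is_derive x (1 : R) f (g x)) & smooth1 g.
Proof.
move=> sf; have [g fg _] := sf 1%N; exists g => // k.
have [g' fg' Ck'] := sf k.+1.
rewrite (_ : g = g')//; apply/funext => x.
by have [_ <-] := fg x; have [_ <-] := fg' x.
Qed.

Lemma smooth1_cont f : smooth1 f -> continuous f.
Proof. by move=> sf; exact: (Ck_cont (sf 0%N)). Qed.

Lemma Ck_affine k f (a b : R) : Ck k f -> Ck k (fun x => f (a * x + b)).
Proof.
elim: k f => [|k IH] f.
  move=> cf x; apply: (@continuous_comp _ _ _ (fun x : R => a * x + b) f); last exact: cf.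
  by apply: continuousD; [exact: mulrl_continuous|exact: cvg_cst].
move=> [g fg Cg]; exists (fun x => a * g (a * x + b)).
  move=> x; have h : is_derive x (1 : R) (fun x : R => a * x + b) a.
    by apply: is_derive_eq; rewrite /GRing.scale/= mulr1 addr0.
  exact: (is_derive_eq (is_derive1_comp (g := fun x => a * x + b) (fg _) h) (mulrC _ _)).
by apply: CkM; [exact: Ck_cst|exact: IH].
Qed.

Lemma smooth1_affine f (a b : R) : smooth1 f -> smooth1 (fun x => f (a * x + b)).
Proof. by move=> sf k; exact: Ck_affine. Qed.

Lemma smooth1_sincos : smooth1 (@sin R) /\ smooth1 (@cos R).
Proof.
suff h k : Ck k (@sin R) /\ Ck k (@cos R) by split=> k; have [] := h k.
elim: k => [|k [Cs Cc]]; first by split; [exact: continuous_sin|exact: continuous_cos].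
split; first by exists cos => // x; exact: is_derive_sin.
exists (fun x => - 1 * sin x); last by apply: CkM => //; exact: Ck_cst.
by move=> x; rewrite mulN1r; exact: is_derive_cos.
Qed.

Lemma smooth1_bounded f (K : R) : smooth1 f ->
  exists2 C : R, 0 <= C & forall x, `|x| <= K -> `|f x| <= C.
Proof.
move=> sf; have [K0|K0] := leP 0 K; last first.
  by exists 0 => // x xK; move: (le_lt_trans xK K0); rewrite normr_lt0.
have cf : {within `[- K, K], continuous f}.
  by apply: continuous_subspaceT; exact: smooth1_cont.
have KK : - K <= K by rewrite ge0_cp.
have [c1 _ h1] := EVT_max KK cf; have [c2 _ h2] := EVT_min KK cf.
exists (`|f c1| + `|f c2|); first exact: addr_ge0.
move=> x; rewrite ler_norml => xK.
have := h1 x; have := h2 x; rewrite in_itv/= => /(_ xK) e2 /(_ xK) e1.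
have := ler_norm (f c1); have := ler_norm (- f c2); rewrite normrN => n2 n1'.
have := normr_ge0 (f c1); have := normr_ge0 (f c2).
by move=> *; rewrite ler_norml; apply/andP; split; lra.
Qed.

Lemma smooth1_lip f (K : R) : smooth1 f ->
  exists2 C : R, 0 <= C & forall x y, `|x| <= K -> `|y| <= K -> `|f x - f y| <= C * `|x - y|.
Proof.
move=> sf; have [g fg sg] := smooth1_derive sf.
have [C C0 gC] := smooth1_bounded K sg; exists C => // x y.
wlog xy : x y / x <= y.
  move=> h xK yK; have [/h|/ltW/h] := leP x y; first exact.
  by rewrite distrC (distrC x); exact.
move=> xK yK; move: xy; rewrite le_eqVlt => /predU1P[->|xy].
  by rewrite !subrr normr0 mulr0.
have cf : {within `[x, y], continuous f}.
  by apply: continuous_subspaceT; exact: smooth1_cont.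
have [c cxy e] := MVT xy (fun t _ => fg t) cf.
rewrite distrC e normrM (distrC x) ler_wpM2r// gC//.
move: cxy xK yK; rewrite in_itv/= !ler_norml => /andP[c1 c2] /andP[x1 x2] /andP[y1 y2].
by apply/andP; split; lra.
Qed.

End smooth1.

(** * A smooth sine-cosine pair built from exp(-1/x) *)

Section window.
Context {R : realType}.
Implicit Types x y t : R.

(** The inequality y <= exp y at y = 1 / ((k + 1) x), raised to the power k + 1 and inverted. *)
Lemma expRN_bound (k : nat) x : 0 < x -> expR (- x^-1) <= k.+1%:R ^+ k.+1 * x ^+ k.+1.
Proof.
move=> x0; have k0 : 0 < k.+1%:R :> R by [].
have h : (k.+1%:R * x)^-1 <= expR (k.+1%:R * x)^-1.
  by rewrite (le_trans _ (expR_ge1Dx _))// lerDr.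
have kx : 0 < k.+1%:R * x by rewrite mulr_gt0.
rewrite expRN -exprMn -[X in _ <= X]invrK lef_pV2 ?posrE ?expR_gt0 ?invr_gt0 ?exprn_gt0//.
rewrite -exprVn.
have -> : expR x^-1 = expR (k.+1%:R * x)^-1 ^+ k.+1.
  by rewrite -expRM_natl; congr expR; rewrite invfM mulrA divff ?mul1r// gt_eqF.
by rewrite lerXn2r ?nnegrE ?invr_ge0 ?expR_ge0// ltW.
Qed.

(** The family x^-m exp(-1/x), extended by 0: it is closed under differentiation up to linear
    combinations, so smoothness is an induction on the order for all [m] together. The flat function
    itself is [m = 0]. *)
Definition EE (m : nat) x : R := if x <= 0 then 0 else x^-1 ^+ m * expR (- x^-1).

Lemma EE_derive m x : is_derive x (1 : R) (EE m) (EE m.+2 x - m%:R * EE m.+1 x).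
Proof.
have [x0|x0|x0] := ltgtP x 0.
- rewrite /EE (ltW x0) mulr0 subrr.
  have D0 : is_derive x (1 : R) (cst 0 : R -> R) 0 by exact: is_derive_cst.
  apply: (near_eq_is_derive _ D0).
  near=> y; rewrite ifT//; apply: ltW; near: y; exact: lt_nbhsl.
- rewrite /EE leNgt x0/=.
  have x0' : x != 0 by rewrite gt_eqF.
  have dV : is_derive x (1 : R) (fun y : R => y^-1) (- x^-1 ^+ 2).
    by apply: (is_derive_eq (is_deriveV x0' (is_derive_id _ _))); rewrite /GRing.scale/= mulr1 exprVn.
  have dE : is_derive x (1 : R) (fun y : R => expR (- y^-1)) (expR (- x^-1) * x^-1 ^+ 2).
    have dN : is_derive x (1 : R) (fun y : R => - y^-1) (x^-1 ^+ 2).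
      by apply: (is_derive_eq (is_deriveN dV)); rewrite opprK.
    by apply: (is_derive_eq (is_derive1_comp (f := expR) (g := fun y : R => - y^-1) _ dN)).
  have dX : is_derive x (1 : R) (fun y : R => y^-1 ^+ m) (- (m%:R * x^-1 ^+ m.+1)).
    rewrite (_ : (fun y => _) = (fun y : R => y^-1) ^+ m); last first.
      by apply/funext => y; rewrite exprfctE.
    apply: (is_derive_eq (is_deriveX m dV)); rewrite /GRing.scale/=.
    case: m => [|m]; first by rewrite !mul0r oppr0.
    by rewrite /= mulrN -mulrA -exprD addn2.
  have D : is_derive x (1 : R) (fun y => y^-1 ^+ m * expR (- y^-1))
      (x^-1 ^+ m.+2 * expR (- x^-1) - m%:R * (x^-1 ^+ m.+1 * expR (- x^-1))).
    apply: (is_derive_eq (is_deriveM dX dE)); rewrite /GRing.scale/=.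
    by rewrite !exprS; ring.
  apply: (near_eq_is_derive _ D).
  near=> y; rewrite ifF//; apply/negbTE; rewrite -ltNge; near: y; exact: lt_nbhsr.
- rewrite x0 /EE lexx mulr0 subrr.
  (* By [expRN_bound] of order m + 2 the factor h^-m still leaves h^2, with this constant. *)
  apply: (@is_derive_bound _ _ _ _ _ _ (m.+2%:R ^+ m.+2)) => h.
  rewrite addr0 mulr0 subr0 lexx subr0 /GRing.scale/= mulr1.
  have [h0|h0] := leP h 0.
    by rewrite normr0; apply: mulr_ge0; [exact: exprn_ge0|exact: sqr_ge0].
  rewrite ger0_norm ?mulr_ge0 ?exprn_ge0 ?expR_ge0 ?invr_ge0 ?(ltW h0)//.
  rewrite (le_trans (ler_wpM2l _ (expRN_bound m.+1 h0)))//.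
    by rewrite exprn_ge0// invr_ge0 ltW.
  rewrite mulrCA ler_wpM2l ?exprn_ge0//.
  by rewrite -addn2 exprD mulrA -exprMn mulVf ?gt_eqF// expr1n mul1r.
Unshelve. all: by end_near. Qed.

Lemma EE_smooth m : smooth1 (EE m).
Proof.
move=> k; elim: k m => [|k IH] m; first exact: is_derive_continuous (EE_derive m).
exists (fun x => EE m.+2 x + (- m%:R) * EE m.+1 x).
  by move=> x; apply: (is_derive_eq (EE_derive m x)); rewrite mulNr.
by apply: CkD => //; apply: CkM => //; exact: Ck_cst.
Qed.

Definition ee x := EE 0 x.
Lemma ee0 x : x <= 0 -> ee x = 0. Proof. by rewrite /ee /EE => ->. Qed.
Lemma ee_gt0 x : 0 < x -> 0 < ee x.
Proof. by move=> x0; rewrite /ee /EE leNgt x0/= expr0 mul1r expR_gt0. Qed.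
Lemma ee_ge0 x : 0 <= ee x.
Proof. by have [/ee0->//|/ee_gt0/ltW] := leP x 0. Qed.

(** Positive everywhere, since ee x and ee (1 - x) never vanish together. Dividing both by its
    square root gives [ws] and [wc], whose squares sum to 1. *)
Definition dd x := ee x * ee x + ee (-1 * x + 1) * ee (-1 * x + 1).
Lemma dd_gt0 x : 0 < dd x.
Proof.
have [x0|x0] := ltP 0 x.
  by rewrite ltr_pwDl ?mulr_gt0 ?ee_gt0// mulr_ge0 ?ee_ge0.
by rewrite ltr_wpDl ?mulr_gt0 ?mulr_ge0 ?ee_ge0// ee_gt0//; lra.
Qed.

Lemma dd_smooth : smooth1 dd.
Proof.
have s1 : smooth1 ee by exact: EE_smooth.
have s2 : smooth1 (fun x => ee (-1 * x + 1)) by exact: smooth1_affine.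
by apply: smooth1D; exact: smooth1M.
Qed.

Definition rho x := expR (- 2^-1 * ln (dd x)).
Lemma rho2 x : rho x ^+ 2 * dd x = 1.
Proof.
rewrite /rho -expRM_natl.
have -> : 2 * (- 2^-1 * ln (dd x)) = - ln (dd x) by field.
by rewrite expRN lnK ?posrE ?dd_gt0// mulVf// gt_eqF// dd_gt0.
Qed.

(** [rho] is dd^(-1/2), so rho' = - rho^3 dd' / 2; apart from smooth factors only [rho] occurs, and
    each order of smoothness yields the next. *)
Lemma rho_smooth : smooth1 rho.
Proof.
have [d' dd' sd'] := smooth1_derive dd_smooth.
have rho' x : is_derive x (1 : R) rho (- 2^-1 * (rho x * (rho x * (rho x * d' x)))).
  have dl : is_derive x (1 : R) (fun y => ln (dd y)) ((dd x)^-1 * d' x).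
    have hl : is_derive (dd x) (1 : R) (@ln R) (dd x)^-1 := is_derive1_ln (dd_gt0 x).
    exact: (is_derive_eq (@is_derive1_comp R (@ln R) dd x _ _ hl (dd' x)) erefl).
  have dl2 : is_derive x (1 : R) (fun y => - 2^-1 * ln (dd y)) (- 2^-1 * ((dd x)^-1 * d' x)).
    by apply: (is_derive_eq (is_deriveZ (- 2^-1) dl)).
  apply: (is_derive_eq (is_derive1_comp (f := expR) (g := fun y => - 2^-1 * ln (dd y)) _ dl2)).
  rewrite -/(rho x).
  have -> : (dd x)^-1 = rho x ^+ 2.
    by apply: (mulIf (lt0r_neq0 (dd_gt0 x))); rewrite rho2 mulVf// gt_eqF// dd_gt0.
  by ring.
move=> k; elim: k => [|k IH]; first exact: is_derive_continuous rho'.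
exists (fun x => - 2^-1 * (rho x * (rho x * (rho x * d' x)))) => //.
by do !apply: CkM => //; exact: Ck_cst.
Qed.

Definition ws x := ee x * rho x.
Definition wc x := ee (-1 * x + 1) * rho x.

Lemma ws_smooth : smooth1 ws.
Proof. by apply: smooth1M; [exact: EE_smooth|exact: rho_smooth]. Qed.
Lemma wc_smooth : smooth1 wc.
Proof. by apply: smooth1M; [apply: smooth1_affine; exact: EE_smooth|exact: rho_smooth]. Qed.
Lemma wsc x : ws x ^+ 2 + wc x ^+ 2 = 1.
Proof. by rewrite -(rho2 x) /ws /wc /dd; ring. Qed.
Lemma ws_ge0 x : 0 <= ws x. Proof. by rewrite mulr_ge0 ?ee_ge0 ?expR_ge0. Qed.
Lemma wc_ge0 x : 0 <= wc x. Proof. by rewrite mulr_ge0 ?ee_ge0 ?expR_ge0. Qed.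
Lemma ws0 x : x <= 0 -> ws x = 0. Proof. by move=> /ee0; rewrite /ws => ->; rewrite mul0r. Qed.
Lemma wc0 x : 1 <= x -> wc x = 0.
Proof. by move=> x1; rewrite /wc ee0 ?mul0r//; lra. Qed.
Lemma ws1 x : 1 <= x -> ws x = 1.
Proof.
move=> x1; have := wsc x; rewrite (wc0 x1) expr0n addr0 => /eqP.
by rewrite sqrf_eq1 => /orP[/eqP//|/eqP e]; have := ws_ge0 x; rewrite e; lra.
Qed.
Lemma wc1 x : x <= 0 -> wc x = 1.
Proof.
move=> x0; have := wsc x; rewrite (ws0 x0) expr0n add0r => /eqP.
by rewrite sqrf_eq1 => /orP[/eqP//|/eqP e]; have := wc_ge0 x; rewrite e; lra.
Qed.

End window.

(** * Smooth functions of several variables *)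

Section good.
Context {R : realType} {n : nat}.
Local Notation T := 'cV[R]_n.
Implicit Types (f g : T -> R).

(** The algebra generated by ridge functions of smooth profiles. It contains the windows and the
    trigonometric modes and is stable under directional derivatives and affine substitutions, so
    smoothness in several variables reduces to one variable. *)
Inductive good : (T -> R) -> Prop :=
| good_ridge (eta : R -> R) (a : T) (b : R) : smooth1 eta ->
    good (fun x => eta (dot a x + b))
| goodD f g : good f -> good g -> good (fun x => f x + g x)
| goodM f g : good f -> good g -> good (fun x => f x * g x).

Lemma eq_good f g : f =1 g -> good f -> good g.
Proof. by move=> /funext ->. Qed.

Lemma good_cst (c : R) : good (fun=> c).
Proof. exact: (good_ridge 0 0 (smooth1_cst c)). Qed.

Lemma good_coord i : good (fun x => x i ord0).
Proof.
apply: eq_good (good_ridge (delta_mx i ord0) 0 smooth1_id) => x.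
rewrite addr0 /dot (bigD1 i)//= mxE !eqxx mul1r big1 ?addr0// => j ji.
by rewrite mxE (negbTE ji) mul0r.
Qed.

Lemma good_eta_coord (eta : R -> R) i (b : R) : smooth1 eta ->
  good (fun x => eta (x i ord0 + b)).
Proof.
move=> se; apply: eq_good (good_ridge (delta_mx i ord0) b se) => x.
congr (eta (_ + _)); rewrite /dot (bigD1 i)//= mxE !eqxx mul1r big1 ?addr0// => j ji.
by rewrite mxE (negbTE ji) mul0r.
Qed.

Lemma good_sum (I : Type) (r : seq I) (P : pred I) (F : I -> T -> R) :
  (forall i, good (F i)) -> good (fun x => \sum_(i <- r | P i) F i x).
Proof.
move=> gF; elim: r => [|i r IH]; first by under eq_fun do rewrite big_nil; exact: good_cst.
case: (boolP (P i)) => Pi; last by under eq_fun do rewrite big_cons (negbTE Pi).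
by under eq_fun do rewrite big_cons Pi; exact: goodD.
Qed.

Lemma good_prod (I : Type) (r : seq I) (P : pred I) (F : I -> T -> R) :
  (forall i, good (F i)) -> good (fun x => \prod_(i <- r | P i) F i x).
Proof.
move=> gF; elim: r => [|i r IH]; first by under eq_fun do rewrite big_nil; exact: good_cst.
case: (boolP (P i)) => Pi; last by under eq_fun do rewrite big_cons (negbTE Pi).
by under eq_fun do rewrite big_cons Pi; exact: goodM.
Qed.

Lemma goodZ (c : R) f : good f -> good (fun x => c * f x).
Proof. exact/goodM/good_cst. Qed.

Lemma good_derive f (v : T) : good f ->
  exists2 g, good g & forall x, is_derive x v f (g x).
Proof.
elim=> {f} [eta a b se|f g gf [f' gf' ff'] gg [g' gg' gg'']|f g gf [f' gf' ff'] gg [g' gg' gg'']].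
- have [eta' ee' se'] := smooth1_derive se.
  exists (fun x => dot a v * eta' (dot a x + b)).
    by apply: goodZ; exact: good_ridge.
  move=> x; apply: is_derive_line.
  rewrite (_ : (fun h => _) = eta \o (fun h : R => dot a v * h + (dot a x + b))); last first.
    by apply/funext => h /=; rewrite dotDr dotZr addrA (mulrC h).
  have dl : is_derive (0 : R) (1 : R) (fun h : R => dot a v * h + (dot a x + b)) (dot a v).
    by apply: is_derive_eq; rewrite /GRing.scale/= mulr1 addr0.
  apply: (is_derive_eq (is_derive1_comp (g := fun h : R => dot a v * h + (dot a x + b)) (ee' _) dl)).
  by rewrite mulr0 add0r mulrC.
- exists (fun x => f' x + g' x); first exact: goodD.
  by move=> x; exact: is_deriveD.
- exists (fun x => f x * g' x + g x * f' x); first by apply: goodD; exact: goodM.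
  by move=> x; apply: (is_derive_eq (is_deriveM (ff' x) (gg'' x))).
Qed.

Lemma good_measurable f : good f -> measurable_fun setT f.
Proof.
elim=> {f} [eta a b se|f g _ mf _ mg|f g _ mf _ mg].
- apply: measurableT_comp.
    by apply: continuous_measurable_fun; exact: smooth1_cont.
  by apply: measurable_funD => //; exact: measurable_linform.
- exact: measurable_funD.
- exact: measurable_funM.
Qed.

Lemma good_bounded f (K : R) : good f -> exists2 C : R, 0 <= C & forall x, n1 x <= K -> `|f x| <= C.
Proof.
elim=> {f} [eta a b se|f g _ [C C0 fC] _ [D D0 gD]|f g _ [C C0 fC] _ [D D0 gD]].
- have [C C0 eC] := smooth1_bounded (n1 a * K + `|b|) se; exists C => // x xK.
  apply: eC; rewrite (le_trans (ler_normD _ _))// lerD2r (le_trans (dot_le _ _))//.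
  by rewrite ler_wpM2l// n1_ge0.
- exists (C + D) => [|x xK]; first exact: addr_ge0.
  by rewrite (le_trans (ler_normD _ _))// lerD ?fC ?gD.
- exists (C * D) => [|x xK]; first exact: mulr_ge0.
  by rewrite normrM ler_pM ?fC ?gD.
Qed.

Lemma good_lip f (K : R) : good f -> exists2 C : R, 0 <= C &
  forall x y, n1 x <= K -> n1 y <= K -> `|f x - f y| <= C * n1 (x - y).
Proof.
elim=> {f} [eta a b se|f g _ [C C0 fC] _ [D D0 gD]|f g gf [C C0 fC] gg [D D0 gD]].
- have [C C0 eC] := smooth1_lip (n1 a * K + `|b|) se.
  exists (C * n1 a) => [|x y xK yK]; first by rewrite mulr_ge0// n1_ge0.
  have h z : n1 z <= K -> `|dot a z + b| <= n1 a * K + `|b|.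
    move=> zK; rewrite (le_trans (ler_normD _ _))// lerD2r (le_trans (dot_le _ _))//.
    by rewrite ler_wpM2l// n1_ge0.
  rewrite (le_trans (eC _ _ (h _ xK) (h _ yK)))// -mulrA ler_wpM2l//.
  have -> : dot a x + b - (dot a y + b) = dot a (x - y) by rewrite dotBr; ring.
  exact: dot_le.
- exists (C + D) => [|x y xK yK]; first exact: addr_ge0.
  by rewrite opprD addrACA (le_trans (ler_normD _ _))// mulrDl lerD ?fC ?gD.
- have [M M0 fM] := good_bounded K gf; have [N N0 gN] := good_bounded K gg.
  exists (M * D + C * N) => [|x y xK yK]; first by rewrite addr_ge0 ?mulr_ge0.
  have -> : f x * g x - f y * g y = f x * (g x - g y) + (f x - f y) * g y by ring.
  rewrite (le_trans (ler_normD _ _))// !normrM mulrDl lerD//.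
    by rewrite -mulrA ler_pM ?fM ?gD.
  by rewrite mulrAC ler_pM ?fC ?gN.
Qed.

Lemma continuous_n1lip f (C : R) : (forall x y, `|f x - f y| <= C * n1 (x - y)) -> continuous f.
Proof.
move=> fC x; have FF : Filter (nbhs x) by exact: nbhs_filter.
apply/(@cvgrPdist_le _ _ _ (nbhs x) FF) => e e0.
have C0 : 0 < `|C| + 1 by rewrite ltr_wpDl.
have n0 : 0 < n.+1%:R :> R by [].
(* The added 1 and the factor [n.+1] keep the denominator positive, also for [C = 0] and in
   dimension 0. *)
pose d := e / ((`|C| + 1) * n.+1%:R).
have d0 : 0 < d by rewrite divr_gt0 ?mulr_gt0.
have xd : nbhs x [set y : T | forall i, `|x i ord0 - y i ord0| <= d].
  exists (fun i j => [set t | `|x i j - t| <= d]); last by move=> y /= h i; exact: h.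
  move=> i j /=; apply: filterS (nbhsx_ballx (x i j) d d0) => t /=.
  exact: ltW.
apply: (@filterS _ (nbhs x) _ _ _ _ xd) => y yd; rewrite (le_trans (fC _ _))//.
have h : n1 (x - y) <= n.+1%:R * d.
  rewrite (@le_trans _ _ (\sum_(i < n) d))//.
    by apply: ler_sum => i _; rewrite !mxE yd.
  rewrite sumr_const card_ord -(mulr_natl d n); apply: ler_wpM2r; first exact: ltW.
  by rewrite ler_nat.
have -> : e = (`|C| + 1) * (n.+1%:R * d) by rewrite /d; field; rewrite !gt_eqF.
rewrite (@le_trans _ _ ((`|C| + 1) * n1 (x - y)))//.
  by rewrite ler_wpM2r ?n1_ge0// (le_trans (ler_norm _))// lerDl.
by rewrite ler_wpM2l// ltW.
Qed.

Lemma good_continuous f : good f -> continuous f.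
Proof.
elim=> {f} [eta a b se|f g _ cf _ cg|f g _ cf _ cg] x.
- apply: (@continuous_comp _ _ _ (fun x => dot a x + b) eta); last exact: smooth1_cont.
  move: x; apply: (@continuous_n1lip _ (n1 a)) => x y.
  have -> : dot a x + b - (dot a y + b) = dot a (x - y) by rewrite dotBr; ring.
  exact: dot_le.
- by apply: continuousD; [exact: cf|exact: cg].
- by apply: continuousM; [exact: cf|exact: cg].
Qed.

End good.

Lemma good_comp_affine (R : realType) m n (f : 'cV[R]_n -> R) (M : 'M[R]_(n, m)) (w : 'cV[R]_n) :
  good f -> good (fun x : 'cV[R]_m => f (M *m x + w)).
Proof.
elim=> {f} [eta a b se|f g _ gf _ gg|f g _ gf _ gg].
- apply: eq_good (good_ridge (M^T *m a) (dot a w + b) se) => x.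
  by congr eta; rewrite dotDr addrA; congr (_ + _ + _); rewrite dot_mulmxl trmxK.
- exact: goodD.
- exact: goodM.
Qed.

(** * Fourier transforms of smooth functions *)

(** Two uses of the mean value theorem bound both cos t - 1 and sin t - t by t^2. *)
Lemma cexpi_taylor (R : realType) (t : R) :
  normc (cexpi t - 1 - t%:C * 'i%C) <= 2 * t ^+ 2.
Proof.
have lip (f df : R -> R) : (forall x : R, is_derive x (1 : R) f (df x)) ->
    (forall x, `|df x| <= `|x|) -> `|f t - f 0| <= t ^+ 2.
  move=> fdf df1.
  have cf (a b : R) : {within `[a, b], continuous f}.
    by apply: continuous_subspaceT; exact: is_derive_continuous fdf.
  have [t0|t0|->] := ltgtP t 0; last by rewrite subrr normr0 sqr_ge0.
    have [c ct e] := MVT t0 (fun x _ => fdf x) (cf _ _).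
    rewrite distrC e sub0r normrM normrN -[leRHS]real_normK ?num_real// expr2 ler_wpM2r//.
    rewrite (le_trans (df1 _))//; move: ct; rewrite in_itv/= => /andP[c1 c2].
    by rewrite !ler0_norm ?lerN2 ?ltW.
  have [c ct e] := MVT t0 (fun x _ => fdf x) (cf _ _).
  rewrite e subr0 normrM -[leRHS]real_normK ?num_real// expr2 ler_wpM2r//.
  rewrite (le_trans (df1 _))//; move: ct; rewrite in_itv/= => /andP[c1 c2].
  by rewrite !ger0_norm ?ltW.
have lc x : `|sin x| <= `|x| /\ `|cos x - 1| <= `|x| :> R.
  have := cexpi_lip x 0; rewrite cexpi0 subr0 => h.
  have lip1 (f df : R -> R) : (forall y : R, is_derive y (1 : R) f (df y)) ->
      (forall y, `|df y| <= 1) -> `|f x - f 0| <= `|x|.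
    move=> fdf df1.
    have cf (a b : R) : {within `[a, b], continuous f}.
      by apply: continuous_subspaceT; exact: is_derive_continuous fdf.
    have [t0|t0|->] := ltgtP x 0; last by rewrite subrr normr0.
      have [c ct e] := MVT t0 (fun x _ => fdf x) (cf _ _).
      by rewrite distrC e sub0r normrM normrN ler_piMl.
    have [c ct e] := MVT t0 (fun x _ => fdf x) (cf _ _).
    by rewrite e subr0 normrM ler_piMl.
  split.
    by have := lip1 sin cos (@is_derive_sin R); rewrite sin0 subr0; apply => y; rewrite ler_norml cos_geN1 cos_le1.
  have := lip1 cos (fun x => - sin x) (@is_derive_cos R); rewrite cos0; apply => y.
  by rewrite normrN ler_norml sin_geN1 sin_le1.
rewrite (le_trans (normc_le_ReIm _))// !ReImE/= mulr_natl mulr2n lerD//.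
  have := lip cos (fun x => - sin x) (@is_derive_cos R).
  rewrite cos0 mulr0 mul0r subrr oppr0 addr0; apply => x; rewrite normrN.
  by have [] := lc x.
have := lip (fun x => sin x - x) (fun x => cos x - 1).
by rewrite sin0 !subr0 mulr1 mul0r addr0; apply => x; have [] := lc x.
Qed.

Section schwartz.
Context {R : realType} {n : nat}.
Local Notation mu := (lebesgue_cV (R := R) n).
Local Notation T := 'cV[R]_n.
Implicit Types (G : T -> R[i]) (s : R) (x v : T).

Definition cgood G := [/\ good (fun x => Re (G x)), good (fun x => Im (G x))
  & exists K, supp K G].

(** A [good] function is Lipschitz only on balls. A point of the support ball and a point beyond
    radius K + 1 are at distance at least 1, so there the sup bound [M] serves as a Lipschitz
    constant. *)
Lemma good_blip_ball (f : T -> R) K : good f -> (forall x, f x != 0 -> n1 x <= K) ->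
  clip (fun x => (f x)%:C).
Proof.
move=> gf fK.
have [C C0 fC] := good_lip (K + 1) gf; have [M M0 fM] := good_bounded (K + 1) gf.
have fout x : K < n1 x -> f x = 0.
  by move=> Kx; apply/eqP; apply: contraT => /fK; rewrite leNgt Kx.
have L x y : n1 x <= K -> `|f x - f y| <= (C + M) * n1 (x - y).
  move=> xK; have xK1 : n1 x <= K + 1 by rewrite (le_trans xK)// lerDl.
  have [yK|yK] := leP (n1 y) (K + 1).
    by rewrite (le_trans (fC _ _ xK1 yK))// ler_wpM2r ?n1_ge0// lerDl.
  rewrite (fout y) ?(lt_trans _ yK) ?ltrDl// subr0 (le_trans (fM _ xK1))//.
  rewrite -[leLHS]mulr1 ler_pM// ?lerDr//.
  by have := n1D (y - x) x; rewrite subrK n1B; lra.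
apply: (@lip_bnd_clip _ _ _ K).
- by apply: cmeas_real; exact: good_measurable.
- exists (C + M) => [|x y]; first exact: addr_ge0.
  rewrite -rmorphB normc_real.
  have [xK|xK] := leP (n1 x) K; first exact: L.
  have [yK|yK] := leP (n1 y) K; first by rewrite distrC n1B; exact: L.
  by rewrite !fout// subrr normr0 mulr_ge0 ?n1_ge0// addr_ge0.
- by move=> x fx; apply: fK; apply: contra fx => /eqP ->.
Qed.

Lemma cgood_clip G : cgood G -> clip G.
Proof.
move=> [gr gi [K GK]].
have h (u : R[i] -> R) : u 0 = 0 -> good (fun x => u (G x)) -> clip (fun x => (u (G x))%:C).
  move=> u0 gu; apply: (@good_blip_ball _ K) => // x ux; apply: GK.
  by apply: contra ux => /eqP ->; rewrite u0.
have c1 := h (@complex.Re R) erefl gr.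
have c2 := clipZ 'i%C (h (@complex.Im R) erefl gi).
have := clipD c1 c2.
rewrite (_ : (fun x => _) = G)//; apply/funext => x.
by rewrite [RHS]complex_split mulrC.
Qed.

Lemma cgoodMr (c : R[i]) (f : T -> R) G : good f -> cgood G ->
  cgood (fun x => c * (f x)%:C * G x).
Proof.
move=> gf [gr gi [K GK]]; split.
- apply: (@eq_good _ _ (fun x => (Re c * f x) * Re (G x) + (-1 * (Im c * f x)) * Im (G x))).
    by move=> x; rewrite !ReImE; ring.
  by apply: goodD; apply: goodM => //; do ?apply: goodZ.
- apply: (@eq_good _ _ (fun x => (Re c * f x) * Im (G x) + (Im c * f x) * Re (G x))).
    by move=> x; rewrite !ReImE; ring.
  by apply: goodD; apply: goodM => //; exact: goodZ.
- exists K => x h; apply: GK; apply: contra h => /eqP ->; by rewrite mulr0.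
Qed.

Lemma derive_supp (f : T -> R) (K d : R) x v : (forall y, f y != 0 -> n1 y <= K) ->
  K < n1 x -> is_derive x v f d -> d = 0.
Proof.
move=> fK Kx /(@lim_is_derive _ _ _ _ _ _) c.
have fout y : K < n1 y -> f y = 0.
  by move=> Ky; apply/eqP; apply: contraT => /fK; rewrite leNgt Ky.
have c0 : h^-1 * (f (h *: v + x) - f x) @[h --> (0 : R)^'] --> (0 : R).
  apply: cvg_near_cst.
  have v0 : 0 < n1 v + 1 by rewrite ltr_wpDl ?n1_ge0.
  have d0 : 0 < (n1 x - K) / (n1 v + 1) by rewrite divr_gt0 ?subr_gt0.
  have : \forall h \near (0 : R)^', `|0 - h| < (n1 x - K) / (n1 v + 1).
    by apply: nbhs_dnbhs; exact: nbhsx_ballx.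
  apply: filterS => h; rewrite sub0r normrN ltr_pdivlMr// => hK.
  rewrite !fout ?subrr ?mulr0//.
  have := n1D (h *: v + x) (- (h *: v)); rewrite addrAC subrr add0r n1N n1Z => h1.
  have : `|h| * n1 v <= `|h| * (n1 v + 1) by rewrite ler_wpM2l// lerDl.
  by move: h1 hK; lra.
exact: (cvg_unique _ c c0).
Qed.

Lemma cgood_derive G v : cgood G -> exists2 G', cgood G' & forall x,
  is_derive x v (fun y => Re (G y)) (Re (G' x)) /\
  is_derive x v (fun y => Im (G y)) (Im (G' x)).
Proof.
move=> [gr gi [K GK]].
have [r' gr' rr'] := good_derive v gr; have [i' gi' ii'] := good_derive v gi.
exists (fun x => r' x +i* i' x); last by move=> x; split; [exact: rr'|exact: ii'].
split => //; exists K => x; apply: contraNT; rewrite -ltNge => Kx.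
apply/eqP; apply: complexP => /=.
  apply: (derive_supp _ Kx (rr' x)) => y h; apply: GK.
  by apply: contra h => /eqP ->.
apply: (derive_supp _ Kx (ii' x)) => y h; apply: GK.
by apply: contra h => /eqP ->.
Qed.

Lemma dot_delta i x : dot (delta_mx i ord0) x = x i ord0.
Proof.
rewrite /dot (bigD1 i)//= mxE !eqxx mul1r big1 ?addr0// => j ji.
by rewrite mxE (negbTE ji) mul0r.
Qed.

(** The Taylor bound for the character, integrated over the bounded support of [G], gives the
    quadratic remainder that [is_derive_bound] asks for. *)
Lemma ft_partial s G i x : cgood G ->
  let G1 := fun xi : T => (s * (2 * pi))%:C * 'i%C * (xi i ord0)%:C * G xi in
  is_derive x (delta_mx i ord0) (fun y => Re (ft s G y)) (Re (ft s G1 x)) /\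
  is_derive x (delta_mx i ord0) (fun y => Im (ft s G y)) (Im (ft s G1 x)).
Proof.
move=> gG G1.
have gG1 : cgood G1 by apply: cgoodMr => //; exact: good_coord.
have cG := clip_cintg (cgood_clip gG); have cG1 := clip_cintg (cgood_clip gG1).
have [_ _ [K GK]] := gG.
pose C := 2 * (`|s * (2 * pi)| * `|K|) ^+ 2 * \int[mu]_xi normc (G xi).
have key (h : R) : normc (ft s G (h *: delta_mx i ord0 + x) - ft s G x - h%:C * ft s G1 x)
    <= C * h ^+ 2.
  have E : ft s G (h *: delta_mx i ord0 + x) - ft s G x - h%:C * ft s G1 x =
    cint mu (fun xi => G xi * cexpi (s * (2 * pi * dot x xi)) *
      (cexpi (h * (s * (2 * pi) * xi i ord0)) - 1
        - (h * (s * (2 * pi) * xi i ord0))%:C * 'i%C)).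
    rewrite -cintZ; last exact: cintg_ker.
    rewrite -cintB; [|exact: cintg_ker|exact: cintg_ker].
    rewrite -cintB; [| |by apply: cintgZ; exact: cintg_ker]; last first.
      by apply: cintgB; exact: cintg_ker.
    apply: eq_cint => xi; rewrite dotDl dotZl dot_delta.
    have -> : s * (2 * pi * (h * xi i ord0 + dot x xi)) =
       s * (2 * pi * dot x xi) + h * (s * (2 * pi) * xi i ord0) by ring.
    rewrite cexpiD /G1 !rmorphM/=; ring.
  rewrite E /C mulrAC -rintZ; last exact: cintg_normc.
  apply: normc_cint_le.
  - apply: cmeasM; first exact: cintg_cmeas (cintg_ker s x cG).
    have mth : measurable_fun setT (fun xi : T => h * (s * (2 * pi) * xi i ord0)).
      by apply: measurable_funM => //; apply: measurable_funM => //; exact: measurable_coord.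
    apply: cmeasB; first by apply: cmeasB; [exact: cmeas_cexpi|exact: cmeas_cst].
    by apply: cmeasM; [exact: cmeas_real|exact: cmeas_cst].
  - by apply: rintgZ; exact: cintg_normc.
  move=> xi; rewrite !normcM normc_cexpi mulr1.
  have [->|gx] := eqVneq (G xi) 0; first by rewrite normc0 mul0r mulr0.
  rewrite mulrC ler_wpM2r ?normc_ge0// (le_trans (cexpi_taylor _))//.
  set u := s * (2 * pi) * _.
  have -> : 2 * (h * u) ^+ 2 = 2 * u ^+ 2 * h ^+ 2 by ring.
  rewrite ler_wpM2r ?sqr_ge0// ler_wpM2l// -[leLHS]real_normK ?num_real//.
  apply: lerXn2r; rewrite ?nnegrE ?mulr_ge0//.
  by rewrite /u normrM ler_wpM2l// (le_trans (n1_coord _ _))// (le_trans (GK _ gx))// ler_norm.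
split; apply: (@is_derive_bound _ _ _ _ _ _ C) => h; apply: le_trans (key h).
  rewrite (_ : _ - _ - _ = Re (ft s G (h *: delta_mx i ord0 + x) - ft s G x - h%:C * ft s G1 x)).
    exact: Re_le_normc.
  by rewrite !(ReD, ReN, ReM) /=; rewrite mul0r subr0.
rewrite (_ : _ - _ - _ = Im (ft s G (h *: delta_mx i ord0 + x) - ft s G x - h%:C * ft s G1 x)).
  exact: Im_le_normc.
by rewrite !(ImD, ImN, ImM) /=; rewrite mul0r addr0.
Qed.

Lemma cvg_harmonic_dnbhs : (m.+1%:R^-1 : R) @[m --> \oo] --> (0 : R)^'.
Proof.
move=> P hP.
have H : \forall m \near \oo, (m.+1%:R^-1 : R) != 0 -> P (m.+1%:R^-1) :=
  @cvg_harmonic R _ hP.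
suff : \forall m \near \oo, P (m.+1%:R^-1) by [].
apply: filterS H => m; apply.
have h : 0 < m.+1%:R^-1 :> R by rewrite invr_gt0 ltr0n.
exact: (lt0r_neq0 h).
Qed.

(** Integration by parts through difference quotients: [D m] is the quotient of [G] along [v]. Its
    transform tends to that of [G'] by dominated convergence, while by translation invariance it is
    [ft s G x] times a factor tending to - i th. *)
Lemma ft_ibp s G v G' x : cgood G -> cgood G' ->
  (forall x, is_derive x v (fun y => Re (G y)) (Re (G' x)) /\
    is_derive x v (fun y => Im (G y)) (Im (G' x))) ->
  ft s G' x = - ((s * (2 * pi * dot x v))%:C * 'i%C) * ft s G x.
Proof.
move=> gG gG' dG.
have cG := cgood_clip gG; have icG := clip_cintg cG.
have [[mG [M GM] [C C0 GC]] [K GK]] := cG.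
have [mG' [M' GM'] _] := (cgood_clip gG').1.
pose th := s * (2 * pi * dot x v).
pose D (m : nat) (xi : T) : R[i] := m.+1%:R%:C * (G (xi + m.+1%:R^-1 *: v) - G xi).
have m0 m : m.+1%:R != 0 :> R by rewrite pnatr_eq0.
have iGs m : cintg mu (fun xi => G (xi + m.+1%:R^-1 *: v)).
  exact: (rescales_cintg (rescales_shift _) icG).
have iD m : cintg mu (D m) by apply: cintgZ; exact: cintgB.
apply: (@normc_cvg_unique _ (fun m => ft s (D m) x)).
  pose L := K + n1 v.
  have [_ [K' GK']] := cgood_clip gG'.
  pose B := Num.max L K'.
  (* One bound for both: [C * n1 v] controls the quotients, the bound on [G'] their limit. *)
  pose N := C * n1 v + `|M'|.
  have N0 : 0 <= N by rewrite addr_ge0 ?mulr_ge0 ?n1_ge0.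
  have h1 m : m.+1%:R^-1 <= 1 :> R by rewrite invf_le1// ler1n.
  have Dball m xi : D m xi != 0 -> n1 xi <= L.
    rewrite leNgt => Dx; apply/negP => Lx; move/negP: Dx; apply.
    have o1 : G xi = 0.
      apply/eqP; apply: contraT => /GK; rewrite leNgt (le_lt_trans _ Lx)// /L lerDl.
      exact: n1_ge0.
    have o2 : G (xi + m.+1%:R^-1 *: v) = 0.
      apply/eqP; apply: contraT => /GK hK.
      have := n1D (xi + m.+1%:R^-1 *: v) (- (m.+1%:R^-1 *: v)).
      rewrite addrK n1N n1Z ger0_norm// => h2.
      have : m.+1%:R^-1 * n1 v <= n1 v by rewrite ler_piMl ?n1_ge0.
      move: Lx h2; rewrite /L; move: (_ * n1 v) (n1 (_ + _)) hK => p q hK Lx h2 h3.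
      by lra.
    by rewrite /D o1 o2 subrr mulr0.
  have ub (z : R[i]) xi : normc z <= N -> (z != 0 -> n1 xi <= B) ->
      normc (z * cexpi (s * (2 * pi * dot x xi))) <= N * \1_(@ballK R n B) xi.
    move=> zN zB; rewrite normcM normc_cexpi mulr1.
    have [->|/zB xB] := eqVneq z 0; first by rewrite normc0 mulr_ge0.
    by rewrite indicE mem_set// mulr1.
  apply: (@cint_dom_cvg _ _ _ mu _ _ (fun xi => N * \1_(@ballK R n B) xi)).
  - by move=> m; exact: cintg_cmeas (cintg_ker s x (iD m)).
  - exact: cintg_cmeas (cintg_ker s x (clip_cintg (cgood_clip gG'))).
  - apply: aeW => xi.
    have cc (u : R[i] -> R) : (forall y, is_derive y v (fun y => u (G y)) (u (G' y))) ->
       (forall a b, u (a - b) = u a - u b) -> (forall (a : R) b, u (a%:C * b) = a * u b) ->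
       u (D m xi) @[m --> \oo] --> u (G' xi).
      move=> du uB uZ; have c1 := lim_is_derive (du xi).
      have := cvg_comp _ _ cvg_harmonic_dnbhs c1; apply: cvg_trans.
      apply: near_eq_cvg; apply: nearW => m /=.
      by rewrite invrK /D uZ uB [xi + _]addrC.
    have cr : Re (D m xi) @[m --> \oo] --> Re (G' xi).
      apply: (cc (@complex.Re R)) => [y|a b|a b]; first by have [] := dG y.
        by rewrite ReD ReN.
      by rewrite ReM Re_real Im_real mul0r subr0.
    have ci : Im (D m xi) @[m --> \oo] --> Im (G' xi).
      apply: (cc (@complex.Im R)) => [y|a b|a b]; first by have [] := dG y.
        by rewrite ImD ImN.
      by rewrite ImM Re_real Im_real mul0r addr0.
    have c2 : `|Re (D m xi) - Re (G' xi)| + `|Im (D m xi) - Im (G' xi)| @[m --> \oo] --> (0 + 0 : R).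
      have cn (f : nat -> R) (l : R) : f m @[m --> \oo] --> l -> `|f m - l| @[m --> \oo] --> (0 : R).
        have e : 0 = `|l - l| by rewrite subrr normr0.
        move=> fl; rewrite [X in _ --> X]e.
        by apply: cvg_norm; apply: cvgB => //; exact: cvg_cst.
      by apply: cvgD; exact: cn.
    rewrite addr0 in c2.
    apply: (cvg0_le _ c2) => m; rewrite ger0_norm ?normc_ge0// -mulrBl normcM normc_cexpi mulr1.
    by rewrite (le_trans (normc_le_ReIm _))// !ReImE.
  - by apply: rintgZ; exact: rintg_ballK.
  - move=> m xi; apply: ub.
      rewrite /D normcM normc_real ger0_norm// (le_trans (y := m.+1%:R * (C * n1 (m.+1%:R^-1 *: v))))//.
        by rewrite ler_wpM2l// (le_trans (GC _ _))// addrAC subrr add0r.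
      by rewrite n1Z ger0_norm// mulrCA mulVKf// /N lerDl.
    by move=> /Dball xL; rewrite /B le_max xL.
  - move=> xi; apply: ub.
      by rewrite (le_trans (GM' _))// (le_trans (ler_norm _))// /N lerDr mulr_ge0 ?n1_ge0.
    by move=> /GK' xK; rewrite /B le_max xK orbT.
have E m : ft s (D m) x = m.+1%:R%:C * (cexpi (- (m.+1%:R^-1 * th)) - 1) * ft s G x.
  rewrite /D ftZ; last exact: cintgB.
  rewrite ftB// -mulrA; congr (_ * _); rewrite mulrBl mul1r; congr (_ - _).
  rewrite /ft -cintZ; last exact: cintg_ker.
  rewrite -[RHS]mul1r -[RHS](rescales_cint (rescales_shift (m.+1%:R^-1 *: v))).
    apply: eq_cint => xi; rewrite [RHS]mulrCA; congr (_ * _).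
    rewrite -cexpiD; congr cexpi; rewrite /th dotDr dotZr; ring.
  apply: cintgZ; exact: cintg_ker.
have c0 : 2 * th ^+ 2 * normc (ft s G x) * m.+1%:R^-1 @[m --> \oo] --> (0 : R).
  rewrite -[X in _ --> X](mulr0 (2 * th ^+ 2 * normc (ft s G x))).
  by apply: cvgM; [exact: cvg_cst|exact: cvg_harmonic].
apply: (cvg0_le _ c0) => m; rewrite ger0_norm ?normc_ge0// E.
have -> : m.+1%:R%:C * (cexpi (- (m.+1%:R^-1 * th)) - 1) * ft s G x -
    - (th%:C * 'i%C) * ft s G x = m.+1%:R%:C *
    (cexpi (- (m.+1%:R^-1 * th)) - 1 - (- (m.+1%:R^-1 * th))%:C * 'i%C) * ft s G x.
  have -> : th%:C = - (m.+1%:R%:C * (- (m.+1%:R^-1 * th))%:C) :> R[i].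
    by rewrite -rmorphM mulrN mulVKf// rmorphN opprK.
  ring.
rewrite !normcM normc_real ger0_norm// [leRHS]mulrAC ler_wpM2r ?normc_ge0//.
apply: (le_trans (ler_wpM2l _ (cexpi_taylor _))) => //; rewrite sqrrN.
have -> : 2 * th ^+ 2 / m.+1%:R = m.+1%:R / m.+1%:R * (2 * th ^+ 2 / m.+1%:R).
  by rewrite mulfV// mul1r.
move: (m.+1%:R) => a; rewrite le_eqVlt; apply/orP; left; apply/eqP; ring.
Qed.

Lemma ft_coord s i G : s != 0 -> cgood G -> exists2 G', cgood G' &
  forall x, (x i ord0)%:C * ft s G x = ft s G' x.
Proof.
move=> s0 gG; have [G1 gG1 dG] := cgood_derive (delta_mx i ord0) gG.
exists (fun xi => ((s * (2 * pi))^-1%:C * 'i%C) * 1%:C * G1 xi).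
  by apply: (cgoodMr _ (good_cst 1) gG1).
move=> x; rewrite ftZ; last exact: clip_cintg (cgood_clip gG1).
rewrite (ft_ibp s x gG gG1 dG) dotC dot_delta mulr1 [RHS]mulrA; congr (_ * _).
have p0 : s * (2 * pi) != 0 by rewrite !mulf_neq0 ?pnatr_eq0// gt_eqF ?pi_gt0.
have -> : s * (2 * pi * x i ord0) = (s * (2 * pi)) * x i ord0 by ring.
move: (s * (2 * pi)) p0 => p p0.
have i2 : 'i%C * 'i%C = -1 :> R[i] by rewrite -expr2 sqr_i.
rewrite mulrN -mulrA ['i%C * _]mulrCA i2 mulrN1 mulrN opprK -rmorphM.
by rewrite mulKf.
Qed.

Lemma ft_cpartial s i G : cgood G -> exists2 G', cgood G' &
  cpartial i (ft s G) = ft s G'.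
Proof.
move=> gG; exists (fun xi : T => (s * (2 * pi))%:C * 'i%C * (xi i ord0)%:C * G xi).
  by apply: cgoodMr => //; exact: good_coord.
apply/funext => x; rewrite /cpartial; have [dr di] := ft_partial s i x gG.
by rewrite (@derive_val _ _ _ _ _ _ _ dr) (@derive_val _ _ _ _ _ _ _ di) .
Qed.

Lemma ft_cpartials s (l : seq 'I_n) G : cgood G -> exists2 G', cgood G' &
  cpartials l (ft s G) = ft s G'.
Proof.
move=> gG; elim: l => [|i l [G' gG' e]]; first by exists G.
by rewrite /= e; exact: ft_cpartial.
Qed.

Lemma smooth_ft s G : cgood G -> smooth (ft s G).
Proof.
move=> gG l; have [G' gG' ->] := ft_cpartials s l gG.
have [_ _ [C C0 hC]] := blip_ft s (cgood_clip gG'); split => [| |i x].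
- apply: (@continuous_n1lip _ _ _ C) => x y; rewrite -ReN -ReD.
  exact: le_trans (Re_le_normc _) (hC _ _).
- apply: (@continuous_n1lip _ _ _ C) => x y; rewrite -ImN -ImD.
  exact: le_trans (Im_le_normc _) (hC _ _).
by have [[dr _] [di _]] := ft_partial s i x gG'.
Qed.

(** Partial derivatives and products with coordinates of such a transform are again transforms of
    [cgood] functions, and each of these is bounded by the integral of a modulus. *)
Lemma schwartz_ft s G : s != 0 -> cgood G -> schwartz (ft s G).
Proof.
move=> s0 gG; split; first exact: smooth_ft.
move=> a l; have [G1 gG1 ->] := ft_cpartials s l gG.
pose Q (p : T -> R) := forall G, cgood G -> exists2 G', cgood G' &
  forall x, (p x)%:C * ft s G x = ft s G' x.
have Q1 : Q (fun=> 1) by move=> H gH; exists H => // x; rewrite mul1r.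
have QM p q : Q p -> Q q -> Q (fun x => p x * q x).
  move=> hp hq H /hq[H1 /hp[H2 gH2 e2] e1]; exists H2 => // x.
  by rewrite rmorphM -mulrA e1 e2.
have QX i k : Q (fun x => x i ord0 ^+ k).
  elim: k => [|k hk].
    rewrite (_ : (fun x => _) = (fun=> 1)); first exact: Q1.
    by apply/funext => x; rewrite expr0.
  rewrite (_ : (fun x => _) = (fun x => x i ord0 * x i ord0 ^+ k)); last first.
    by apply/funext => x; rewrite exprS.
  by apply: QM => // H gH; exact: ft_coord.
have QP (r : seq 'I_n) : Q (fun x => \prod_(i <- r) x i ord0 ^+ a i).
  elim: r => [|i r hr].
    rewrite (_ : (fun x => _) = (fun=> 1)); first exact: Q1.
    by apply/funext => x; rewrite big_nil.
  rewrite (_ : (fun x => _) = (fun x => x i ord0 ^+ a i * \prod_(j <- r) x j ord0 ^+ a j)).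
    exact: QM.
  by apply/funext => x; rewrite big_cons.
have [G2 gG2 e] := QP (index_enum 'I_n) _ gG1.
exists (\int[mu]_xi normc (G2 xi)) => x; rewrite e.
exact: normc_ft (clip_cintg (cgood_clip gG2)).
Qed.

Lemma smooth_good f : good (fun x => Re (f x)) -> good (fun x => Im (f x)) -> smooth f.
Proof.
move=> gr gi l.
suff [hr hi] : good (fun x => Re (cpartials l f x)) /\ good (fun x => Im (cpartials l f x)).
  split => [| |i x]; [exact: good_continuous|exact: good_continuous|].
  have [r' _ dr] := good_derive (delta_mx i ord0) hr.
  have [i' _ di] := good_derive (delta_mx i ord0) hi.
  by split; [case: (dr x)|case: (di x)].
elim: l => [|i l [hr hi]] //=.
have [r' gr' dr] := good_derive (delta_mx i ord0) hr.
have [i' gi' di] := good_derive (delta_mx i ord0) hi.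
split; [apply: (eq_good _ gr') => x|apply: (eq_good _ gi') => x].
  by rewrite (@derive_val _ _ _ _ _ _ _ (dr x)).
by rewrite (@derive_val _ _ _ _ _ _ _ (di x)).
Qed.

End schwartz.

(** * Trigonometric approximation *)

Section turns.
Context {R : realType}.
Implicit Types x y : R.

Definition turn x : R[i] := cexpi (2 * pi * x).

Lemma turnD x y : turn (x + y) = turn x * turn y.
Proof. by rewrite /turn mulrDr cexpiD. Qed.

Lemma turn0 : turn 0 = 1. Proof. by rewrite /turn mulr0 cexpi0. Qed.

Lemma normc_turn x : normc (turn x) = 1. Proof. exact: normc_cexpi. Qed.

Lemma turnJ x : conjc (turn x) = turn (- x).
Proof. by rewrite /turn conj_cexpi mulrN. Qed.

Lemma turn1 : turn 1 = 1.
Proof. by rewrite /turn /cexpi mulr1 mulr_natl cos2pi sin2pi. Qed.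

Lemma turn_nat k : turn k%:R = 1.
Proof. by elim: k => [|k IH]; rewrite ?turn0// -natr1 turnD IH turn1 mulr1. Qed.

Lemma turn_int x : x \is a Num.int -> turn x = 1.
Proof.
move=> /intrP[[k|k] ->]; first exact: turn_nat.
by rewrite NegzE rmorphN -turnJ turn_nat conjc1.
Qed.

Lemma turnMn x k : turn (k%:R * x) = turn x ^+ k.
Proof. by elim: k => [|k IH]; rewrite ?mul0r ?turn0// -natr1 mulrDl mul1r turnD IH exprSr. Qed.

Lemma turn_eq1 x : -1 < x < 1 -> turn x = 1 -> x = 0.
Proof.
suff h y : 0 < y < 1 -> turn y != 1.
  move=> /andP[x1 x2] e; have [x0|x0|//] := ltgtP x 0.
    suff : turn (- x) = 1 by move/eqP; apply: contraTeq => _; apply: h; rewrite oppr_gt0 x0/=; lra.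
    by rewrite -turnJ e conjc1.
  by move/eqP: e; apply: contraTeq => _; apply: h; rewrite x0.
move=> /andP[y0 y1]; apply/eqP => /(congr1 (@complex.Re R)) /=.
have -> : 2 * pi * y = (pi * y) *+ 2 by rewrite mulr2n; ring.
rewrite cos_mulr2n cos2sin2 => /eqP; rewrite mulrnBl addrAC subr_eq addrC -subr_eq.
have s0 : 0 < sin (pi * y).
  by apply: sin_gt0_pi; rewrite mulr_gt0 ?pi_gt0//= gtr_pMr ?pi_gt0.
have : 0 < sin (pi * y) ^+ 2 by rewrite exprn_gt0.
by move=> h /eqP; move: h; rewrite !mulr2n; lra.
Qed.

Lemma normc2_turnB1 x : normc (turn x - 1) ^+ 2 = 4 * sin (pi * x) ^+ 2.
Proof.
rewrite normc2E !ReImE /= subr0.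
have -> : 2 * pi * x = (pi * x) *+ 2 by rewrite mulr2n; ring.
rewrite cos_mulr2n sin_mulr2n !mulr2n.
have := cos2Dsin2 (pi * x); move: (cos _) (sin _) => c s e.
have -> : c ^+ 2 = 1 - s ^+ 2 by rewrite -e addrK.
rewrite (_ : (c * s + c * s) ^+ 2 = 4 * c ^+ 2 * s ^+ 2); last ring.
have -> : c ^+ 2 = 1 - s ^+ 2 by rewrite -e addrK.
ring.
Qed.

(** The left side is the distance from [x] to the nearest integer. *)
Lemma sin_lower x : `|x| <= 1 -> Num.min `|x| (1 - `|x|) <= 2 * `|sin (pi * x)|.
Proof.
have h (t : R) : 0 <= t <= 1 / 2 -> t <= 2 * sin (pi * t).
  move=> /andP[]; rewrite le_eqVlt => /predU1P[<- _|t0 t2].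
    by rewrite mulr0 sin0 mulr0.
  have p0 : 0 < pi :> R := pi_gt0 R; have p2 : 2 <= pi :> R := pi_ge2 R.
  (* Duplication: sin (2 z) = 2 sin z cos z with z at most pi / 4, where all cosines that occur are
     at least 1 / 2. *)
  pose z := pi * t / 2.
  have z0 : 0 < z by rewrite /z divr_gt0 ?mulr_gt0.
  have z1 : 2 * z <= pi / 2.
    have -> : 2 * z = pi * t by rewrite /z mulrCA mulfV ?mulr1.
    by rewrite ler_wpM2l ?(ltW p0)// -[leRHS]div1r.
  have ch c : 0 <= c <= z -> 1 / 2 <= cos c.
    move=> /andP[c0 cz].
    have c1 : 0 <= cos (c *+ 2) by apply: cos_ge0_pihalf; rewrite [c *+ 2]mulr2n; apply/andP; split; lra.
    have c2 : 0 <= cos c by apply: cos_ge0_pihalf; apply/andP; split; lra.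
    move: c1; rewrite cos_mulr2n [_ *+ 2]mulr2n => c1; rewrite leNgt; apply/negP => c3.
    have : cos c ^+ 2 < 1 / 2 by rewrite expr2; move: (cos c) c2 c3 => u c2 c3; nra.
    by move: c1; lra.
  have [c cz e] : exists2 c, c \in `]0, z[%R & sin z - sin 0 = cos c * (z - 0).
    apply: MVT z0 _ _.
    by apply: continuous_subspaceT; exact: continuous_sin.
  move: cz e; rewrite in_itv/= sin0 !subr0 => /andP[c0 cz] e.
  have -> : pi * t = z *+ 2 by rewrite /z mulr2n; field.
  rewrite sin_mulr2n [_ *+ 2]mulr2n e.
  have hc := ch c _; have hz := ch z _.
  have {}hc : 1 / 2 <= cos c by apply: hc; rewrite !ltW.
  have {}hz : 1 / 2 <= cos z by apply: hz; rewrite ltW/=.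
  have h1 : 1 / 4 <= cos z * cos c by nra.
  have h2 : z / 4 <= cos z * (cos c * z) by rewrite mulrA mulrC; apply: (le_trans (y := (1/4) * z)); [lra|rewrite ler_wpM2r// ltW].
  have h3 : t <= z by rewrite /z ler_pdivlMr// mulrC ler_wpM2r// ltW.
  by move: h2 h3; lra.
move=> x1; have -> : `|sin (pi * x)| = sin (pi * `|x|).
  have s0 : 0 <= sin (pi * `|x|).
    apply: sin_ge0_pi; rewrite mulr_ge0 ?pi_ge0//=.
    by rewrite ler_piMr ?pi_ge0.
  have [x0|x0] := leP 0 x; first by move: s0; rewrite (ger0_norm x0) => /ger0_norm.
  by move: s0; rewrite (ltr0_norm x0) mulrN sinN => /ger0_norm; rewrite normrN.
move: (normr_ge0 x) x1; move: `|x| => t t0 t1.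
rewrite ge_min; have [t2|t2] := leP t (1 / 2); first by rewrite h// t0.
apply/orP; right.
have -> : sin (pi * t) = sin (pi * (1 - t)).
  by rewrite mulrBr mulr1 addrC sinDpi sinN opprK.
by apply: h; lra.
Qed.

End turns.

(** * Fejer kernels as a discrete partition of unity *)

Section fejer.
Context {R : realType}.
Implicit Types (x t : R) (m : nat).

(** The Fejer kernel divided by [m]. With this normalization its [m] translates by j / m sum to 1,
    and sampling on a grid can replace convolution. *)
Definition fejer m t : R := normc (\sum_(l < m) turn (l%:R * t)) ^+ 2 / m%:R ^+ 2.

Lemma fejer_ge0 m t : 0 <= fejer m t.
Proof. by rewrite divr_ge0// sqr_ge0. Qed.

Lemma fejerE m t : (fejer m t)%:C =
  (m%:R ^- 2)%:C * \sum_(l < m) \sum_(k < m) turn ((l%:R - k%:R) * t).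
Proof.
rewrite /fejer mulrC rmorphM/=; congr (_ * _).
have J (s : 'I_m -> R[i]) : conjc (\sum_k s k) = \sum_k conjc (s k) by exact: rmorph_sum.
rewrite -mulcJ J mulr_suml; apply: eq_bigr => l _.
rewrite mulr_sumr; apply: eq_bigr => k _.
by rewrite turnJ -turnD mulrBl.
Qed.

(** Multiplying the geometric sum by turn t - 1, of modulus 2 |sin (pi t)|, leaves turn (m t) - 1,
    of modulus at most 2. *)
Lemma fejer_sin m t : (0 < m)%N -> fejer m t * sin (pi * t) ^+ 2 <= m%:R ^- 2.
Proof.
move=> m0; have m1 : 0 < m%:R ^+ 2 :> R by rewrite exprn_gt0// ltr0n.
rewrite /fejer mulrAC ler_piMl ?invr_ge0 ?(ltW m1)//.
have e : (turn t - 1) * \sum_(l < m) turn (l%:R * t) = turn (m%:R * t) - 1.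
  rewrite turnMn subrX1; congr (_ * _); apply: eq_bigr => l _.
  by rewrite turnMn.
have := congr1 (fun z => normc z ^+ 2) e; rewrite normcM exprMn !normc2_turnB1.
have : sin (pi * (m%:R * t)) ^+ 2 <= 1.
  by have := cos2Dsin2 (pi * (m%:R * t)); have := sqr_ge0 (cos (pi * (m%:R * t))); lra.
by lra.
Qed.

(** Orthogonality of the characters of Z / m, from the geometric sum. *)
Lemma sum_turn m (p : R) : p \is a Num.int -> `|p| < m%:R ->
  \sum_(j < m) turn (p * (j%:R / m%:R)) = (m%:R * (p == 0)%:R)%:C.
Proof.
move=> pint pm; have m0 : 0 < m%:R :> R by rewrite (le_lt_trans _ pm).
have -> : \sum_(j < m) turn (p * (j%:R / m%:R)) = \sum_(j < m) turn (p / m%:R) ^+ j.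
  by apply: eq_bigr => j _; rewrite -turnMn; congr turn; rewrite mulrCA.
have [->|p0] := eqVneq p 0.
  rewrite mul0r turn0; under eq_bigr do rewrite expr1n.
  by rewrite sumr_const card_ord mulr1 rmorph_nat.
rewrite mulr0; apply: (mulfI (x := turn (p / m%:R) - 1)).
  rewrite subr_eq0; apply: contra p0 => /eqP /turn_eq1 h.
  have : p / m%:R = 0.
    by apply: h; rewrite -ltr_norml normrM normfV [`|m%:R|]ger0_norm ?ltW// ltr_pdivrMr// mul1r.
  by move/eqP; rewrite mulf_eq0 invr_eq0 (gt_eqF m0) orbF.
rewrite -subrX1 mulr0 -turnMn mulrCA mulfV ?gt_eqF// mulr1 turn_int//.
by rewrite subrr.
Qed.

Lemma fejer_sum m t : (0 < m)%N -> \sum_(j < m) fejer m (t - j%:R / m%:R) = 1.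
Proof.
move=> m0; have m1 : m%:R != 0 :> R by rewrite pnatr_eq0 -lt0n.
suff : (\sum_(j < m) fejer m (t - j%:R / m%:R))%:C = 1 by move=> /(congr1 (@complex.Re R)).
rewrite rmorph_sum/=; under eq_bigr do rewrite fejerE.
rewrite -mulr_sumr exchange_big/=.
have -> : \sum_(l < m) \sum_(j < m) \sum_(k < m) turn ((l%:R - k%:R) * (t - j%:R / m%:R)) =
    \sum_(l < m) m%:R%:C.
  apply: eq_bigr => l _; rewrite exchange_big/= (bigD1 l)//= subrr.
  rewrite [X in _ + X]big1 ?addr0 => [|k kl].
    under eq_bigr do rewrite mul0r turn0.
    by rewrite sumr_const card_ord rmorph_nat.
  have -> : \sum_(j < m) turn ((l%:R - k%:R) * (t - j%:R / m%:R)) =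
    turn ((l%:R - k%:R) * t) * \sum_(j < m) turn ((k%:R - l%:R) * (j%:R / m%:R)).
    rewrite mulr_sumr; apply: eq_bigr => j _; rewrite -turnD; congr turn; ring.
  rewrite sum_turn ?rpredB ?natr_int//.
    by rewrite subr_eq0 eqr_nat (_ : _ == _ = false) ?mulr0 ?mulr0//; exact: negbTE.
  have lm : l%:R < m%:R :> R by rewrite ltr_nat.
  have km : k%:R < m%:R :> R by rewrite ltr_nat.
  have l0 : 0 <= l%:R :> R by []. have k0 : 0 <= k%:R :> R by [].
  by rewrite ltr_norml; apply/andP; split; lra.
rewrite sumr_const card_ord.
have -> : m%:R%:C *+ m = (m%:R ^+ 2)%:C :> R[i].
  by rewrite -[LHS]mulr_natr expr2 rmorphM/= !rmorph_nat.
by rewrite -rmorphM/= mulVf// expf_neq0.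
Qed.

(** From |s| <= (1/r + r s^2) / 2. The first half sums to 1 / (2 r) because the kernels sum to 1; by
    [fejer_sin] the second half is at most r / (2 m), again 1 / (2 r) since m = r^2. *)
Lemma fejer_abs_sin (r : nat) t : (0 < r)%N ->
  \sum_(j < r ^ 2) fejer (r ^ 2) (t - j%:R / (r ^ 2)%:R) *
     `|sin (pi * (t - j%:R / (r ^ 2)%:R))| <= r%:R^-1.
Proof.
move=> r0; set m := (r ^ 2)%N; have m0 : (0 < m)%N by rewrite expn_gt0 r0.
have r1 : 0 < r%:R :> R by rewrite ltr0n.
pose x (j : 'I_m) := t - j%:R / m%:R.
apply: (le_trans (y := \sum_(j < m) (fejer m (x j) * (r%:R^-1 / 2) + r%:R / 2 * m%:R ^- 2))).
  apply: ler_sum => j _; rewrite -/(x j).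
  have := fejer_sin (x j) m0; have := fejer_ge0 m (x j).
  rewrite -[sin _ ^+ 2]real_normK ?num_real//.
  move: (fejer m (x j)) (`|sin (pi * x j)|) => f s f0.
  move=> h; apply: (le_trans (y := f * (r%:R^-1 / 2) + r%:R / 2 * (f * s ^+ 2))); last first.
    by rewrite lerD2l ler_wpM2l// divr_ge0// ltW.
  have -> : f * (r%:R^-1 / 2) + r%:R / 2 * (f * s ^+ 2) =
    f * ((r%:R^-1 + r%:R * s ^+ 2) / 2) by ring.
  rewrite ler_wpM2l// ler_pdivlMr//.
  have : 0 <= r%:R * (s - r%:R^-1) ^+ 2 by rewrite mulr_ge0 ?sqr_ge0 ?ltW.
  have -> : r%:R * (s - r%:R^-1) ^+ 2 = r%:R * s ^+ 2 - 2 * (r%:R * r%:R^-1) * s + (r%:R * r%:R^-1) * r%:R^-1 by ring.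
  by rewrite mulfV ?gt_eqF//; move: (r%:R * s ^+ 2) (r%:R^-1) => a b; lra.
rewrite big_split/= -mulr_suml fejer_sum// mul1r sumr_const card_ord -[X in _ + X]mulr_natl.
have -> : m%:R = r%:R ^+ 2 :> R by rewrite natrX.
rewrite le_eqVlt; apply/orP; left; apply/eqP; move: r%:R r1 => a a0; field.
exact: lt0r_neq0.
Qed.

End fejer.

(** * Trigonometric polynomials and uniform approximation *)

Section trigpoly.
Context {R : realType} {n : nat}.
Local Notation T := 'cV[R]_n.
Implicit Types (x y v : T) (f g : T -> R[i]) (k : R).

Definition int_vec v := forall d, v d ord0 \is a Num.int.

Lemma int_vecD v w : int_vec v -> int_vec w -> int_vec (v + w).
Proof. by move=> hv hw d; rewrite mxE rpredD. Qed.

Lemma int_vecN v : int_vec v -> int_vec (- v).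
Proof. by move=> hv d; rewrite mxE rpredN. Qed.

Lemma dot_int v w : int_vec v -> int_vec w -> dot v w \is a Num.int.
Proof. by move=> hv hw; apply: rpred_sum => d _; rewrite rpredM. Qed.

Inductive trig k : (T -> R[i]) -> Prop :=
| trig_turn v : int_vec v -> trig k (fun x => turn (dot v x / k))
| trigD f g : trig k f -> trig k g -> trig k (fun x => f x + g x)
| trigZ (c : R[i]) f : trig k f -> trig k (fun x => c * f x).

Lemma eq_trig k f g : f =1 g -> trig k f -> trig k g.
Proof. by move=> /funext ->. Qed.

Lemma trig_cst k (c : R[i]) : trig k (fun=> c).
Proof.
apply: (@eq_trig _ (fun x => c * turn (dot 0 x / k))) => [x|].
  by rewrite dot0l mul0r turn0 mulr1.
by apply: trigZ; apply: trig_turn => d; rewrite mxE rpred0.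
Qed.

Lemma trigM k f g : trig k f -> trig k g -> trig k (fun x => f x * g x).
Proof.
move=> hf hg; elim: hf => {f} [v hv|f1 f2 _ h1 _ h2|c f _ h].
- elim: hg => {g} [w hw|f1 f2 _ h1 _ h2|c f _ h].
  + apply: (@eq_trig _ (fun x => turn (dot (v + w) x / k))) => [x|].
      by rewrite dotDl mulrDl turnD.
    by apply: trig_turn; exact: int_vecD.
  + by apply: eq_trig (trigD h1 h2) => x; rewrite mulrDr.
  + by apply: eq_trig (trigZ c h) => x; rewrite mulrCA.
- by apply: eq_trig (trigD h1 h2) => x; rewrite mulrDl.
- by apply: eq_trig (trigZ c h) => x; rewrite mulrA.
Qed.

Lemma trig_sum k (I : Type) (r : seq I) (F : I -> T -> R[i]) :
  (forall i, trig k (F i)) -> trig k (fun x => \sum_(i <- r) F i x).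
Proof.
move=> hF; elim: r => [|i r h].
  by apply: eq_trig (trig_cst k 0) => x; rewrite big_nil.
by apply: eq_trig (trigD (hF i) h) => x; rewrite big_cons.
Qed.

Lemma trig_prod k (I : Type) (r : seq I) (F : I -> T -> R[i]) :
  (forall i, trig k (F i)) -> trig k (fun x => \prod_(i <- r) F i x).
Proof.
move=> hF; elim: r => [|i r h].
  by apply: eq_trig (trig_cst k 1) => x; rewrite big_nil.
by apply: eq_trig (trigM (hF i) h) => x; rewrite big_cons.
Qed.

Lemma trig_shift k f v : trig k f -> trig k (fun x => f (x + v)).
Proof.
elim=> {f} [w hw|f g _ h1 _ h2|c f _ h].
- apply: eq_trig (trigZ (turn (dot w v / k)) (trig_turn k hw)) => x.
  by rewrite dotDr mulrDl turnD mulrC.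
- exact: trigD.
- exact: trigZ.
Qed.

Lemma trig_periodic k f v x : k != 0 -> trig k f -> int_vec v -> f (x + k *: v) = f x.
Proof.
move=> k0 + hv; elim=> {f} [w hw|f g _ h1 _ h2|c f _ h]; last 2 first.
- by rewrite h1 h2.
- by rewrite h.
rewrite dotDr dotZr mulrDl turnD mulrAC mulfV// mul1r.
by rewrite [X in _ * X]turn_int ?mulr1//; exact: dot_int.
Qed.

Lemma trig_fejer k m d (a : R) : trig k (fun x => (fejer m (x d ord0 / k - a))%:C).
Proof.
pose v (l j : 'I_m) : T := (l%:R - j%:R) *: delta_mx d ord0.
have hv l j : int_vec (v l j).
  by move=> e; rewrite !mxE rpredM ?rpredB ?natr_int//; case: (_ && _); rewrite ?rpred0 ?rpred1.
apply: (@eq_trig _ (fun x => (m%:R ^- 2)%:C * \sum_(l < m) \sum_(j < m)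
    (turn (- ((l%:R - j%:R) * a)) * turn (dot (v l j) x / k)))) => [x|].
  rewrite fejerE; congr (_ * _); apply: eq_bigr => l _; apply: eq_bigr => j _.
  rewrite -turnD; congr turn; rewrite dotZl /dot (bigD1 d)//= mxE !eqxx mul1r big1 ?addr0.
    by rewrite mulrBr mulrA addrC.
  by move=> e ed; rewrite mxE (negbTE ed) mul0r.
apply: trigZ; apply: trig_sum => l; apply: trig_sum => j; apply: trigZ.
exact: trig_turn.
Qed.

(* H extends to a k-periodic function in each coordinate, whose modulus of
   continuity is controlled by the sines of the coordinates. *)
Lemma wrap_lip k (H : T -> R[i]) (C : R) x y : 0 < k -> 0 <= C ->
  (forall x y, normc (H x - H y) <= C * n1 (x - y)) ->
  (forall x d, x d ord0 <= 0 \/ k <= x d ord0 -> H x = 0) ->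
  (forall d, 0 <= x d ord0 <= k) -> (forall d, 0 <= y d ord0 <= k) ->
  normc (H x - H y) <= 2 * C * k * \sum_d `|sin (pi * (x d ord0 / k - y d ord0 / k))|.
Proof.
move=> k0 C0 HC H0 hx hy.
pose t d := x d ord0 / k - y d ord0 / k.
have kt d : k * `|t d| = `|x d ord0 - y d ord0|.
  by rewrite /t -mulrBl normrM normfV (gtr0_norm k0) mulrC divfK// gt_eqF.
have t1 d : `|t d| <= 1.
  rewrite -(ler_pM2l k0) kt mulr1 ler_norml.
  by have := hx d; have := hy d => /andP[? ?] /andP[? ?]; apply/andP; split; lra.
(* If some coordinate differs by more than half a period, the short way from [x] to [y] crosses a
   face, where [H] vanishes, and both values are compared with 0 there. Otherwise the Lipschitz
   bound applies directly. *)
have [/existsP[d td]|/existsPn h] := boolP [exists d, 1 / 2 < `|t d|].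
  have := sin_lower (t1 d).
  have -> : Num.min `|t d| (1 - `|t d|) = 1 - `|t d| by apply/min_idPr; lra.
  move=> sd; apply: (le_trans (y := C * (k - `|x d ord0 - y d ord0|))); last first.
    rewrite -kt (bigD1 d)//= [leRHS](_ : _ = C * (k * (2 * (`|sin (pi * t d)| +
        \sum_(i < n | i != d) `|sin (pi * (x i ord0 / k - y i ord0 / k))|)))); last by rewrite -/(t d); ring.
    rewrite ler_wpM2l// -[X in X - _]mulr1 -mulrBr ler_pM2l//.
    rewrite mulrDr (le_trans sd)// lerDl mulr_ge0// sumr_ge0//.
  have hd (z : T) (e : R) : (z d ord0 + e <= 0) \/ (k <= z d ord0 + e) -> normc (H z) <= C * `|e|.
    move=> he; have := HC z (z + e *: delta_mx d ord0).
    rewrite (H0 (z + _) d) ?mxE ?eqxx ?mulr1// subr0 opprD addrA subrr sub0r n1N n1Z.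
    rewrite /n1 (bigD1 d)//= mxE !eqxx normr1 big1 ?addr0 ?mulr1//.
    by move=> i id; rewrite mxE (negbTE id) normr0.
  have tri : normc (H x - H y) <= normc (H x) + normc (H y).
    by rewrite (le_trans (normcD _ _))// normcN.
  have [/andP[x0 x1] /andP[y0 y1]] := (hx d, hy d).
  have [xy|xy] := leP (x d ord0) (y d ord0).
    have h1 : normc (H x) <= C * `|- x d ord0| by apply: hd; left; rewrite subrr.
    have h2 : normc (H y) <= C * `|k - y d ord0| by apply: hd; right; rewrite subrKC.
    rewrite normrN ger0_norm// in h1; rewrite ger0_norm ?subr_ge0// in h2.
    rewrite (le_trans tri)// (le_trans (lerD h1 h2))//.
    rewrite -mulrDr ler_wpM2l// ler0_norm ?subr_le0//; lra.
  have h1 : normc (H y) <= C * `|- y d ord0| by apply: hd; left; rewrite subrr.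
  have h2 : normc (H x) <= C * `|k - x d ord0| by apply: hd; right; rewrite subrKC.
  rewrite normrN ger0_norm// in h1; rewrite ger0_norm ?subr_ge0// in h2.
  rewrite (le_trans tri)// (le_trans (lerD h2 h1))//.
  rewrite -mulrDr ler_wpM2l// gtr0_norm ?subr_gt0//; lra.
rewrite (le_trans (HC _ _))// [2 * C]mulrC -!mulrA ler_wpM2l// !mulr_sumr ler_sum// => d _.
have := sin_lower (t1 d).
have -> : Num.min `|t d| (1 - `|t d|) = `|t d|.
  by apply/min_idPl; have := h d; rewrite -leNgt; lra.
by move=> sd; rewrite !mxE -kt mulrCA ler_wpM2l ?(ltW k0)//; exact: sd.
Qed.

(** [H] is sampled at the nodes k j / m and recombined with products of Fejer kernels, a partition
    of unity made of trigonometric polynomials. The error averages differences of [H], which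
    [wrap_lip] bounds by sines and [fejer_abs_sin] sums to order 1 / r. *)
Lemma trig_approx k (H : T -> R[i]) (C e : R) : 0 < k -> 0 <= C -> 0 < e ->
  (forall x y, normc (H x - H y) <= C * n1 (x - y)) ->
  (forall x d, x d ord0 <= 0 \/ k <= x d ord0 -> H x = 0) ->
  exists2 t, trig k t & forall x, (forall d, 0 <= x d ord0 <= k) -> normc (t x - H x) <= e.
Proof.
move=> k0 C0 e0 HC H0.
have [r r0 re] : exists2 r : nat, (0 < r)%N & 2 * C * k * n%:R * r%:R^-1 <= e.
  have B0 : 0 <= 2 * C * k * n%:R / e by rewrite divr_ge0 ?mulr_ge0// ltW.
  exists (Num.truncn (2 * C * k * n%:R / e)).+1 => //.
  have /andP[_ h] := truncn_itv B0.
  by rewrite ler_pdivrMr// [leRHS]mulrC -ler_pdivrMr// ltW.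
pose m := (r ^ 2)%N; have m0 : (0 < m)%N by rewrite expn_gt0 r0.
have m1 : 0 < m%:R :> R by rewrite ltr0n.
pose a (j : 'I_m) : R := j%:R / m%:R.
have a0 j : 0 <= a j by rewrite divr_ge0.
have a1 j : a j <= 1 by rewrite ler_pdivrMr// mul1r ler_nat ltnW.
pose w (j : {ffun 'I_n -> 'I_m}) (x : T) := \prod_d fejer m (x d ord0 / k - a (j d)).
pose node (j : {ffun 'I_n -> 'I_m}) : T := \col_d (k * a (j d)).
have w1 x : \sum_j w j x = 1.
  rewrite /w -(bigA_distr_bigA (fun d j => fejer m (x d ord0 / k - a j))).
  by rewrite big1// => d _; exact: fejer_sum.
have w0 j x : 0 <= w j x by apply: prodr_ge0 => d _; exact: fejer_ge0.
exists (fun x => \sum_j H (node j) * (w j x)%:C).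
  apply: trig_sum => j; apply: trigZ.
  apply: (@eq_trig _ (fun x => \prod_d (fejer m (x d ord0 / k - a (j d)))%:C)) => [x|].
    by rewrite /w rmorph_prod.
  by apply: trig_prod => d; exact: trig_fejer.
move=> x hx.
have -> : \sum_j H (node j) * (w j x)%:C - H x = \sum_j (H (node j) - H x) * (w j x)%:C.
  rewrite -[H x in LHS]mulr1 (_ : 1 = (\sum_j w j x)%:C); last by rewrite w1.
  rewrite rmorph_sum/= mulr_sumr -sumrB; apply: eq_bigr => j _.
  by rewrite mulrBl.
apply: (le_trans (normc_sum _ _ _)).
apply: (le_trans (y := \sum_j 2 * C * k * \sum_d w j x * `|sin (pi * (x d ord0 / k - a (j d)))|)).
  apply: ler_sum => j _; rewrite normcM normc_real ger0_norm// mulrC.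
  rewrite -mulr_sumr mulrCA ler_wpM2l// -opprB normcN.
  have -> : \sum_d `|sin (pi * (x d ord0 / k - a (j d)))| =
    \sum_d `|sin (pi * (x d ord0 / k - node j d ord0 / k))|.
    by apply: eq_bigr => d _; rewrite !mxE mulrAC mulfV ?mul1r// gt_eqF.
  by apply: wrap_lip => // d; rewrite mxE mulr_ge0 ?(ltW k0)//= ger_pMr.
rewrite -mulr_sumr exchange_big/= (le_trans _ re)//.
suff h : \sum_(d < n) \sum_j w j x * `|sin (pi * (x d ord0 / k - a (j d)))| <= n%:R * r%:R^-1.
  by rewrite -[leRHS]mulrA ler_wpM2l// !mulr_ge0// ltW.
have -> : n%:R * r%:R^-1 = \sum_(d < n) r%:R^-1 :> R by rewrite sumr_const card_ord mulr_natl.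
apply: ler_sum => d _.
(* The sum over all nodes factors over the coordinates; every coordinate except [d] contributes
   1. *)
pose F d' j := if d' == d then fejer m (x d' ord0 / k - a j) * `|sin (pi * (x d' ord0 / k - a j))|
  else fejer m (x d' ord0 / k - a j).
have -> : \sum_j w j x * `|sin (pi * (x d ord0 / k - a (j d)))| =
    \sum_(j : {ffun 'I_n -> 'I_m}) \prod_d' F d' (j d').
  apply: eq_bigr => j _; rewrite /w (bigD1 d)//= [RHS](bigD1 d)//= /F eqxx mulrAC.
  by congr (_ * _); apply: eq_bigr => d' /negbTE ->.
rewrite -bigA_distr_bigA (bigD1 d)//= [X in _ * X]big1 ?mulr1 => [|d' d'd].
  by rewrite /F eqxx; exact: fejer_abs_sin.
by rewrite /F (negbTE d'd); exact: fejer_sum.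
Qed.

End trigpoly.

(** * Windows on boxes *)

Section windows.
Context {R : realType}.
Implicit Types (x M : R).

(* Sealed, since unifying the two explicit windows unfolds exponentials. *)
Lemma windows : {p : (R -> R) * (R -> R) | [/\ smooth1 p.1, smooth1 p.2 &
  forall x, [/\ p.1 x ^+ 2 + p.2 x ^+ 2 = 1, 0 <= p.1 x, 0 <= p.2 x,
    x <= 0 -> p.1 x = 0 /\ p.2 x = 1 & 1 <= x -> p.1 x = 1 /\ p.2 x = 0]]}.
Proof.
exists (ws, wc); split => [||x]; [exact: ws_smooth|exact: wc_smooth|split].
- exact: wsc.
- exact: ws_ge0.
- exact: wc_ge0.
- by move=> h; split; [exact: ws0|exact: wc1].
- by move=> h; split; [exact: ws1|exact: wc0].
Qed.

Definition wup := (sval windows).1.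
Definition wdn := (sval windows).2.

Lemma wup_smooth : smooth1 wup. Proof. by rewrite /wup; case: (svalP windows). Qed.
Lemma wdn_smooth : smooth1 wdn. Proof. by rewrite /wdn; case: (svalP windows). Qed.
Lemma wupdn x : wup x ^+ 2 + wdn x ^+ 2 = 1.
Proof. by have [_ _ h] := svalP windows; case: (h x). Qed.
Lemma wup_ge0 x : 0 <= wup x. Proof. by have [_ _ h] := svalP windows; case: (h x). Qed.
Lemma wdn_ge0 x : 0 <= wdn x. Proof. by have [_ _ h] := svalP windows; case: (h x). Qed.
Lemma wup0 x : x <= 0 -> wup x = 0.
Proof. by move=> x0; have [_ _ h] := svalP windows; case: (h x) => _ _ _ /(_ x0)[]. Qed.
Lemma wdn1 x : x <= 0 -> wdn x = 1.
Proof. by move=> x0; have [_ _ h] := svalP windows; case: (h x) => _ _ _ /(_ x0)[]. Qed.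
Lemma wup1 x : 1 <= x -> wup x = 1.
Proof. by move=> x0; have [_ _ h] := svalP windows; case: (h x) => _ _ _ _ /(_ x0)[]. Qed.
Lemma wdn0 x : 1 <= x -> wdn x = 0.
Proof. by move=> x0; have [_ _ h] := svalP windows; case: (h x) => _ _ _ _ /(_ x0)[]. Qed.

(** Rises on [0, 1] and falls on [M, M + 1]: translates by multiples of [M] overlap only in unit
    intervals, where their squares sum to 1. *)
Definition window M x : R := wup x * wdn (x - M).

Lemma smooth_window M : smooth1 (window M).
Proof.
apply: smooth1M; first exact: wup_smooth.
have -> : (fun x => wdn (x - M)) = (fun x => wdn (1 * x + (- M))) by apply/funext => x; rewrite mul1r.
by apply: smooth1_affine; exact: wdn_smooth.
Qed.

Lemma window_ge0 M x : 0 <= window M x.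
Proof. by apply: mulr_ge0; [exact: wup_ge0|exact: wdn_ge0]. Qed.

Lemma window_le1 M x : window M x <= 1.
Proof.
have s1 : wup x <= 1.
  by have := wupdn x; have := sqr_ge0 (wdn x); move: (wup_ge0 x); move: (wup x) (wdn x) => a b; nra.
have c1 : wdn (x - M) <= 1.
  by have := wupdn (x - M); have := sqr_ge0 (wup (x - M)); move: (wdn_ge0 (x - M)); move: (wup _) (wdn _) => a b; nra.
have := wup_ge0 x; have := wdn_ge0 (x - M); rewrite /window.
by move: (wup x) (wdn _) s1 c1 => a b; nra.
Qed.

Lemma window_supp M x : window M x != 0 -> 0 < x < M + 1.
Proof.
move=> h; apply/andP; split; rewrite ltNge; apply: contra h => h; apply/eqP.
  by rewrite /window wup0 ?mul0r.
by rewrite /window wdn0 ?mulr0//; lra.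
Qed.

Lemma window_one M x : 1 <= x <= M -> window M x = 1.
Proof. by move=> /andP[h1 h2]; rewrite /window wup1// wdn1 ?mulr1//; lra. Qed.

(** This form makes the squares of successive translates telescope; [1 <= M] ensures that the rise
    is over before the fall begins. *)
Lemma window_sqr M x : 1 <= M -> window M x ^+ 2 = wup x ^+ 2 - wup (x - M) ^+ 2.
Proof.
move=> M1; rewrite /window exprMn.
have -> : wdn (x - M) ^+ 2 = 1 - wup (x - M) ^+ 2 
  by move: (wupdn (x - M)); move: (wdn (x - M) ^+ 2) (wup (x - M) ^+ 2) => a b; lra.
have [xM|xM] := leP x M; first by rewrite (@wup0 (x - M)) ?subr_le0// expr0n subr0 mulr1 subr0.
by rewrite (@wup1 x) ?(le_trans M1) ?ltW// expr1n mul1r.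
Qed.

Lemma window_sum M (N : nat) x : 1 <= M ->
  \sum_(j < N) window M (x - M * j%:R) ^+ 2 = wup x ^+ 2 - wup (x - M * N%:R) ^+ 2.
Proof.
move=> M1; pose S (j : nat) := wup (x - M * j%:R) ^+ 2.
have tel (F : nat -> R) : \sum_(j < N) (F j - F j.+1) = F 0%N - F N.
  elim: N => [|N IH]; first by rewrite big_ord0 subrr.
  by rewrite big_ord_recr/= IH addrA subrK.
have e0 : x - M * 0%:R = x by rewrite mulr0 subr0.
transitivity (S 0%N - S N); last by rewrite {1}/S e0.
rewrite -tel; apply: eq_bigr => j _; rewrite (window_sqr _ M1) /S.
have -> : x - M * j.+1%:R = x - M * j%:R - M by rewrite -[j.+1%:R]natr1 mulrDr mulr1 opprD addrA.
by [].
Qed.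

End windows.

(** * Box windows and the exponentials of their period *)

Section boxes.
Context {R : realType} {n : nat}.
Local Notation T := 'cV[R]_n.
Local Notation mu := (lebesgue_cV (R := R) n).
Implicit Types (x o : T) (M : R).

Definition wbox M o x : R := \prod_d window M (x d ord0 - o d ord0).

Lemma good_wbox M o : good (wbox M o).
Proof. by apply: good_prod => d; apply: good_eta_coord; exact: smooth_window. Qed.

Lemma wbox_ge0 M o x : 0 <= wbox M o x.
Proof. by apply: prodr_ge0 => d _; exact: window_ge0. Qed.

Lemma wbox_le1 M o x : wbox M o x <= 1.
Proof. by apply: prodr_ile1 => d _; rewrite window_ge0 window_le1. Qed.

Lemma wbox_supp M o x : wbox M o x != 0 -> forall d, 0 < x d ord0 - o d ord0 < M + 1.
Proof. by move=> h d; apply: window_supp; move: h; rewrite /wbox (bigD1 d)//= mulf_eq0 negb_or => /andP[]. Qed.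

Lemma wbox_one M o x : (forall d, 1 <= x d ord0 - o d ord0 <= M) -> wbox M o x = 1.
Proof. by move=> h; rewrite /wbox big1// => d _; exact: window_one. Qed.

Lemma wbox_translate M o v x : wbox M o (x - v) = wbox M (o + v) x.
Proof. by apply: eq_bigr => d _; rewrite !mxE; congr window; ring. Qed.

Lemma wbox_partition M (N : nat) o x : 1 <= M ->
  (forall d, 1 <= x d ord0 - o d ord0 <= M * N%:R) ->
  \sum_(a : {ffun 'I_n -> 'I_N}) wbox M (\col_d (o d ord0 + M * (a d)%:R)) x ^+ 2 = 1.
Proof.
move=> M1 hx.
transitivity (\sum_(a : {ffun 'I_n -> 'I_N}) \prod_d window M (x d ord0 - o d ord0 - M * (a d)%:R) ^+ 2).
  apply: eq_bigr => a _; rewrite -prodrXl; apply: eq_bigr => d _.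
  by rewrite mxE opprD addrA.
rewrite -(bigA_distr_bigA (fun d (j : 'I_N) => window M (x d ord0 - o d ord0 - M * j%:R) ^+ 2)).
rewrite big1// => d _; have /andP[h1 h2] := hx d.
by rewrite window_sum// wup1// wup0 ?subr_le0// expr1n expr0n subr0.
Qed.

Lemma clip_coord (f : T -> R) o (B : R) : good f ->
  (forall x, f x != 0 -> forall d, `|x d ord0 - o d ord0| <= B) -> clip (fun x => (f x)%:C).
Proof.
move=> gf fB; apply: (@good_blip_ball _ _ _ (\sum_(d < n) (B + `|o d ord0|))) => // x /fB h.
apply: ler_sum => d _; have := h d; have := ler_normD (x d ord0 - o d ord0) (o d ord0).
by rewrite subrK; lra.
Qed.

Lemma cintg_turn (f : T -> R) l k : clip (fun x => (f x)%:C) ->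
  cintg mu (fun x => (f x)%:C * turn (dot l x / k)).
Proof.
move=> cf; apply: (@cintg_bM _ _ _ _ _ _ 1) => [||x]; [exact: clip_cintg| |by rewrite normc_turn].
apply: cmeas_cexpi; apply: measurable_funM => //; apply: measurable_funM => //.
exact: measurable_dot.
Qed.

Lemma clip_wbox M o : clip (fun x => (wbox M o x ^+ 2)%:C).
Proof.
apply: (@clip_coord _ o (M + 1)) => [|x]; first by apply: (@eq_good _ _ (fun x => wbox M o x * wbox M o x)) => [x|]; [rewrite expr2|apply: goodM; exact: good_wbox].
rewrite sqrf_eq0 => /wbox_supp h d; have /andP[h1 h2] := h d.
by rewrite gtr0_norm// ltW.
Qed.

(** A shift by half a period of the exponential changes its sign, while the squared window is a step
    minus its translate by [M]. Hence [F x + F (x + v)] equals [G x - G (x + w)] for a boundedly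
    supported [G], and twice the integral of [F] vanishes. *)
Lemma wbox_turn0 M o l : 1 <= M -> int_vec l -> l != 0 ->
  cint mu (fun x => (wbox M o x ^+ 2)%:C * turn (dot l x / M)) = 0.
Proof.
move=> M1 il l0; have M0 : M != 0 by rewrite gt_eqF// (lt_le_trans _ M1).
have [d ld] : exists d, l d ord0 != 0.
  apply/existsP; apply: contraNT l0 => /existsPn h; apply/eqP/colP => d; rewrite mxE.
  by apply/eqP; have := h d; rewrite negbK.
(* Half the period of the exponential along the coordinate [d]. *)
pose a : R := M / (2 * l d ord0); pose v : T := a *: delta_mx d ord0.
pose S (t : R) := wup t ^+ 2.
(* A single step [S] does not decay; this difference of two translates has bounded support in the
   coordinate [d]. *)
pose t (x : T) : R := S (x d ord0 - o d ord0) - S (x d ord0 - o d ord0 + a).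
pose r (x : T) : R := \prod_(e < n | e != d) window M (x e ord0 - o e ord0) ^+ 2.
pose F (x : T) : R[i] := (wbox M o x ^+ 2)%:C * turn (dot l x / M).
pose G (x : T) : R[i] := (t x * r x)%:C * turn (dot l x / M).
have iF : cintg mu F by apply: cintg_turn; exact: clip_wbox.
have gS b : good (fun x : T => S (x d ord0 + b)).
  by apply: (good_eta_coord d b (eta := S)); apply: smooth1M; exact: wup_smooth.
have iG : cintg mu G.
  apply: cintg_turn; apply: (@clip_coord _ o (M + 1 + `|a| + 1)).
    apply: goodM.
      apply: (@eq_good _ _ (fun x => S (x d ord0 + - o d ord0) + (- 1) * S (x d ord0 + (- o d ord0 + a)))).
        by move=> x; rewrite /t addrA mulN1r.
      by apply: goodD; [exact: gS|exact/goodZ/gS].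
    apply: good_prod => e; apply: (good_eta_coord e _ (eta := fun u => window M u ^+ 2)).
    by apply: smooth1M; exact: smooth_window.
  move=> x; rewrite mulf_eq0 negb_or => /andP[tx rx] e.
  have [->|ed] := eqVneq e d.
    rewrite leNgt; apply: contra tx; rewrite /t; move: (x d ord0 - _) => z hz; apply/eqP.
    have a1 := ler_norm a; have a2 := ler_norm (- a); rewrite normrN in a2.
    have a0 := normr_ge0 a.
    case: (ltP 0 z) => z0; [rewrite (gtr0_norm z0) in hz|rewrite (ler0_norm z0) in hz].
      by rewrite /S !wup1 ?subrr//; lra.
    by rewrite /S !wup0 ?subrr//; lra.
  have := rx; rewrite /r (bigD1 e)//= mulf_eq0 negb_or sqrf_eq0 => /andP[/window_supp + _].
  move: (x e ord0 - _) => z /andP[z0 z1]; rewrite (gtr0_norm z0).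
  by have := normr_ge0 a; lra.
have Fv : cint mu (fun x => F (x + v)) = cint mu F.
  by rewrite (rescales_cint (rescales_shift v))// mul1r.
pose w : T := (- M) *: delta_mx d ord0.
have Gw : cint mu (fun x => G (x + w)) = cint mu G.
  by rewrite (rescales_cint (rescales_shift w))// mul1r.
have deltaE (b : R) (x : T) e : (x + b *: delta_mx d ord0) e ord0 = x e ord0 + b * (e == d)%:R.
  by rewrite !mxE eqxx andbT.
have rE (b : R) (x : T) : r (x + b *: delta_mx d ord0) = r x.
  by apply: eq_bigr => e /negbTE ed; rewrite deltaE ed mulr0 addr0.
have dotE (b : R) (x : T) : dot l (x + b *: delta_mx d ord0) = dot l x + b * l d ord0.
  by rewrite dotDr dotZr [dot l (delta_mx _ _)]dotC dot_delta.
have boxE (x : T) : wbox M o x ^+ 2 = (S (x d ord0 - o d ord0) - S (x d ord0 - o d ord0 - M)) * r x.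
  by rewrite /wbox (bigD1 d)//= exprMn window_sqr// /r prodrXl.
have key (x : T) : F x + F (x + v) = G x - G (x + w).
  have half : turn (2%:R^-1 : R) = -1.
    rewrite /turn (_ : 2 * pi / 2 = pi); last by rewrite mulrAC mulfV ?mul1r.
    by rewrite /cexpi cospi sinpi; apply: complexP; rewrite ?ReImE//= oppr0.
  rewrite /F /G !boxE /t !rE !dotE !deltaE eqxx !mulr1.
  have -> : (dot l x + a * l d ord0) / M = dot l x / M + 2^-1.
    by rewrite /a; move: (dot l x) (l d ord0) ld => z y y0; field; rewrite M0 y0.
  have -> : (dot l x + - M * l d ord0) / M = dot l x / M - l d ord0.
    by move: (dot l x) (l d ord0) => z y; field.
  rewrite !turnD half (turn_int (x := - _)) ?rpredN// mulr1.
  have -> : x d ord0 + a - o d ord0 = x d ord0 - o d ord0 + a by ring.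
  have -> : x d ord0 - M - o d ord0 = x d ord0 - o d ord0 - M by ring.
  have -> : x d ord0 - o d ord0 + a - M = x d ord0 - o d ord0 - M + a by ring.
  rewrite !(rmorphM, rmorphB)/=; ring.
have iFv : cintg mu (fun x => F (x + v)) := rescales_cintg (rescales_shift v) iF.
have iGw : cintg mu (fun x => G (x + w)) := rescales_cintg (rescales_shift w) iG.
have : cint mu F + cint mu F = 0.
  rewrite -{2}Fv -cintD// (eq_cint _ (g := fun x => G x - G (x + w)))//.
  by rewrite cintB// Gw subrr.
rewrite -mulr2n => /eqP; rewrite mulrn_eq0/= => /eqP //.
Qed.

Lemma wbox_int_translate M o : \int[mu]_x wbox M o x ^+ 2 = \int[mu]_x wbox M 0 x ^+ 2.
Proof.
have [rg _] := clip_cintg (clip_wbox M 0).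
have := rescales_rint (rescales_shift (- o)) rg; rewrite mul1r => <-.
by apply: eq_Rintegral => x _; rewrite Re_real wbox_translate add0r.
Qed.

Lemma wbox_int_gt0 M : 2 <= M -> 0 < \int[mu]_x wbox M 0 x ^+ 2.
Proof.
move=> M2; pose A := [set x : T | forall i, x i ord0 \in `[(fun=> 1) i, (fun=> M) i]].
have mA : measurable A.
  rewrite (_ : A = \big[setI/setT]_(i < n) ((fun x : T => x i ord0) @^-1` `[1, M])); last first.
    by rewrite -bigcap_seq; apply/seteqP; split=> x /= xb i;
      [move=> _; exact: xb|exact: (xb i (mem_index_enum i))].
  apply: bigsetI_measurable => i _; rewrite -[X in measurable X]setTI.
  exact: (measurable_coord i measurableT (measurable_itv _)).
have muA : mu A = ((M - 1) ^+ n)%:E.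
  rewrite lebesgue_cV_box; last by move=> _; lra.
  by rewrite prodr_const card_ord.
have [rg _] := clip_cintg (clip_wbox M 0).
have hA : (\int[mu]_x (\1_A x)%:E)%E = mu A by rewrite integral_indic// setIT.
have iA : rintg mu (fun x => \1_A x).
  apply/rintgP; split; first exact: measurable_indic.
  rewrite (eq_integral (fun x => (\1_A x)%:E)); last by move=> x _; rewrite ger0_norm.
  by rewrite hA muA ltry.
apply: (@lt_le_trans _ _ (\int[mu]_x \1_A x)).
  by rewrite /Rintegral hA muA /= exprn_gt0//; lra.
apply: rint_le => // x; rewrite indicE; have [xA|xA] := boolP (x \in A); last exact: sqr_ge0.
rewrite wbox_one ?expr1n// => d.
by move: xA; rewrite inE => /(_ d); rewrite mxE subr0 in_itv.
Qed.

End boxes.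

(** * Cosine-sine modes *)

Section cas.
Context {R : realType}.
Implicit Types t : R.

(** The kernel of the Hartley transform: real-valued, orthogonal over a period like the
    exponentials, and with the same complex span once t and - t are both allowed. *)
Definition cas t : R := cos (2 * pi * t) + sin (2 * pi * t).

Let ReC (a b : R) : Re (a +i* b) = a. Proof. by []. Qed.
Let ImC (a b : R) : Im (a +i* b) = b. Proof. by []. Qed.

(* One half as an atom: simplification unfolds the inverse inside [+i*]. *)
Definition half : R := 2^-1.

Let halfD (c : R) : c = half * c + half * c.
Proof. by rewrite -mulrDl /half; lra. Qed.

Definition cas_m : R[i] := half +i* (- half).
Definition cas_p : R[i] := half +i* half.

Lemma cas_turn t : (cas t)%:C = cas_m * turn t + cas_p * turn (- t).
Proof.
rewrite /turn /cexpi mulrN cosN sinN /cas; move: (cos _) (sin _) => c s.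
rewrite /cas_m /cas_p; move: half (halfD c) (halfD s) => a ec es.
by apply: complexP; rewrite !(ReImE, ReC, ImC); nra.
Qed.

Lemma turn_cas t : turn t = cas_p * (cas t)%:C + cas_m * (cas (- t))%:C.
Proof.
rewrite /turn /cexpi /cas mulrN cosN sinN; move: (cos _) (sin _) => c s.
rewrite /cas_m /cas_p; move: half (halfD c) (halfD s) => a ec es.
by apply: complexP; rewrite !(ReImE, ReC, ImC); nra.
Qed.

(** The identity cas t cas u = sin (t + u) + cos (t - u), arguments counted in turns, written with
    exponentials. *)
Lemma casM_turn t u : (cas t)%:C * (cas u)%:C =
  (0 +i* (- half)) * (turn (t + u) - turn (- t - u)) + half%:C * (turn (t - u) + turn (- t + u)).
Proof.
rewrite !cas_turn !turnD.
have : half%:C = half%:C * half%:C + half%:C * half%:C :> R[i].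
  by rewrite -rmorphM -rmorphD -halfD.
have -> : cas_m = half%:C - half%:C * 'i%C by rewrite [LHS]complex_split ReC ImC rmorphN mulNr.
have -> : cas_p = half%:C + half%:C * 'i%C by rewrite [LHS]complex_split ReC ImC.
have -> : 0 +i* (- half) = - (half%:C * 'i%C) :> R[i].
  by rewrite [LHS]complex_split ReC ImC rmorphN mulNr add0r.
have i2 : 'i%C * 'i%C = -1 :> R[i] by rewrite -expr2 sqr_i.
move: half%:C 'i%C i2 => z i i2 hz.
have A : (z - z * i) * (z - z * i) = - (z * i).
  transitivity (z * z * (1 + i * i) - (z * z + z * z) * i); first ring.
  by rewrite i2 subrr mulr0 add0r -hz.
have B : (z + z * i) * (z + z * i) = z * i.
  transitivity (z * z * (1 + i * i) + (z * z + z * z) * i); first ring.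
  by rewrite i2 subrr mulr0 add0r -hz.
have C : (z - z * i) * (z + z * i) = z.
  transitivity (z * z * (1 + i * i) - (z * z + z * z) * (i * i)); first ring.
  by rewrite i2 subrr mulr0 add0r -hz mulrN1 opprK.
move: (z - z * i) (z + z * i) A B C => m p A B C.
transitivity (m * m * (turn t * turn u) + p * p * (turn (- t) * turn (- u))
  + m * p * (turn t * turn (- u) + turn (- t) * turn u)); first ring.
by rewrite A B C; ring.
Qed.

End cas.

(** * Orthogonality of the cosine-sine modes *)

Section cas_vectors.
Context {R : realType} {n : nat}.
Local Notation T := 'cV[R]_n.
Local Notation mu := (lebesgue_cV (R := R) n).
Implicit Types (x y z v : T) (k : R).

Lemma int_vec_small k (u : T) z : (forall d, `|u d ord0| < k) -> int_vec z ->
  (u + k *: z == 0) = (u == 0) && (z == 0).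
Proof.
move=> uk iz; apply/eqP/andP => [e|[/eqP -> /eqP ->]]; last by rewrite scaler0 addr0.
have z0 : z = 0.
  apply/colP => d; rewrite mxE; apply/eqP; apply: contraT => zd.
  have z1 : 1 <= `|z d ord0| by exact: norm_intr_ge1.
  have := congr1 (fun w : T => w d ord0) e; rewrite !mxE => /eqP.
  rewrite addr_eq0 => /eqP e'; have := uk d; rewrite e' normrN normrM.
  have k0 : 0 < k by exact: le_lt_trans (normr_ge0 _) (uk d).
  by rewrite gtr0_norm// ltNge ler_peMr// ltW.
by move: e; rewrite z0 scaler0 addr0 => ->.
Qed.

Lemma int_vecZ k z : k \is a Num.int -> int_vec z -> int_vec (k *: z).
Proof. by move=> ik iz d; rewrite mxE rpredM. Qed.

(** By [casM_turn] the frequencies are k z plus or minus y + y', and k z plus or minus y - y', all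
    over k. Since 2 |y| and 2 |y'| stay below k, they vanish only for z = 0. The two terms with y +
    y' then vanish or survive together and carry opposite signs, so only the case y = y' is left. *)
Lemma cas_orthogonal (f : T -> R) k y y' z : clip (fun x => (f x)%:C) -> k != 0 ->
  k \is a Num.int ->
  (forall l, int_vec l -> l != 0 -> cint mu (fun x => (f x)%:C * turn (dot l x / k)) = 0) ->
  int_vec y -> int_vec y' -> int_vec z ->
  (forall d, 2 * `|y d ord0| < k) -> (forall d, 2 * `|y' d ord0| < k) ->
  cint mu (fun x => (f x * cas (dot y x / k) * cas (dot y' x / k))%:C * turn (dot z x)) =
  (\int[mu]_x f x * ((y == y') && (z == 0))%:R)%:C.
Proof.
move=> cf k0 ik f0 iy iy' iz hy hy'.
pose F l x : R[i] := (f x)%:C * turn (dot l x / k).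
have iF l : cintg mu (F l) by exact: cintg_turn.
have FE l : int_vec l -> cint mu (F l) = (\int[mu]_x f x * (l == 0)%:R)%:C.
  move=> il; have [->|l0] := eqVneq l 0; last by rewrite mulr0; exact: f0.
  rewrite mulr1 -cint_real; apply: eq_cint => x.
  by rewrite /F dot0l mul0r turn0 mulr1.
have ikz : int_vec (k *: z) by exact: int_vecZ.
have small (a b : T) : (forall d, 2 * `|a d ord0| < k) -> (forall d, 2 * `|b d ord0| < k) ->
    (a + b + k *: z == 0) = (a + b == 0) && (z == 0).
  move=> ha hb; apply: int_vec_small => // d; rewrite mxE (le_lt_trans (ler_normD _ _))//.
  by have := ha d; have := hb d; lra.
have hN (a : T) : (forall d, 2 * `|a d ord0| < k) -> (forall d, 2 * `|(- a) d ord0| < k).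
  by move=> ha d; rewrite mxE normrN.
rewrite (eq_cint _ (g := fun x => (0 +i* (- half)) * (F (y + y' + k *: z) x - F (- y - y' + k *: z) x)
   + half%:C * (F (y - y' + k *: z) x + F (- y + y' + k *: z) x))); last first.
  move=> x; have -> : turn (dot z x) = turn (dot (k *: z) x / k).
    by rewrite dotZl mulrAC mulfV ?mul1r.
  rewrite /F -mulrA !rmorphM/= casM_turn !dotDl !dotNl !mulrDl !mulNr !turnD.
  ring.
rewrite cintD; [|by apply: cintgZ; exact: cintgB|by apply: cintgZ; exact: cintgD].
rewrite !cintZ; [|exact: cintgD|exact: cintgB].
rewrite cintB// cintD// !FE; do ?[exact: int_vecD|apply: int_vecD|exact: int_vecN|exact: ikz] => //.
rewrite !small; do ?[exact: hN|done].
have -> : (- y - y' == 0) = (y + y' == 0) by rewrite -opprD oppr_eq0.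
have -> : (- y + y' == 0) = (y - y' == 0) by rewrite addrC -oppr_eq0 opprB.
rewrite subrr mulr0 add0r subr_eq0 -!(rmorphM, rmorphD)/= /half; congr (_ %:C); lra.
Qed.

End cas_vectors.

(** * Splitting a frequency into a mode and an integer part *)

Section trig_cas.
Context {R : realType} {n : nat} (h : nat).
Local Notation T := 'cV[R]_n.
Local Notation K := h.*2.+1.
Implicit Types (y : {ffun 'I_n -> 'I_K}).

(** The residues modulo [K] represented in [-h, h]. As [K] is odd this set is symmetric, and
    reversing the ordinals negates the mode. *)
Definition mode y : T := \col_d ((y d)%:R - h%:R).

Lemma int_mode y : int_vec (mode y).
Proof. by move=> d; rewrite mxE rpredB ?natr_int. Qed.

Lemma mode_lt y d : 2 * `|mode y d ord0| < K%:R.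
Proof.
have -> : K%:R = h%:R + h%:R + 1 :> R by rewrite -addn1 -addnn !natrD.
have : (y d)%:R <= h%:R + h%:R :> R by rewrite -natrD ler_nat addnn -ltnS.
have : 0 <= (y d)%:R :> R by [].
rewrite mxE; move: (y d)%:R h%:R => a b a0 ab.
have : `|a - b| <= b by rewrite ler_norml; apply/andP; split; lra.
by lra.
Qed.

Lemma mode_inj : injective mode.
Proof.
move=> y y' e; apply/ffunP => d; apply: val_inj; apply/eqP; rewrite -(eqr_nat R) /=.
by have := congr1 (fun v : T => v d ord0) e; rewrite !mxE => /addIr ->.
Qed.

Lemma mode_opp y : mode [ffun d => rev_ord (y d)] = - mode y.
Proof.
apply/colP => d; rewrite !mxE ffunE /= subSS natrB; last by rewrite -ltnS.
have -> : h.*2%:R = h%:R + h%:R :> R by rewrite -addnn natrD.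
by ring.
Qed.

(** A frequency v = mode y + K z over K gives the exponential of the mode times one of integer
    frequency; [turn_cas] rewrites the former with the modes of y and of its opposite. *)
Lemma trig_cas (t : T -> R[i]) : trig K%:R t ->
  exists2 ty : {ffun 'I_n -> 'I_K} -> T -> R[i], forall y, trig 1 (ty y) &
    forall x, t x = \sum_y (cas (dot (mode y) x / K%:R))%:C * ty y x.
Proof.
have K0 : K%:R != 0 :> R by rewrite pnatr_eq0.
elim=> {t} [v iv|f g _ [tf hf fE] _ [tg hg gE]|c f _ [tf hf fE]]; last 2 first.
- exists (fun y x => tf y x + tg y x) => [y|x]; first exact: trigD.
  by rewrite fE gE -big_split; apply: eq_bigr => y _; rewrite mulrDr.
- exists (fun y x => c * tf y x) => [y|x]; first exact: trigZ.
  by rewrite fE mulr_sumr; apply: eq_bigr => y _; rewrite mulrCA.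
(* Euclidean division of v d + h by [K]: the shift by [h] centres the remainder. *)
have dec d : exists p : 'I_K * R, p.2 \is a Num.int /\ v d ord0 = p.1%:R - h%:R + K%:R * p.2.
  have /intrP[m ->] := iv d.
  have r0 : 0 <= modz (m + h%:Z) K%:Z by rewrite modz_ge0.
  have rK : modz (m + h%:Z) K%:Z < K%:Z by rewrite ltz_pmod.
  move: (divz_eq (m + h%:Z) K%:Z) r0 rK; move: (modz _ _) (divz _ _) => r q e r0 rK.
  have rE : r = (`|r|%N)%:Z by rewrite gez0_abs.
  have rK' : (`|r|%N < K)%N by move: rK; rewrite {1}rE ltz_nat.
  exists (Ordinal rK', q%:~R); split => //=.
  have er : r%:~R = (`|r|%N)%:R :> R by rewrite {1}rE.
  have := congr1 (fun i : int => i%:~R : R) e.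
  rewrite !rmorphD rmorphM /= er => {}e.
  by apply: (addIr h%:R); rewrite e; ring.
have [p hp] := choice dec.
pose y : {ffun 'I_n -> 'I_K} := [ffun d => (p d).1].
pose z : T := \col_d (p d).2.
have iz : int_vec z by move=> d; rewrite mxE; case: (hp d).
have vE : v = mode y + K%:R *: z.
  by apply/colP => d; rewrite !mxE ffunE; case: (hp d).
pose ny := [ffun d => rev_ord (y d)].
exists (fun y' x => ((y' == y)%:R * cas_p + (y' == ny)%:R * cas_m) * turn (dot z x / 1)) => [y'|x].
  by apply: trigZ; exact: trig_turn.
have pick (y0 : {ffun 'I_n -> 'I_K}) (F : _ -> R[i]) : \sum_y' F y' * (y' == y0)%:R = F y0.
  rewrite (bigD1 y0)//= eqxx mulr1 big1 ?addr0// => i /negbTE ->.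
  by rewrite mulr0.
pose C y' : R[i] := (cas (dot (mode y') x / K%:R))%:C; pose E := turn (dot z x / 1).
rewrite (eq_bigr (fun y' => (C y' * (y' == y)%:R) * (cas_p * E) + (C y' * (y' == ny)%:R) * (cas_m * E))); last first.
  by move=> y' _; rewrite -/(C y') -/E; ring.
rewrite big_split/= -!mulr_suml !pick /C mode_opp dotNl mulNr.
have -> : turn (dot v x / K%:R) = turn (dot (mode y) x / K%:R) * E.
  rewrite vE dotDl dotZl mulrDl turnD /E divr1; congr (_ * turn _).
  by rewrite mulrAC mulfV ?mul1r.
by rewrite turn_cas; ring.
Qed.

End trig_cas.

(** * Adapted norms *)

Record gauge (R : realType) (n : nat) (q : 'cV[R]_n -> R) (C : R) : Prop := Gauge {
  gauge_ge : forall x, n1 x <= q x;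
  gaugeD : forall x y, q (x + y) <= q x + q y;
  gaugeZ : forall a x, q (a *: x) = `|a| * q x;
  gauge_le : forall x, q x <= C * n1 x }.

Section gauges.
Context {R : realType} {n : nat}.
Implicit Types (M A : 'M[R]_n.+1).

Lemma n1_mulmx_entries M (C : R) x : (forall i j, `|M i j| <= C) ->
  n1 (M *m x) <= n.+1%:R * C * n1 x.
Proof.
move=> MC; rewrite /n1 -mulrA mulr_natl.
rewrite (_ : _ *+ n.+1 = \sum_(i < n.+1) C * n1 x); last by rewrite sumr_const card_ord.
apply: ler_sum => i _; rewrite mxE (le_trans (ler_norm_sum _ _ _))// /n1 mulr_sumr.
by apply: ler_sum => j _; rewrite normrM ler_wpM2r.
Qed.

Lemma geometric_small (C r : R) : 0 <= C -> 0 <= r < 1 -> exists N : nat, C * r ^+ N <= 1.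
Proof.
move=> C0 /andP[r0 r1].
have c : (fun N => C * r ^+ N) @ \oo --> (C * 0 : R).
  by apply: cvgM; [exact: cvg_cst|apply: cvg_expr; rewrite ger0_norm].
rewrite mulr0 in c.
have : \forall N \near \oo, C * r ^+ N < 1 by apply: (cvgr_lt _ c).
by case=> N _ /(_ N (leqnn N)) /= h; exists N; exact: ltW.
Qed.

(* An adapted norm: the orbit sum of n1, weighted by the inverse rate. *)
Lemma gauge_of_decay M (C r : R) : 0 <= C -> 0 <= r < 1 ->
  (forall k i j, `|(M ^+ k) i j| <= C * r ^+ k) ->
  exists q C' th, [/\ gauge q C', 0 < th < 1 & forall x, q (M *m x) <= th * q x].
Proof.
(* Any rate strictly between r and 1 would do: the slack makes the powers of r / th small. *)
move=> C0 /andP[r0 r1] MC; pose th := (1 + r) / 2.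
have th0 : 0 < th by rewrite /th; lra.
have th1 : th < 1 by rewrite /th; lra.
have rt : 0 <= r / th < 1 by rewrite divr_ge0 ?(ltW th0)//= ltr_pdivrMr// /th; lra.
have nC : 0 <= n.+1%:R * C by rewrite mulr_ge0.
have [N hN] := geometric_small nC rt.
pose q (x : 'cV[R]_n.+1) := \sum_(k < N.+1) th ^- k * n1 (M ^+ k *m x).
have w0 k : 0 <= th ^- k by rewrite invr_ge0 exprn_ge0// ltW.
have dec k x : n1 (M ^+ k *m x) <= n.+1%:R * (C * r ^+ k) * n1 x by exact: n1_mulmx_entries.
exists q, (\sum_(k < N.+1) th ^- k * (n.+1%:R * (C * r ^+ k))), th; split.
- split => [x|x y|a x|x].
  + by rewrite /q big_ord_recl/= expr0 invr1 mul1r mul1mx lerDl sumr_ge0// => k _; rewrite mulr_ge0 ?n1_ge0.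
  + by rewrite /q -big_split ler_sum// => k _ /=; rewrite mulmxDr -mulrDr ler_wpM2l ?n1D.
  + by rewrite /q mulr_sumr; apply: eq_bigr => k _; rewrite -scalemxAr n1Z mulrCA.
  + by rewrite /q mulr_suml ler_sum// => k _; rewrite -mulrA ler_wpM2l.
- by rewrite th0.
move=> x.
have step k : th ^- k * n1 (M ^+ k *m (M *m x)) = th * (th ^- k.+1 * n1 (M ^+ k.+1 *m x)).
  rewrite mulmxA (_ : M ^+ k *m M = M ^+ k.+1); last by rewrite exprSr.
  have -> : th ^- k = th * th ^- k.+1 by rewrite [th ^+ k.+1]exprS invfM mulrA mulfV ?mul1r// gt_eqF.
  by rewrite -mulrA.
rewrite /q (eq_bigr (fun k : 'I_N.+1 => th * (th ^- k.+1 * n1 (M ^+ k.+1 *m x)))) => [|k _]; last exact: step.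
(* Passing from x to M x drops the term [n1 x] of index 0 and creates one of index N + 1, which the
   choice of [N] makes no larger. *)
rewrite -mulr_sumr ler_pM2l// big_ord_recr/= [leRHS]big_ord_recl/= expr0 invr1 mul1r mul1mx addrC lerD2r.
rewrite (le_trans (ler_wpM2l (w0 _) (dec N.+1 x)))//.
have -> : th ^- N.+1 * (n.+1%:R * (C * r ^+ N.+1) * n1 x) = (n.+1%:R * C * (r / th) ^+ N * (r / th)) * n1 x.
  have e : (r / th) ^+ N * (r / th) = r ^+ N.+1 * th ^- N.+1 by rewrite -exprSr exprMn exprVn.
  by rewrite -[_ * (r / th)]mulrA e; ring.
rewrite ler_piMl ?n1_ge0//; have /andP[t0 t1] := rt.
by rewrite (le_trans (ler_wpM2r t0 hN))// mul1r ltW.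
Qed.

(** Solving for y (k + 1) divides by l, which contracts faster than r, so a forcing of size r^k is
    passed on at the same rate. The constant B solves s B + s C r = B r with s = 1 / |l|. *)
Lemma recurrence_decay (y z : nat -> R[i]) (l : R[i]) (C r : R) : 0 <= C -> 0 < r ->
  (normc l)^-1 < r -> l != 0 -> (forall k, normc (z k) <= C * r ^+ k) ->
  (forall k, y k = l * y k.+1 + z k.+1) ->
  forall k, normc (y k) <= (normc (y 0%N) + (normc l)^-1 * C * r / (r - (normc l)^-1)) * r ^+ k.
Proof.
move=> C0 r0 lr l0 zC yz.
set s := (normc l)^-1; set B := s * C * r / (r - s).
have s0 : 0 <= s by rewrite invr_ge0 normc_ge0.
have nl : normc l != 0 by apply: contra l0 => /eqP /eq0_normc ->.
have B0 : 0 <= B by rewrite divr_ge0 ?mulr_ge0 ?(ltW r0)// subr_ge0 ltW.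
have BE : s * B + s * C * r = B * r.
  have e : B * (r - s) = s * C * r by rewrite divfK// subr_eq0 gt_eqF.
  by rewrite -e; ring.
elim=> [|k IH]; first by rewrite expr0 mulr1 lerDl.
have e : y k.+1 = l^-1 * (y k - z k.+1) by rewrite (yz k) addrK mulKf.
rewrite e normcM normcV -/s (le_trans (ler_wpM2l s0 (normcD _ _)))// normcN.
apply: (le_trans (ler_wpM2l s0 (lerD IH (zC k.+1)))).
rewrite exprS; move: (normc (y 0%N)) (normc_ge0 (y 0%N)) (r ^+ k) (exprn_ge0 k (ltW r0)) => a a0 p p0.
have -> : s * ((a + B) * p + C * (r * p)) = (s * a + (s * B + s * C * r)) * p by ring.
rewrite BE mulrA [(a + B) * r]mulrDl ler_wpM2r// lerD2r mulrC ler_wpM2l// ltW//.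
Qed.

(** Takes the place of the Jordan form: the factors of an annihilating product are absorbed into [X]
    one at a time. Once decay is known for [(Ac - l%:M) * X], the entries of [Ai ^+ k * X] satisfy
    the recurrence of [recurrence_decay]. *)
Lemma matrix_decay (Ac Ai X : 'M[R[i]]_n.+1) (s : seq R[i]) (r : R) : 0 < r -> Ai * Ac = 1 ->
  (forall l, l \in s -> 1 < normc l /\ (normc l)^-1 < r) ->
  (\prod_(l <- s) (Ac - l%:M)) * X = 0 ->
  exists2 C : R, 0 <= C & forall k i j, normc ((Ai ^+ k * X) i j) <= C * r ^+ k.
Proof.
move=> r0 AiA; elim/last_ind: s X => [|s l IH] X hs.
  rewrite big_nil mul1r => ->; exists 0 => // k i j.
  by rewrite mulr0 mxE normc0 mul0r.
rewrite -cats1 big_cat big_seq1 /= -mulrA => h.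
have [|C C0 hC] := IH _ _ h; first by move=> l' l's; apply: hs; rewrite mem_rcons in_cons l's orbT.
have [l1 lr] : 1 < normc l /\ (normc l)^-1 < r by apply: hs; rewrite mem_rcons mem_head.
have l0 : l != 0 by apply: contraTneq l1 => ->; rewrite normc0 ltr10.
pose B : R := (normc l)^-1 * C * r / (r - (normc l)^-1).
have B0 : 0 <= B by rewrite /B divr_ge0 ?mulr_ge0 ?invr_ge0 ?normc_ge0 ?(ltW r0)// subr_ge0 ltW.
exists (\sum_i \sum_j normc (X i j) + B).
  by rewrite addr_ge0// sumr_ge0// => i _; rewrite sumr_ge0// => j _; exact: normc_ge0.
move=> k i j.
have rec m : (Ai ^+ m * X) i j = l * (Ai ^+ m.+1 * X) i j + (Ai ^+ m.+1 * ((Ac - l%:M) * X)) i j.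
  have -> : Ai ^+ m.+1 * ((Ac - l%:M) * X) = Ai ^+ m * X - l *: (Ai ^+ m.+1 * X).
    rewrite mulrBl mulrBr; congr (_ - _).
      by rewrite exprSr -!mulrA (mulrA Ai) AiA mul1r.
    by rewrite -[l%:M * X]/(l%:M *m X) mul_scalar_mx -scalerAr.
  by rewrite !mxE; ring.
have := recurrence_decay C0 r0 lr l0 (fun m => hC m i j) rec k.
move=> /le_trans; apply; rewrite ler_wpM2r ?exprn_ge0 ?(ltW r0)// lerD2r expr0 mul1r.
rewrite (bigD1 i)//= (bigD1 j)//= -addrA lerDl addr_ge0// ?sumr_ge0// => [j' _|i' _]; first exact: normc_ge0.
by rewrite sumr_ge0// => j' _; exact: normc_ge0.
Qed.

Lemma expansive_decay A : expansive A -> A \in unitmx /\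
  exists C r : R, [/\ 0 <= C, 0 <= r < 1 & forall k i j, `|((A^-1) ^+ k) i j| <= C * r ^+ k].
Proof.
move=> eA; pose Ac := map_mx (real_complex R) A.
have n1l (l : R[i]) : eigenvalue Ac l -> 1 < normc l.
  by move=> /eA; rewrite -[1]/(1%:C) -[`|l|]/((normc l)%:C) ltcR.
have uA : A \in unitmx.
  rewrite -(map_unitmx (real_complex R)) -/Ac -row_free_unit -kermx_eq0.
  apply: contraT => k0; suff : eigenvalue Ac 0 by move/n1l; rewrite normc0 ltr10.
  by rewrite /eigenvalue /eigenspace raddf0 subr0.
split=> //.
have [s hs] := closed_field_poly_normal (char_poly Ac).
have pm := char_poly_monic Ac; rewrite (monicP pm) scale1r in hs.
have hl l : l \in s -> 1 < normc l.
  by move=> ls; apply: n1l; rewrite eigenvalue_root_char hs root_prod_XsubC.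
(* One rate below 1 and strictly above every inverse modulus; the annihilating product is the
   characteristic polynomial, by Cayley-Hamilton. *)
have [r /andP[r0 r1] rs] : exists2 r : R, 0 < r < 1 & forall l, l \in s -> (normc l)^-1 < r.
  elim: s hl {hs} => [|l s IH] hl; first by exists (1 / 2) => //; apply/andP; split; lra.
  have [|r /andP[r0 r1] rs] := IH; first by move=> l' l's; apply: hl; rewrite in_cons l's orbT.
  have l1 : 1 < normc l by apply: hl; rewrite mem_head.
  have l2 : (normc l)^-1 < 1 by rewrite invf_lt1// (lt_trans ltr01).
  exists (Num.max r ((1 + (normc l)^-1) / 2)).
    by rewrite lt_max r0/= gt_max r1/=; lra.
  move=> l'; rewrite in_cons => /predU1P[->|l's]; rewrite lt_max; apply/orP; [right; lra|left; exact: rs].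
pose Ai := map_mx (real_complex R) (A^-1).
have AiA : Ai * Ac = 1.
  by rewrite -[LHS]map_mxM -[A^-1]/(invmx A) mulVmx// map_mx1.
have h0 : (\prod_(l <- s) (Ac - l%:M)) * 1 = 0.
  rewrite mulr1 -(Cayley_Hamilton Ac) hs rmorph_prod; apply: eq_bigr => l _.
  by rewrite rmorphB/= horner_mx_X horner_mx_C.
have [C C0 hC] := matrix_decay r0 AiA (fun l ls => conj (hl l ls) (rs l ls)) h0.
exists C, r; split => //; first by rewrite (ltW r0).
move=> k i j; have := hC k i j; rewrite mulr1.
have -> : Ai ^+ k = map_mx (real_complex R) (A^-1 ^+ k) by rewrite rmorphXn.
by rewrite mxE normc_real.
Qed.

End gauges.

(** * The orthonormal system in frequency *)

Lemma sum_enum_val (I : finType) (D : {pred I}) (V : nmodType) (F : I -> V) :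
  \sum_(k < #|D|) F (enum_val k) = \sum_(i in D) F i.
Proof. by rewrite [RHS]big_enum_val. Qed.

Lemma cell_unique (R : realType) (a b : nat) (x o l : R) : 0 < l ->
  1 < x - l * (a%:R - o) < l -> 0 < x - l * (b%:R - o) < l + 1 -> a = b.
Proof.
move=> l0 /andP[h1 h2] /andP[h3 h4].
have step (u v : nat) : (u < v)%N -> l * (u%:R - o) + l <= l * (v%:R - o).
  move=> uv; rewrite -[X in _ + X]mulr1 -mulrDr ler_pM2l// addrAC lerD2r natr1.
  by rewrite ler_nat.
by case: (ltngtP a b) => // ab; exfalso; have := step _ _ ab; lra.
Qed.

Lemma grid_unique (R : realType) (a b : nat) (x o : R) :
  0 < x - (o + 2 * a%:R) < 2 -> 0 < x - (o + 2 * b%:R) < 2 -> a = b.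
Proof.
move=> /andP[h1 h2] /andP[h3 h4].
have step (u v : nat) : (u < v)%N -> 2 * u%:R + 2 <= 2 * v%:R :> R.
  by move=> uv; rewrite -[X in _ + X]mulr1 -mulrDr ler_pM2l// natr1 ler_nat.
by case: (ltngtP a b) => // ab; exfalso; have := step _ _ ab; lra.
Qed.

Section shell.
Context {R : realType} {n : nat}.
Local Notation T := 'cV[R]_n.+1.
Local Notation mu := (lebesgue_cV (R := R) n.+1).
Context (q : T -> R) (C th : R) (c J W m : nat).
Context (gq : gauge q C).
Context (L h : nat) (LE : L = (2 * c * J)%N) (hE : h = (c * J).+1).
Local Notation K := h.*2.+1.
Local Notation I := {ffun 'I_n.+1 -> 'I_(m.*2)}.
Local Notation A := {ffun 'I_n.+1 -> 'I_(L + 5)}.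
Local Notation G := {ffun 'I_n.+1 -> 'I_J}.
Local Notation Y := {ffun 'I_n.+1 -> 'I_K}.
Local Notation LR := (L%:R : R).
Local Notation KR := (K%:R : R).
Let k0 := q (delta_mx ord0 ord0).
Let R0 := (W%:R * k0 + 1) * LR.
Implicit Types (x y : T) (Q : I) (z : I * A) (i : I * Y).

(** For z = (Q, a) the unit window [chi z] covers x - off Q in (a - 2, a) along each axis. If a lies
    between 3 and L on every axis this is inside (1, L), where [aw Q] is 1 and all other cells
    vanish; the frame consists of the remaining positions. *)
Definition frame z := ~~ [forall d, (3 <= z.2 d <= L)%N].

Context (p : I * A -> G) (pinj : {in frame &, injective p}).
Context (c0 : (0 < c)%N) (J0 : (5 <= J)%N) (Cc : C * n.+1%:R <= c%:R) (C0 : 0 <= C).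
Context (th0 : 0 < th) (th1 : th < 1).
(** In units of [L] the shell extends from W k0 - 1 to W k0 + 1 around [W] times the first basis
    vector. [hW] keeps every cell that meets the inner ball below it; [hm] makes the 2 m cells per
    axis cover the ball of radius [R0] with 3 L to spare. *)
Context (hW : th * (W%:R * k0 + 1) + 2 * c%:R < W%:R * k0 - 1).
Context (hm : W%:R * k0 + 1 + 3 <= m%:R).

Definition origin : T := const_mx (- (LR * m%:R)).
Definition off Q : T := \col_d (origin d ord0 + LR * (Q d)%:R).
Definition aw Q x := wbox LR (off Q) x.
(** The window that carries the modes of period [K]. It equals 1 where [aw Q] is nonzero, and the
    surplus of 3 over [L] leaves a unit margin around that support on each side of one period. *)
Definition bw Q x := wbox KR (off Q - const_mx 1) x.
Definition al z : T := \col_d ((off z.1 - const_mx 2) d ord0 + 1 * (z.2 d)%:R).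
Definition chi z x := wbox 1 (al z) x.
(** Entry (Q', Q) of the projection 1 - a a^T at the point [x]. *)
Definition dev Q' Q x : R := (Q' == Q)%:R - aw Q' x * aw Q x.
(** The target places: integer points spaced by 2, the width of a unit window, so that the pieces
    put there are disjoint. *)
Definition corner (g : G) : T := \col_d ((d == ord0)%:R * (W * L)%:R + 2 * (g d)%:R).
Definition tau z : T := corner (p z) - al z.
Definition phi i x : R := bw i.1 x * cas (dot (mode i.2) x / KR).
Definition moved z i x : R := chi z x * dev z.1 i.1 x * phi i x.
(** A column of the isometry: the entry of a stays in place, the entries of 1 - a a^T are cut by the
    unit windows and moved. *)
Definition gen i x : R := aw i.1 x * phi i x + \sum_(z | frame z) moved z i (x - tau z).
(** Only these cells carry generators, whereas all cells occur as row index [z.1] of the moved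
    pieces. *)
Definition inner_cell Q := `[< exists x, q x <= th * R0 /\ aw Q x != 0 >].

Lemma L10 : 10 <= LR.
Proof. by rewrite (ler_nat _ 10) LE (@leq_trans (2 * 1 * 5)%N)// !leq_mul. Qed.

Lemma KRE : KR = LR + 3.
Proof. by rewrite -(natrD _ _ 3); congr (_%:R); rewrite LE hE -mulnA mul2n addn3. Qed.

Lemma k01 : 1 <= k0.
Proof.
apply: le_trans (gauge_ge gq _); rewrite (le_trans _ (n1_coord _ ord0))//.
by rewrite mxE !eqxx normr1.
Qed.

Lemma offE Q d : off Q d ord0 = LR * ((Q d)%:R - m%:R).
Proof. by rewrite !mxE; ring. Qed.

Lemma aw_supp Q x d : aw Q x != 0 -> 0 < x d ord0 - off Q d ord0 < LR + 1.
Proof. by move=> /wbox_supp. Qed.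

Lemma bw_supp Q x d : bw Q x != 0 -> - 1 < x d ord0 - off Q d ord0 < LR + 3.
Proof.
move=> /wbox_supp /(_ d); rewrite KRE [(off Q - const_mx 1) d ord0]mxE [(- const_mx 1) d ord0]mxE [const_mx 1 d ord0]mxE.
by move=> /andP[h1 h2]; apply/andP; split; lra.
Qed.

Lemma bw_one Q x : aw Q x != 0 -> bw Q x = 1.
Proof.
move=> a0; apply: wbox_one => d; have /andP[h1 h2] := aw_supp d a0.
rewrite KRE [(off Q - const_mx 1) d ord0]mxE [(- const_mx 1) d ord0]mxE [const_mx 1 d ord0]mxE.
by apply/andP; split; lra.
Qed.

Lemma aw_01 Q x : 0 <= aw Q x <= 1. Proof. by rewrite wbox_ge0 wbox_le1. Qed.

Lemma aw_sum x : (forall d, `|x d ord0| <= LR * m%:R - 1) -> \sum_Q aw Q x ^+ 2 = 1.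
Proof.
move=> hx; apply: wbox_partition => [|d]; first by have := L10; lra.
have := hx d; rewrite ler_norml mxE opprK -addnn natrD mulrDr => /andP[h1 h2].
by apply/andP; split; lra.
Qed.

Lemma R0_ge0 : 0 <= R0.
Proof. by rewrite mulr_ge0// addr_ge0// mulr_ge0// (le_trans ler01 k01). Qed.

Lemma R0_bound : R0 + 3 * LR <= LR * m%:R.
Proof. by rewrite /R0 -mulrDl mulrC ler_wpM2l. Qed.

Lemma thR0 : th * R0 <= R0. Proof. by rewrite ler_piMl ?R0_ge0// ltW. Qed.

Lemma q_coord x d : `|x d ord0| <= q x.
Proof. exact: le_trans (n1_coord _ _) (gauge_ge gq x). Qed.

Lemma aw_sum_q x : q x <= th * R0 -> \sum_Q aw Q x ^+ 2 = 1.
Proof.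
move=> qx; apply: aw_sum => d; rewrite (le_trans (q_coord x d))//.
by have := thR0; have := R0_bound; have := L10; lra.
Qed.

(** The window of such a cell may leave the inner ball; the margin in [R0_bound] keeps it where the
    cells still form a partition. *)
Lemma aw_sum_b Q x : inner_cell Q -> bw Q x != 0 -> \sum_Q' aw Q' x ^+ 2 = 1.
Proof.
move=> /asboolP[y [qy ay]] bx; apply: aw_sum => d.
have := q_coord y d; have /andP[a1 a2] := aw_supp d ay; have /andP[b1 b2] := bw_supp d bx.
have := thR0; have := R0_bound; have := L10; rewrite !ler_norml => ? ? ? /andP[? ?].
by apply/andP; split; lra.
Qed.

Lemma inner_cellP Q x : q x <= th * R0 -> aw Q x != 0 -> inner_cell Q.
Proof. by move=> qx ax; apply/asboolP; exists x. Qed.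

Lemma al_coord z d : al z d ord0 = off z.1 d ord0 - 2 + (z.2 d)%:R.
Proof. by rewrite !mxE mul1r. Qed.

Lemma chi_supp z x d : chi z x != 0 -> 0 < x d ord0 - al z d ord0 < 2.
Proof. by move=> /wbox_supp /(_ d) /andP[h1 h2]; apply/andP; split; lra. Qed.

Lemma aw_disjoint Q Q' x : Q != Q' -> (forall d, 1 < x d ord0 - off Q d ord0 < LR) -> aw Q' x = 0.
Proof.
move=> QQ' hx; apply/eqP; apply: contraNT QQ' => a0; apply/eqP/ffunP => d; apply: val_inj => /=.
have l0 : 0 < LR by have := L10; lra.
have := hx d; have := aw_supp d a0; rewrite !offE => h1 h2.
exact: cell_unique l0 h2 h1.
Qed.

(** Well inside its own cell a is a basis vector, so the row of 1 - a a^T belonging to that cell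
    vanishes. *)
Lemma frame0 z Q x : ~~ frame z -> chi z x * dev z.1 Q x = 0.
Proof.
rewrite negbK => /forallP hz; have [->|cx] := eqVneq (chi z x) 0; first by rewrite mul0r.
have hx d : 1 < x d ord0 - off z.1 d ord0 < LR.
  have /andP[h1 h2] := chi_supp d cx; have /andP[z1 z2] := hz d; rewrite al_coord in h1 h2.
  rewrite -(ler_nat R) in z1; rewrite -(ler_nat R) in z2.
  by apply/andP; split; lra.
have a1 : aw z.1 x = 1 by apply: wbox_one => d; have /andP[h1 h2] := hx d; apply/andP; split; lra.
have [e|zQ] := eqVneq z.1 Q; first by rewrite /dev -e eqxx a1 mulr1 subrr mulr0.
by rewrite /dev (negbTE zQ) (aw_disjoint zQ hx) !mulr0 subrr mulr0.
Qed.

(** Where the entry is nonzero, x - off Q' lies in (-1, L + 3). Unit windows starting at - 2, with L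
    + 5 of them per axis, form a partition exactly on [-1, L + 3]; this fixes both constants. *)
Lemma chi_sum Q' Q x : bw Q x != 0 -> dev Q' Q x != 0 -> \sum_(a : A) chi (Q', a) x ^+ 2 = 1.
Proof.
move=> bx dx; apply: (@wbox_partition R n.+1 1 (L + 5) (off Q' - const_mx 2) x (lexx 1)) => d.
have {dx} : -1 < x d ord0 - off Q' d ord0 < LR + 3.
  have [->|QQ'] := eqVneq Q' Q; first exact: bw_supp.
  have : aw Q' x != 0 by apply: contra dx => /eqP e; rewrite /dev e (negbTE QQ') mul0r subrr.
  by move=> /(aw_supp d) /andP[h1 h2]; apply/andP; split; lra.
rewrite [(_ - const_mx 2) d ord0]mxE [(- const_mx 2) d ord0]mxE [const_mx 2 d ord0]mxE mul1r natrD.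
by move=> /andP[h1 h2]; apply/andP; split; lra.
Qed.

(** The pointwise identity a a^T + (1 - a a^T)^2 = 1, from |a| = 1; the squared unit windows sum to
    1 and those off the frame contribute nothing. *)
Lemma frame_sum Q Q2 x : inner_cell Q -> bw Q x != 0 ->
  aw Q x * aw Q2 x + \sum_(z | frame z) (chi z x * dev z.1 Q x) * (chi z x * dev z.1 Q2 x)
  = (Q == Q2)%:R.
Proof.
move=> iQ bx; rewrite (_ : \sum_(z | frame z) _ = \sum_Q' dev Q' Q x * dev Q' Q2 x).
  have a1 := aw_sum_b iQ bx.
  have -> : \sum_Q' dev Q' Q x * dev Q' Q2 x = \sum_Q' ((Q' == Q)%:R * (Q' == Q2)%:R
      - (Q' == Q)%:R * (aw Q' x * aw Q2 x) - (Q' == Q2)%:R * (aw Q' x * aw Q x)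
      + aw Q' x ^+ 2 * (aw Q x * aw Q2 x)).
    by apply: eq_bigr => Q' _; rewrite /dev; ring.
  rewrite big_split/= -mulr_suml a1 mul1r !sumrB.
  have pk (Q0 : I) (F : I -> R) : \sum_Q' (Q' == Q0)%:R * F Q' = F Q0.
    rewrite (bigD1 Q0)//= eqxx mul1r big1 ?addr0// => j /negbTE ->.
    by rewrite mul0r.
  by rewrite !pk; ring.
rewrite [LHS](_ : _ = \sum_z (chi z x * dev z.1 Q x) * (chi z x * dev z.1 Q2 x)).
  rewrite (eq_bigr (fun z => dev z.1 Q x * dev z.1 Q2 x * chi (z.1, z.2) x ^+ 2)); last first.
    by move=> [Q' a] _ /=; ring.
  rewrite -(pair_bigA _ (fun Q' a => dev Q' Q x * dev Q' Q2 x * chi (Q', a) x ^+ 2))/=.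
  apply: eq_bigr => Q' _; rewrite -mulr_sumr.
  have [->|d0] := eqVneq (dev Q' Q x) 0; first by rewrite !mul0r.
  by rewrite (chi_sum bx d0) mulr1.
rewrite [RHS](bigID frame)/= [X in _ = _ + X]big1 ?addr0// => z fz.
by rewrite (frame0 _ _ fz) mul0r.
Qed.

(** A cell has [q]-diameter at most c (L + 1) <= 2 c L, so [hW] keeps it below the shell. *)
Lemma aw_q Q x : inner_cell Q -> aw Q x != 0 -> q x < (W%:R * k0 - 1) * LR.
Proof.
move=> /asboolP[y [qy ay]] ax.
have l10 := L10.
have d1 d : `|(x - y) d ord0| <= LR + 1.
  rewrite !mxE ler_norml; have /andP[? ?] := aw_supp d ax; have /andP[? ?] := aw_supp d ay.
  by apply/andP; split; lra.
have n1d : n1 (x - y) <= n.+1%:R * (LR + 1).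
  rewrite /n1 (le_trans (ler_sum _ (fun d _ => d1 d)))//.
  by rewrite sumr_const card_ord mulr_natl.
have qd : q (x - y) <= c%:R * (LR + 1).
  apply: (le_trans (gauge_le gq _)); apply: (le_trans (ler_wpM2l C0 n1d)).
  have -> : C * (n.+1%:R * (LR + 1)) = (C * n.+1%:R) * (LR + 1) by rewrite mulrA.
  by apply: ler_wpM2r; [lra|exact: Cc].
have := gaugeD gq y (x - y); rewrite subrKC => qx.
have c1 : 0 <= c%:R :> R by [].
have h1 : c%:R * (LR + 1) <= 2 * c%:R * LR by move: (LR) (c%:R : R) l10 c1 => l a l10 c1; nra.
have l0 : 0 < LR by lra.
have : (th * (W%:R * k0 + 1) + 2 * c%:R) * LR < (W%:R * k0 - 1) * LR by rewrite ltr_pM2r.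
by rewrite mulrDl -mulrA -/R0; lra.
Qed.

Lemma moved_supp z i x d : moved z i (x - tau z) != 0 -> 0 < x d ord0 - corner (p z) d ord0 < 2.
Proof.
rewrite /moved -mulrA mulf_eq0 negb_or => /andP[/(chi_supp d) + _].
have -> : (x - tau z) d ord0 = x d ord0 - corner (p z) d ord0 + al z d ord0.
  by rewrite [(x - tau z) d ord0]mxE [(- tau z) d ord0]mxE [tau z d ord0]mxE [(- al z) d ord0]mxE; ring.
by rewrite addrK.
Qed.

(** All places lie within 2 J of [e] in each coordinate, hence within 2 c J in [q]; the definition
    of [L] makes this bound equal to [L]. *)
Lemma moved_q z i x : moved z i (x - tau z) != 0 -> (W%:R * k0 - 1) * LR <= q x <= R0.
Proof.
move=> mx; pose e : T := (W%:R * LR) *: delta_mx ord0 ord0.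
have J1 : (1 <= J)%N by exact: leq_trans J0.
have wd d : `|(x - e) d ord0| <= 2 * J%:R.
  have := moved_supp d mx; rewrite [corner _ _ _]mxE.
  rewrite [(x - e) d ord0]mxE [(- e) d ord0]mxE [e d ord0]mxE [delta_mx _ _ _ _]mxE eqxx andbT natrM.
  have : (p z d)%:R <= J%:R - 1 :> R by rewrite lerBrDr natr1 ler_nat.
  have : 0 <= (p z d)%:R :> R by [].
  rewrite [W%:R * LR * _]mulrC; move: ((d == ord0)%:R * (W%:R * LR)) => b g0 g1 /andP[h1 h2].
  by rewrite ler_norml; apply/andP; split; lra.
have n1w : n1 (x - e) <= n.+1%:R * (2 * J%:R).
  rewrite /n1 (le_trans (ler_sum _ (fun d _ => wd d)))//.
  by rewrite sumr_const card_ord -[leLHS]mulr_natl.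
have qw : q (x - e) <= LR.
  apply: (le_trans (gauge_le gq _)); apply: (le_trans (ler_wpM2l C0 n1w)).
  have -> : C * (n.+1%:R * (2 * J%:R)) = (C * n.+1%:R) * (2 * J%:R) by rewrite mulrA.
  have J2 : 0 <= 2 * J%:R :> R by rewrite mulr_ge0.
  apply: (le_trans (ler_wpM2r J2 Cc)).
  by rewrite LE !natrM le_eqVlt; apply/orP; left; apply/eqP; ring.
have qe : q e = W%:R * k0 * LR.
  by rewrite /e (gaugeZ gq) ger0_norm ?mulr_ge0// -/k0; ring.
have := gaugeD gq e (x - e); have := gaugeD gq x (e - x); rewrite !subrKC.
have -> : q (e - x) = q (x - e) by rewrite -opprB -scaleN1r (gaugeZ gq) normrN1 mul1r.
rewrite qe /R0 => h1 h2; apply/andP; split; rewrite ?mulrBl ?mulrDl ?mul1r; lra.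
Qed.

Lemma corner_inj x z z' : frame z -> frame z' ->
  (forall d, 0 < x d ord0 - corner (p z) d ord0 < 2) ->
  (forall d, 0 < x d ord0 - corner (p z') d ord0 < 2) -> z = z'.
Proof.
move=> fz fz' hz hz'; apply: pinj => //; apply/ffunP => d; apply: val_inj => /=.
by have := hz d; have := hz' d; rewrite !mxE => h1 h2; exact: grid_unique h2 h1.
Qed.

Lemma gen_q i x : inner_cell i.1 -> gen i x != 0 -> q x <= R0.
Proof.
move=> ii; apply: contraR; rewrite -ltNge => qx; rewrite /gen.
have [->|ax] := eqVneq (aw i.1 x) 0; last first.
  have := aw_q ii ax; have := L10; move: qx; rewrite /R0; move: (W%:R * k0) => b; nra.
rewrite mul0r add0r big1// => z fz; apply/eqP; apply: contraT => /moved_q /andP[_].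
by rewrite leNgt qx.
Qed.

(** Parts in place lie below the shell, moved parts inside it, and different moved parts at disjoint
    places, so only products of matching parts survive. *)
Lemma gen_mul i j x : inner_cell i.1 -> inner_cell j.1 -> gen i x * gen j x =
  (aw i.1 x * phi i x) * (aw j.1 x * phi j x) +
  \sum_(z | frame z) moved z i (x - tau z) * moved z j (x - tau z).
Proof.
move=> ii ij.
have mm (i' j' : I * Y) z : inner_cell i'.1 -> aw i'.1 x * phi i' x * moved z j' (x - tau z) = 0.
  move=> ii'; have [->|a0] := eqVneq (aw i'.1 x) 0; first by rewrite !mul0r.
  have [->|m0] := eqVneq (moved z j' (x - tau z)) 0; first by rewrite mulr0.
  by have := aw_q ii' a0; have /andP[] := moved_q m0; lra.
rewrite /gen mulrDl !mulrDr.
have -> : aw i.1 x * phi i x * \sum_(z | frame z) moved z j (x - tau z) = 0.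
  by rewrite mulr_sumr big1// => z _; exact: mm.
have -> : (\sum_(z | frame z) moved z i (x - tau z)) * (aw j.1 x * phi j x) = 0.
  by rewrite mulr_suml big1// => z _; rewrite mulrC; exact: mm.
rewrite addr0 add0r; congr (_ + _); rewrite mulr_suml; apply: eq_bigr => z fz.
rewrite mulr_sumr (bigD1 z)//= big1 ?addr0// => z' /andP[fz' zz'].
have [->|m0] := eqVneq (moved z i (x - tau z)) 0; first by rewrite mul0r.
have [->|m0'] := eqVneq (moved z' j (x - tau z')) 0; first by rewrite mulr0.
have e : z' = z by apply: (@corner_inj x) => // d; [exact: moved_supp d m0'|exact: moved_supp d m0].
by rewrite e eqxx in zz'.
Qed.

Lemma good_phi i : good (phi i).
Proof.
apply: goodM; first exact: good_wbox.
have [ss sc] := @smooth1_sincos R.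
apply: (@eq_good _ _ (fun x => (fun t => cos t + sin t) (dot ((2 * pi / KR) *: mode i.2) x + 0))) => [x|].
  by rewrite /cas addr0 dotZl; congr (cos _ + sin _); ring.
by apply: (good_ridge _ _ (eta := fun t => cos t + sin t)); exact: smooth1D sc ss.
Qed.

Lemma good_dev Q' Q : good (dev Q' Q).
Proof.
apply: (@eq_good _ _ (fun x => (Q' == Q)%:R + (-1) * (aw Q' x * aw Q x))) => [x|].
  by rewrite mulN1r.
by apply: goodD; [exact: good_cst|apply: goodZ; apply: goodM; exact: good_wbox].
Qed.

Lemma good_moved z i : good (moved z i).
Proof. by apply: goodM; [apply: goodM; [exact: good_wbox|exact: good_dev]|exact: good_phi]. Qed.

Lemma good_gen i : good (gen i).
Proof.
apply: goodD; first by apply: goodM; [exact: good_wbox|exact: good_phi].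
apply: good_sum => z.
apply: (@eq_good _ _ (fun x => moved z i (1%:M *m x + (- tau z)))) => [x|].
  by rewrite mul1mx.
by apply: good_comp_affine; exact: good_moved.
Qed.

Lemma clip_main i j : clip (fun x => (aw i.1 x * phi i x * (aw j.1 x * phi j x))%:C).
Proof.
apply: (@clip_coord _ _ _ (off i.1) (LR + 1)) => [|x].
  by apply: goodM; apply: goodM; do ?[exact: good_wbox|exact: good_phi].
rewrite -mulrA mulf_eq0 negb_or => /andP[a0 _] d.
by have /andP[h1 h2] := aw_supp d a0; rewrite gtr0_norm// ltW.
Qed.

Lemma clip_moved z i j : clip (fun x => (moved z i x * moved z j x)%:C).
Proof.
apply: (@clip_coord _ _ _ (al z) 2) => [|x]; first by apply: goodM; exact: good_moved.
rewrite {1}/moved -!mulrA mulf_eq0 negb_or => /andP[a0 _] d.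
by have /andP[h1 h2] := chi_supp d a0; rewrite gtr0_norm// ltW.
Qed.

Lemma int_off Q : int_vec (off Q).
Proof. by move=> d; rewrite offE rpredM ?rpredB ?natr_int. Qed.

Lemma int_tau z : int_vec (tau z).
Proof.
apply: int_vecD => d; first by rewrite mxE rpredD// rpredM ?natr_int.
rewrite mxE rpredN al_coord rpredD ?natr_int// rpredB ?natr_int//; exact: int_off.
Qed.

(** Each moved part is shifted back by the integer vector [tau w], which leaves the modulation
    unchanged. Under a single integral [frame_sum] then reduces the product to modes of one cell
    weighted by [bw ^+ 2], where [cas_orthogonal] applies. *)
Lemma gen_orthogonal i j (z : T) : inner_cell i.1 -> inner_cell j.1 -> int_vec z ->
  cint mu (fun x => (gen i x * gen j x)%:C * turn (dot z x)) =
  (\int[mu]_x wbox KR 0 x ^+ 2 * ((i == j) && (z == 0))%:R)%:C.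
Proof.
move=> ii ij iz.
pose f x := aw i.1 x * phi i x * (aw j.1 x * phi j x).
pose g w x := moved w i x * moved w j x.
pose E x := turn (dot z x / 1).
have EE x : turn (dot z x) = E x by rewrite /E divr1.
have iF : cintg mu (fun x => (f x)%:C * E x) by apply: cintg_turn; exact: clip_main.
have iG w : cintg mu (fun x => (g w x)%:C * E x) by apply: cintg_turn; exact: clip_moved.
have iGt w : cintg mu (fun x => (g w (x - tau w))%:C * E (x - tau w)).
  exact: (rescales_cintg (rescales_shift (- tau w)) (iG w)).
transitivity (cint mu (fun x => (f x)%:C * E x) + \sum_(w | frame w) cint mu (fun x => (g w x)%:C * E x)).
  rewrite (eq_cint _ (g := fun x => (f x)%:C * E x + \sum_(w | frame w) (g w (x - tau w))%:C * E (x - tau w))); last first.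
    move=> x; rewrite gen_mul// EE rmorphD mulrDl; congr (_ + _).
    rewrite rmorph_sum mulr_suml; apply: eq_bigr => w _; congr (_ * _).
    rewrite /E !divr1 dotBr turnD [turn (- _)]turn_int ?mulr1// rpredN.
    by apply: dot_int => //; exact: int_tau.
  rewrite cintD//; last exact: cintg_sum.
  rewrite cint_sum//; congr (_ + _); apply: eq_bigr => w _.
  by rewrite (rescales_cint (rescales_shift (- tau w)) (iG w)) mul1r.
rewrite -cint_sum// -cintD//; last exact: cintg_sum.
rewrite (eq_cint _ (g := fun x => ((i.1 == j.1)%:R)%:C *
   ((bw i.1 x ^+ 2 * cas (dot (mode i.2) x / KR) * cas (dot (mode j.2) x / KR))%:C * turn (dot z x)))); last first.
  move=> x; rewrite EE -mulr_suml -mulrDl mulrA -[RHS]/(_ * E x); congr (_ * _).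
  rewrite -rmorph_sum -rmorphD -rmorphM; congr (_%:C).
  have [b0|b0] := eqVneq (bw i.1 x) 0.
    rewrite b0 expr0n !mul0r mulr0 /f {1}/phi b0 mul0r mulr0 mul0r add0r big1// => w _.
    by rewrite /g {1}/moved {1}/phi b0 mul0r mulr0 mul0r.
  have fs := frame_sum j.1 ii b0.
  transitivity (phi i x * phi j x * (aw i.1 x * aw j.1 x + \sum_(w | frame w) (chi w x * dev w.1 i.1 x) * (chi w x * dev w.1 j.1 x))).
    rewrite mulrDr /f; congr (_ + _); first ring.
    by rewrite mulr_sumr; apply: eq_bigr => w _; rewrite /g /moved; ring.
  rewrite fs; have [e|_] := eqVneq i.1 j.1; last by rewrite mulr0 mul0r.
  by rewrite /phi -e; ring.
have cb : clip (fun x => (bw i.1 x ^+ 2)%:C) by exact: clip_wbox.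
have K0 : KR != 0 by rewrite pnatr_eq0.
have K1 : 1 <= KR by rewrite ler1n.
have iK : KR \is a Num.int by rewrite natr_int.
have orth := cas_orthogonal cb K0 iK (fun l => wbox_turn0 (off i.1 - const_mx 1) K1 (l := l))
  (@int_mode _ _ _ i.2) (@int_mode _ _ _ j.2) iz (@mode_lt _ _ _ i.2) (@mode_lt _ _ _ j.2).
rewrite cintZ; last first.
  apply: (@eq_cintg _ _ _ _ (fun x => ((bw i.1 x ^+ 2 * cas (dot (mode i.2) x / KR) * cas (dot (mode j.2) x / KR))%:C * E x))).
    by move=> x; rewrite EE.
  apply: cintg_turn; apply: (@clip_coord _ _ _ (off i.1) (LR + 3)) => [|x].
    apply: (@eq_good _ _ (fun x => phi i x * phi (i.1, j.2) x)); first by move=> x; rewrite /phi /=; ring.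
    by apply: goodM; exact: good_phi.
  rewrite -mulrA mulf_eq0 negb_or sqrf_eq0 => /andP[b0 _] d.
  by have /andP[h1 h2] := bw_supp d b0; have := L10; rewrite ler_norml => h3; apply/andP; split; lra.
rewrite orth wbox_int_translate -rmorphM; congr (_%:C); rewrite mulrCA; congr (_ * _).
rewrite (inj_eq (@mode_inj R _ _)) -natrM mulnb; congr (_%:R).
by rewrite andbA; case: i j {ii ij f g iF iG iGt cb orth} => [? ?] [? ?].
Qed.

(** After recentring, [aw Q] times [F] lives in a box of side [K] and vanishes near its faces, so
    [trig_approx] applies with period [K], and [trig_cas] splits the polynomial into modes with
    coefficients of integer frequency. The factor [bw Q] extends the estimate to the whole space. *)
Lemma cell_approx (F : T -> R[i]) Q (e : R) : clip F -> 0 < e ->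
  exists2 t : Y -> T -> R[i], forall y : Y, trig 1 (t y) &
    forall x, normc (\sum_(y : Y) (phi (Q, y) x)%:C * t y x - (aw Q x)%:C * F x) <= e.
Proof.
move=> cF e0; pose o : T := off Q - const_mx 1.
have oE d : o d ord0 = off Q d ord0 - 1 by rewrite !mxE.
have ca : clip (fun x => (aw Q x)%:C).
  apply: (@clip_coord _ _ _ (off Q) (LR + 1)) => [|x ax d]; first exact: good_wbox.
  by have /andP[h1 h2] := aw_supp d ax; rewrite gtr0_norm// ltW.
have [_ _ [D D0 hD]] := (clipMl ca cF.1).1.
pose H x := (aw Q (x + o))%:C * F (x + o).
have K0 : 0 < KR by rewrite ltr0n.
have a0 x d : x d ord0 - off Q d ord0 <= 0 \/ LR + 1 <= x d ord0 - off Q d ord0 -> aw Q x = 0.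
  move=> hx; apply/eqP; apply: contraT => /(aw_supp d) /andP[h1 h2].
  by case: hx; lra.
have H0 x d : x d ord0 <= 1 \/ KR - 1 <= x d ord0 -> H x = 0.
  move=> hx; rewrite /H (a0 _ d) ?mul0r// [(x + o) d ord0]mxE oE.
  by case: hx => hx; [left|right; move: hx; rewrite KRE => hx]; lra.
have HD x y : normc (H x - H y) <= D * n1 (x - y).
  by rewrite (le_trans (hD _ _))// opprD addrACA subrr addr0.
have [t0 tt0 ht0] := trig_approx K0 D0 e0 HD (fun x d hx => H0 x d (ltac:(case: hx => hx; [left|right]; lra))).
have tt : trig KR (fun x => t0 (x - o)) by exact: trig_shift.
have [t ht tE] := trig_cas tt; exists t => // x.
have -> : \sum_(y : Y) (phi (Q, y) x)%:C * t y x = (bw Q x)%:C * t0 (x - o).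
  rewrite tE mulr_sumr; apply: eq_bigr => y _.
  by rewrite /phi rmorphM mulrA.
have -> : (aw Q x)%:C * F x = (bw Q x)%:C * H (x - o).
  rewrite /H subrK; have [->|ax] := eqVneq (aw Q x) 0; first by rewrite mul0r mulr0.
  by rewrite bw_one// mul1r.
rewrite -mulrBr normcM normc_real; have [->|bx] := eqVneq (bw Q x) 0.
  by rewrite normr0 mul0r ltW.
(* [bw Q] reaches up to one unit beyond the period. Coordinates above [K] are brought back by one
   period into (0, 1], where [H] vanishes as it does at the original point. *)
pose v : T := \col_d (- (KR < (x - o) d ord0)%R%:R).
have iv : int_vec v by move=> d; rewrite mxE rpredN natr_int.
pose y := (x - o) + KR *: v.
have xd d : 0 < (x - o) d ord0 < KR + 1.
  have -> : (x - o) d ord0 = x d ord0 - o d ord0 by rewrite !mxE.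
  by have /andP[h1 h2] := bw_supp d bx; rewrite oE KRE; apply/andP; split; lra.
have yE d : y d ord0 = (x - o) d ord0 - KR * (KR < (x - o) d ord0)%R%:R.
  by rewrite [y d ord0]mxE [(KR *: v) d ord0]mxE [v d ord0]mxE mulrN.
have yd d : 0 <= y d ord0 <= KR.
  rewrite yE; have /andP[h1 h2] := xd d; move: ((x - o) d ord0) h1 h2 => w h1 h2.
  have K1 : 1 <= KR by rewrite ler1n.
  move: (KR) K1 h2 => k K1 h2.
  by case: (ltP k w) => hw; rewrite /= ?mulr1 ?mulr0; apply/andP; split; lra.
have tE' : t0 (x - o) = t0 y by rewrite /y trig_periodic// gt_eqF.
have HE : H (x - o) = H y.
  have [/existsP[d hd]|/existsPn hh] := boolP [exists d, KR < (x - o) d ord0].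
    rewrite (H0 _ d); last by right; lra.
    rewrite (H0 y d)//; left; rewrite yE hd mulr1; have /andP[_ h2] := xd d; lra.
  congr H; rewrite /y (_ : v = 0) ?scaler0 ?addr0//.
  by apply/colP => d; rewrite [v d ord0]mxE (negbTE (hh d)) oppr0 mxE.
rewrite tE' HE; have b1 : `|bw Q x| <= 1 by rewrite ger0_norm ?wbox_ge0// wbox_le1.
by rewrite (le_trans (ler_wpM2r _ b1)) ?normc_ge0// mul1r ht0.
Qed.

Lemma normc_dev_le z Q x : normc ((chi z x * dev z.1 Q x)%:C) <= 1.
Proof.
rewrite normc_real normrM mulr_ile1//.
  by rewrite ger0_norm ?wbox_ge0// wbox_le1.
rewrite /dev; have /andP[a1 a2] := aw_01 z.1 x; have /andP[b1 b2] := aw_01 Q x.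
move: (aw z.1 x) (aw Q x) a1 a2 b1 b2 => a b a1 a2 b1 b2.
by rewrite ler_norml; case: eqP => _ /=; apply/andP; split; nra.
Qed.

(** The coefficients are chosen so that cell [Q] reproduces [aw Q] times [F]. In place this
    contributes [aw Q ^+ 2] times [F], which sums to [F]; in the moved parts the projection
    annihilates it. *)
Lemma gen_approx (F : T -> R[i]) (e : R) : clip F -> (forall x, F x != 0 -> q x <= th * R0) ->
  0 < e -> exists2 t : I * Y -> T -> R[i], forall i, trig 1 (t i) &
    forall x, normc (F x - \sum_(i | inner_cell i.1) t i x * (gen i x)%:C) <= e.
Proof.
move=> cF sF e0.
(* One error for each cell in place and one for each pair of a cell and a moved piece. *)
pose B : R := #|{: I}|%:R * (1 + #|{: I * A}|%:R).
have B0 : 0 <= B by rewrite mulr_ge0// addr_ge0.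
have e1 : 0 < e / (B + 1) by rewrite divr_gt0// ltr_wpDl.
have /choice[t ht] : forall Q, exists t : Y -> T -> R[i], (forall y : Y, trig 1 (t y)) /\
    forall x, normc (\sum_(y : Y) (phi (Q, y) x)%:C * t y x - (aw Q x)%:C * F x) <= e / (B + 1).
  by move=> Q; have [t h1 h2] := cell_approx Q cF e1; exists t.
exists (fun i => t i.1 i.2) => [i|x]; first by case: (ht i.1).
pose P Q x := \sum_(y : Y) (phi (Q, y) x)%:C * t Q y x.
pose E Q x := P Q x - (aw Q x)%:C * F x.
have EB Q y : normc (E Q y) <= e / (B + 1) by have [_ h2] := ht Q; exact: h2.
have F0 y : ~~ (q y <= th * R0) -> F y = 0.
  by move=> qy; apply/eqP; apply: contraT => /sF; rewrite (negbTE qy).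
have sumF y : \sum_(Q | inner_cell Q) (aw Q y ^+ 2)%:C * F y = F y.
  have [qy|qy] := boolP (q y <= th * R0); last first.
    by rewrite big1 ?(F0 _ qy)// => Q _; rewrite mulr0.
  rewrite -mulr_suml -rmorph_sum; have <- : \sum_Q aw Q y ^+ 2 = \sum_(Q | inner_cell Q) aw Q y ^+ 2.
    rewrite [LHS](bigID inner_cell)/= [X in _ + X]big1 ?addr0// => Q.
    by move=> iQ; apply/eqP; rewrite sqrf_eq0; apply: contraNT iQ => aQ; exact: inner_cellP aQ.
  by rewrite aw_sum_q// mul1r.
(* The identity (1 - a a^T) a = 0. Restricting to inner cells changes nothing where [F] is
   nonzero. *)
have devF Q' y : \sum_(Q | inner_cell Q) (dev Q' Q y)%:C * ((aw Q y)%:C * F y) = 0.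
  transitivity (\sum_(Q | inner_cell Q) ((Q' == Q)%:R * aw Q y)%:C * F y -
      (aw Q' y)%:C * \sum_(Q | inner_cell Q) (aw Q y ^+ 2)%:C * F y).
    rewrite mulr_sumr -sumrB; apply: eq_bigr => Q _.
    rewrite /dev !(rmorphB, rmorphM, rmorphXn)/=; ring.
  rewrite sumF.
  have [qy|qy] := boolP (q y <= th * R0); last first.
    by rewrite (F0 _ qy) mulr0 subr0 big1// => Q _; rewrite mulr0.
  have [iQ|iQ] := boolP (inner_cell Q').
    rewrite (bigD1 Q')//= eqxx mul1r big1 ?addr0 ?subrr// => Q /andP[_ QQ'].
    by rewrite eq_sym (negbTE QQ') mul0r mul0r.
  rewrite big1 => [|Q iQ']; last first.
    by case: eqP iQ => [->|_ _]; [rewrite iQ'|rewrite mul0r mul0r].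
  rewrite sub0r; apply/eqP; rewrite oppr_eq0 mulf_eq0; apply/orP; left.
  have -> : aw Q' y = 0 by apply/eqP; apply: contraNT iQ => aQ; exact: inner_cellP aQ.
  by [].
have sumg Q : \sum_(y : Y) t Q y x * (gen (Q, y) x)%:C = (aw Q x)%:C * P Q x +
    \sum_(z | frame z) (chi z (x - tau z) * dev z.1 Q (x - tau z))%:C * P Q (x - tau z).
  have -> : \sum_(y : Y) t Q y x * (gen (Q, y) x)%:C = \sum_(y : Y) ((aw Q x)%:C * ((phi (Q, y) x)%:C * t Q y x) +
      \sum_(z | frame z) (chi z (x - tau z) * dev z.1 Q (x - tau z))%:C *
         ((phi (Q, y) (x - tau z))%:C * t Q y (x - tau z))).
    apply: eq_bigr => y _; rewrite /gen rmorphD rmorphM mulrDr; congr (_ + _); first by rewrite /=; ring.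
    rewrite rmorph_sum mulr_sumr; apply: eq_bigr => z _.
    (* Coefficients of integer frequency do not see the integer shift, so the error at [x] is one at
       [x - tau z]. *)
    have -> : t Q y (x - tau z) = t Q y x.
      have [hQ _] := ht Q; have iz : int_vec (- tau z) by apply: int_vecN; exact: int_tau.
      by have := trig_periodic x (oner_neq0 R) (hQ y) iz; rewrite scale1r.
    by rewrite /moved !rmorphM/=; ring.
  rewrite big_split/= -mulr_sumr; congr (_ + _); rewrite exchange_big/=.
  by apply: eq_bigr => z _; rewrite -mulr_sumr.
have -> : \sum_(i | inner_cell i.1) t i.1 i.2 x * (gen i x)%:C =
    \sum_(Q | inner_cell Q) \sum_(y : Y) t Q y x * (gen (Q, y) x)%:C.
  rewrite pair_big_dep/=; apply: eq_big => [[Q y]|[Q y] _] //=.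
  by rewrite andbT.
rewrite (eq_bigr _ (fun Q _ => sumg Q)) big_split/= exchange_big/=.
have PE Q y : P Q y = (aw Q y)%:C * F y + E Q y by rewrite /E addrC subrK.
have -> : \sum_(Q | inner_cell Q) (aw Q x)%:C * P Q x = F x + \sum_(Q | inner_cell Q) (aw Q x)%:C * E Q x.
  rewrite -{1}(sumF x) -big_split; apply: eq_bigr => Q _.
  by rewrite PE mulrDr mulrA -rmorphM expr2.
have -> : \sum_(z | frame z) \sum_(Q | inner_cell Q) (chi z (x - tau z) * dev z.1 Q (x - tau z))%:C * P Q (x - tau z)
   = \sum_(z | frame z) \sum_(Q | inner_cell Q) (chi z (x - tau z) * dev z.1 Q (x - tau z))%:C * E Q (x - tau z).
  apply: eq_bigr => z _; apply/eqP; rewrite -subr_eq0 -sumrB; apply/eqP.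
  transitivity ((chi z (x - tau z))%:C * \sum_(Q | inner_cell Q) (dev z.1 Q (x - tau z))%:C * ((aw Q (x - tau z))%:C * F (x - tau z))).
    by rewrite mulr_sumr; apply: eq_bigr => Q _; rewrite PE rmorphM/=; ring.
  by rewrite devF mulr0.
rewrite -addrA opprD addrA subrr add0r normcN.
have sle (S : finType) (p0 : pred S) (f : S -> R[i]) (M : R) : 0 <= M ->
    (forall s, normc (f s) <= M) -> normc (\sum_(s | p0 s) f s) <= #|S|%:R * M.
  move=> M0 fM; rewrite (le_trans (normc_sum _ _ _))//.
  rewrite (le_trans (ler_sum _ (fun s _ => fM s)))// sumr_const -[leLHS]mulr_natl ler_wpM2r// ler_nat.
  exact: max_card.
have e2 := ltW e1.
rewrite (le_trans (normcD _ _))//.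
apply: (le_trans (y := #|{: I}|%:R * (e / (B + 1)) + #|{: I * A}|%:R * (#|{: I}|%:R * (e / (B + 1))))).
  have t1 : normc (\sum_(Q | inner_cell Q) (aw Q x)%:C * E Q x) <= #|{: I}|%:R * (e / (B + 1)).
    apply: sle => // Q; rewrite normcM normc_real -[leRHS]mul1r.
    by apply: ler_pM; rewrite ?normr_ge0 ?normc_ge0// ger0_norm ?wbox_ge0// wbox_le1.
  have sle2 := sle; apply: (lerD t1); apply: sle => [|z]; first exact: mulr_ge0.
  apply: sle2 => // Q; rewrite normcM -[leRHS]mul1r.
  by apply: ler_pM; rewrite ?normc_ge0//; exact: normc_dev_le.
have -> : #|{: I}|%:R * (e / (B + 1)) + #|{: I * A}|%:R * (#|{: I}|%:R * (e / (B + 1))) = B * e / (B + 1).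
  by rewrite /B; ring.
by rewrite ler_pdivrMr ?ltr_wpDl// mulrC ler_wpM2l ?(ltW e0)// lerDl.
Qed.

Lemma shell_frequency : exists (N : nat) (R1 cc : R) (u : 'I_N -> T -> R),
  [/\ (0 < N)%N, 0 < R1 /\ 0 < cc, forall i : 'I_N, good (u i), forall (i : 'I_N) x, u i x != 0 -> q x <= R1 &
   (forall (i j : 'I_N) (z : T), int_vec z ->
     cint mu (fun x => (u i x * u j x)%:C * turn (dot z x)) = (cc * ((i == j) && (z == 0))%:R)%:C) /\
   (forall (F : T -> R[i]) (e : R), clip F -> (forall x, F x != 0 -> q x <= th * R1) -> 0 < e ->
     exists2 t : 'I_N -> T -> R[i], forall i : 'I_N, trig 1 (t i) &
       forall x, normc (F x - \sum_(i : 'I_N) t i x * (u i x)%:C) <= e)].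
Proof.
pose D : {pred I * Y} := [pred i | inner_cell i.1].
exists #|D|, R0, (\int[mu]_x wbox KR 0 x ^+ 2), (fun k => gen (enum_val k)).
have inD (k : 'I_#|D|) : inner_cell (enum_val k).1 by have := enum_valP k.
split.
- have q0 : q 0 <= th * R0.
    by rewrite -(scale0r (0 : T)) (gaugeZ gq) normr0 mul0r mulr_ge0 ?R0_ge0// ltW.
  have [Q aQ] : exists Q, aw Q 0 != 0.
    apply/existsP; apply: contraT => /existsPn h0; have := aw_sum_q q0.
    rewrite big1 => [/esym/eqP|Q _]; first by rewrite oner_eq0.
    by have := h0 Q; rewrite negbK => /eqP ->; rewrite expr0n.
  by apply/card_gt0P; exists (Q, [ffun=> ord0] : Y); apply: inner_cellP q0 aQ.
- split; last by apply: wbox_int_gt0; rewrite KRE; have := L10; lra.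
  have l0 : 0 < LR by have := L10; lra.
  by rewrite mulr_gt0// ltr_wpDl// mulr_ge0// (le_trans ler01 k01).
- by move=> k; exact: good_gen.
- by move=> k x; exact: gen_q.
split=> [i j z iz|F e cF sF e0].
  by rewrite gen_orthogonal// (inj_eq enum_val_inj).
have [t tt tE] := gen_approx cF sF e0; exists (fun k => t (enum_val k)) => // x.
have -> : \sum_(k < #|D|) t (@enum_val _ D k) x * (gen (@enum_val _ D k) x)%:C = \sum_(i | inner_cell i.1) t i x * (gen i x)%:C.
  exact: (sum_enum_val D (fun i : I * Y => t i x * (gen i x)%:C)).
exact: tE.
Qed.

End shell.

(** * Counting: the pieces fit into the shell *)

Lemma inj_card (X Y : finType) (F : {pred X}) : (#|F| <= #|Y|)%N -> (0 < #|Y|)%N ->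
  exists p : X -> Y, {in F &, injective p}.
Proof.
move=> FY /card_gt0P[y0 _]; exists (fun x => nth y0 (enum Y) (index x (enum F))).
move=> x x' xF x'F /eqP; rewrite nth_uniq ?enum_uniq//; last 2 first.
- by rewrite -cardE (leq_trans _ FY)// cardE index_mem mem_enum.
- by rewrite -cardE (leq_trans _ FY)// cardE index_mem mem_enum.
by move=> /eqP/(congr1 (nth x (enum F))); rewrite !nth_index ?mem_enum.
Qed.

Lemma exprn_diff_le (X Y k : nat) : (Y <= X)%N -> (X ^ k.+1 - Y ^ k.+1 <= (X - Y) * k.+1 * X ^ k)%N.
Proof.
move=> YX; elim: k => [|k IH]; first by rewrite !expn1 expn0 !muln1.
have -> : (X ^ k.+2 - Y ^ k.+2 = X * (X ^ k.+1 - Y ^ k.+1) + (X - Y) * Y ^ k.+1)%N.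
  rewrite mulnBr mulnBl -!expnS addnBA ?leq_mul// ?leq_exp2r// subnK//.
  by rewrite [(X ^ k.+2)%N]expnS leq_mul2l leq_exp2r// YX orbT.
have -> : ((X - Y) * k.+2 * X ^ k.+1 = X * ((X - Y) * k.+1 * X ^ k) + (X - Y) * X ^ k.+1)%N.
  by rewrite [(X ^ k.+1)%N]expnS; move: (X - Y)%N (X ^ k)%N => a b; ring.
by rewrite leq_add// leq_mul// leq_exp2r.
Qed.

Lemma card_middle (L : nat) : (L - 2 <= #|[pred a : 'I_(L + 5) | (3 <= a <= L)%N]|)%N.
Proof.
have lt3 (i : 'I_(L - 2)) : (i + 3 < L + 5)%N.
  by rewrite (leq_ltn_trans (n := (L + 3)%N))// ?leq_add2r ?ltn_add2l// (leq_trans (ltnW (ltn_ord i)))// leq_subr.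
pose f i := Ordinal (lt3 i).
have fi : injective f by move=> i j /(congr1 val) /= /addIn /val_inj.
rewrite -[X in (X <= _)%N]card_ord -(fintype.card_image fi); apply: subset_leq_card.
apply/fintype.subsetP => a /mapP[i _ ->]; rewrite inE /= leq_addl/=.
by have := ltn_ord i; rewrite ltn_subRL addn3 add2n.
Qed.

(** Positions off the frame leave at least L - 2 choices per axis, so the frame has at most (L +
    5)^(n+1) - (L - 2)^(n+1) positions per cell; the factor 7 is the difference of the two bases. *)
Lemma card_frame (I : finType) (L n : nat) :
  (#|[pred z : I * {ffun 'I_n.+1 -> 'I_(L + 5)} | ~~ [forall d, (3 <= z.2 d <= L)%N]]|
    <= #|I| * (7 * n.+1 * (L + 5) ^ n))%N.
Proof.
pose B := [pred a : 'I_(L + 5) | (3 <= a <= L)%N].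
pose S := [pred a : {ffun 'I_n.+1 -> 'I_(L + 5)} | [forall d, (3 <= a d <= L)%N]].
have -> : #|[pred z : I * {ffun 'I_n.+1 -> 'I_(L + 5)} | ~~ [forall d, (3 <= z.2 d <= L)%N]]|
    = #|[predX (predT : {pred I}) & predC S]|.
  by apply: eq_card => -[Q a]; rewrite !inE.
rewrite cardX leq_mul ?max_card//.
have : (#|S| + #|predC S| = (L + 5) ^ n.+1)%N by rewrite cardC card_ffun !card_ord.
have SE : #|S| = #|(ffun_on B : {pred {ffun 'I_n.+1 -> 'I_(L + 5)}})|.
  apply: fintype.eq_card => a; apply/idP/idP => [/forallP h|/ffun_onP h].
    by apply/ffun_onP => d; have := h d; rewrite inE.
  by apply/forallP => d; have := h d; rewrite inE.
have : ((L - 2) ^ n.+1 <= #|S|)%N by rewrite SE card_ffun_on card_ord leq_exp2r// card_middle.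
have L25 : (L - 2 <= L + 5)%N by rewrite (leq_trans (leq_subr _ _))// leq_addr.
have := exprn_diff_le n L25 => h1 h2 h3.
have h4 : (#|predC S| <= (L + 5) ^ n.+1 - (L - 2) ^ n.+1)%N.
  have -> : #|predC S| = ((L + 5) ^ n.+1 - #|S|)%N by rewrite -h3 addKn.
  exact: leq_sub2l.
rewrite (leq_trans h4)//.
have [L2|L2] := leqP 2 L.
  have e : (L + 5 - (L - 2) = 7)%N by rewrite -{1}(subnK L2) -addnA addnC addnK.
  by rewrite e in h1.
(* For L < 2 the truncated L - 2 is 0, but L + 5 is then at most 7. *)
rewrite (leq_trans (leq_subr _ _))// expnS leq_mul2r; apply/orP; right.
by rewrite (leq_trans (n := 7))// ?leq_pmulr// (leq_add (n1 := 2) (n2 := 5))// ltnW.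
Qed.

(** The order of the choices matters: [c], [W] and [m] depend only on the gauge and on [th], hence
    so does the number of cells. Only then is [J], and with it [L], taken large against the number
    of pieces. *)
Lemma frequency (R : realType) (n : nat) (q : 'cV[R]_n.+1 -> R) (C th : R) :
  gauge q C -> 0 < th < 1 -> exists (N : nat) (R1 cc : R) (u : 'I_N -> 'cV[R]_n.+1 -> R),
  [/\ (0 < N)%N, 0 < R1 /\ 0 < cc, forall i, good (u i), forall i x, u i x != 0 -> q x <= R1 &
   (forall i j z, int_vec z ->
     cint (lebesgue_cV n.+1) (fun x => (u i x * u j x)%:C * turn (dot z x)) =
       (cc * ((i == j) && (z == 0))%:R)%:C) /\
   (forall (F : 'cV[R]_n.+1 -> R[i]) (e : R), clip F -> (forall x, F x != 0 -> q x <= th * R1) -> 0 < e ->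
     exists2 t : 'I_N -> 'cV[R]_n.+1 -> R[i], forall i, trig 1 (t i) &
       forall x, normc (F x - \sum_i t i x * (u i x)%:C) <= e)].
Proof.
move=> gq /andP[th0 th1].
have k1 : 1 <= q (delta_mx ord0 ord0).
  apply: le_trans (gauge_ge gq _); rewrite (le_trans _ (n1_coord _ ord0))//.
  by rewrite mxE !eqxx normr1.
set k := q (delta_mx ord0 ord0).
have n1e : n1 (delta_mx ord0 ord0 : 'cV[R]_n.+1) = 1.
  by rewrite /n1 (bigD1 ord0)//= mxE !eqxx normr1 big1 ?addr0// => i /negbTE i0; rewrite mxE i0 normr0.
have C1 : 1 <= C by have := gauge_le gq (delta_mx ord0 ord0); rewrite n1e mulr1; exact: le_trans.
have C0 : 0 <= C by rewrite (le_trans _ C1).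
have up (a : R) : 0 <= a -> exists2 b : nat, (0 < b)%N & a < b%:R.
  by move=> a0; exists (Num.truncn a).+1 => //; have /andP[] := truncn_itv a0.
have [c c0 hc] : exists2 c : nat, (0 < c)%N & C * n.+1%:R < c%:R by apply: up; rewrite mulr_ge0.
(* Since k >= 1 and th + 1 < 2, this makes W k (1 - th) exceed th + 1 + 2 c, which is the gap
   condition between the cells and the shell. *)
have [W W0 hW] : exists2 W : nat, (0 < W)%N & (2 + 2 * c%:R) / (1 - th) < W%:R.
  by apply: up; apply: divr_ge0; [rewrite addr_ge0 ?mulr_ge0|rewrite subr_ge0 ltW].
have [m m0 hm] : exists2 m : nat, (0 < m)%N & W%:R * k + 1 + 3 < m%:R.
  by apply: up; rewrite !addr_ge0// mulr_ge0// (le_trans ler01 k1).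
(* As L + 5 <= 3 c J, there are at most J0 J^n pieces, against J^(n+1) places. *)
pose J0 := (m.*2 ^ n.+1 * (7 * n.+1) * (3 * c) ^ n)%N; pose J := (J0 + 5)%N.
have J5 : (5 <= J)%N by rewrite leq_addl.
pose L := (2 * c * J)%N.
have count : (#|[pred z : {ffun 'I_n.+1 -> 'I_(m.*2)} * {ffun 'I_n.+1 -> 'I_(L + 5)} |
    ~~ [forall d, (3 <= z.2 d <= L)%N]]| <= #|{: {ffun 'I_n.+1 -> 'I_J}}|)%N.
  rewrite (leq_trans (card_frame _ _ _))// !card_ffun !card_ord.
  have LJ : (L + 5 <= 3 * c * J)%N.
    rewrite (leq_trans (n := (L + J)%N)) ?leq_add2l// /L.
    have -> : (3 * c * J = 2 * c * J + c * J)%N by ring.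
    by rewrite leq_add2l leq_pmull.
  rewrite (leq_trans (n := (J0 * J ^ n)%N)).
  - by [].
  - rewrite /J0 -!mulnA leq_mul// leq_mul// leq_mul// -expnMn.
    by case: (n) => // n'; rewrite leq_exp2r.
  - by rewrite expnS leq_mul2r /J leq_addr orbT.
have [p pinj] : exists p : {ffun 'I_n.+1 -> 'I_(m.*2)} * {ffun 'I_n.+1 -> 'I_(L + 5)} ->
    {ffun 'I_n.+1 -> 'I_J}, {in frame (m := m) (L := L) &, injective p}.
  apply: inj_card count _; rewrite card_ffun !card_ord expn_gt0.
  by rewrite (leq_trans _ J5).
apply: (@shell_frequency R n q C th c J W m gq L (c * J).+1 erefl erefl p pinj) => //.
- exact: ltW.
- have h1 : 0 < 1 - th by rewrite subr_gt0.
  rewrite ltr_pdivrMr// in hW; rewrite -/k.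
  have : W%:R * (1 - th) <= W%:R * k * (1 - th) by rewrite ler_wpM2r ?(ltW h1)// ler_peMr.
  rewrite [W%:R * k * _]mulrBr mulr1 => h2; have : W%:R * k * th = th * (W%:R * k) by rewrite mulrC.
  by move: (W%:R * k * th) (th * (W%:R * k)) h2 (mulrDr th (W%:R * k) 1) => a b h2 e1 e2; rewrite e1 mulr1; lra.
- exact: ltW.
Qed.

(** * Linear changes of variables in L2 *)

Section transport.
Context {R : realType} {n : nat}.
Local Notation T := 'cV[R]_n.+1.
Local Notation mu := (lebesgue_cV (R := R) n.+1).
Implicit Types (M : 'M[R]_n.+1) (f g G : T -> R[i]) (x y : T).

Lemma n1_mulmx_le M : exists2 c : R, 0 < c & forall x, n1 (M *m x) <= c * n1 x.
Proof.
pose c : R := \sum_i \sum_j `|M i j|.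
have c0 : 0 <= c by rewrite sumr_ge0// => i _; exact: sumr_ge0.
exists (n.+1%:R * c + 1) => [|x]; first by rewrite ltr_wpDl// mulr_ge0.
rewrite (le_trans (n1_mulmx_entries x (C := c) _))// => [i j|].
  rewrite /c (bigD1 i)//= (bigD1 j)//= -addrA lerDl addr_ge0//; first exact: sumr_ge0.
  by apply: sumr_ge0 => k _; exact: sumr_ge0.
by rewrite ler_wpM2r ?n1_ge0// lerDl.
Qed.

Lemma mulmxVK M x : M \in unitmx -> M^-1 *m (M *m x) = x.
Proof. by move=> uM; rewrite mulmxA -[M^-1]/(invmx M) mulVmx// mul1mx. Qed.

Lemma mulmxKV M x : M \in unitmx -> M *m (M^-1 *m x) = x.
Proof. by move=> uM; rewrite mulmxA -[M^-1]/(invmx M) mulmxV// mul1mx. Qed.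

Lemma unitmx_inv' M : (M^-1 \in unitmx) = (M \in unitmx).
Proof. by rewrite -[M^-1]/(invmx M) unitmx_inv. Qed.

Lemma clip_mulmx M G : M \in unitmx -> clip G -> clip (fun x => G (M *m x)).
Proof.
move=> uM [[mG [B GB] [D D0 hD]] [K GK]].
have [c c0 hc] := n1_mulmx_le M; have [c' c0' hc'] := n1_mulmx_le M^-1.
split; last first.
  exists (c' * `|K|) => x /GK h; rewrite -[x in n1 x](mulmxVK x uM) (le_trans (hc' _))//.
  by rewrite ler_wpM2l ?(ltW c0')// (le_trans h)// ler_norm.
split.
- exact: cmeas_comp (measurable_mulmx M) mG.
- by exists B.
- exists (D * c) => [|x y]; first by rewrite mulr_ge0// ltW.
  by rewrite (le_trans (hD _ _))// -mulmxBr -mulrA ler_wpM2l.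
Qed.

Lemma ft_mulmx M : M \in unitmx -> exists2 c : R, 0 < c & forall s G, clip G ->
  (fun x => ft s G (M *m x)) = ft s (fun z => c%:C * G ((M^T)^-1 *m z)).
Proof.
move=> uM; have uT : M^T \in unitmx by rewrite unitmx_tr.
have uN : (M^T)^-1 \in unitmx by rewrite unitmx_inv'.
have [c c0 hc] := rescales_mulmx uN; exists c^-1 => [|s G cG]; first by rewrite invr_gt0.
have cGN := clip_cintg (clip_mulmx uN cG).
apply/funext => x; rewrite ftZ//.
have E : ft s (fun z => G ((M^T)^-1 *m z)) x = c%:C * ft s G (M *m x).
  rewrite /ft -(rescales_cint hc); last exact: cintg_ker (clip_cintg cG).
  by apply: eq_cint => z; rewrite dot_mulmxl mulmxKV.
by rewrite E mulrA -rmorphM mulVf ?mul1r// gt_eqF.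
Qed.

Lemma L2_mulmx M f : M \in unitmx -> L2 f -> L2 (fun x => f (M *m x)).
Proof.
move=> uM /L2P[mf sf]; have [c c0 hc] := rescales_mulmx uM; apply/L2P; split.
  exact: (rescales_cmeas hc).
exact: (rescales_rintg hc (u := fun x => normc (f x) ^+ 2)).
Qed.

Lemma inner_mulmx M : M \in unitmx -> exists2 c : R, 0 < c & forall f g, L2 f -> L2 g ->
  inner (fun x => f (M *m x)) (fun x => g (M *m x)) = c%:C * inner f g.
Proof.
move=> uM; have [c c0 hc] := rescales_mulmx uM; exists c => // f g Lf Lg.
exact: (rescales_cint hc (f := fun x => f x * conjc (g x)) (L2_cintgM Lf Lg)).
Qed.

Lemma nq_mulmx M : M \in unitmx -> exists2 c : R, 0 < c & forall f, L2 f ->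
  nq (fun x => f (M *m x)) = c * nq f.
Proof.
move=> uM; have [c c0 hc] := inner_mulmx uM; exists c => // f Lf.
have := hc f f Lf Lf; rewrite !inner_self -rmorphM => /(congr1 (@complex.Re R)).
by rewrite !Re_real.
Qed.

Lemma closed_subspace_mulmx W M : closed_subspace W -> M \in unitmx ->
  closed_subspace [set f | L2 f /\ W (fun x => f (M *m x))].
Proof.
move=> cW uM; have [c c0 hc] := nq_mulmx uM; split.
- by move=> f [].
- by split; [exact: L20|exact: closed_subspace0 cW].
- move=> a f g [Lf Wf] [Lg Wg]; split; first exact: L2lin.
  exact: (closed_subspace_linear cW a Wf Wg).
move=> f /L2closureP[|Lf hf]; first by move=> g [].
split=> //; apply: (closed_subspace_approx cW); first exact: L2_mulmx.
move=> e e0; have [g [Lg Wg] fg] := hf (e / c) (divr_gt0 e0 c0).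
exists (fun x => g (M *m x)) => //.
have -> : nq (fun x => f (M *m x) - g (M *m x)) = c * nq (fun x => f x - g x) := hc _ (L2B Lf Lg).
by rewrite mulrC -ltr_pdivlMr.
Qed.

Lemma L2zeroP f : L2zero f <-> L2 f /\ nq f = 0.
Proof.
split=> [[mf ae0]|[/L2P[mf sf] nf]].
  have e : ae_eq mu setT (fun x => (normc (f x) ^+ 2)%:E) (cst 0%E).
    by apply: filterS ae0 => x fx _; rewrite fx normc0 expr0n.
  have mn : measurable_fun setT (fun x => (normc (f x) ^+ 2)%:E).
    by apply/measurable_EFinP; apply: measurable_funX; exact: measurable_normc.
  have i0 : (\int[mu]_x (normc (f x) ^+ 2)%:E = 0)%E.
    by rewrite (ae_eq_integral _ _ _ _ _ e)// integral_cst// mul0e.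
  split; last by rewrite /nq /Rintegral i0.
  apply/L2P; split=> //; apply/rintgP; split; first exact/measurable_EFinP.
  under eq_integral do rewrite ger0_norm ?sqr_ge0//.
  by rewrite i0.
split=> //; move: sf => /rintgP[/measurable_EFinP mn i1].
have i0 : (\int[mu]_x `|(normc (f x) ^+ 2)%:E| = 0)%E.
  have -> : (\int[mu]_x `|(normc (f x) ^+ 2)%:E| = \int[mu]_x (normc (f x) ^+ 2)%:E)%E.
    by apply: eq_integral => x _; rewrite gee0_abs// lee_fin sqr_ge0.
  move: nf; rewrite /nq /Rintegral => /eqP; rewrite fine_eq0.
    by move=> /eqP.
  rewrite ge0_fin_numE ?integral_ge0// => [|x _]; last by rewrite lee_fin sqr_ge0.
  by move: i1; under eq_integral do rewrite ger0_norm ?sqr_ge0//.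
have /ae_eq_integral_abs := i0; move=> /(_ measurableT mn) => ae0.
apply: filterS ae0 => x /(_ I) /= [] /eqP.
by rewrite sqrf_eq0 => /eqP /eq0_normc.
Qed.

Lemma L2zero_sub W : closed_subspace W -> @L2zero R n.+1 `<=` W.
Proof.
move=> cW f /L2zeroP[Lf nf]; apply: (closed_subspace_approx cW Lf) => e e0.
exists (fun=> 0); first exact: closed_subspace0 cW.
by rewrite (eq_nq (g := f)) ?nf// => x; rewrite subr0.
Qed.

(* Multiplying by [1 + (2 pi x)^2] in each coordinate trades the boundedness of
   a Schwartz function for its integrability. *)
Lemma cintg_ft_cgood s G : s != 0 -> cgood G -> cintg mu (ft s G).
Proof.
move=> s0 gG.
pose Q (p : T -> R) := forall G, cgood G -> exists2 G', cgood G' &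
  forall x, (p x)%:C * ft s G x = ft s G' x.
have QM p r : Q p -> Q r -> Q (fun x => p x * r x).
  move=> hp hr H /hr[H1 /hp[H2 gH2 e2] e1]; exists H2 => // x.
  by rewrite rmorphM -mulrA e1 e2.
have QC i : Q (fun x => (P1 (x i ord0))^-1).
  move=> H gH; have [H1 gH1 e1] := ft_coord i s0 gH; have [H2 gH2 e2] := ft_coord i s0 gH1.
  have c1 := clip_cintg (cgood_clip gH); have c2 := clip_cintg (cgood_clip gH2).
  exists (fun x => (2^-1)%:C * 1%:C * H x + (2^-1 * (2 * pi) ^+ 2)%:C * 1%:C * H2 x).
    have [g1 g2 [K1 k1]] := cgoodMr (2^-1)%:C (good_cst 1) gH.
    have [g3 g4 [K2 k2]] := cgoodMr (2^-1 * (2 * pi) ^+ 2)%:C (good_cst 1) gH2.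
    split; [by apply: eq_good (goodD g1 g3) => x; rewrite ReD|by apply: eq_good (goodD g2 g4) => x; rewrite ImD|].
    exists (Num.max K1 K2) => x; rewrite le_max; apply: contraR; rewrite negb_or -!ltNge => /andP[h1 h2].
    apply/eqP; have z1 : (2^-1)%:C * 1%:C * H x = 0 by apply/eqP; apply: contraT => /k1; rewrite leNgt h1.
    have z2 : (2^-1 * (2 * pi) ^+ 2)%:C * 1%:C * H2 x = 0 by apply/eqP; apply: contraT => /k2; rewrite leNgt h2.
    by rewrite z1 z2 addr0.
  move=> x; rewrite ftD; [|exact: cintgZ|exact: cintgZ].
  rewrite !ftZ// -e2 -e1 !mulr1 /P1 invfM invrK.
  have -> : 2^-1 * (1 + (2 * pi * x i ord0) ^+ 2) = 2^-1 + 2^-1 * (2 * pi) ^+ 2 * (x i ord0 * x i ord0) :> R by ring.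
  have key (y b a : R) (z : R[i]) : (a + b * (y * y))%:C * z = a%:C * z + b%:C * (y%:C * (y%:C * z)).
    by rewrite !(rmorphD, rmorphM)/=; ring.
  exact: key.
have QP (r : seq 'I_n.+1) : Q (fun x => \prod_(i <- r) (P1 (x i ord0))^-1).
  elim: r => [|i r hr].
    by move=> H gH; exists H => // x; rewrite big_nil mul1r.
  rewrite (_ : (fun x => _) = (fun x => (P1 (x i ord0))^-1 * \prod_(j <- r) (P1 (x j ord0))^-1)).
    exact: QM.
  by apply/funext => x; rewrite big_cons.
have [G' gG' e] := QP (index_enum 'I_n.+1) _ gG.
have [_ [iP _]] := @rintg_en R n.+1.
have cG := clip_cintg (cgood_clip gG).
apply: (cintg_le _ (rintgZ (\int[mu]_x normc (G' x)) iP)).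
  by apply: cmeas_ft; exact: cintg_cmeas cG.
move=> x; have := normc_ft s x (clip_cintg (cgood_clip gG')).
rewrite -e normcM normc_real prodfV -/(Pn x) ger0_norm ?invr_ge0 ?(ltW (Pn_gt0 x))//.
by rewrite mulrC ler_pdivrMr// Pn_gt0.
Qed.

(** The support lies in a product of segments, which is compact as a set of row vectors and is
    carried to columns by transposition. *)
Lemma compact_n1_supp f (K : R) : supp K f -> compactly_supported f.
Proof.
move=> fK; pose B : set T := [set x | forall i, `[- K, K]%classic (x i ord0)].
have cB : compact B.
  have cr : compact [set v : 'rV[R]_n.+1 | forall i, `[- K, K]%classic (v ord0 i)].
    by apply: (@rV_compact R n.+1 (fun=> `[- K, K]%classic)) => i; exact: segment_compact.
  rewrite (_ : B = trmx @` [set v : 'rV[R]_n.+1 | forall i, `[- K, K]%classic (v ord0 i)]).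
    apply: continuous_compact cr; apply: continuous_subspaceT => v.
    move=> S /nbhs_ballP[e e0 eS]; apply/nbhs_ballP; exists e => // v' vv'.
    apply: eS; case: vv' => _ vv'; split => // i j.
    by rewrite !mxE; exact: vv'.
  apply/seteqP; split=> [x xB|_ [v vB <-] i]; last by rewrite mxE.
  by exists x^T; [move=> i; rewrite mxE|exact: trmxK].
have clB : closed B by apply: compact_closed => //; exact: norm_hausdorff.
apply: (subclosed_compact _ cB); first exact: closed_closure.
rewrite closureE => x; apply; split => // y /fK yK i.
by rewrite /= in_itv/= -ler_norml (le_trans (n1_coord _ _)).
Qed.

End transport.

(** * The multiresolution analysis *)

Section multiresolution.
Context {R : realType} {n : nat}.
Local Notation T := 'cV[R]_n.+1.
Local Notation mu := (lebesgue_cV (R := R) n.+1).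
Implicit Types (f g G : T -> R[i]) (x y : T).
Context (A P : 'M[R]_n.+1) (uA : A \in unitmx) (uP : P \in unitmx).
Context (q : T -> R) (C th : R) (gq : gauge q C) (th0 : 0 < th) (th1 : th < 1).
Context (hM : forall x, q (P^T *m ((A^-1)^T *m x)) <= th * q (P^T *m x)).
Context (N : nat) (R1 cc : R) (u : 'I_N -> T -> R) (R10 : 0 < R1) (cc0 : 0 < cc).
Context (gu : forall i, good (u i)) (su : forall i x, u i x != 0 -> q x <= R1).
Context (ou : forall i j z, int_vec z ->
  cint mu (fun x => (u i x * u j x)%:C * turn (dot z x)) = (cc * ((i == j) && (z == 0))%:R)%:C).
Context (au : forall (F : T -> R[i]) (e : R), clip F -> (forall x, F x != 0 -> q x <= th * R1) -> 0 < e ->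
  exists2 t : 'I_N -> T -> R[i], forall i, trig 1 (t i) &
    forall x, normc (F x - \sum_i t i x * (u i x)%:C) <= e).
Context (s : R) (s0 : 0 < s) (hs : rescales (fun x : T => P^T *m x) s).

Let p x := q (P^T *m x).
Let kp := Num.sqrt (s * cc)^-1.
(** In the variable [P^T *m x] the modulation by the lattice point [P *m z] becomes the integer
    modulation by [z]. The factor [kp] normalizes: [cc] is the squared norm of [u i], and [s] the
    constant of the substitution. *)
Definition profile i x : R := kp * u i (P^T *m x).

Lemma uPT : P^T \in unitmx. Proof. by rewrite unitmx_tr. Qed.

Lemma kp_sqr : kp ^+ 2 * (s * cc) = 1.
Proof.
have sc : 0 < s * cc by rewrite mulr_gt0.
by rewrite sqr_sqrtr ?invr_ge0 ?ltW// mulVf// gt_eqF.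
Qed.

Lemma p_lower : exists2 c : R, 0 < c & forall x, n1 x <= c * p x.
Proof.
have [c c0 hc] := n1_mulmx_le (P^T)^-1; exists c => // x.
rewrite -[x in n1 x](mulmxVK x uPT) (le_trans (hc _))// ler_wpM2l ?(ltW c0)//.
exact: gauge_ge gq _.
Qed.

Lemma p_upper : exists2 c : R, 0 < c & forall x, p x <= c * n1 x.
Proof.
have [c c0 hc] := n1_mulmx_le P^T; exists ((`|C| + 1) * c) => [|x].
  by rewrite mulr_gt0// ltr_wpDl.
rewrite (le_trans (gauge_le gq _))// -mulrA.
apply: (le_trans (y := (`|C| + 1) * n1 (P^T *m x))).
  by rewrite ler_wpM2r ?n1_ge0// (le_trans (ler_norm C))// lerDl.
by rewrite ler_wpM2l// addr_ge0.
Qed.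

Lemma good_profile i : good (profile i).
Proof.
apply: goodZ; apply: (@eq_good _ _ (fun x => u i (P^T *m x + 0))) => [x|]; first by rewrite addr0.
exact: good_comp_affine.
Qed.

Lemma profile_supp i x : profile i x != 0 -> p x <= R1.
Proof. by rewrite mulf_eq0 negb_or => /andP[_ /su]. Qed.

Lemma profile_n1 i : exists K, supp K (fun x => (profile i x)%:C).
Proof.
have [c c0 hc] := p_lower; exists (c * R1) => x h; rewrite (le_trans (hc x))// ler_wpM2l ?(ltW c0)//.
by apply: (@profile_supp i); apply: contra h => /eqP ->.
Qed.

Lemma cgood_profile i : cgood (fun x => (profile i x)%:C).
Proof. by split; [exact: good_profile|exact: good_cst|exact: profile_n1]. Qed.

Definition scaling i : T -> R[i] := ft 1 (fun x => (profile i x)%:C).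
Definition modulated (c : T) i x : R[i] := (profile i x)%:C * turn (- dot c x).

Lemma clip_modulated c i : clip (modulated c i).
Proof.
apply: clipMl; first exact: cgood_clip (cgood_profile i).
have := blip_ker (-1) c; congr blip; apply/funext => x.
by rewrite /turn; congr cexpi; ring.
Qed.

Lemma translation_scaling c i : translation c (scaling i) = ft 1 (modulated c i).
Proof.
apply/funext => x; rewrite /translation /scaling /ft; apply: eq_cint => y.
rewrite /modulated -[RHS]mulrA /turn -cexpiD; congr (_ * cexpi _).
by rewrite dotBl; ring.
Qed.

Lemma modulated_orthogonal i j z z' : int_vec z -> int_vec z' ->
  cint mu (fun x => modulated (P *m z) i x * conjc (modulated (P *m z') j x)) =
  ((i == j) && (z == z'))%:R.
Proof.
move=> iz iz'.
have iF : cintg mu (fun y => (u i y * u j y)%:C * turn (dot (z' - z) y)).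
  rewrite (_ : (fun y => _) = (fun y => (u i y * u j y)%:C * turn (dot (z' - z) y / 1))); last first.
    by apply/funext => y; rewrite divr1.
  apply: cintg_turn; apply: (@good_blip_ball _ _ _ R1) => [|y]; first exact: goodM.
  by rewrite mulf_eq0 negb_or => /andP[/su h _]; exact: le_trans (gauge_ge gq y) h.
have iFs := rescales_cintg hs iF.
rewrite (eq_cint _ (g := fun x => (kp ^+ 2)%:C *
   ((u i (P^T *m x) * u j (P^T *m x))%:C * turn (dot (z' - z) (P^T *m x))))); last first.
  have cM (a b : R[i]) : conjc (a * b) = conjc a * conjc b by exact: rmorphM.
  move=> x; rewrite /modulated /profile cM turnJ opprK.
  have -> : conjc ((kp * u j (P^T *m x))%:C) = (kp * u j (P^T *m x))%:C by apply: complexP; rewrite !ReImE ?oppr0.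
  rewrite dotBl turnD -!dot_mulmxl !(rmorphM, rmorphXn)/=.
  by ring.
rewrite cintZ// (rescales_cint hs iF) ou; last exact: int_vecD (iz') (int_vecN iz).
rewrite subr_eq0 [z' == z]eq_sym -!rmorphM.
have -> : kp ^+ 2 * (s * (cc * ((i == j) && (z == z'))%:R)) = ((i == j) && (z == z'))%:R.
  by rewrite !mulrA -(mulrA (kp ^+ 2)) kp_sqr mul1r.
by rewrite rmorph_nat.
Qed.

Definition lattice : set T := [set P *m map_mx intr z | z in [set: 'cV[int]_n.+1]].
Definition translates := (fun a : T * 'I_N => translation a.1 (scaling a.2)) @` (lattice `*` setT).

Lemma int_vec_intr (z : 'cV[int]_n.+1) : int_vec (map_mx intr z : T).
Proof. by move=> d; rewrite mxE intr_int. Qed.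

Lemma int_vecP (v : T) : int_vec v -> exists z : 'cV[int]_n.+1, v = map_mx intr z.
Proof.
move=> iv; exists (\col_d Num.floor (v d ord0)); apply/colP => d; rewrite !mxE.
by apply/esym/eqP; rewrite -intrEfloor.
Qed.

Lemma translatesP f : translates f <-> exists c i, lattice c /\ f = ft 1 (modulated c i).
Proof.
split=> [[[c i] [/= lc _] <-]|[c [i [lc ->]]]].
  by exists c, i; split=> //; exact: translation_scaling.
by exists (c, i); [split|exact: translation_scaling].
Qed.

Lemma ft1_L2 G : clip G -> L2 (ft 1 G).
Proof. by apply: ft_L2; rewrite expr1n. Qed.

Lemma translates_L2 : translates `<=` L2.
Proof. by move=> f /translatesP[c [i [_ ->]]]; apply: ft1_L2; exact: clip_modulated. Qed.

Lemma span_L2 : linear_span translates `<=` L2.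
Proof.
apply: span_min translates_L2; split; first exact: L20.
by move=> *; exact: L2lin.
Qed.

Definition base := L2closure (linear_span translates).

Lemma closed_base : closed_subspace base.
Proof. exact: closed_subspace_closure span_L2 (linear_set_span _). Qed.

(** Under the transform, coefficients of integer frequency become finite combinations of lattice
    translates of [scaling i], with the sign of the frequency reversed. *)
Lemma trig_base i t : trig 1 t ->
  clip (fun x => t (P^T *m x) * (profile i x)%:C) /\
  linear_span translates (ft 1 (fun x => t (P^T *m x) * (profile i x)%:C)).
Proof.
have [l0 ll] := linear_set_span translates.
elim=> {t} [v iv|f g _ [cf lf] _ [cg lg]|c f _ [cf lf]].
- have e : (fun x => turn (dot v (P^T *m x) / 1) * (profile i x)%:C) = modulated (P *m (- v)) i.
    apply/funext => x; rewrite /modulated divr1 mulrC; congr (_ * turn _).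
    by rewrite mulmxN dotNl opprK dotC dot_mulmxl trmxK dotC.
  rewrite e; split; first exact: clip_modulated.
  apply: span_incl; apply/translatesP; exists (P *m (- v)), i; split=> //.
  by have [z ->] := int_vecP (int_vecN iv); exists z.
- have e : (fun x => (f (P^T *m x) + g (P^T *m x)) * (profile i x)%:C) =
      (fun x => f (P^T *m x) * (profile i x)%:C + g (P^T *m x) * (profile i x)%:C).
    by apply/funext => x; rewrite mulrDl.
  rewrite e; split; first exact: clipD.
  have := ll 1 _ _ lf lg; congr linear_span; apply/funext => x.
  by rewrite mul1r ftD//; exact: clip_cintg.
- have e : (fun x => c * f (P^T *m x) * (profile i x)%:C) = (fun x => c * (f (P^T *m x) * (profile i x)%:C)).
    by apply/funext => x; rewrite mulrA.
  rewrite e; split; first exact: clipZ.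
  have := ll c _ _ lf l0; congr linear_span; apply/funext => x.
  by rewrite addr0 ftZ//; exact: clip_cintg.
Qed.

(** The uniform approximation [au] becomes one in L2: target and approximant vanish outside a common
    bounded set, and Plancherel carries the estimate to the other side. *)
Lemma base_ft G : clip G -> (forall x, G x != 0 -> p x <= th * R1) -> base (ft 1 G).
Proof.
move=> cG sG; have uPi : (P^T)^-1 \in unitmx by rewrite unitmx_inv'; exact: uPT.
pose F y := G ((P^T)^-1 *m y).
have cF : clip F by exact: clip_mulmx.
have sF y : F y != 0 -> q y <= th * R1 by move=> /sG; rewrite /p mulmxKV//; exact: uPT.
have [c c0 hc] := p_lower.
have [Kb hKb] : exists K, forall x, p x <= R1 -> @ballK R n.+1 K x.
  by exists (c * R1) => x h; rewrite /ballK /= (le_trans (hc x))// ler_wpM2l// ltW.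
pose B : R := \int[mu]_x \1_(@ballK R n.+1 Kb) x.
have B0 : 0 <= B by apply: Rintegral_ge0 => x _; rewrite indicE.
apply: (closed_subspace_approx closed_base); first exact: ft1_L2.
(* The cap at 1 bounds the square of the uniform error by [e1] itself. *)
move=> e e0; pose e1 := Num.min 1 (e / (B + 1)).
have B1 : 0 < B + 1 by rewrite ltr_wpDl.
have e10 : 0 < e1 by rewrite lt_min ltr01 divr_gt0.
have [t tt ht] := au cF sF e10.
have kp0 : kp != 0.
  by apply/eqP => k0; have := kp_sqr; rewrite k0 expr0n mul0r => /esym/eqP; rewrite oner_eq0.
pose S x : R[i] := \sum_i kp^-1%:C * (t i (P^T *m x) * (profile i x)%:C).
have cS : clip S by apply: clip_sum => i; apply: clipZ; have [] := trig_base i (tt i).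
have SE x : S x = \sum_i t i (P^T *m x) * (u i (P^T *m x))%:C.
  have k1 : kp^-1%:C * kp%:C = 1 :> R[i] by rewrite -rmorphM mulVf.
  apply: eq_bigr => i _; rewrite /profile [(kp * _)%:C]rmorphM.
  transitivity (kp^-1%:C * kp%:C * (t i (P^T *m x) * (u i (P^T *m x))%:C)); first ring.
  by rewrite k1 mul1r.
exists (ft 1 S).
  apply: (subset_L2closure span_L2).
  have hl := linear_set_span translates.
  have -> : ft 1 S = (fun x => \sum_i kp^-1%:C * ft 1 (fun x => t i (P^T *m x) * (profile i x)%:C) x).
    apply/funext => x; rewrite ft_sum => [|i]; last by apply: cintgZ; apply: clip_cintg; have [] := trig_base i (tt i).
    apply: eq_bigr => i _; rewrite ftZ//; apply: clip_cintg; by have [] := trig_base i (tt i).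
  apply: (linear_set_sum _ _ hl) => i; apply: linear_setZ; first exact: linear_set_span.
  by have [] := trig_base i (tt i).
have cGS := clipB cG cS.
have -> : nq (fun x => ft 1 G x - ft 1 S x) = nq (fun x => G x - S x).
  transitivity (nq (ft 1 (fun x => G x - S x))); last by rewrite nq_ft ?expr1n.
  apply: eq_nq => x.
  by rewrite ftB//; exact: clip_cintg.
have pt x : normc (G x - S x) ^+ 2 <= e1 * \1_(@ballK R n.+1 Kb) x.
  have := ht (P^T *m x); rewrite /F mulmxVK ?uPT// -SE => h.
  have [xB|xB] := boolP (x \in (@ballK R n.+1 Kb)).
    rewrite indicE xB mulr1 expr2 (le_trans (ler_pM _ _ h h)) ?normc_ge0//.
    by rewrite ler_piMr ?(ltW e10)// ge_min lexx.
  have px : R1 < p x.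
    rewrite ltNge; apply: contra xB => px; rewrite inE; exact: hKb.
  have G0 : G x = 0.
    apply/eqP; apply: contraT => /sG h2; exfalso.
    have : th * R1 <= R1 by rewrite ler_piMl// ltW.
    by lra.
  have S0 : S x = 0.
    rewrite /S big1// => i _; have [->|w0] := eqVneq (profile i x) 0; first by rewrite mulr0 mulr0.
    by exfalso; have := profile_supp w0; lra.
  by rewrite G0 S0 subrr normc0 expr0n mulr_ge0// ltW.
have le1 : nq (fun x => G x - S x) <= e1 * B.
  rewrite /B -rintZ; last exact: rintg_ballK.
  apply: rint_le => //; last by apply: rintgZ; exact: rintg_ballK.
  by have /L2P[] := clip_L2 cGS.
rewrite (le_lt_trans le1)//; apply: (@le_lt_trans _ _ (e / (B + 1) * B)).
  by rewrite ler_wpM2r// ge_min lexx orbT.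
by rewrite mulrAC ltr_pdivrMr// ltr_pM2l// ltrDl.
Qed.

(** The source of nestedness. The dilation carries spectrum from {p <= R1} into {p <= th R1} by
    [hM], and [base_ft] contains everything supported there. Generators suffice, since the condition
    defines a closed subspace. *)
Lemma base_dilate f : base f -> base (fun x => f (A^-1 *m x)).
Proof.
have uAi : A^-1 \in unitmx by rewrite unitmx_inv'.
have cW := closed_subspace_mulmx closed_base uAi.
suff h : base `<=` [set f | L2 f /\ base (fun x => f (A^-1 *m x))] by move=> /h[].
apply: (L2closure_min cW); apply: (span_min (closed_subspace_linset cW)) => g /translatesP[c [i [_ ->]]].
split; first exact/ft1_L2/clip_modulated.
have [d d0 ->] := ft_mulmx uAi; last exact: clip_modulated.
have uAT : (A^-1)^T \in unitmx by rewrite unitmx_tr.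
apply: base_ft.
  by apply: clipZ; apply: clip_mulmx (clip_modulated c i); rewrite unitmx_inv'.
move=> z; rewrite mulf_eq0 negb_or => /andP[_].
rewrite /modulated mulf_eq0 negb_or => /andP[h _].
have {}h : p (((A^-1)^T)^-1 *m z) <= R1 by apply: (@profile_supp i); apply: contra h => /eqP ->.
rewrite -[z in p z](mulmxKV z uAT) (le_trans (hM _))// ler_wpM2l//; exact: ltW.
Qed.

(** A preimage of [base] rather than an image, so that [closed_subspace_mulmx] applies as it
    stands. *)
Definition resolution (j : int) : set (T -> R[i]) :=
  [set f | L2 f /\ base (fun x => f (A ^ (- j) *m x))].

Lemma base_L2 : base `<=` L2. Proof. by move=> f []. Qed.

Lemma unit_expz j : A ^ j \in unitmx. Proof. exact: (@unitrXz _ A j uA). Qed.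

Lemma resolution0 : resolution 0 = base.
Proof.
apply/seteqP; split=> f; rewrite /resolution /= oppr0 expr0z.
  by move=> [_]; congr base; apply/funext => x; rewrite mul1mx.
move=> bf; split; first exact: base_L2.
by move: bf; congr base; apply/funext => x; rewrite mul1mx.
Qed.

Lemma decay_p j y : p (((A^-1) ^+ j)^T *m y) <= th ^+ j * p y.
Proof.
elim: j => [|j IH]; first by rewrite expr0 trmx1 mul1mx mul1r.
rewrite exprSr -[(_ * _)^T]/((_ *m _)^T) trmx_mul -mulmxA (le_trans (hM _))//.
by rewrite exprS -mulrA ler_wpM2l// ltW.
Qed.

Lemma exprVK j : A ^+ j *m (A^-1) ^+ j = 1%:M.
Proof.
have uj : A ^+ j \is a GRing.unit by rewrite unitrX.
by rewrite exprVn; exact: (mulrV uj).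
Qed.

Lemma small_pow (a b : R) : 0 < a -> 0 < b -> exists j : nat, th ^+ j * a <= b.
Proof.
move=> a0 b0; have [j hj] := @geometric_small R (a / b) th (ltW (divr_gt0 a0 b0)) (introT andP (conj (ltW th0) th1)).
by exists j; move: hj; rewrite mulrAC ler_pdivrMr// mul1r mulrC.
Qed.

(** Each dilation shrinks the compact spectrum by [th], until it fits into {p <= th R1}. *)
Lemma band_resolution f : band f -> exists j, resolution j f.
Proof.
move=> [G [cG _ ->]]; have [_ [K GK]] := cG; have [c c0 hc] := p_upper.
have [j hj] := small_pow (mulr_gt0 c0 (ltr_wpDl (normr_ge0 K) ltr01)) (mulr_gt0 th0 R10).
exists j%:Z; split; first exact: ft1_L2.
have -> : A ^ (- j%:Z) = (A^-1) ^+ j by rewrite -exprz_inv.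
have uj : (A^-1) ^+ j \in unitmx by apply: (@unitrX _ A^-1 j); rewrite unitrV.
have [d d0 ->] := ft_mulmx uj => //.
have ujT : ((A^-1) ^+ j)^T \in unitmx by rewrite unitmx_tr.
apply: base_ft; first by apply: clipZ; apply: clip_mulmx cG; rewrite unitmx_inv'.
move=> z; rewrite mulf_eq0 negb_or => /andP[_ /GK h].
rewrite -[z in p z](mulmxKV z ujT) (le_trans (decay_p _ _))// (le_trans _ hj)//.
rewrite ler_wpM2l ?exprn_ge0 ?(ltW th0)// (le_trans (hc _))// ler_wpM2l ?(ltW c0)//.
by rewrite (le_trans h)// (le_trans (ler_norm K))// lerDl.
Qed.

(** Membership at level - j puts the spectrum of the dilated [f] in {p <= R1}. The same dilation
    expands the spectrum of [g], which avoids 0, until it leaves that set; Parseval then gives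
    orthogonality. *)
Lemma resolution_orthogonal f g : (forall j, resolution j f) -> band g -> inner f g = 0.
Proof.
move=> hf [G [cG [r r0 Gr] ->]]; have [c c0 hc] := p_lower.
(* With th^j c R1 <= r / 2 no point of {p <= R1} satisfies r <= c th^j p, which holds on the dilated
   spectrum of [g]. *)
have [j hj] := small_pow (mulr_gt0 (mulr_gt0 c0 R10) ltr01) (divr_gt0 r0 (ltr0Sn R 1)).
have [Lf] := hf (- j%:Z); rewrite opprK -[A ^ j%:Z]/(A ^+ j) => bf.
have uj : A ^+ j \in unitmx by exact: (@unitrX _ A j uA).
have ujT : (A ^+ j)^T \in unitmx by rewrite unitmx_tr.
have [d d0 hd] := ft_mulmx uj; have [a a0 ha] := inner_mulmx uj.
have Lg : L2 (ft 1 G) by exact: ft1_L2.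
have cH : clip (fun z => d%:C * G (((A ^+ j)^T)^-1 *m z)).
  by apply: clipZ; apply: clip_mulmx cG; rewrite unitmx_inv'.
have sH z : d%:C * G (((A ^+ j)^T)^-1 *m z) != 0 -> R1 < p z.
  rewrite mulf_eq0 negb_or => /andP[_ Gz]; set y := _ *m z in Gz.
  have ry : r <= n1 y by rewrite leNgt; apply: contra Gz => /Gr ->.
  have yE : y = ((A^-1) ^+ j)^T *m z.
    by rewrite -[z in RHS](mulmxKV z ujT) mulmxA -trmx_mul exprVK trmx1 mul1mx.
  have h1 : r <= c * (th ^+ j * p z).
    by rewrite (le_trans ry)// (le_trans (hc _))// ler_wpM2l ?(ltW c0)// yE decay_p.
  rewrite ltNge; apply/negP => pz.
  have h2 : c * (th ^+ j * p z) <= th ^+ j * (c * R1 * 1).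
    by rewrite mulr1 mulrCA ler_wpM2l ?exprn_ge0 ?(ltW th0)// ler_wpM2l// ltW.
  by move: h1 h2 hj; lra.
have o0 : inner (fun x => f (A ^+ j *m x)) (ft 1 (fun z => d%:C * G (((A ^+ j)^T)^-1 *m z))) = 0.
  apply: (inner_closure0 translates_L2 (ft1_L2 cH)) bf => h /translatesP[v [i [_ ->]]].
  rewrite /inner -[cintegral _]/(cint mu _) parseval ?expr1n//; last exact: clip_modulated.
  rewrite (eq_cint _ (g := fun=> 0)) ?cint0// => z.
  have [->|/sH pz] := eqVneq (d%:C * G (((A ^+ j)^T)^-1 *m z)) 0; first by rewrite conjc0 mulr0.
  have -> : modulated v i z = 0.
    rewrite /modulated; have [->|/profile_supp] := eqVneq (profile i z) 0; first by rewrite mul0r.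
    by rewrite leNgt pz.
  by rewrite mul0r.
have key (g1 g2 : T -> R[i]) (z : R[i]) : g1 = g2 ->
    inner (fun x => f (A ^+ j *m x)) g2 = 0 -> inner (fun x => f (A ^+ j *m x)) g1 = z -> z = 0.
  by move=> -> -> ->.
have /eqP := key _ _ _ (hd 1 G cG) o0 (ha f (ft 1 G) Lf Lg).
have na : (a%:C == 0 :> R[i]) = false by rewrite eq_complex /= (gt_eqF a0).
by rewrite mulf_eq0 na orFb => /eqP.
Qed.

Lemma closed_resolution j : closed_subspace (resolution j).
Proof. exact: closed_subspace_mulmx closed_base (unit_expz _). Qed.

Lemma scaling_resolution : scaling_functions lattice (resolution 0) scaling.
Proof.
have tr0 i : translates (scaling i).
  exists (0, i); last by apply/funext => x; rewrite /translation subr0.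
  by split=> //; exists 0 => //; apply/matrixP => a b; rewrite !mxE big1// => k _; rewrite !mxE mulr0.
have tb : translates `<=` base.
  by move=> f tf; apply: (subset_L2closure span_L2); exact: span_incl.
rewrite resolution0; split; first by move=> i; exact/tb/tr0.
split => //.
- by move=> [c i] lc; apply: tb; exists (c, i).
move=> [c1 i] [c2 j] [[z _ /= <-] _] [[z' _ /= <-] _] /=.
rewrite !translation_scaling /inner -[cintegral _]/(cint mu _) parseval ?expr1n//; do ?exact: clip_modulated.
rewrite modulated_orthogonal; do ?exact: int_vec_intr.
congr (_%:R); rewrite xpair_eqE andbC; congr (nat_of_bool (_ && _)).
apply/eqP/eqP => [->//|]; move=> /(congr1 (mulmx (P^-1))); rewrite !mulmxVK//.
Qed.

Lemma resolution_MRA : MRA A lattice N resolution.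
Proof.
split.
- exact: closed_resolution.
- move=> j f [Lf bf]; split=> //; have := base_dilate bf; congr base; apply/funext => x.
  by rewrite mulmxA -[A ^ (- j) *m A^-1]/(A ^ (- j) * A ^ (-1)) -exprzDr// -opprD.
- apply/seteqP; split=> [f hf|f f0 j _]; last exact: L2zero_sub (closed_resolution j) f f0.
  have Lf : L2 f by have [] := hf 0 I.
  apply/L2zeroP; split=> //; have := inner_self f.
  (* [f] is orthogonal to [band], hence to its closure, hence to itself. *)
  have bf : L2closure (linear_span (@band R n)) f.
    have [_ h] := band_dense Lf; split=> // e e0; have [g bg fg] := h e e0; exists g => //.
    exact: span_incl.
  rewrite (inner_closure0 (@band_L2 R n) Lf _ bf); first by move=> /(congr1 (@complex.Re R)).
  move=> g bg; rewrite innerC//; last exact: band_L2.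
  by rewrite (resolution_orthogonal (fun j => hf j I) bg) conjc0.
- apply/seteqP; split=> [f []//|f Lf]; have [_ h] := band_dense Lf; split=> // e e0.
  have [g bg fg] := h e e0; exists g => //; have [j jg] := band_resolution bg.
  by exists j.
- move=> f j Lf; rewrite resolution0.
  have e : (fun x => f (A ^ j *m (A ^ (- j) *m x))) = f.
    apply/funext => x; rewrite mulmxA -[A ^ j *m A ^ (- j)]/(A ^ j * A ^ (- j)) -exprzDr// subrr expr0z.
    by rewrite mul1mx.
  split=> [bf|[_]]; last by rewrite e.
  split; first exact: L2_mulmx (unit_expz j) Lf.
  by rewrite e.
- by exists scaling; exact: scaling_resolution.
Qed.

Lemma fourier_scaling i : fourier (scaling i) = (fun x => (profile i x)%:C).
Proof.
rewrite fourierE /scaling inversion ?expr1n//; first exact: cgood_clip (cgood_profile i).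
by apply: cintg_ft_cgood; [exact: oner_neq0|exact: cgood_profile].
Qed.

Lemma scaling_regular i : schwartz (scaling i) /\
  [/\ smooth (fourier (scaling i)), real_valued (fourier (scaling i))
    & compactly_supported (fourier (scaling i))].
Proof.
split; first by apply: schwartz_ft; [exact: oner_neq0|exact: cgood_profile].
rewrite fourier_scaling; split => //.
- by apply: smooth_good; [exact: good_profile|exact: good_cst].
- by have [K hK] := profile_n1 i; exact: compact_n1_supp hK.
Qed.

End multiresolution.

Theorem theorem1p2 (R : realType) (n : nat) (A : 'M[R]_n.+1)
    (Gamma : set 'cV[R]_n.+1)
    (hA : expansive A) (hGamma : full_rank_lattice Gamma) :
  exists (N : nat) (V : int -> set ('cV[R]_n.+1 -> R[i]))
      (Phi : 'I_N -> 'cV[R]_n.+1 -> R[i]),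
    [/\ (0 < N)%N,
        MRA A Gamma N V,
        scaling_functions Gamma (V 0) Phi,
        forall i, schwartz (Phi i)
      & forall i, [/\ smooth (fourier (Phi i)),
                      real_valued (fourier (Phi i))
                    & compactly_supported (fourier (Phi i))]].
Proof.
have [P uP ->] := hGamma; have [uA [C0 [r [C00 r01 hr]]]] := expansive_decay hA.
have uPT : P^T \in unitmx by rewrite unitmx_tr.
(* The transposed inverse dilation in the coordinates [P^T *m x], where the lattice becomes
   integral. Conjugation keeps the rate [r] of decay and changes only the constant. *)
pose M := P^T * (A^-1)^T * (P^T)^-1.
have MX k : M ^+ k = P^T * ((A^-1) ^+ k)^T * (P^T)^-1.
  elim: k => [|k IH]; first by rewrite !expr0 trmx1 mulr1 divrr.
  rewrite exprSr IH /M !mulrA mulrVK// exprS.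
  by rewrite -[in RHS](mulrA P^T) -[((A^-1) * _)^T]/((_ *m _)^T) trmx_mul -[_ *m (A^-1)^T]/(_ * _) !mulrA.
have [a1 a10 ha1] : exists2 a : R, 0 <= a & forall i j, `|P^T i j| <= a.
  exists (\sum_i \sum_j `|P^T i j|) => [|i j]; first by rewrite sumr_ge0// => i _; exact: sumr_ge0.
  rewrite (bigD1 i)//= (bigD1 j)//= -addrA lerDl addr_ge0//; first exact: sumr_ge0.
  by apply: sumr_ge0 => k _; exact: sumr_ge0.
have [a2 a20 ha2] : exists2 a : R, 0 <= a & forall i j, `|(P^T)^-1 i j| <= a.
  exists (\sum_i \sum_j `|(P^T)^-1 i j|) => [|i j]; first by rewrite sumr_ge0// => i _; exact: sumr_ge0.
  rewrite (bigD1 i)//= (bigD1 j)//= -addrA lerDl addr_ge0//; first exact: sumr_ge0.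
  by apply: sumr_ge0 => k _; exact: sumr_ge0.
have Mdec k i j : `|(M ^+ k) i j| <= (\sum_(l < n.+1) \sum_(l' < n.+1) a1 * C0 * a2) * r ^+ k.
  have h1 l : `|(P^T * ((A^-1) ^+ k)^T) i l| <= \sum_(l' < n.+1) a1 * (C0 * r ^+ k).
    rewrite mxE (le_trans (ler_norm_sum _ _ _))//; apply: ler_sum => l' _; rewrite normrM.
    by apply: ler_pM => //; rewrite mxE; exact: hr.
  rewrite MX -[_ * (P^T)^-1]/(_ *m _) mxE (le_trans (ler_norm_sum _ _ _))// mulr_suml.
  apply: ler_sum => l _; rewrite normrM (le_trans (ler_pM _ _ (h1 l) (ha2 l j)))//.
  rewrite !mulr_suml le_eqVlt; apply/orP; left; apply/eqP; apply: eq_bigr => l' _.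
  ring.
have D0 : 0 <= \sum_(l < n.+1) \sum_(l' < n.+1) a1 * C0 * a2.
  by apply: sumr_ge0 => l _; apply: sumr_ge0 => l' _; rewrite !mulr_ge0.
have [q [C [th [gq th01 qM]]]] := gauge_of_decay D0 r01 Mdec.
have /andP[th0 th1] := th01.
have [N [R1 [cc [u [N0 [R10 cc0] gu su [ou au]]]]]] := frequency gq th01.
have [s s0 hs] := rescales_mulmx uPT.
have hM x : q (P^T *m ((A^-1)^T *m x)) <= th * q (P^T *m x).
  have := qM (P^T *m x); congr (q _ <= _).
  by rewrite /M -[P^T * _ * _]/(P^T *m _ *m _) -!mulmxA mulmxVK.
have sr i : schwartz (scaling P cc u s i) /\ [/\ smooth (fourier (scaling P cc u s i)),
    real_valued (fourier (scaling P cc u s i)) & compactly_supported (fourier (scaling P cc u s i))].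
  exact: (scaling_regular uP gq cc gu su s i).
exists N, (resolution A P cc u s), (scaling P cc u s); split.
- exact: N0.
- exact: (resolution_MRA uA uP gq th0 th1 hM R10 cc0 gu su ou au s0 hs).
- exact: (scaling_resolution A uP gq cc0 gu su ou s0 hs).
- by move=> i; have [] := sr i.
- by move=> i; have [] := sr i.
Qed.
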